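(* Let $r\ge2$ be an integer. Let $\varphi\in W^{r,1}(\mathbb{R})$ be a discrete kernel satisfying condition (i), and let $\psi\in L^1(\mathbb{R})$ be a continuous kernel. Let $1\le p\le+\infty$, let $0<\alpha<r$, and let $f\in L^p(\mathbb{R})$ (with $f\in C(\mathbb{R})$ if $p=+\infty$) be such that \[ \|\mathcal{D}_w^{\varphi,\psi}f-f\|_p=\mathcal{O}(w^{-\alpha}),\qquad w\to+\infty. \] (a) If $p=+\infty$ and $\varphi^{(i)}$ ($i=1,\dots,r$) and $\psi$ satisfy $(\Theta)$ for some $\theta>r+1$, then $f\in Lip^*(\alpha,L^\infty)$. (b) If $1\le p<+\infty$ and $\varphi^{(i)}$ ($i=1,\dots,r$) and $\psi$ satisfy $(\Theta)$ for some $\theta>pr+1$, with $\psi$ moreover compactly supported when $p=1$, then $f\in Lip^*(\alpha,L^p)$.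
   Context: For $p=\infty$ the space $L^\infty$ is replaced by $C(\mathbb{R})$, the bounded uniformly continuous functions with the sup-norm. $W^{r,1}(\mathbb{R})$ is the set of $f\in L^1$ with $f^{(r-1)}$ absolutely continuous and $f^{(r)}\in L^1$. A discrete kernel is a bounded function $\varphi\in L^1(\mathbb{R})$ with $\sum_{k\in\mathbb{Z}}\varphi(u-k)=1$ for all $u$. A continuous kernel is a function $\psi\in L^1(\mathbb{R})$, bounded near $0$, with $\int\psi=1$. Discrete moments: $m_\nu(\varphi,u)=\sum_k\varphi(u-k)(k-u)^\nu$. Condition (i): $m_\nu(\varphi,u)$ is independent of $u\in\mathbb{R}$ for $\nu=1,\dots,r$. Condition $(\Theta)$ with $\theta$: $\xi(u)=\mathcal{O}(|u|^{-\theta})$ as $|u|\to\infty$. Durrmeyer sampling operators: \[ (\mathcal{D}_w^{\varphi,\psi}f)(x)=\sum_{k\in\mathbb{Z}}\varphi(wx-k)\,w\int_{\mathbb{R}}\psi(wu-k)f(u)\,du,\qquad w>0. \] Moduli of smoothness: $\omega_m(f,\delta)_p=\sup_{|t|\le\delta}\|\sum_{j=0}^m\binom{m}{j}(-1)^{m-j}f(\cdot+jt)\|_p$. For $\alpha>0$, $Lip^*(\alpha,L^p)$ is the set of $f\in L^p(\mathbb{R})$ (respectively $C(\mathbb{R})$ if $p=\infty$) with $\omega_{\lfloor\alpha\rfloor+1}(f,\delta)_p=\mathcal{O}(\delta^\alpha)$ as $\delta\to0^+$. *)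

(* Defs.v *)
From HB Require Import structures.
From mathcomp Require Import all_boot all_order all_algebra.
From mathcomp Require Import all_classical all_reals all_analysis.
Set Implicit Arguments. Unset Strict Implicit. Unset Printing Implicit Defensive.
Import Order.TTheory GRing.Theory Num.Theory.
Import numFieldNormedType.Exports.
Local Open Scope classical_set_scope.
Local Open Scope ring_scope.

Section Defs.
Variable R : realType.
Local Notation leb := (@lebesgue_measure R).

Definition zpartial (a : int -> R) (N : nat) : R :=
  \sum_(0 <= i < (N.*2).+1) a (i%:Z - N%:Z).

Definition zseries_to (a : int -> R) (l : R) : Prop :=
  zpartial a @ \oo --> l.

Definition zsum (a : int -> R) : R := lim (zpartial a @ \oo).

Definition integrableR (g : R -> R) : Prop := leb.-integrable setT (EFin \o g).

Definition prim (g : R -> R) (x : R) : R :=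
  if 0 <= x then Rintegral leb `[0, x] g else - Rintegral leb `[x, 0] g.

(* g 0 = phi, g i = phi^{(i)} (i <= r): phi in W^{r,1}(R), with
   g i locally absolutely continuous (an indefinite integral of g (i+1))
   for i < r, and every g i in L^1. *)
Definition sobolev_rep (r : nat) (phi : R -> R) (g : nat -> R -> R) : Prop :=
  g 0%N = phi /\
  (forall i, (i <= r)%N -> integrableR (g i)) /\
  (forall i, (i < r)%N -> forall x, g i x = g i 0 + prim (g i.+1) x).

Definition discrete_kernel (phi : R -> R) : Prop :=
  (exists M, forall u, `|phi u| <= M) /\ integrableR phi /\
  (forall u, zseries_to (fun k => phi (u - k%:~R)) 1).

Definition continuous_kernel (psi : R -> R) : Prop :=
  integrableR psi /\
  (exists delta M, 0 < delta /\ forall u, `|u| < delta -> `|psi u| <= M) /\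
  Rintegral leb setT psi = 1.

Definition condition_i (r : nat) (phi : R -> R) : Prop :=
  forall nu, (1 <= nu <= r)%N ->
    exists c, forall u, zseries_to (fun k => phi (u - k%:~R) * (k%:~R - u) ^+ nu) c.

Definition condition_Theta (theta : R) (xi : R -> R) : Prop :=
  exists C U, forall u, U <= `|u| -> `|xi u| <= C * (`|u| `^ (- theta)).

Definition durrmeyer (phi psi f : R -> R) (w : R) (x : R) : R :=
  zsum (fun k => phi (w * x - k%:~R) *
                 (w * Rintegral leb setT (fun u => psi (w * u - k%:~R) * f u))).

Definition supnorm (g : R -> R) : \bar R :=
  ereal_sup [set `|g x|%:E | x in [set: R]].

Definition pnorm (p : \bar R) (g : R -> R) : \bar R :=
  if p is +oo%E then supnorm g else Lnorm leb p (EFin \o g).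

Definition bounded_unif_cont (f : R -> R) : Prop :=
  (exists M, forall x, `|f x| <= M) /\
  (forall e, 0 < e -> exists d, 0 < d /\
     forall x y, `|x - y| < d -> `|f x - f y| < e).

(* f in L^p(R), resp. C(R) for p = +oo *)
Definition inLp (p : \bar R) (f : R -> R) : Prop :=
  if p is +oo%E then bounded_unif_cont f
  else measurable_fun setT f /\ (Lnorm leb p (EFin \o f) < +oo)%E.

Definition diffm (m : nat) (t : R) (f : R -> R) (x : R) : R :=
  \sum_(j < m.+1) ('C(m, j))%:R * (-1) ^+ (m - j) * f (x + j%:R * t).

Definition modulus (p : \bar R) (m : nat) (f : R -> R) (delta : R) : \bar R :=
  ereal_sup [set pnorm p (diffm m t f) | t in [set t | `|t| <= delta]].

Definition LipStar (alpha : R) (p : \bar R) (f : R -> R) : Prop :=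
  inLp p f /\
  exists M d0, 0 < d0 /\ forall delta, 0 < delta <= d0 ->
    (modulus p (Num.truncn alpha).+1 f delta <= (M * delta `^ alpha)%:E)%E.

Definition durrmeyer_rate (phi psi : R -> R) (p : \bar R) (alpha : R) (f : R -> R) : Prop :=
  exists M w0, 0 < w0 /\ forall w, w0 <= w ->
    (pnorm p (fun x => (durrmeyer phi psi f w x - f x)%R) <= (M * w `^ (- alpha))%:E)%E.

End Defs.

(* Main.v *)
(* Write [Dn r s] for the [r]-th forward difference with step [s], [c_k = w * int psi(w u - k) f(u) du]
   and [b = Dn r 1 c], so that [D_w f(x) = sum_k c_k phi(w x - k)]. Condition (i) provides an
   integrable kernel [Gam], decaying at infinity, with [phi^(r) = Dn r 1 Gam] a.e., and summation by
   parts gives [Dn r s (D_w f) (x) = sum_k b_k Phi(w x - k)], where [Phi] is the [r]-fold integral of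
   [Gam] with step [w s].

   Let [a s] be the norm of [Dn r s f] and suppose that [a s / s^alpha] is unbounded. Choose almost
   extremal scales [t_i -> 0], for which [a s <= 2 a(t_i) (s / t_i)^alpha] when [s >= t_i]. Since
   [phi^(r)] need not be bounded, there is no Bernstein inequality for a single [w]; however averaging over
   [w] in [[W, 2 W]] bounds [Dn r s f] on [|x| >= C / W] by [(s W)^r a] plus the approximation
   error. For [p < oo] the same averages control [sum_k |b_k|^p], by Kemperman's identity for
   differences with two steps.

   Near the origin, rescale [f] by [t_i], normalize by [a(t_i)] and pass to a limit along an
   ultrafilter. The limits [be m] of the coefficients for [w = om_m / t_i], where [om_m -> 0],
   satisfy [H(x) = om_m^r sum_k be_(m,k) Gam(om_m x - k)] with one function [H] for all [m], which
   is p-integrable away from [0]. If the translates of [Gam] are p-integrable at the origin,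
   letting [om_m -> 0] gives [H = 0]. Otherwise the [be m] solve a linear recurrence, hence lie in a
   finite-dimensional subspace of l^1, while the dilates [H(x / om_m)] concentrate at the origin,
   so [H = 0] again. Thus the normalized differences tend to [0] everywhere, contradicting the
   normalization. So [a s = O(s^alpha)], and Marchaud's inequality lowers the order of the
   difference from [r] to [floor(alpha) + 1]. *)

Require Import Defs.
From HB Require Import structures.
From mathcomp Require Import all_boot all_order all_algebra.
From mathcomp Require Import all_classical all_reals all_analysis.
From mathcomp Require Import measurable_realfun.
From mathcomp Require Import zify ring lra.
Import Order.TTheory GRing.Theory Num.Theory.
Import numFieldNormedType.Exports.
Set Implicit Arguments. Unset Strict Implicit. Unset Printing Implicit Defensive.
Local Open Scope classical_set_scope.
Local Open Scope ring_scope.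

(** * Sums over the integers *)

(** The decay [theta > r + 1] is what the series need: [Gam] decays with exponent [theta - r > 1],
    so its translates can be summed against bounded coefficients. The rest has to cope with kernels
    that are merely integrable. For finite [p] the product [psi (w u - k) f(u)] may fail to be
    integrable, and the coefficient is then a default value. Averages over [w] exclude this for
    almost every [w], but only for [k] outside a finite window: for [u] near the origin [w u] stays
    bounded, and dilation does not smooth a singularity of [psi]. The coefficients in the window are
    recovered from the operator itself, because the translates of its kernel are linearly
    independent. The same failure of dilations at the origin, now for [Gam], forces the compactness
    argument there. As the bounds hold only for almost every [w], a single dilation factor in
    [[1, 2]] has to serve countably many frequencies at once, along a subsequence of scales. Powers
    of order [p] enter through [y <= L + L^(1-p) y^p], where [L] is chosen only after integration
    against an integrable weight. *)

Lemma le_of_eq d (T : porderType d) (x y : T) : x = y -> (x <= y)%O.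
Proof. by move=> ->. Qed.

Section affine.
Context {R : realType}.
Local Notation mu := (@lebesgue_measure R).
Local Notation mR := (measurableTypeR R).
Implicit Types (F : R -> \bar R) (a b : R).

Lemma measurable_affine a b : measurable_fun [set: R] (fun x : R => a * x + b).
Proof. by apply: measurable_funD => //; exact: measurable_funM. Qed.

(** Scaled by [a], the push-forward of Lebesgue measure under [x |-> a x + b] agrees with Lebesgue
    measure on half-open intervals, hence everywhere, by uniqueness of the measure. *)
Lemma ge0_integral_affine_gt0 F a b : 0 < a -> measurable_fun [set: R] F ->
  (forall x, 0 <= F x)%E ->
  (\int[mu]_x F (a * x + b)%R = (a^-1)%:E * \int[mu]_x F x)%E.
Proof.
move=> a0 mF F0.
have ma : measurable_fun [set: mR] (fun x : mR => (a * x + b : mR)).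
  exact: measurable_affine.
have a0' : 0 <= a by exact: ltW.
pose h (x : mR) : mR := a * x + b.
pose nu : {measure set mR -> \bar R} := mscale (NngNum a0') (measure_function_pushforward__canonical__measure_function_Measure mu (ma : measurable_fun setT h)).
have E : forall A, measurable A -> mu A = nu A.
  apply: lebesgue_measure_unique => _ [[x y]] _ <-.
  rewrite /nu/= /mscale/= /pushforward/=.
  have -> : (fun x0 : R => a * x0 + b) @^-1` `]x, y]%classic =
    `](x - b) / a, (y - b) / a]%classic.
    apply/seteqP; split => z /=; rewrite !in_itv/= ltr_pdivrMr// ler_pdivlMr//;
    by rewrite ltrBlDr lerBrDr (mulrC z).
  rewrite !lebesgue_measure_itv/= !lte_fin ltr_pM2r ?invr_gt0// ltrD2r.
  case: ifPn => xy; last by rewrite mule0.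
  rewrite -!EFinB -EFinM; congr EFin.
  by rewrite -mulrBl mulrCA mulfV ?gt_eqF// mulr1; lra.
rewrite -[in RHS](@eq_measure_integral _ _ _ _ mu nu); last first.
  by move=> A mA _; exact/esym/E.
rewrite /nu ge0_integral_mscale// ge0_integral_pushforward//=.
by rewrite muleA -EFinM mulVf ?gt_eqF// mul1e.
Qed.

Lemma ge0_integral_opp F : measurable_fun [set: R] F ->
  (forall x, 0 <= F x)%E -> (\int[mu]_x F (- x)%R = \int[mu]_x F x)%E.
Proof.
move=> mF F0.
have mN : measurable_fun [set: mR] (fun x : mR => (- x : mR)) by exact: measurable_funN.
rewrite -[in RHS](@eq_measure_integral _ _ _ _ mu (pushforward mu (fun x : mR => (- x : mR)))); last first.
  by move=> A mA _; rewrite /= lebesgue_measureN.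
by rewrite ge0_integral_pushforward.
Qed.

Lemma ge0_integral_affine F a b : a != 0 -> measurable_fun [set: R] F ->
  (forall x, 0 <= F x)%E ->
  (\int[mu]_x F (a * x + b)%R = (`|a|^-1)%:E * \int[mu]_x F x)%E.
Proof.
move=> a0 mF F0; have [a0'|a0'] := ltrP 0 a.
  by rewrite gtr0_norm// ge0_integral_affine_gt0.
have {a0'} a0' : a < 0 by rewrite lt_neqAle a0.
rewrite ltr0_norm// -ge0_integral_opp//; last first.
  by apply: measurableT_comp => //; exact: measurable_affine.
under eq_integral do rewrite mulrN -mulNr.
by rewrite ge0_integral_affine_gt0// oppr_gt0.
Qed.

Lemma ge0_integral_affine_in F a b (A : set R) : a != 0 -> measurable A ->
  measurable_fun A F -> (forall x, A x -> 0 <= F x)%E ->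
  (\int[mu]_(x in [set x | A (a * x + b)%R]) F (a * x + b)%R
   = (`|a|^-1)%:E * \int[mu]_(x in A) F x)%E.
Proof.
move=> a0 mA mF F0.
rewrite [in RHS]integral_mkcond -(@ge0_integral_affine _ a b)//.
- rewrite integral_mkcond; apply: eq_integral => x _.
  by rewrite /patch/= /in_mem/= /in_set/= .
- exact/(measurable_restrictT _ _).1.
- by move=> x; rewrite /patch; case: ifPn => // /set_mem; exact: F0.
Qed.

End affine.

(** The enumeration 0, 1, -1, 2, -2, and so on: its first [2 N + 1] values fill [[-N, N]], so the
    symmetric partial sums [zpartial] are a subsequence of the partial sums of an ordinary
    series. *)
Definition zen (n : nat) : int := if odd n then (n./2.+1)%:Z else - (n./2)%:Z.
Definition zne (k : int) : nat :=
  match k with Posz 0 => 0%N | Posz m.+1 => m.*2.+1 | Negz m => m.+1.*2 end.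

Lemma zenK : cancel zen zne.
Proof.
move=> n; rewrite /zen -[in RHS](odd_double_half n).
case: ifPn => on /=; first by rewrite add1n.
by rewrite add0n; case: (n./2).
Qed.

Lemma zneK : cancel zne zen.
Proof.
case=> [[|m]|m]; rewrite /zen /zne //=.
  by rewrite odd_double /= uphalf_double.
by rewrite negbK odd_double/= doubleK NegzE.
Qed.

Lemma zen_bij : set_bij [set: nat] [set: int] zen.
Proof.
split => //; first by move=> x y _ _ /(can_inj zenK).
by move=> k _; exists (zne k) => //; rewrite zneK.
Qed.

Section esZ.
Context {R : realType}.
Implicit Types (a b : int -> \bar R) (r : R).
Local Open Scope ereal_scope.

Definition esZ a : \bar R := \sum_(n <oo) a (zen n).

Lemma esZ_esum a : (forall k, 0 <= a k) -> esZ a = \esum_(k in [set: int]) a k.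
Proof.
move=> a0; rewrite /esZ nneseries_esumT//.
by rewrite (reindex_esum [set: nat] [set: int] zen)//; exact: zen_bij.
Qed.

Lemma esZ_ge0 a : (forall k, 0 <= a k) -> 0 <= esZ a.
Proof. by move=> a0; exact: nneseries_ge0. Qed.

Lemma esZ_shift a (m : int) : (forall k, 0 <= a k) ->
  esZ (fun k => a (k + m)%R) = esZ a.
Proof.
move=> a0; rewrite !esZ_esum//.
rewrite [RHS](reindex_esum [set: int] [set: int] (fun k => (k + m)%R))//.
split => //; first by move=> x y _ _ /addIr.
by move=> k _; exists (k - m)%R => //; rewrite subrK.
Qed.

Lemma esZ_opp a : (forall k, 0 <= a k) -> esZ (fun k => a (- k)%R) = esZ a.
Proof.
move=> a0; rewrite !esZ_esum//.
rewrite [RHS](reindex_esum [set: int] [set: int] -%R)//.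
Qed.

Lemma le_esZ a b : (forall k, 0 <= a k) -> (forall k, a k <= b k) -> esZ a <= esZ b.
Proof. by move=> a0 ab; apply: lee_nneseries => n _. Qed.

Lemma esZD a b : (forall k, 0 <= a k) -> (forall k, 0 <= b k) ->
  esZ (fun k => a k + b k) = esZ a + esZ b.
Proof. by move=> a0 b0; rewrite /esZ nneseriesD. Qed.

Lemma esZZl r a : (0 <= r)%R -> (forall k, 0 <= a k) ->
  esZ (fun k => r%:E * a k) = r%:E * esZ a.
Proof. by move=> r0 a0; rewrite /esZ nneseriesZl. Qed.

Lemma esZ_sum (I : Type) (s : seq I) (P : pred I) (F : I -> int -> \bar R) :
  (forall i k, 0 <= F i k) ->
  esZ (fun k => \sum_(i <- s | P i) F i k) = \sum_(i <- s | P i) esZ (F i).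
Proof. by move=> F0; rewrite /esZ nneseries_sum. Qed.

Lemma sum_le_esZ a (s : seq int) : uniq s -> (forall k, 0 <= a k) ->
  \sum_(k <- s) a k <= esZ a.
Proof.
move=> us a0; rewrite esZ_esum//.
have -> : \sum_(k <- s) a k = \sum_(k \in [set` s]) a k.
  by rewrite -fsbig_seq.
apply: esum_ge; exists [set` s]; last exact: lexx.
by split => //; exact: finite_seq.
Qed.

Lemma esZ_le_sums a (M : \bar R) : (forall k, 0 <= a k) ->
  (forall s : seq int, uniq s -> \sum_(k <- s) a k <= M) -> esZ a <= M.
Proof.
move=> a0 H; rewrite /esZ; apply: lime_le; first exact: is_cvg_nneseries.
apply: nearW => n.
rewrite (_ : \sum_(0 <= i < n) a (zen i) = \sum_(k <- map zen (index_iota 0 n)) a k); last by rewrite big_map.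
apply: H; rewrite map_inj_uniq ?iota_uniq//; exact: can_inj zenK.
Qed.

Lemma term_le_esZ a k : (forall k, 0 <= a k) -> a k <= esZ a.
Proof. by move=> a0; have := @sum_le_esZ a [:: k] isT a0; rewrite big_seq1. Qed.

End esZ.

Section integral_esZ.
Context d (T : measurableType d) {R : realType} (mu : {measure set T -> \bar R}).
Local Open Scope ereal_scope.

Lemma measurable_esZ (D : set T) (f : int -> T -> \bar R) :
  (forall k x, D x -> 0 <= f k x) ->
  (forall k, measurable_fun D (f k)) -> measurable_fun D (fun x => esZ (f ^~ x)).
Proof.
move=> f0 mf; apply: ge0_emeasurable_sum => //.
by move=> n x Dx _; exact: f0.
Qed.

Lemma integral_esZ (D : set T) (f : int -> T -> \bar R) : measurable D ->
  (forall k, measurable_fun D (f k)) -> (forall k x, D x -> 0 <= f k x) ->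
  \int[mu]_(x in D) esZ (f ^~ x) = esZ (fun k => \int[mu]_(x in D) f k x).
Proof.
by move=> mD mf f0; rewrite /esZ integral_nneseries// => n x; exact: f0.
Qed.

End integral_esZ.

Section zsum.
Context {R : realType}.
Implicit Types (a b : int -> R).

Definition summZ a : Prop := (esZ (fun k => `|a k|%:E) < +oo)%E.

Lemma zpartialS a N : zpartial a N.+1 = zpartial a N + (a N.+1%:Z + a (- N.+1%:Z)).
Proof.
rewrite /zpartial doubleS big_nat_recr//= big_nat_recl//=.
rewrite sub0r.
under eq_bigr => i _ do rewrite -addn1 -(addn1 N) !PoszD opprD addrACA subrr addr0.
rewrite (_ : (N.*2.+2)%:Z - N.+1%:Z = N.+1%:Z); last first.
  by rewrite -addnn -(addn1 N) -addn2 !PoszD; ring.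
by ring.
Qed.

Lemma zpartial_series a N :
  zpartial a N = \sum_(0 <= n < N.*2.+1) a (zen n).
Proof.
elim: N => [|N IH]; first by rewrite /zpartial !big_nat1 subr0.
rewrite zpartialS IH doubleS [RHS]big_nat_recr//= [in RHS]big_nat_recr//= -addrA.
congr (_ + (a _ + a _)); rewrite /zen /= ?negbK odd_double/= ?uphalf_double//.
by rewrite doubleK.
Qed.

Lemma cvgn_odd (u : nat -> R) (l : R) : u @ \oo --> l -> u (N.*2.+1) @[N --> \oo] --> l.
Proof.
move=> ul; apply: cvg_comp ul => A [N _ NA]; exists N => // n /= Nn.
by apply: NA => /=; rewrite (leq_trans Nn)// -addnn -addnS leq_addr.
Qed.

Lemma summZ_cvg a : summZ a -> cvgn (series (a \o zen)).
Proof.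
move=> sa; apply: normed_cvg.
apply: nondecreasing_is_cvgn.
  by apply: nondecreasing_series => n _ _ /=.
exists (fine (esZ (fun k => `|a k|%:E))) => _ [n _ <-].
rewrite -lee_fin fineK; last first.
  by rewrite ge0_fin_numE//; apply: esZ_ge0 => k; rewrite lee_fin.
rewrite /series/= -sumEFin.
rewrite (_ : (\sum_(0 <= i < n) _ = \sum_(k <- map zen (index_iota 0 n)) `|a k|%:E)%E); last by rewrite big_map.
apply: sum_le_esZ => [|k]; last by rewrite lee_fin.
by rewrite map_inj_uniq ?iota_uniq//; exact: can_inj zenK.
Qed.

Lemma zsumE a : summZ a -> zsum a = limn (series (a \o zen)).
Proof.
move=> /summZ_cvg sa; apply/cvg_lim => //; rewrite (funext (zpartial_series a)).
exact: (@cvgn_odd (series (a \o zen))).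
Qed.

Lemma zsum_cvg a : summZ a -> zpartial a @ \oo --> zsum a.
Proof.
move=> sa; rewrite zsumE// (funext (zpartial_series a)).
by apply: (@cvgn_odd (series (a \o zen))); exact: summZ_cvg.
Qed.

Lemma zseries_zsum a l : summZ a -> zseries_to a l -> zsum a = l.
Proof. by move=> sa; exact: cvg_lim. Qed.

Lemma zpartialD a b N : zpartial (fun k => a k + b k) N = zpartial a N + zpartial b N.
Proof. by rewrite /zpartial big_split. Qed.

Lemma zpartialZ r a N : zpartial (fun k => r * a k) N = r * zpartial a N.
Proof. by rewrite /zpartial mulr_sumr. Qed.

Lemma norm_zpartial_le a N : (`|zpartial a N|%:E <= esZ (fun k => `|a k|%:E))%E.
Proof.
rewrite zpartial_series.
apply: (@le_trans _ _ (\sum_(0 <= n < N.*2.+1) `|a (zen n)|%:E)%E).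
  by rewrite sumEFin lee_fin ler_norm_sum.
rewrite (_ : (\sum_(0 <= i < _) _ = \sum_(k <- map zen (index_iota 0 N.*2.+1)) `|a k|%:E)%E); last by rewrite big_map.
apply: sum_le_esZ => [|k]; last by rewrite lee_fin.
by rewrite map_inj_uniq ?iota_uniq//; exact: can_inj zenK.
Qed.

Lemma zsumD a b : summZ a -> summZ b -> zsum (fun k => a k + b k) = zsum a + zsum b.
Proof.
move=> sa sb; apply/cvg_lim => //; rewrite (funext (zpartialD a b)).
by apply: cvgD; exact: zsum_cvg.
Qed.

Lemma zsumZ r a : summZ a -> zsum (fun k => r * a k) = r * zsum a.
Proof.
move=> sa; apply/cvg_lim => //; rewrite (funext (zpartialZ r a)).
by apply: cvgMr; exact: zsum_cvg.
Qed.

(** No summability is assumed: without it the right-hand side is infinite. *)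
Lemma le_norm_zsum a : (`|zsum a|%:E <= esZ (fun k => `|a k|%:E))%E.
Proof.
have [sa|] := pselect (summZ a); last first.
  by move/negP; rewrite -leNgt leye_eq => /eqP ->; rewrite leey.
have F : esZ (fun k => `|a k|%:E) \is a fin_num.
  by rewrite ge0_fin_numE//; apply: esZ_ge0 => k; rewrite lee_fin.
rewrite -(fineK F) lee_fin.
have := zsum_cvg sa => /cvg_norm/= h.
rewrite -(cvg_lim _ h)//.
apply: limr_le; first by apply/cvg_ex; exists `|zsum a|.
by apply: nearW => N; rewrite -lee_fin (fineK F) norm_zpartial_le.
Qed.

Lemma summZD a b : summZ a -> summZ b -> summZ (fun k => a k + b k).
Proof.
move=> sa sb; rewrite /summZ.
apply: (@le_lt_trans _ _ (esZ (fun k => `|a k|%:E + `|b k|%:E)%E)).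
  by apply: le_esZ => k; rewrite -?EFinD lee_fin// ler_normD.
by rewrite esZD ?lte_add_pinfty// => k; rewrite lee_fin.
Qed.

Lemma summZZ r a : summZ a -> summZ (fun k => r * a k).
Proof.
move=> sa; rewrite /summZ.
under eq_fun do rewrite normrM EFinM.
by rewrite esZZl// lte_mul_pinfty// lee_fin.
Qed.

Lemma summZ_shift a m : summZ a -> summZ (fun k => a (k + m)).
Proof.
by rewrite /summZ => sa; rewrite (esZ_shift (a := fun k => `|a k|%:E)).
Qed.

Lemma zsum0 : zsum (fun=> 0 : R) = 0.
Proof.
apply/cvg_lim => //; rewrite (_ : zpartial _ = cst 0); first exact: cvg_cst.
by apply/funext => N; rewrite /zpartial big1.
Qed.

Lemma summZ_sum (I : Type) (s : seq I) (F : I -> int -> R) :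
  (forall i, summZ (F i)) -> summZ (fun k => \sum_(i <- s) F i k).
Proof.
move=> sF; elim: s => [|i s IH].
  rewrite /summZ; under eq_fun do rewrite big_nil normr0.
  by rewrite /esZ eseries0.
under eq_fun do rewrite big_cons.
exact: summZD.
Qed.

Lemma zsum_sum (I : Type) (s : seq I) (F : I -> int -> R) :
  (forall i, summZ (F i)) ->
  zsum (fun k => \sum_(i <- s) F i k) = \sum_(i <- s) zsum (F i).
Proof.
move=> sF; elim: s => [|i s IH].
  rewrite big_nil -[RHS]zsum0.
  by congr zsum; apply/funext => k; rewrite big_nil.
under eq_fun do rewrite big_cons.
rewrite zsumD ?big_cons ?IH//; exact: summZ_sum.
Qed.

Lemma summZ_term a : summZ a -> a (zen n) @[n --> \oo] --> 0.
Proof. by move=> /summZ_cvg; exact: cvg_series_cvg_0. Qed.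

Lemma summZ_cvgr a : summZ a -> a N%:Z @[N --> \oo] --> 0.
Proof.
move=> /summZ_term h; rewrite -(cvg_shiftS (fun N => a N%:Z)).
have := cvgn_odd h; apply: cvg_trans; apply: near_eq_cvg; apply: nearW => N.
by rewrite /zen /= odd_double/= uphalf_double.
Qed.

Lemma summZN a : summZ a -> summZ (fun k => a (- k)).
Proof. by rewrite /summZ => sa; rewrite (esZ_opp (a := fun k => `|a k|%:E)). Qed.

Lemma summZ_cvgl a : summZ a -> a (- N%:Z) @[N --> \oo] --> 0.
Proof. by move=> /summZN /summZ_cvgr. Qed.

(** A shift changes a symmetric partial sum by two boundary terms, which tend to 0 for a summable
    sequence. *)
Lemma zsum_shift1 a : summZ a -> zsum (fun k => a (k + 1)) = zsum a.
Proof.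
move=> sa; apply/cvg_lim => //.
have E N : zpartial (fun k => a (k + 1)) N = zpartial a N + (a N.+1%:Z - a (- N%:Z)).
  rewrite /zpartial big_nat_recr//= [in RHS]big_nat_recl//=.
  rewrite sub0r -addnn PoszD addrK.
  rewrite (_ : N%:Z + 1 = N.+1%:Z); last by rewrite -[in RHS]addn1 [in RHS]PoszD.
  rewrite (eq_bigr (fun i : nat => a (i.+1%:Z - N%:Z))); last first.
    by move=> i _; congr a; rewrite -addn1 PoszD; ring.
  lra.
have L : (zpartial a N + (a N.+1%:Z - a (- N%:Z))) @[N --> \oo] --> zsum a + (0 - 0).
  apply: cvgD; first exact: zsum_cvg.
  apply: cvgB; last exact: summZ_cvgl.
  by rewrite (cvg_shiftS (fun N => a N%:Z)); exact: summZ_cvgr.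
by rewrite (eq_cvg _ _ E); move: L; rewrite subr0 addr0.
Qed.

Lemma zsum_shift a (m : int) : summZ a -> zsum (fun k => a (k + m)) = zsum a.
Proof.
have P (n : nat) b : summZ b -> zsum (fun k => b (k + n%:Z)) = zsum b.
  elim: n b => [|n IH] b sb; first by under eq_fun do rewrite addr0.
  rewrite -[RHS](IH _ sb) -[RHS]zsum_shift1; last exact: summZ_shift.
  by congr zsum; apply/funext => k; congr b; rewrite -addn1 PoszD; ring.
move=> sa; case: m => m; first exact: P.
rewrite -[LHS](P m.+1); last exact: summZ_shift.
by congr zsum; apply/funext => k; congr a; rewrite NegzE; ring.
Qed.

Lemma eq_zsum a b : a =1 b -> zsum a = zsum b.
Proof. by move=> /funext ->. Qed.

End zsum.

(** * Iterated integrals and series of translates *)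

Section integration_tools.
Context {R : realType}.
Local Notation mu := (@lebesgue_measure R).
Local Notation mR := (measurableTypeR R).
Implicit Types (F : R -> \bar R) (G : R -> R) (a b s u : R).

Lemma ge0_integral_shift F a b u : measurable_fun [set: R] F ->
  (forall x, 0 <= F x)%E ->
  (\int[mu]_(z in `[a, b]) F (u + z)%R = \int[mu]_(x in `[(a + u)%R, (b + u)%R]) F x)%E.
Proof.
move=> mF F0.
have := @ge0_integral_affine_in R F 1 u `[a + u, b + u]%classic (oner_neq0 _).
rewrite normr1 invr1 mul1e => <- //; last exact: measurable_funTS.
rewrite (_ : [set x | _] = `[a, b]%classic); last first.
  by apply/seteqP; split => z /=; rewrite !in_itv/= mul1r !lerD2r.
by apply: eq_integral => z _; rewrite mul1r addrC.
Qed.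

(** Integrability is not assumed: the positive and negative parts scale by the same positive factor,
    and in the infinite cases both sides are the default value 0 of [fine]. *)
Lemma Rintegral_affine_in G a b (A : set R) : a != 0 -> measurable A ->
  measurable_fun A G ->
  Rintegral mu [set x | A (a * x + b)] (fun x => G (a * x + b)) =
  `|a|^-1 * Rintegral mu A G.
Proof.
move=> a0 mA mG; rewrite /Rintegral.
have ia : 0 < `|a|^-1 by rewrite invr_gt0 normr_gt0.
rewrite integralE [in RHS]integralE.
have mE : measurable_fun (A : set mR) (EFin \o G : mR -> \bar R) by exact/measurable_EFinP.
rewrite (_ : (\int[mu]_(x in [set x | A (a * x + b)%R]) _ = (`|a|^-1)%:E * \int[mu]_(x in A) (EFin \o G)^\+ x)%E); last first.
  rewrite -(@ge0_integral_affine_in R _ a b)//; last exact: measurable_funepos mE.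
  by apply: eq_integral => x _; rewrite !funeposE.
rewrite (_ : (\int[mu]_(x in [set x | A (a * x + b)%R]) _ = (`|a|^-1)%:E * \int[mu]_(x in A) (EFin \o G)^\- x)%E); last first.
  rewrite -(@ge0_integral_affine_in R _ a b)//; last exact: measurable_funeneg mE.
  by apply: eq_integral => x _; rewrite !funenegE.
have : (0 <= \int[mu]_(x in A) (EFin \o G)^\+ x)%E by exact: integral_ge0.
have : (0 <= \int[mu]_(x in A) (EFin \o G)^\- x)%E by exact: integral_ge0.
case: (\int[mu]_(x in A) (EFin \o G)^\- x)%E => [n||]//; case: (\int[mu]_(x in A) (EFin \o G)^\+ x)%E => [p||]// _ _ /=.
- by rewrite mulrBr.
- by rewrite mulry gtr0_sg// mul1e mulr0.
- by rewrite mulry gtr0_sg// mul1e mulr0.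
- by rewrite mulry gtr0_sg// mul1e mulr0.
Qed.

Lemma Rintegral_shift G a b u : measurable_fun [set: R] G ->
  Rintegral mu `[a, b] (fun z => G (u + z)) = Rintegral mu `[a + u, b + u] G.
Proof.
move=> mG.
have := @Rintegral_affine_in G 1 u `[a + u, b + u]%classic (oner_neq0 _).
rewrite normr1 invr1 mul1r => <- //; last exact: measurable_funTS.
rewrite (_ : [set x | _] = `[a, b]%classic); last first.
  by apply/seteqP; split => z /=; rewrite !in_itv/= mul1r !lerD2r.
by apply: eq_Rintegral => z _; rewrite mul1r addrC.
Qed.

Lemma measurable_param_integral (K : mR * mR -> \bar R) (D : set R) : measurable D ->
  measurable_fun [set: mR * mR] K -> (forall z, 0 <= K z)%E ->
  measurable_fun [set: R] (fun x => \int[mu]_(y in D) K (x, y))%E.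
Proof.
move=> mD mK K0.
pose K' := K \_ (setT `*` D).
have mK' : measurable_fun setT K'.
  apply/(measurable_restrictT _ _).1; last exact: measurable_funTS.
  by apply: measurableX.
have K'0 : forall z, (0 <= K' z)%E by move=> z; rewrite /K' /patch; case: ifP.
have := @measurable_fun_fubini_tonelli_F _ _ _ _ _ mu K' mK' K'0.
apply: eq_measurable_fun => x _; rewrite /fubini_F [RHS]integral_mkcond.
apply: eq_integral => y _; rewrite /K' /patch.
by rewrite /in_mem/= /in_set/=; congr (if _ then _ else _); apply/asbool_equiv_eq; split => [[]|].
Qed.

Lemma measurable_param_Rintegral (K : mR * mR -> R) (D : set R) : measurable D ->
  measurable_fun [set: mR * mR] K ->
  measurable_fun [set: R] (fun x => Rintegral mu D (fun y => K (x, y))).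
Proof.
move=> mD mK; rewrite /Rintegral.
apply: measurableT_comp => //.
under eq_fun do rewrite integralE.
have mE : measurable_fun setT (EFin \o K) by exact/measurable_EFinP.
apply: emeasurable_funB.
  have := @measurable_param_integral (EFin \o K)^\+%E D mD (measurable_funepos mE) (funepos_ge0 _).
  by apply: eq_measurable_fun => x _; apply: eq_integral => y _; rewrite !funeposE.
have := @measurable_param_integral (EFin \o K)^\-%E D mD (measurable_funeneg mE) (funeneg_ge0 _).
by apply: eq_measurable_fun => x _; apply: eq_integral => y _; rewrite !funenegE.
Qed.

Definition LI G : Prop := measurable_fun [set: R] G /\
  forall K, (\int[mu]_(x in `[(- K)%R, K]) `|G x|%:E < +oo)%E.

Lemma mabs G : measurable_fun [set: R] G -> measurable_fun [set: R] (fun x => `|G x|%:E).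
Proof. by move=> mG; apply/measurable_EFinP/measurableT_comp. Qed.

Lemma mabsD (D : set mR) G : measurable_fun [set: R] G ->
  measurable_fun D (fun x : mR => `|G x|%:E).
Proof. by move=> mG; apply: (@measurable_funS _ _ _ _ setT) => //; exact: mabs. Qed.

Lemma LI_itv G a b : LI G -> (\int[mu]_(x in `[a, b]) `|G x|%:E < +oo)%E.
Proof.
move=> [mG GK]; apply: le_lt_trans (GK (`|a| + `|b|)).
apply: ge0_subset_integral => //=.
  exact: mabsD.
move=> x /=; rewrite !in_itv/= => /andP[ax xb]; apply/andP; split.
  by rewrite (le_trans _ ax)// lerNl (le_trans (ler_norm _))// normrN lerDl.
by rewrite (le_trans xb)// (le_trans (ler_norm _))// lerDr.
Qed.

Lemma LI_integrable G a b : LI G -> mu.-integrable `[a, b] (EFin \o G).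
Proof.
move=> GL; apply/integrableP; split; last exact: LI_itv.
by apply/measurable_EFinP/measurable_funTS; case: GL.
Qed.

Lemma integrable_LI G : integrableR G -> LI G.
Proof.
move=> /integrableP[mG iG]; have mG' : measurable_fun setT G by exact/measurable_EFinP.
split => // K; apply: le_lt_trans iG; apply: ge0_subset_integral => //=.
exact: mabs.
Qed.

Lemma LI_affine G a b : a != 0 -> LI G -> LI (fun x => G (a * x + b)).
Proof.
move=> a0 GL; have [mG _] := GL; split.
  by apply: measurableT_comp => //; exact: measurable_affine.
move=> K.
apply: (@le_lt_trans _ _ (\int[mu]_(x in [set x | `[(- (`|a| * K + `|b|))%R, (`|a| * K + `|b|)%R]%classic (a * x + b)%R]) `|G (a * x + b)|%:E)%E).
  apply: ge0_subset_integral => //=.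
  - have := @measurable_affine R a b measurableT _ (measurable_itv `[- (`|a| * K + `|b|), `|a| * K + `|b|]).
    by rewrite setTI.
  - by apply: mabsD; apply: measurableT_comp => //; exact: measurable_affine.
  - move=> x /=; rewrite !in_itv/= -!ler_norml => xK.
    by rewrite (le_trans (ler_normD _ _))// lerD2r normrM ler_wpM2l.
rewrite (@ge0_integral_affine_in _ (fun x => `|G x|%:E))//.
  by rewrite lte_mul_pinfty// ?lee_fin// LI_itv.
exact: mabsD.
Qed.

Lemma LI_shift G u : LI G -> LI (fun x => G (u + x)).
Proof.
move=> /(LI_affine u (oner_neq0 _)); congr LI; apply/funext => x.
by rewrite mul1r addrC.
Qed.

Lemma LI_le G1 G2 : measurable_fun [set: R] G1 -> (forall x, `|G1 x| <= `|G2 x|) -> LI G2 -> LI G1.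
Proof.
move=> mG1 le12 [mG2 iG2]; split => // K; apply: le_lt_trans (iG2 K).
apply: ge0_le_integral => //=.
- exact: mabsD.
- exact: mabsD.
- by move=> x _; rewrite lee_fin.
Qed.

Lemma LI_cst (r : R) : LI (cst r).
Proof.
split => // K; rewrite (_ : (fun x => _) = cst `|r|%:E)// integral_cst//= lebesgue_measure_itv/=.
case: ifP => _; last by rewrite mule0.
by rewrite -EFinB -EFinM ltry.
Qed.

Lemma LID G1 G2 : LI G1 -> LI G2 -> LI (fun x => G1 x + G2 x).
Proof.
move=> [mG1 iG1] [mG2 iG2]; split; first exact: measurable_funD.
move=> K; apply: (@le_lt_trans _ _ (\int[mu]_(x in `[(- K)%R, K]) (`|G1 x|%:E + `|G2 x|%:E))%E).
  apply: ge0_le_integral => //=.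
  - by apply: mabsD; exact: measurable_funD.
  - by apply: emeasurable_funD; exact: mabsD.
  - by move=> x _; rewrite -EFinD lee_fin ler_normD.
rewrite ge0_integralD//=; first by rewrite lte_add_pinfty.
- exact: mabsD.
- exact: mabsD.
Qed.

Lemma LIZ r G : LI G -> LI (fun x => r * G x).
Proof.
move=> [mG iG]; split; first exact: measurable_funM.
move=> K; under eq_integral do rewrite normrM EFinM.
rewrite ge0_integralZl//=; last exact: mabsD.
by rewrite lte_mul_pinfty// lee_fin.
Qed.

Lemma LI_norm G : LI G -> LI (fun x => `|G x|).
Proof.
by move=> GL; have [mG _] := GL; apply: LI_le GL => [|x]; [exact: measurableT_comp|rewrite normr_id].
Qed.

Lemma LI_locally G : LI G -> locally_integrable setT G.
Proof.
move=> GL; split => //; first by case: GL.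
  exact: openT.
move=> K _ cK; have [M [_ HM]] := compact_bounded cK.
have /= H := HM (`|M| + 1) (ltr_pwDr ltr01 (ler_norm _)).
apply: le_lt_trans (LI_itv (- (`|M| + 1)) (`|M| + 1) GL).
apply: ge0_subset_integral => //=.
- exact: compact_measurable.
- by apply: mabsD; case: GL.
- by move=> x /H/=; rewrite in_itv/= -ler_norml.
Qed.

End integration_tools.

Section ae_tools.
Context {R : realType}.
Local Notation mu := (@lebesgue_measure R).

Lemma aeS (P Q : R -> Prop) : (forall x, P x -> Q x) ->
  {ae mu, forall x, P x} -> {ae mu, forall x, Q x}.
Proof. by move=> PQ; apply: (@filterS _ _ (ae_filter_ringOfSetsType mu)). Qed.

Lemma aeI (P Q : R -> Prop) : {ae mu, forall x, P x} -> {ae mu, forall x, Q x} ->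
  {ae mu, forall x, P x /\ Q x}.
Proof. exact: (@filterI _ _ (ae_filter_ringOfSetsType mu)). Qed.

End ae_tools.

Section running_integral.
Context {R : realType}.
Local Notation mu := (@lebesgue_measure R).
Implicit Types (G : R -> R) (s u : R).

(** The integral of [G] over [[u, u + s]]. The iterate [Irn n s] is convolution with an unnormalised
    B-spline; it turns an n-th derivative into the n-th difference with step [s]. *)
Definition Ir s G u : R := Rintegral mu `[0, s] (fun z => G (u + z)).

Lemma Ir_shift s G a u : Ir s (fun x => G (x + a)) u = Ir s G (u + a).
Proof. by apply: eq_Rintegral => z _; rewrite addrAC. Qed.

Lemma integrable_Ir s G u : LI G -> mu.-integrable `[0, s] (EFin \o (fun z => G (u + z))).
Proof. by move=> GL; apply: LI_integrable; exact: LI_shift. Qed.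

Lemma IrD s G1 G2 u : LI G1 -> LI G2 ->
  Ir s (fun x => G1 x + G2 x) u = Ir s G1 u + Ir s G2 u.
Proof. by move=> L1 L2; rewrite /Ir RintegralD//; exact: integrable_Ir. Qed.

Lemma IrZ s r G u : LI G -> Ir s (fun x => r * G x) u = r * Ir s G u.
Proof. by move=> L; rewrite /Ir RintegralZl//; exact: integrable_Ir. Qed.

Lemma Ir_cst s r u : 0 <= s -> Ir s (cst r) u = s * r.
Proof.
move=> s0; rewrite /Ir Rintegral_cst//= mulrC; congr (_ * _).
by rewrite lebesgue_measure_itv/= lte_fin; case: ltgtP s0 => //= _ _; rewrite oppr0 addr0.
Qed.

Lemma norm_Ir_le s G u : LI G ->
  (`|Ir s G u|%:E <= \int[mu]_(z in `[0%R, s]) `|G (u + z)|%:E)%E.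
Proof.
move=> GL; rewrite EFin_normr_Rintegral//; last exact: integrable_Ir.
apply: le_trans (le_abse_integral _ _ _) _ => //.
by case/integrableP : (integrable_Ir s u GL).
Qed.

Lemma measurable_Ir s G : measurable_fun [set: R] G -> measurable_fun [set: R] (Ir s G).
Proof.
move=> mG; apply: (@measurable_param_Rintegral R (fun z => G (z.1 + z.2))) => //.
by apply: measurableT_comp => //; exact: measurable_funD.
Qed.

Lemma LI_Ir s G : LI G -> LI (Ir s G).
Proof.
move=> GL; split; first by apply: measurable_Ir; case: GL.
move=> K.
pose B := (\int[mu]_(x in `[(- K)%R, (s + K)%R]) `|G x|%:E)%E.
have Bf : B \is a fin_num.
  by rewrite ge0_fin_numE ?LI_itv//; exact: integral_ge0.
apply: (@le_lt_trans _ _ (\int[mu]_(x in `[(- K)%R, K]) (fine B)%:E)%E); last first.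
  have [_ /(_ K)] := LI_cst (fine B); apply: le_lt_trans.
  by apply: ge0_le_integral => //= *; rewrite ?lee_fin ?ler_norm// fine_ge0//; exact: integral_ge0.
apply: ge0_le_integral => //=.
- by apply: mabsD; apply: measurable_Ir; case: GL.
- move=> x; rewrite in_itv/= => /andP[Kx xK].
  apply: le_trans (norm_Ir_le _ _ GL) _.
  have mG : measurable_fun setT (fun x => `|G x|%:E) by apply: mabs; case: GL.
  rewrite (ge0_integral_shift 0 s x mG)// add0r fineK//.
  apply: ge0_subset_integral => //=; first exact: measurable_funTS.
  move=> y /=; rewrite !in_itv/= => /andP[xy ysx].
  by rewrite (le_trans Kx)//= (le_trans ysx)// lerD2l.
Qed.

Lemma ae_eq_Ir s G1 G2 u : measurable_fun [set: R] G1 -> measurable_fun [set: R] G2 ->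
  {ae mu, forall x, G1 x = G2 x} -> Ir s G1 u = Ir s G2 u.
Proof.
move=> m1 m2 e12; rewrite /Ir !Rintegral_shift// /Rintegral; congr fine.
apply: ae_eq_integral => //.
- exact/measurable_EFinP/measurable_funTS.
- exact/measurable_EFinP/measurable_funTS.
- by apply: aeS e12 => x /= -> _.
Qed.

Definition Irn (n : nat) s G := iter n (Ir s) G.

Lemma eq_Ir s G1 G2 u : G1 =1 G2 -> Ir s G1 u = Ir s G2 u.
Proof. by move=> /funext ->. Qed.

Lemma LI_Irn n s G : LI G -> LI (Irn n s G).
Proof. by move=> GL; elim: n => //= n; exact: LI_Ir. Qed.

Lemma IrnD n s G1 G2 u : LI G1 -> LI G2 ->
  Irn n s (fun x => G1 x + G2 x) u = Irn n s G1 u + Irn n s G2 u.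
Proof.
move=> L1 L2; elim: n u => // n IH u /=.
rewrite -IrD; [|exact: LI_Irn|exact: LI_Irn].
exact: eq_Ir.
Qed.

Lemma IrnZ n s r G u : LI G -> Irn n s (fun x => r * G x) u = r * Irn n s G u.
Proof.
move=> L1; elim: n u => // n IH u /=.
rewrite -IrZ; last exact: LI_Irn.
exact: eq_Ir.
Qed.

Lemma Irn_shift n s G a u : Irn n s (fun x => G (x + a)) u = Irn n s G (u + a).
Proof.
elim: n u => // n IH u /=.
by rewrite -Ir_shift; exact: eq_Ir.
Qed.

Lemma Irn_cst n s r u : 0 <= s -> Irn n s (cst r) u = s ^+ n * r.
Proof.
move=> s0; elim: n u => [|n IH] u; first by rewrite expr0 mul1r.
rewrite exprS -mulrA -(Ir_cst _ u)//; exact: eq_Ir.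
Qed.

Lemma ae_eq_Irn n s G1 G2 u : measurable_fun [set: R] G1 -> measurable_fun [set: R] G2 ->
  {ae mu, forall x, G1 x = G2 x} -> Irn n.+1 s G1 u = Irn n.+1 s G2 u.
Proof.
move=> m1 m2 e12; rewrite /Irn !iterSr; congr (iter n _ _ _).
by apply/funext => x; exact: ae_eq_Ir.
Qed.

(** One integration of [|G|] is kept and the other [n] are bounded by their length [s]: [G] is only
    locally integrable, so no pointwise bound on it is available. *)
Lemma norm_Irn_le n s G u : 0 <= s -> LI G ->
  (`|Irn n.+1 s G u|%:E <= (s ^+ n)%:E * \int[mu]_(z in `[0%R, (n.+1%:R * s)%R]) `|G (u + z)|%:E)%E.
Proof.
move=> s0 GL; have mG : measurable_fun setT (fun x => `|G x|%:E) by apply: mabs; case: GL.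
elim: n u => [|n IH] u.
  by rewrite expr0 mul1e mul1r; exact: norm_Ir_le.
rewrite [Irn n.+2 _ _]/=; apply: le_trans (norm_Ir_le _ _ (LI_Irn n.+1 s GL)) _.
pose B := (\int[mu]_(z in `[0%R, (n.+2%:R * s)%R]) `|G (u + z)|%:E)%E.
apply: (@le_trans _ _ (\int[mu]_(z in `[0%R, s]) ((s ^+ n)%:E * B))%E).
  apply: ge0_le_integral => //=.
  - have [mI _] := LI_shift u (LI_Irn n.+1 s GL).
    exact: mabsD.
  - move=> y; rewrite in_itv/= => /andP[y0 ys].
    apply: le_trans (IH _) _; rewrite lee_wpmul2l ?lee_fin ?exprn_ge0//.
    rewrite /B !(ge0_integral_shift _ _ _ mG)// !add0r.
    apply: ge0_subset_integral => //=; first exact: measurable_funTS.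
    move=> x /=; rewrite !in_itv/= => /andP[ux xu]; apply/andP; split; first by lra.
    by rewrite (le_trans xu)// -natr1 mulrDl mul1r; lra.
rewrite integral_cst//= lebesgue_measure_itv/= lte_fin exprS.
case: ltgtP s0 => // [s0 _|<- _]; last by rewrite mul0r mule0 mul0e.
by rewrite -EFinB subr0 muleC muleA -EFinM.
Qed.

Lemma Irn_scale n s G (w b : R) u : 0 < w -> LI G ->
  Irn n s (fun x => G (w * x + b)) u = w ^- n * Irn n (w * s) G (w * u + b).
Proof.
move=> w0 GL; elim: n u => [|n IH] u; first by rewrite expr0 invr1 mul1r.
rewrite [LHS]/= (_ : Ir s _ u = Ir s (fun v => w ^- n * Irn n (w * s) G (w * v + b)) u); last first.
  exact: eq_Ir.
have L' := LI_Irn n (w * s) GL.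
rewrite IrZ; last by apply: LI_affine => //; rewrite gt_eqF.
rewrite exprS invfM (mulrC w^-1) -mulrA; congr (_ * _).
rewrite /= /Ir.
have := @Rintegral_affine_in R (fun z => Irn n (w * s) G (w * u + b + z)) w 0 `[0, w * s]%classic.
rewrite gt_eqF// gtr0_norm// => /(_ isT) <- //; last first.
  by apply: measurable_funTS; have [] := LI_shift (w * u + b) L'.
rewrite (_ : [set x | `[0, w * s]%classic (w * x + 0)] = `[0, s]%classic); last first.
  apply/seteqP; split => z /=; rewrite !in_itv/= addr0 ler_pM2l// pmulr_rge0//.
by apply: eq_Rintegral => z _; rewrite addr0; congr (Irn _ _ _ _); lra.
Qed.

End running_integral.

Section power_tails.
Context {R : realType}.
Implicit Types (a x y : R).

Lemma ler_powRN a x y : 0 <= a -> 0 < x -> x <= y -> y `^ (- a) <= x `^ (- a).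
Proof.
move=> a0 x0 xy; have y0 : 0 < y by exact: lt_le_trans xy.
rewrite !powRN lef_pV2 ?posrE ?powR_gt0//.
by apply: ge0_ler_powR => //; rewrite nnegrE ltW.
Qed.

(** A telescoping majorant in place of the comparison with an integral. With [z = y + 1] it follows
    from [1 + t <= exp t] at [t = (a - 1) / z] and from [ln (1 - 1/z) <= - 1/z]. *)
Lemma powR_telescope a y : 1 < a -> 1 <= y ->
  (y + 1) `^ (- a) <= (a - 1)^-1 * (y `^ (1 - a) - (y + 1) `^ (1 - a)).
Proof.
move=> a1 y1; set z := y + 1.
have z0 : 0 < z by rewrite /z; lra.
have y0 : 0 < y by lra.
rewrite mulrC ler_pdivlMr ?subr_gt0// lerBrDr.
rewrite (_ : 1 - a = - a + 1); last by lra.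
have pz : z `^ (- a + 1) = z `^ (- a) * z.
  rewrite powRD; first by rewrite powRr1// ltW.
  by rewrite (gt_eqF z0) implybT.
apply: (@le_trans _ _ (z `^ (- a + 1) * expR ((a - 1) / z))).
  rewrite pz -mulrDr -mulrA ler_wpM2l ?powR_ge0//.
  apply: (@le_trans _ _ (z * (1 + (a - 1) / z))).
    by rewrite mulrDr mulr1 mulrCA mulfV ?gt_eqF// mulr1 addrC.
  by rewrite ler_pM2l// expR_ge1Dx.
rewrite /powR !gt_eqF// -expRD ler_expR.
have : ln y <= ln z - z^-1.
  rewrite (_ : y = z * (1 + (- z^-1))); last first.
    by rewrite mulrDr mulr1 mulrN mulfV ?gt_eqF// /z; lra.
  have h : 0 < 1 - z^-1 by rewrite subr_gt0 invf_lt1// /z; lra.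
  rewrite lnM ?posrE// lerD2l.
  by apply: le_ln1Dx; lra.
move=> h; have : (a - 1) * ln y <= (a - 1) * (ln z - z^-1) by rewrite ler_wpM2l// subr_ge0 ltW.
by lra.
Qed.

Lemma tail_powR a : 1 < a -> exists C, 0 <= C /\ forall x n, 1 <= x ->
  \sum_(0 <= m < n) (x + m%:R) `^ (- a) <= C * x `^ (1 - a).
Proof.
move=> a1; exists (1 + (a - 1)^-1); split.
  by rewrite addr_ge0// invr_ge0 subr_ge0 ltW.
move=> x n x1.
have P : \sum_(0 <= m < n.+1) (x + m%:R) `^ (- a) <=
    x `^ (- a) + (a - 1)^-1 * (x `^ (1 - a) - (x + n%:R) `^ (1 - a)).
  elim: n => [|n IH]; first by rewrite big_nat1 addr0 subrr mulr0 addr0.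
  rewrite big_nat_recr//=; apply: le_trans (lerD IH (lexx _)) _.
  rewrite -addrA lerD2l.
  have xn : 1 <= x + n%:R by rewrite (le_trans x1)// lerDl.
  have := powR_telescope a1 xn.
  by rewrite -addrA natr1 => h; lra.
apply: (@le_trans _ _ (\sum_(0 <= m < n.+1) (x + m%:R) `^ (- a))).
  by rewrite big_nat_recr//= lerDl powR_ge0.
apply: le_trans P _; rewrite mulrDl mul1r lerD//.
  by apply: ler_powR => //; lra.
apply: ler_wpM2l; first by rewrite invr_ge0 subr_ge0 ltW.
by have := powR_ge0 (x + n%:R) (1 - a); lra.
Qed.

End power_tails.

Section esZ_bounds.
Context {R : realType}.

Definition ints (N : nat) : seq int := map zen (iota 0 N.*2.+1).

Lemma ints_uniq N : uniq (ints N).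
Proof. by rewrite map_inj_uniq ?iota_uniq//; exact: can_inj zenK. Qed.

Lemma mem_ints N k : (k \in ints N) = (`|k| <= N)%N.
Proof.
apply/mapP/idP => [[n]|].
  rewrite mem_iota/= add0n ltnS => nN ->; rewrite /zen.
  move: nN; rewrite -[n in (n <= _)%N]odd_double_half; case: ifPn => on.
    by rewrite add1n ltn_double.
  by rewrite add0n leq_double abszN.
move=> kN; exists (zne k); last by rewrite zneK.
rewrite mem_iota/= add0n ltnS; case: k kN => [[|m]|m]//= h.
  by rewrite ltn_double.
by rewrite leq_double.
Qed.

Lemma ints_index K k : k \in ints K ->
  (`|(k + K%:Z)%R| < K.*2.+1)%N /\ (`|(k + K%:Z)%R|%N%:Z - K%:Z = k).
Proof. by rewrite mem_ints; lia. Qed.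

Lemma esZ1 (j : int) (x : \bar R) : (0 <= x)%E ->
  (esZ (fun k => if k == j then x else 0) <= x)%E.
Proof.
move=> x0; apply: esZ_le_sums => [k|s us]; first by case: ifP.
rewrite -big_mkcond/=; have [js|js] := boolP (j \in s).
  by rewrite -big_filter filter_pred1_uniq// big_seq1.
rewrite big_seq_cond big1// => k /andP[ks /eqP kj].
by rewrite -kj ks in js.
Qed.

(** A decaying kernel that may be locally unbounded can be dominated only outside a finite window of
    translates; the window is kept term by term. *)
Lemma esZ_split (f e : int -> \bar R) (s : seq int) : uniq s ->
  (forall k, 0 <= f k)%E -> (forall k, 0 <= e k)%E ->
  (forall k, k \notin s -> f k <= e k)%E ->
  (esZ f <= \sum_(k <- s) f k + esZ e)%E.
Proof.
move=> us f0 e0 fe.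
apply: (@le_trans _ _ (esZ (fun k => \sum_(j <- s) (if k == j then f j else 0) + e k)%E)).
  apply: le_esZ => // k; have [ks|ks] := boolP (k \in s); last first.
    apply: le_trans (fe _ ks) _; rewrite leeDr//.
    by apply: sume_ge0 => j _; case: ifP.
  rewrite -big_mkcond/=.
  rewrite (eq_bigl (fun i => i == k)); last by move=> i; rewrite eq_sym.
  by rewrite -big_filter filter_pred1_uniq// big_seq1 leeDl.
rewrite esZD//; last by move=> k; apply: sume_ge0 => j _; case: ifP.
rewrite leeD2r// esZ_sum; last by move=> i k; case: ifP.
by apply: lee_sum => j _; exact: esZ1.
Qed.

Lemma esZ_le_zpartial (f : int -> R) M : (forall k, 0 <= f k) ->
  (forall N, zpartial f N <= M) -> (esZ (fun k => (f k)%:E) <= M%:E)%E.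
Proof.
move=> f0 H; rewrite /esZ; apply: lime_le.
  by apply: is_cvg_nneseries => n _ _; rewrite lee_fin.
apply: nearW => n; rewrite sumEFin lee_fin (le_trans _ (H n))//.
rewrite zpartial_series [leRHS](big_cat_nat (n := n))//=; last by rewrite -addnn -addnS leq_addr.
by rewrite lerDl sumr_ge0.
Qed.

Lemma esZ_powR_tail (a : R) : 1 < a -> exists C, 0 <= C /\ forall x, 1 <= x ->
  (esZ (fun k => ((x + `|k%:~R : R|) `^ (- a))%:E) <= (C * x `^ (1 - a))%:E)%E.
Proof.
move=> a1; have [C [C0 HC]] := tail_powR a1.
exists (2 * C); split; first by rewrite mulr_ge0.
move=> x x1; apply: esZ_le_zpartial => [k|N]; first exact: powR_ge0.
apply: (@le_trans _ _ (2 * \sum_(0 <= m < N.+1) (x + m%:R) `^ (- a))); last first.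
  by rewrite -mulrA ler_pM2l// HC.
elim: N => [|N IH].
  by rewrite /zpartial !big_nat1 subr0 normr0 addr0; have := powR_ge0 x (- a); lra.
rewrite zpartialS big_nat_recr//= mulrDr lerD//.
by rewrite mulrNz normrN (ger0_norm (ler0n _ _)); lra.
Qed.

Lemma esZ_powR (a : R) : 1 < a ->
  (esZ (fun k => ((1 + `|k%:~R : R|) `^ (- a))%:E) < +oo)%E.
Proof.
move=> a1; have [C [_ H]] := esZ_powR_tail a1.
by apply: le_lt_trans (H 1 (lexx _)) _; rewrite ltry.
Qed.

Lemma esZ_tail0 (e : int -> R) : (forall k, 0 <= e k) ->
  (esZ (fun k => (e k)%:E) < +oo)%E -> forall eps, 0 < eps -> exists N,
  (esZ (fun k => if k \in ints N then 0 else (e k)%:E) <= eps%:E)%E.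
Proof.
move=> e0 fin eps eps0.
have E0 : (0 <= esZ (fun k => (e k)%:E))%E by apply: esZ_ge0 => k; rewrite lee_fin.
have Ef : esZ (fun k => (e k)%:E) \is a fin_num by rewrite ge0_fin_numE.
have [N HN] : exists N, (esZ (fun k => (e k)%:E) - eps%:E <= \sum_(k <- ints N) (e k)%:E)%E.
  apply: contrapT => /forallNP H.
  have : (esZ (fun k => (e k)%:E) <= esZ (fun k => (e k)%:E) - eps%:E)%E.
    apply: lime_le; first by apply: is_cvg_nneseries => n _ _; rewrite lee_fin.
    apply: nearW => n; have /negP := H n; rewrite -ltNge => /ltW; apply: le_trans.
    rewrite (_ : \sum_(k <- ints n) _ = \sum_(0 <= i < n.*2.+1) (e (zen i))%:E); last by rewrite big_map /index_iota subn0.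
    rewrite [leRHS](big_cat_nat (n := n))//=; last by rewrite -addnn -addnS leq_addr.
    by rewrite leeDl// sume_ge0// => *; rewrite lee_fin.
  by rewrite -(fineK Ef) -EFinB lee_fin; lra.
exists N; have D : esZ (fun k => (e k)%:E) = (esZ (fun k => if k \in ints N then 0 else (e k)%:E)
    + esZ (fun k => if k \in ints N then (e k)%:E else 0))%E.
  rewrite -esZD => [|k|k]; [|by case: ifP; rewrite ?lee_fin..].
  by congr esZ; apply/funext => k; case: ifP; rewrite ?add0e ?adde0.
have L : (\sum_(k <- ints N) (e k)%:E <= esZ (fun k => if k \in ints N then (e k)%:E else 0))%E.
  apply: le_trans (sum_le_esZ (ints_uniq N) _); last by move=> k; case: ifP; rewrite ?lee_fin.
  by rewrite big_seq [leRHS]big_seq; apply: lee_sum => k ->.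
have T0 : (0 <= esZ (fun k => if k \in ints N then 0 else (e k)%:E))%E.
  by apply: esZ_ge0 => k; case: ifP; rewrite ?lee_fin.
move: (le_trans HN L) D fin; move: E0 T0.
case: (esZ (fun k => (e k)%:E)) => [x||]//.
case: (esZ (fun k => if k \in ints N then 0 else (e k)%:E)) => [y||]//.
  case: (esZ (fun k => if k \in ints N then (e k)%:E else 0)) => [z||]//.
  by rewrite -EFinB !lee_fin -EFinD => _ _ h [xE] _; lra.
by case: (esZ (fun k => if k \in ints N then (e k)%:E else 0)).
Qed.

End esZ_bounds.

Section lattice_operator.
Context {R : realType}.
Local Notation mu := (@lebesgue_measure R).
Implicit Types (G : R -> R) (c : int -> R) (d : nat) (s u K : R).

Definition pgrow d c := exists C, forall k, `|c k| <= C * (1 + `|k%:~R|) ^+ d.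

(** The semi-discrete convolution of [c] with [G]. The sampling operator at [x] is [Sop] of its
    coefficients, with kernel [phi], at [w x]. *)
Definition Sop c G u := zsum (fun k => G (u - k%:~R) * c k).

Lemma pgrow_ge0 d c : pgrow d c -> exists C, 0 <= C /\ forall k, `|c k| <= C * (1 + `|k%:~R|) ^+ d.
Proof.
move=> [C HC]; exists `|C|; split => // k; apply: le_trans (HC k) _.
by rewrite ler_wpM2r ?ler_norm// exprn_ge0// addr_ge0.
Qed.

(** The size of [N] gives [|u - k| >= (1 + |k|) / 4 >= U] for [|u| <= K] and [|k| > N], after which
    the decay of [G] absorbs the growth of degree [d] and leaves a summable power. The window
    [ints N] is excluded because (Theta) says nothing on bounded sets. *)
Lemma Theta_env sg d G K : condition_Theta sg G -> d%:R + 1 < sg ->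
  exists (N : nat) (e : int -> R), [/\ forall k, 0 <= e k,
    (esZ (fun k => (e k)%:E) < +oo)%E &
    forall u k, `|u| <= K -> k \notin ints N ->
      `|G (u - k%:~R)| * (1 + `|k%:~R|) ^+ d <= e k].
Proof.
move=> [C [U GT]] dsg.
have [N HN] : exists N : nat, 2 * `|K| + 4 * `|U| + 1 < N%:R.
  exists (Num.truncn (2 * `|K| + 4 * `|U| + 1)).+1; exact: truncnS_gt.
pose e (k : int) : R := `|C| * 4 `^ sg * (1 + `|k%:~R|) `^ (- (sg - d%:R)).
exists N, e; split.
- by move=> k; rewrite !mulr_ge0// powR_ge0.
- rewrite /e; under eq_fun do rewrite EFinM.
  rewrite esZZl; [|by rewrite mulr_ge0 ?powR_ge0|by move=> k; rewrite lee_fin powR_ge0].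
  by rewrite lte_mul_pinfty// ?lee_fin ?mulr_ge0 ?powR_ge0//; apply: esZ_powR; lra.
move=> u k uK; rewrite mem_ints -ltnNge => Nk.
have kN : N%:R < `|k%:~R| :> R by rewrite -intr_norm -natr_absz ltr_nat.
have uk : (1 + `|k%:~R|) / 4 <= `|u - k%:~R|.
  have : `|k%:~R| - `|u| <= `|u - k%:~R| by rewrite distrC lerB_dist.
  by have := ler_norm K; have := normr_ge0 U; have := normr_ge0 K; lra.
have k0 : 0 < (1 + `|k%:~R|) / 4 :> R by rewrite divr_gt0// ltr_wpDr.
have d0 : 0 <= d%:R :> R by exact: ler0n.
have sg0 : 0 <= sg by lra.
have U1 : U <= `|u - k%:~R|.
  apply: le_trans uk; have := ler_norm U; have := normr_ge0 K; have := normr_ge0 U.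
  have : `|k%:~R| - `|u| <= `|u - k%:~R| by rewrite distrC lerB_dist.
  by lra.
apply: (@le_trans _ _ (`|C| * (((1 + `|k%:~R|) / 4) `^ (- sg)) * (1 + `|k%:~R|) ^+ d)).
  rewrite ler_wpM2r ?exprn_ge0 ?addr_ge0//; apply: le_trans (GT _ U1) _.
  apply: (@le_trans _ _ (`|C| * `|u - k%:~R| `^ (- sg))); first by rewrite ler_wpM2r ?powR_ge0 ?ler_norm.
  by rewrite ler_wpM2l// ler_powRN.
have k1 : 0 < 1 + `|k%:~R| :> R by rewrite ltr_wpDr.
rewrite /e -!mulrA ler_wpM2l// powRM ?(ltW k1)// opprB (addrC d%:R) powRD; last by rewrite (gt_eqF k1) implybT.
rewrite powR_mulrn ?(ltW k1)//.
have e4 : (4^-1 : R) `^ (- sg) = 4 `^ sg by rewrite -powR_inv1// -powRrM mulrNN mul1r.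
by rewrite le_eqVlt; apply/orP; left; apply/eqP; rewrite e4; ring.
Qed.

(** On a bounded interval the series of absolute values is at most a finite sum of translates plus a
    constant. Hence it converges at every point, and its sum is locally integrable, which makes it a
    majorant for dominated convergence. *)
Lemma Sop_major sg d G K c : LI G -> condition_Theta sg G -> d%:R + 1 < sg -> pgrow d c ->
  (forall u, summZ (fun k => G (u - k%:~R) * c k)) /\
  (\int[mu]_(x in `[(- K)%R, K]) esZ (fun k => `|G (x - k%:~R) * c k|%:E) < +oo)%E.
Proof.
move=> GL GT ds /pgrow_ge0[C [C0 HC]].
have main K' : exists (N : nat) (M : R), 0 <= M /\ forall u, `|u| <= K' ->
    (esZ (fun k => `|G (u - k%:~R) * c k|%:E) <=
     \sum_(k <- ints N) `|G (u - k%:~R) * c k|%:E + M%:E)%E.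
  have [N [e [e0 efin He]]] := Theta_env K' GT ds.
  exists N, (C * fine (esZ (fun k => (e k)%:E))).
  have E0 : (0 <= esZ (fun k => (e k)%:E))%E by apply: esZ_ge0 => k; rewrite lee_fin.
  split; first by rewrite mulr_ge0// fine_ge0.
  move=> u uK; rewrite EFinM fineK ?ge0_fin_numE// -esZZl; [|by []|by move=> k; rewrite lee_fin].
  apply: esZ_split; first exact: ints_uniq.
  - by move=> k; rewrite lee_fin.
  - by move=> k; rewrite -EFinM lee_fin mulr_ge0.
  move=> k kN; rewrite -EFinM lee_fin normrM.
  apply: (@le_trans _ _ (`|G (u - k%:~R)| * (C * (1 + `|k%:~R|) ^+ d))).
    by rewrite ler_wpM2l.
  by rewrite mulrCA ler_wpM2l// He.
split.
  move=> u; have [N [M [M0 HM]]] := main `|u|.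
  by apply: le_lt_trans (HM u (lexx _)) _; rewrite sumEFin -EFinD ltry.
have [N [M [M0 HM]]] := main K.
have mk k : measurable_fun setT (fun x : R => `|G (x - k%:~R) * c k|).
  apply: measurableT_comp => //; apply: measurable_funM => //.
  by apply: measurableT_comp; [case: GL|exact: measurable_funB].
apply: (@le_lt_trans _ _ (\int[mu]_(x in `[(- K)%R, K])
    (\sum_(k <- ints N) `|G (x - k%:~R) * c k| + M)%:E)%E).
  apply: ge0_le_integral => //=.
  - by move=> x _; apply: esZ_ge0 => k; rewrite lee_fin.
  - apply: (@measurable_funS _ _ _ _ setT) => //; apply: measurable_esZ => [k x _|k]; first by rewrite lee_fin.
    by apply/measurable_EFinP; exact: mk.
  - apply: (@measurable_funS _ _ _ _ setT) => //; apply/measurable_EFinP.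
    by apply: measurable_funD => //; apply: measurable_sum => k; exact: mk.
  move=> x; rewrite in_itv/= -ler_norml => xK.
  by apply: le_trans (HM x xK) _; rewrite EFinD sumEFin.
have := LI_cst M; have : LI (fun x => \sum_(k <- ints N) `|G (x - k%:~R) * c k|).
  elim: (ints N) => [|k t IH].
    by have := LI_cst (0 : R); congr LI; apply/funext => x; rewrite big_nil.
  under eq_fun do rewrite big_cons.
  apply: LID => //; apply: LI_norm.
  under eq_fun do rewrite mulrC.
  apply: LIZ; have := LI_affine (- k%:~R) (oner_neq0 _) GL.
  by congr LI; apply/funext => x; rewrite mul1r.
move=> /LID/[apply] -[_ /(_ K)]; apply: le_lt_trans.
apply: ge0_le_integral => //=.
- by move=> x _; rewrite lee_fin addr_ge0// sumr_ge0.
- apply: (@measurable_funS _ _ _ _ setT) => //; apply/measurable_EFinP.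
  by apply: measurable_funD => //; apply: measurable_sum => k; exact: mk.
- apply: mabsD; apply: measurable_funD => //; apply: measurable_sum => k; exact: mk.
- by move=> x _; rewrite lee_fin ler_norm.
Qed.

Lemma Sop_summ sg d G c u : LI G -> condition_Theta sg G -> d%:R + 1 < sg -> pgrow d c ->
  summZ (fun k => G (u - k%:~R) * c k).
Proof. by move=> GL GT ds cd; have [] := Sop_major 0 GL GT ds cd. Qed.

Lemma measurable_zpartial_Sop G c n : measurable_fun [set: R] G ->
  measurable_fun [set: R] (fun u => zpartial (fun k => G (u - k%:~R) * c k) n).
Proof.
move=> mG; rewrite /zpartial; apply: measurable_sum => i; apply: measurable_funM => //.
by apply: measurableT_comp => //; exact: measurable_funB.
Qed.

Lemma LI_Sop sg d G c : LI G -> condition_Theta sg G -> d%:R + 1 < sg -> pgrow d c ->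
  LI (Sop c G).
Proof.
move=> GL GT ds cd; have mS : measurable_fun [set: R] (Sop c G).
  apply: (@measurable_fun_cvg _ _ _ _ (fun n u => zpartial (fun k => G (u - k%:~R) * c k) n)).
    by move=> n; apply: measurable_zpartial_Sop; case: GL.
  by move=> u _; apply: zsum_cvg; exact: (Sop_summ u GL GT ds cd).
split => // K; have [_] := Sop_major K GL GT ds cd; apply: le_lt_trans.
apply: ge0_le_integral => //=.
- exact: mabsD.
- apply: (@measurable_funS _ _ _ _ setT) => //; apply: measurable_esZ => [k x _|k]; first by rewrite lee_fin.
  apply: mabs; apply: measurable_funM => //.
  by apply: measurableT_comp; [case: GL|exact: measurable_funB].
- by move=> x _; exact: le_norm_zsum.
Qed.

Lemma Rintegral_bigsum (I : Type) (t : seq I) (F : I -> R -> R) s :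
  (forall i, LI (F i)) ->
  Rintegral mu `[0, s] (fun z => \sum_(i <- t) F i z) = \sum_(i <- t) Rintegral mu `[0, s] (F i).
Proof.
move=> FL.
have LS t' : LI (fun z => \sum_(i <- t') F i z).
  elim: t' => [|i t' IH].
    by have := LI_cst (0 : R); congr LI; apply/funext => x; rewrite big_nil.
  by under eq_fun do rewrite big_cons; exact: LID.
elim: t => [|i t IH].
  rewrite big_nil (_ : (fun z => _) = cst 0) ?Rintegral_cst ?mul0r//.
  by apply/funext => z; rewrite big_nil.
rewrite big_cons -IH -RintegralD//; [|exact: LI_integrable..].
by apply: eq_Rintegral => z _; rewrite big_cons.
Qed.

(** Dominated convergence for the symmetric partial sums, with the majorant of [Sop_major]. *)
Lemma Ir_Sop sg d G c s u : LI G -> condition_Theta sg G -> d%:R + 1 < sg -> pgrow d c ->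
  Ir s (Sop c G) u = Sop c (Ir s G) u.
Proof.
move=> GL GT ds cd; have LS := LI_Sop GL GT ds cd.
have GkL k : LI (fun z => G (u + z - k%:~R) * c k).
  under eq_fun do rewrite mulrC.
  apply: LIZ; have := LI_affine (u - k%:~R) (oner_neq0 _) GL.
  by congr LI; apply/funext => x; rewrite mul1r; congr G; lra.
pose f_ (n : nat) (z : R) := (zpartial (fun k => G (u + z - k%:~R) * c k) n)%:E.
pose g z := esZ (fun k => `|G (u + z - k%:~R) * c k|%:E).
have mg : measurable_fun (`[0, s]%classic : set (measurableTypeR R)) (g : measurableTypeR R -> \bar R).
  apply: (@measurable_funS _ _ _ _ setT) => //; apply: measurable_esZ => [k x _|k]; first by rewrite lee_fin.
  by apply: mabs; case: (GkL k).
have [] := @dominated_convergence _ _ R mu `[0, s]%classic (measurable_itv _) f_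
   (fun z => (Sop c G (u + z))%:E) g.
- move=> n; apply/measurable_EFinP; apply: (@measurable_funS _ _ _ _ setT) => //.
  by rewrite /zpartial; apply: measurable_sum => i; case: (GkL (i%:Z - n%:Z)).
- apply/measurable_EFinP; apply: (@measurable_funS _ _ _ _ setT) => //.
  by have [] := LI_shift u LS.
- apply/aeW => z _; apply: cvg_EFin; first exact: nearW.
  by apply: zsum_cvg; exact: (Sop_summ _ GL GT ds cd).
- apply/integrableP; split; first exact: mg.
  have [_] := Sop_major (`|u| + `|s|) GL GT ds cd; apply: le_lt_trans.
  pose h x := esZ (fun k => `|G (x - k%:~R) * c k|%:E).
  have h0 x : (0 <= h x)%E by apply: esZ_ge0 => k; rewrite lee_fin.
  have mh : measurable_fun setT h.
    apply: measurable_esZ => [k x _|k]; first by rewrite lee_fin.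
    apply: mabs; apply: measurable_funM => //.
    by apply: measurableT_comp; [case: GL|exact: measurable_funB].
  rewrite (_ : (\int[mu]_(x in `[0%R, s]) _ = \int[mu]_(x in `[0%R, s]) h (u + x)%R)%E); last first.
    by apply: eq_integral => x _; rewrite gee0_abs//; exact: h0.
  rewrite ge0_integral_shift//.
  apply: ge0_subset_integral => //=; first exact: measurable_funTS.
  move=> x /=; rewrite !in_itv/= => /andP[ux xs]; apply/andP; split.
    by have := ler_norm (- u); rewrite normrN; have := normr_ge0 s; lra.
  by have := ler_norm u; have := ler_norm s; lra.
- by apply/aeW => z n _; exact: norm_zpartial_le.
move=> _ _ cvgI.
have fI : (\int[mu]_(z in `[0%R, s]) (Sop c G (u + z)%R)%:E)%E \is a fin_num.
  by apply: integrable_fin_num => //; exact: integrable_Ir.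
apply/esym/cvg_lim => //; rewrite /Ir [X in _ --> X]/Rintegral.
move: cvgI; rewrite -(fineK fI) => /fine_cvg; apply: cvg_trans.
apply: near_eq_cvg; apply: nearW => n /=.
rewrite -/(Rintegral mu `[0, s] (fun z => zpartial (fun k => G (u + z - k%:~R) * c k) n)).
rewrite /zpartial Rintegral_bigsum; last by move=> i; exact: GkL.
apply: eq_bigr => i _; rewrite mulrC /Ir -RintegralZl//; last first.
  exact: (integrable_Ir s (u - (i%:Z - n%:Z)%:~R) GL).
by apply: eq_Rintegral => z _; rewrite mulrC; congr (_ * G _); lra.
Qed.

Lemma Theta_Ir sg G s : 0 <= sg -> 0 <= s -> LI G -> condition_Theta sg G -> condition_Theta sg (Ir s G).
Proof.
move=> sg0 s0 GL [C [U GT]].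
exists (s * (`|C| * 2^-1 `^ (- sg))), (2 * `|U| + 2 * s + 1) => u uU.
have u0 : 0 < `|u| by have := normr_ge0 U; lra.
have H : forall z, 0 <= z <= s -> `|G (u + z)| <= `|C| * 2^-1 `^ (- sg) * `|u| `^ (- sg).
  move=> z /andP[z0 zs].
  have uz : 2^-1 * `|u| <= `|u + z|.
    have := lerB_normD u z; rewrite (ger0_norm z0); have := normr_ge0 U; lra.
  have Uz : U <= `|u + z| by apply: le_trans uz; have := ler_norm U; lra.
  apply: le_trans (GT _ Uz) _.
  apply: (@le_trans _ _ (`|C| * `|u + z| `^ (- sg))); first by rewrite ler_wpM2r ?powR_ge0 ?ler_norm.
  rewrite -mulrA ler_wpM2l// -powRM//.
  by apply: ler_powRN => //; rewrite mulr_gt0.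
rewrite -lee_fin; apply: le_trans (norm_Ir_le _ _ GL) _.
apply: (@le_trans _ _ (\int[mu]_(z in `[0%R, s]) cst (`|C| * 2^-1 `^ (- sg) * `|u| `^ (- sg))%:E z)%E).
  apply: ge0_le_integral => //=.
  - by apply: mabsD; have [] := LI_shift u GL.
rewrite integral_cst//= lebesgue_measure_itv/= lte_fin.
case: ltgtP s0 => // [s0 _|<- _]; last by rewrite mul0r mul0r mule0.
by rewrite -EFinB subr0 -EFinM lee_fin; lra.
Qed.

Lemma Theta_Irn n sg G s : 0 <= sg -> 0 <= s -> LI G -> condition_Theta sg G ->
  condition_Theta sg (Irn n s G).
Proof.
move=> sg0 s0 GL GT; elim: n => //= n IH; apply: Theta_Ir => //; exact: LI_Irn.
Qed.

Lemma Irn_Sop n sg d G c s u : 0 <= s -> LI G -> condition_Theta sg G -> d%:R + 1 < sg -> pgrow d c ->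
  Irn n s (Sop c G) u = Sop c (Irn n s G) u.
Proof.
move=> s0 GL GT ds cd; elim: n u => // n IH u.
rewrite -(Ir_Sop s u (LI_Irn n s GL) (Theta_Irn n _ s0 GL GT) ds cd); last first.
  by have := ler0n R d; lra.
exact: eq_Ir.
Qed.

Lemma Sop_shift1 sg d G c u : LI G -> condition_Theta sg G -> d%:R + 1 < sg -> pgrow d c ->
  Sop c G (u + 1) = Sop (fun k => c (k + 1)) G u.
Proof.
move=> GL GT ds cd; rewrite /Sop -[LHS](zsum_shift1 (Sop_summ (u + 1) GL GT ds cd)).
apply: eq_zsum => k; congr (G _ * _); rewrite intrD; lra.
Qed.

Lemma SopD sg d G c1 c2 u : LI G -> condition_Theta sg G -> d%:R + 1 < sg -> pgrow d c1 -> pgrow d c2 ->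
  Sop (fun k => c1 k + c2 k) G u = Sop c1 G u + Sop c2 G u.
Proof.
move=> GL GT ds cd1 cd2; rewrite -zsumD; [|exact: (Sop_summ u GL GT ds)..].
by apply: eq_zsum => k; rewrite mulrDr.
Qed.

Lemma SopZ sg d G c r u : LI G -> condition_Theta sg G -> d%:R + 1 < sg -> pgrow d c ->
  Sop (fun k => r * c k) G u = r * Sop c G u.
Proof.
move=> GL GT ds cd; rewrite -zsumZ; last exact: (Sop_summ u GL GT ds).
by apply: eq_zsum => k; rewrite mulrCA.
Qed.

Lemma pgrow_shift d c (m : int) : pgrow d c -> pgrow d (fun k => c (k + m)).
Proof.
move=> /pgrow_ge0[C [C0 HC]]; exists (C * (1 + `|m%:~R|) ^+ d) => k.
apply: le_trans (HC _) _; rewrite -mulrA ler_wpM2l// -exprMn.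
rewrite lerXn2r ?nnegrE ?mulr_ge0 ?addr_ge0// intrD.
have := ler_normD (k%:~R : R) (m%:~R : R); have := mulr_ge0 (normr_ge0 (m%:~R : R)) (normr_ge0 (k%:~R : R)).
rewrite mulrDl mulrDr; lra.
Qed.

Lemma pgrowD d c1 c2 : pgrow d c1 -> pgrow d c2 -> pgrow d (fun k => c1 k + c2 k).
Proof.
move=> [C1 H1] [C2 H2]; exists (C1 + C2) => k.
by rewrite mulrDl; apply: le_trans (ler_normD _ _) _; rewrite lerD.
Qed.

Lemma pgrowZ d c r : pgrow d c -> pgrow d (fun k => r * c k).
Proof.
move=> [C1 H1]; exists (`|r| * C1) => k.
by rewrite normrM -mulrA ler_wpM2l.
Qed.

Lemma pgrow_le d c c' : (forall k, `|c k| <= `|c' k|) -> pgrow d c' -> pgrow d c.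
Proof. by move=> cc' [C H]; exists C => k; rewrite (le_trans (cc' k)). Qed.

End lattice_operator.

(** * Finite differences *)

Section differences.
Context {R : realType}.
Implicit Types (f : R -> R) (s t x : R) (m n : nat).

Definition Dl s f x := f (x + s) - f x.
Definition Dn n s f := iter n (Dl s) f.

(** Pascal's rule; it identifies the binomial sum [diffm] of the definition of the modulus with the
    iterated difference [Dn], which is easier to handle by induction. *)
Lemma diffmS m t f x : diffm m.+1 t f x = diffm m t f (x + t) - diffm m t f x.
Proof.
rewrite /diffm -[LHS](big_mkord xpredT (fun j => 'C(m.+1, j)%:R * (-1) ^+ (m.+1 - j) * f (x + j%:R * t))).
rewrite big_nat_recl//= bin0 mul1r subn0 mul0r addr0.
under eq_big_nat => j jm do rewrite binS natrD subSS 2!mulrDl.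
rewrite big_split/=.
have E1 : \sum_(0 <= i < m.+1) 'C(m, i)%:R * (-1) ^+ (m - i) * f (x + i.+1%:R * t) =
    \sum_(j < m.+1) 'C(m, j)%:R * (-1) ^+ (m - j) * f (x + t + j%:R * t).
  rewrite big_mkord; apply: eq_bigr => j _; congr (_ * f _).
  by rewrite -natr1; lra.
have E2 : (-1) ^+ m.+1 * f x + \sum_(0 <= i < m.+1) 'C(m, i.+1)%:R * (-1) ^+ (m - i) * f (x + i.+1%:R * t) =
    - \sum_(j < m.+1) 'C(m, j)%:R * (-1) ^+ (m - j) * f (x + j%:R * t).
  rewrite -(big_mkord xpredT (fun j => 'C(m, j)%:R * (-1) ^+ (m - j) * f (x + j%:R * t))).
  rewrite big_nat_recr//= bin_small// mul0r mul0r addr0 [in RHS]big_nat_recl//= bin0 mul1r subn0 mul0r addr0.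
  rewrite exprS mulN1r mulNr opprD; congr (_ + _).
  rewrite -sumrN; apply: eq_big_nat => j /andP[_ jm].
  by rewrite -[in LHS](subnSK jm) exprS mulN1r; ring.
by rewrite -E1 addrC -E2; ring.
Qed.

Lemma diffmE m t f : diffm m t f = Dn m t f.
Proof.
elim: m => [|m IH]; apply/funext => x.
  by rewrite /diffm big_ord1 bin0 subnn expr0 !mul1r mul0r addr0.
by rewrite diffmS IH.
Qed.

Lemma DnD n s f1 f2 x : Dn n s (fun y => f1 y + f2 y) x = Dn n s f1 x + Dn n s f2 x.
Proof. by elim: n x => // n IH x; rewrite /= /Dl !IH; lra. Qed.

Lemma DnZ n s r f x : Dn n s (fun y => r * f y) x = r * Dn n s f x.
Proof. by elim: n x => // n IH x; rewrite /= /Dl !IH; lra. Qed.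

Lemma DnSr n s f : Dn n.+1 s f = Dn n s (Dl s f).
Proof. by rewrite /Dn iterSr. Qed.

Lemma eq_Dn n s f1 f2 x : f1 =1 f2 -> Dn n s f1 x = Dn n s f2 x.
Proof. by move=> /funext ->. Qed.

Lemma Dn_scale n s f w b x : Dn n s (fun y => f (w * y + b)) x = Dn n (w * s) f (w * x + b).
Proof.
elim: n x => // n IH x; rewrite /= /Dl !IH; congr (Dn _ _ _ _ - _); lra.
Qed.

Lemma LI_Dl s f : LI f -> LI (Dl s f).
Proof.
move=> fL; apply: LID; first by have := LI_affine s (oner_neq0 _) fL; congr LI; apply/funext => x; rewrite mul1r.
by have := LIZ (-1) fL; congr LI; apply/funext => x; rewrite mulN1r.
Qed.

Lemma Irn_Dl n s a f x : LI f -> Irn n s (Dl a f) x = Dl a (Irn n s f) x.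
Proof.
move=> fL; rewrite /Dl -Irn_shift (_ : Irn n s f x = - Irn n s (fun y => -1 * f y) x); last first.
  by rewrite IrnZ//; lra.
rewrite opprK -IrnD.
- by congr (Irn _ _ _ _); apply/funext => y; rewrite mulN1r.
- by have := LI_affine a (oner_neq0 _) fL; congr LI; apply/funext => y; rewrite mul1r.
- exact: LIZ.
Qed.

Lemma LI_Dn n s f : LI f -> LI (Dn n s f).
Proof. by move=> fL; elim: n => //= n; exact: LI_Dl. Qed.

Lemma Irn_Dn n s m a f x : LI f -> Irn n s (Dn m a f) x = Dn m a (Irn n s f) x.
Proof.
move=> fL; elim: m x => // m IH x.
rewrite [Dn m.+1 a f]/= Irn_Dl; last exact: LI_Dn.
by rewrite /Dl !IH.
Qed.

(** By Taylor's formula each difference lowers the degree by one. *)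
Lemma Dn_poly n s (Q : {poly R}) x : (size Q <= n)%N -> Dn n s (fun y => Q.[y]) x = 0.
Proof.
elim: n Q x => [|n IH] Q x Qn.
  by rewrite /=; move: Qn; rewrite leqn0 size_poly_eq0 => /eqP ->; rewrite horner0.
rewrite DnSr.
pose Q' := \sum_(i < n) s ^+ i.+1 *: Q^`N(i.+1).
rewrite (_ : Dl s _ = fun y => Q'.[y]).
  apply: IH; rewrite /Q'; apply: (leq_trans (size_sum _ _ _)); apply/bigmax_leqP => i _.
  apply: (leq_trans (size_scale_leq _ _)); apply/leq_sizeP => j nj.
  rewrite coef_nderivn nth_default ?mul0rn//; apply: leq_trans Qn _.
  by rewrite addSn ltnS (leq_trans nj)// leq_addl.
apply/funext => y; rewrite /Dl (nderiv_taylor_wide (n := n.+1))//; last exact: mulrC.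
rewrite big_ord_recl/= nderivn0 expr0 mulr1 addrC addKr.
by rewrite /Q' horner_sum; apply: eq_bigr => i _; rewrite hornerZ mulrC.
Qed.

End differences.

Section lebesgue_diff.
Context {R : realType}.
Local Notation mu := (@lebesgue_measure R).
Implicit Types (G : R -> R) (s u x : R).

(** At a Lebesgue point the error is at most a multiple of the mean of [|G - G x|] over a ball of
    radius comparable to [s]. The exceptional set does not depend on [s], so an identity between
    iterated integrals for all small steps can be differentiated almost everywhere. *)
Lemma Irn_differentiation n G : LI G ->
  {ae mu, forall x, forall eps, 0 < eps -> exists d, 0 < d /\
     forall s, 0 < s < d -> `|s ^- n.+1 * Irn n.+1 s G x - G x| <= eps}.
Proof.
move=> GL; have := lebesgue_differentiation (LI_locally GL); apply: aeS => x.
rewrite /lebesgue_pt => /fine_cvgP[fin /cvgrPdist_lt H] eps eps0.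
(* The ratio of the length [2 rho = 4 (n + 1) s] of the ball used below to the step [s]. *)
pose C : R := 4 * n.+1%:R.
have C0 : 0 < C by rewrite mulr_gt0.
have : \forall r \near 0^'+, davg G x r \is a fin_num /\ `|0 - fine (davg G x r)| < eps / C.
  by apply: filterI => //; apply: H; rewrite divr_gt0.
move=> [e /= e0 He]; exists (e / (2 * n.+1%:R)); split; first by rewrite divr_gt0// mulr_gt0.
move=> s /andP[s0 se]; pose rho := 2 * n.+1%:R * s.
have rho0 : 0 < rho by rewrite !mulr_gt0.
have [] := He rho _ rho0.
  rewrite /= sub0r normrN gtr0_norm// /rho.
  by move: se; rewrite ltr_pdivlMr ?mulr_gt0// mulrC.
move=> fr; rewrite sub0r normrN => dr.
pose G' y := G y + (-1) * cst (G x) y.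
have G'L : LI G' by apply: LID => //; apply: LIZ; exact: LI_cst.
have sn0 : s ^- n.+1 * s ^+ n.+1 = 1 by rewrite mulVf// expf_neq0// gt_eqF.
rewrite (_ : s ^- n.+1 * Irn n.+1 s G x - G x = s ^- n.+1 * Irn n.+1 s G' x); last first.
  rewrite IrnD//; last by apply: LIZ; exact: LI_cst.
  rewrite IrnZ; last exact: LI_cst.
  rewrite Irn_cst; last exact: ltW.
  move: sn0; set A := s ^- n.+1; set B := s ^+ n.+1 => AB.
  by rewrite (_ : A * (_ + _) = A * Irn n.+1 s G x - A * B * G x); [rewrite AB mul1r|ring].
have L := @norm_Irn_le R n s G' x (ltW s0) G'L.
pose I := (\int[mu]_(z in `[0%R, (n.+1%:R * s)%R]) `|G' (x + z)|%:E)%E.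
pose J := (\int[mu]_(y in ball x rho) `|G' y|%:E)%E.
have IJ : (I <= J)%E.
  have mG' : measurable_fun setT (fun y => `|G' y|%:E) by apply: mabs; case: G'L.
  rewrite /I (ge0_integral_shift 0 (n.+1%:R * s) x mG')//; apply: ge0_subset_integral => //=.
  - exact: measurable_ball.
  - exact: measurable_funTS.
  - move=> y /=; rewrite in_itv/= add0r => /andP[xy yx]; rewrite /ball/= ltr_norml.
    have : 0 < n.+1%:R * s by rewrite mulr_gt0.
    by rewrite /rho; lra.
have dE : davg G x rho = ((2 * rho)^-1%:E * J)%E.
  rewrite /davg /iavg /J (lebesgue_measure_ball _ (ltW rho0)).
  rewrite inver mulrn_eq0/= gt_eqF//=; congr (_ * _)%E.
    by rewrite mulr_natl.
  apply: eq_integral => y _ /=.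
  by rewrite /G' /= mulN1r.
have Jf : J \is a fin_num.
  move: fr; rewrite dE; case: J {IJ dE} => //.
  + by rewrite mulry gtr0_sg ?mul1e// invr_gt0 mulr_gt0.
  + by rewrite mulrNy gtr0_sg ?mul1e// invr_gt0 mulr_gt0.
have J0 : (0 <= J)%E by exact: integral_ge0.
have I0 : (0 <= I)%E by exact: integral_ge0.
have If : I \is a fin_num by rewrite ge0_fin_numE// (le_lt_trans IJ)// ltey_eq Jf.
move: dr; rewrite dE -(fineK Jf) -EFinM/= => dr.
have fIJ : fine I <= fine J by rewrite fine_le.
move: L; rewrite -/I -(fineK If) -EFinM lee_fin => L.
have sA : 0 <= s ^- n.+1 by rewrite invr_ge0 exprn_ge0// ltW.
have sB : 0 <= s ^+ n by rewrite exprn_ge0// ltW.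
rewrite normrM (ger0_norm sA).
apply: (@le_trans _ _ (s ^- n.+1 * (s ^+ n * fine J))).
  by rewrite ler_wpM2l// (le_trans L)// ler_wpM2l.
have -> : s ^- n.+1 * (s ^+ n * fine J) = s^-1 * fine J.
  by rewrite exprS; field; rewrite ?expf_neq0 gt_eqF.
have Jb : fine J <= 2 * rho * (eps / C).
  have h : 0 < 2 * rho by rewrite mulr_gt0.
  rewrite mulrC -ler_pdivrMr//; apply/ltW; apply: le_lt_trans dr; rewrite mulrC; exact: ler_norm.
rewrite mulrC ler_pdivrMr//; apply: le_trans Jb _.
rewrite le_eqVlt; apply/orP; left; apply/eqP.
have : (n.+1%:R : R) != 0 by rewrite pnatr_eq0.
by rewrite /rho /C; generalize (n.+1%:R : R) => N N0; field.
Qed.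

End lebesgue_diff.

Section primitives.
Context {R : realType}.
Local Notation mu := (@lebesgue_measure R).
Implicit Types (G : R -> R) (s u x a b c : R).

Lemma Rint_split G a b c : LI G -> a <= b -> b <= c ->
  Rintegral mu `[a, c] G = Rintegral mu `[a, b] G + Rintegral mu `[b, c] G.
Proof.
move=> GL ab bc.
have := @Rintegral_itvB R G (BLeft a) (BRight c) b (LI_integrable a c GL).
rewrite !bnd_simp => /(_ ab bc) H.
rewrite -(Rintegral_itv_obnd_cbnd (r := b)); first by rewrite -H; lra.
apply: integrableS (LI_integrable b c GL) => //.
by move=> y /=; rewrite !in_itv/= => /andP[/ltW -> ->].
Qed.

Lemma prim_diff G a b : LI G -> a <= b -> prim G b - prim G a = Rintegral mu `[a, b] G.
Proof.
move=> GL ab; rewrite /prim; case: ifPn => b0; case: ifPn => a0.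
- by rewrite (Rint_split GL a0 ab); lra.
- by rewrite (@Rint_split G a 0 b GL)//; [lra|rewrite ltW// ltNge].
- by exfalso; move: b0; rewrite (le_trans a0 ab).
- by rewrite (@Rint_split G a b 0 GL)//; [lra|rewrite ltW// ltNge].
Qed.

End primitives.

Section one_sided_decay.
Context {R : realType}.
Local Notation mu := (@lebesgue_measure R).
Implicit Types (G F : R -> R) (c : int -> R) (s u x th C U : R).

(* If an integrable [F] had |F x| > 2 delta, then |F| > delta on all of [x, +oo[. *)
Lemma integrable_decay th F C U : 1 < th -> integrableR F ->
  (forall v z, U <= v -> 0 <= z <= 1 -> `|F (v + z) - F v| <= C * v `^ (- th)) ->
  exists C' U', forall x, U' <= x -> `|F x| <= C' * x `^ (1 - th).
Proof.
move=> th1 iF H; have [K [K0 HK]] := tail_powR th1.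
exists (2 * (`|C| * K)), (Num.max 1 U) => x; rewrite ge_max => /andP[x1 Ux].
set delta := `|C| * K * x `^ (1 - th).
have delta0 : 0 <= delta by rewrite !mulr_ge0// powR_ge0.
have step n z : 0 <= z <= 1 -> `|F (x + n%:R + z) - F x| <=
    `|C| * \sum_(0 <= m < n.+1) (x + m%:R) `^ (- th).
  elim: n z => [|n IH] z z01.
    rewrite big_nat1 !addr0; apply: le_trans (H _ _ Ux z01) _.
    by rewrite ler_wpM2r ?powR_ge0// ler_norm.
  rewrite big_nat_recr//= mulrDr.
  rewrite (_ : F _ - F x = (F (x + n.+1%:R + z) - F (x + n.+1%:R)) + (F (x + n%:R + 1) - F x)); last first.
    by rewrite -natr1 addrA; lra.
  rewrite addrC; apply: le_trans (ler_normD _ _) _; apply: lerD.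
    by apply: IH; rewrite ler01 lexx.
  have Un : U <= x + n.+1%:R by rewrite (le_trans Ux)// lerDl.
  by apply: le_trans (H _ _ Un z01) _; rewrite ler_wpM2r ?powR_ge0// ler_norm.
have near y : x <= y -> `|F y - F x| <= delta.
  move=> xy; have y0 : 0 <= y - x by rewrite subr_ge0.
  pose n := Num.truncn (y - x).
  have /andP[n1 n2] : n%:R <= y - x < n.+1%:R by exact: truncn_itv.
  have := step n (y - x - n%:R).
  rewrite (_ : x + n%:R + (y - x - n%:R) = y); last by lra.
  move=> /(_ _)/le_trans; apply.
    by move: n2; rewrite -natr1 => n2; apply/andP; split; lra.
  by rewrite /delta -mulrA ler_wpM2l// HK.
rewrite -mulrA -/delta leNgt; apply/negP => big.
have d0 : 0 < `|F x| - delta by lra.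
have lb n : ((n%:R * (`|F x| - delta))%:E <= \int[mu]_y `|F y|%:E)%E.
  have mF : measurable_fun setT F by case: (integrable_LI iF).
  apply: (@le_trans _ _ (\int[mu]_(y in `[x, (x + n%:R)%R]) (`|F x| - delta)%:E)%E).
    rewrite (_ : (fun=> _) = cst (`|F x| - delta)%:E)// integral_cst//= lebesgue_measure_itv/= lte_fin.
    case: ifPn => xn; last first.
      have : n%:R <= 0 :> R by move: xn; rewrite -leNgt; lra.
      by rewrite lern0 => /eqP ->; rewrite mul0r mule0.
    by rewrite -EFinB -EFinM lee_fin; lra.
  apply: (@le_trans _ _ (\int[mu]_(y in `[x, (x + n%:R)%R]) `|F y|%:E)%E).
    apply: ge0_le_integral => //=.
    - by move=> y _; rewrite lee_fin ltW.
    - exact: mabsD.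
    - move=> y; rewrite in_itv/= => /andP[xy _]; rewrite lee_fin.
      have := near y xy; have := ler_dist_dist (F x) (F y); rewrite distrC.
      by have := lerB_dist (F x) (F y); rewrite distrC; lra.
  by apply: ge0_subset_integral => //=; exact: mabs.
have fin : (\int[mu]_y `|F y|%:E < +oo)%E by case/integrableP : iF.
have I0 : (0 <= \int[mu]_y `|F y|%:E)%E by exact: integral_ge0.
move: lb; rewrite -(@fineK _ (\int[mu]_y `|F y|%:E)%E) ?ge0_fin_numE//.
set I := fine _ => lb.
have := lb (Num.truncn (I / (`|F x| - delta))).+1.
rewrite lee_fin leNgt => /negP; apply.
by rewrite -ltr_pdivrMr// truncnS_gt.
Qed.

(** When [u] and the indices carrying [c] have opposite signs, [|u - k| = |u| + |k|], and the series
    is a tail of a power series. The loss of [d + 1] powers is made of [d] for the growth of [c] and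
    one for the summation. *)
Lemma Sop_decay th d G c : d%:R + 1 < th -> LI G -> condition_Theta th G ->
  pgrow d c -> exists C' U', 0 <= C' /\ forall u, U' <= `|u| ->
  (forall k, c k != 0 -> `|u - k%:~R| = `|u| + `|k%:~R|) ->
  `|Sop c G u| <= C' * `|u| `^ (- (th - d.+1%:R)).
Proof.
move=> dth GL [C [U GT]] /pgrow_ge0[D [D0 HD]].
have a1 : 1 < th - d%:R by lra.
have [K [K0 HK]] := esZ_powR_tail a1.
exists (`|C| * D * K), (Num.max 1 U); split; first by rewrite !mulr_ge0.
move=> u; rewrite ge_max => /andP[u1 Uu] supp.
have u0 : 0 < `|u| by apply: lt_le_trans u1.
rewrite -lee_fin; apply: le_trans (le_norm_zsum _) _.
have pw0 k : 0 <= (`|u| + `|k%:~R|) `^ (- (th - d%:R)) by exact: powR_ge0.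
apply: (@le_trans _ _ (esZ (fun k => (`|C| * D)%:E * ((`|u| + `|k%:~R|) `^ (- (th - d%:R)))%:E)%E)).
  apply: le_esZ => k; first by rewrite lee_fin.
  rewrite -EFinM lee_fin; have [->|ck] := eqVneq (c k) 0.
    by rewrite mulr0 normr0 mulr_ge0// mulr_ge0.
  have E := supp k ck.
  have uk0 : 0 < `|u| + `|k%:~R| :> R by rewrite ltr_wpDr.
  have GT' : `|G (u - k%:~R)| <= `|C| * (`|u| + `|k%:~R|) `^ (- th).
    have /GT : U <= `|u - k%:~R| by rewrite E (le_trans Uu)// lerDl.
    by rewrite E => /le_trans; apply; rewrite ler_wpM2r ?powR_ge0// ler_norm.
  rewrite normrM.
  apply: (@le_trans _ _ ((`|C| * (`|u| + `|k%:~R|) `^ (- th)) * (D * (`|u| + `|k%:~R|) ^+ d))).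
    apply: ler_pM => //; apply: le_trans (HD k) _; rewrite ler_wpM2l//.
    by rewrite lerXn2r ?nnegrE ?addr_ge0// lerD2r.
  rewrite opprB (addrC d%:R) powRD; last by rewrite (gt_eqF uk0) implybT.
  by rewrite powR_mulrn ?(ltW uk0)//; apply: le_of_eq; ring.
rewrite esZZl; [|by rewrite mulr_ge0|by move=> k; rewrite lee_fin].
apply: (@le_trans _ _ ((`|C| * D)%:E * (K * `|u| `^ (1 - (th - d%:R)))%:E)%E).
  by rewrite lee_wpmul2l ?lee_fin ?mulr_ge0// HK.
by rewrite -EFinM lee_fin mulrA -natr1; apply: le_of_eq; congr (_ * _ `^ _); lra.
Qed.

End one_sided_decay.

Section falling_factorials.
Context {R : realType}.
Implicit Types (x : R) (j n : nat) (k : int).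

(** The binomial polynomial [X (X - 1) ... (X - j + 1) / j!]. *)
Fixpoint fallp j : {poly R} :=
  if j is j'.+1 then (j'.+1%:R)^-1 *: (fallp j' * ('X - j'%:R%:P)) else 1.

Lemma fallpE j x : (fallp j.+1).[x] = j.+1%:R^-1 * ((fallp j).[x] * (x - j%:R)).
Proof. by rewrite [fallp j.+1]/= !(hornerZ, hornerM, hornerXsubC). Qed.

Lemma fallpS j x : (fallp j.+1).[x + 1] - (fallp j.+1).[x] = (fallp j).[x].
Proof.
elim: j x => [|j IH] x.
  by rewrite /= !(hornerZ, hornerM, hornerXsubC, hornerC) invr1; lra.
rewrite !(fallpE j.+1).
have E1 y : (fallp j.+1).[y] * j.+1%:R = (fallp j).[y] * (y - j%:R).
  by rewrite fallpE mulrAC mulVf ?mul1r// pnatr_eq0.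
have -> : (fallp j.+1).[x + 1] = (fallp j.+1).[x] + (fallp j).[x] by rewrite -IH; lra.
have j2 : (j.+2)%:R != 0 :> R by rewrite pnatr_eq0.
rewrite -mulrBr; apply: (mulfI j2); rewrite mulrA mulfV// mul1r.
have := E1 x; rewrite -!natr1 => H; nra.
Qed.

Lemma fallp0 j : (fallp j.+1).[0] = 0.
Proof.
elim: j => [|j IH]; first by rewrite /= !(hornerZ, hornerM, hornerXsubC, hornerC) subrr !mulr0.
by rewrite fallpE IH mul0r mulr0.
Qed.

Lemma size_fallp j : (size (fallp j) <= j.+1)%N.
Proof.
elim: j => [|j IH]; first by rewrite size_poly1.
apply: (leq_trans (size_scale_leq _ _)); apply: (leq_trans (size_polyMleq _ _)).
by rewrite size_XsubC addnC.
Qed.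

Lemma pgrow_poly j (P : {poly R}) x : (size P <= j.+1)%N ->
  pgrow j (fun k => P.[k%:~R + x]).
Proof.
move=> Pj; exists (\sum_(i < size P) `|P`_i| * (1 + `|x|) ^+ j) => k.
rewrite horner_coef mulr_suml; apply: le_trans (ler_norm_sum _ _ _) _.
apply: ler_sum => i _; rewrite normrM -mulrA ler_wpM2l// -exprMn normrX.
apply: (@le_trans _ _ (((1 + `|x|) * (1 + `|k%:~R|)) ^+ i)).
  rewrite lerXn2r ?nnegrE ?mulr_ge0 ?addr_ge0//.
  have := ler_normD (k%:~R) x; have := mulr_ge0 (normr_ge0 x) (normr_ge0 (k%:~R : R)).
  by rewrite mulrDl mulrDr; lra.
apply: ler_weXn2l; last by rewrite -ltnS (leq_trans (ltn_ord i)).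
have := mulr_ge0 (normr_ge0 x) (normr_ge0 (k%:~R : R)).
have := normr_ge0 x; have := normr_ge0 (k%:~R : R).
by rewrite mulrDl mulrDr; lra.
Qed.

(** The one-sided inverse of the difference of order [j + 1]: that many unit differences reduce
    [Hseq j] to the unit sequence at 0. This is the reason for the argument [k - 1]. *)
Definition Hseq j k : R := if (1 <= k)%R then (fallp j).[k%:~R - 1] else 0.

Lemma Hseq_diff j k : Hseq j.+1 (k + 1) - Hseq j.+1 k = Hseq j k.
Proof.
rewrite /Hseq; have [k1|k1] := boolP (1 <= k).
  have -> : (1 <= k + 1)%R by lia.
  have -> : ((k + 1)%:~R - 1 : R) = (k%:~R - 1) + 1 by rewrite intrD; lra.
  exact: fallpS.
have [->|k0] := eqVneq k 0; first by rewrite add0r lexx subrr fallp0 subr0.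
by rewrite (_ : (1 <= k + 1)%R = false) ?subr0//; apply/negbTE; lia.
Qed.

Lemma Hseq0_diff k : Hseq 0 (k + 1) - Hseq 0 k = (k == 0)%:R.
Proof.
rewrite /Hseq; have [k1|k1] := boolP (1 <= k).
  have -> : (1 <= k + 1)%R by lia.
  by rewrite /= !hornerE subrr (_ : (k == 0) = false)//; apply/negbTE; lia.
have [->|k0] := eqVneq k 0; first by rewrite add0r lexx/= !hornerE subr0.
by rewrite (_ : (1 <= k + 1)%R = false) ?subr0//; apply/negbTE; lia.
Qed.

Lemma pgrow_Hseq j : pgrow j (Hseq j).
Proof.
have := pgrow_poly (-1) (size_fallp j); apply: pgrow_le => k.
by rewrite /Hseq; case: ifP => // _; rewrite normr0.
Qed.

End falling_factorials.

(** * The kernel [Gam] *)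

Section ae_affine.
Context {R : realType}.
Local Notation mu := (@lebesgue_measure R).

Lemma ae_affine (P : R -> Prop) (a b : R) : a != 0 ->
  {ae mu, forall x, P x} -> {ae mu, forall x, P (a * x + b)}.
Proof.
move=> a0 [N [mN N0 PN]].
exists [set x | N (a * x + b)]; split.
- by have := @measurable_affine R a b measurableT _ mN; rewrite setTI.
- have mN' : measurable [set x : R | N (a * x + b)].
    by have := @measurable_affine R a b measurableT _ mN; rewrite setTI.
  have I0 : (\int[mu]_x (\1_N x)%:E = 0)%E by rewrite integral_indic// setIT; exact: N0.
  have I1 : (\int[mu]_x (\1_[set x : R | N (a * x + b)%R] x)%:E = mu [set x | N (a * x + b)%R])%E.
    by rewrite integral_indic// setIT.
  rewrite -[LHS]I1 (_ : (\int[mu]_x _ = \int[mu]_x (\1_N (a * x + b)%R)%:E)%E); last first.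
    by apply: eq_integral => x _.
  rewrite (@ge0_integral_affine R (fun x => (\1_N x)%:E) a b a0).
  + by rewrite I0 mule0.
  + exact/measurable_EFinP/measurable_indic.
  + by move=> x; rewrite lee_fin.
- by move=> x /= Px; apply: PN.
Qed.

Lemma ae_shift (P : R -> Prop) (b : R) :
  {ae mu, forall x, P x} -> {ae mu, forall x, P (x + b)}.
Proof.
by move=> /(ae_affine b (oner_neq0 _)); apply: aeS => x; rewrite mul1r.
Qed.

Lemma ae_Dn (n : nat) (s : R) (f1 f2 : R -> R) : {ae mu, forall x, f1 x = f2 x} ->
  {ae mu, forall x, Dn n s f1 x = Dn n s f2 x}.
Proof.
move=> f12; elim: n => // n IH.
by have := aeI IH (ae_shift s IH); apply: aeS => x [e1 e2]; rewrite /= /Dl e1 e2.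
Qed.

End ae_affine.

Section Gamma_kernel.
Context {R : realType}.
Local Notation mu := (@lebesgue_measure R).
Variables (r' : nat) (phi : R -> R) (g : nat -> R -> R) (th : R).
Local Notation r := r'.+1.
Hypotheses (hr : (1 <= r')%N) (hs : sobolev_rep r phi g) (hk : discrete_kernel phi)
  (hi : condition_i r phi) (hth : r.+1%:R < th)
  (hg : forall i, (1 <= i <= r)%N -> condition_Theta th (g i)).
Implicit Types (s u x : R) (c : int -> R) (k : int).

Lemma LI_g i : (i <= r)%N -> LI (g i).
Proof. by case: hs => _ [H _] ir; apply: integrable_LI; exact: H. Qed.

Lemma Ir_g i s u : (i < r)%N -> 0 <= s -> Ir s (g i.+1) u = Dl s (g i) u.
Proof.
move=> ir s0; have [_ [_ /(_ i ir) H]] := hs.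
have L := LI_g ir.
rewrite /Ir Rintegral_shift; last by case: L.
rewrite add0r (addrC s) -prim_diff//; last by rewrite lerDl.
by rewrite /Dl (H (u + s)) (H u) opprD addrACA subrr add0r.
Qed.

Lemma Irn_g i s u : (i <= r)%N -> 0 <= s -> Irn i s (g i) u = Dn i s phi u.
Proof.
case: (hs) => g0 _ ir s0; elim: i ir u => [|i IH] ir u; first by rewrite /= g0.
rewrite /Irn iterSr -/(Irn i s _) (_ : Ir s (g i.+1) = Dl s (g i)); last first.
  by apply/funext => x; exact: Ir_g.
rewrite Irn_Dl; last by apply: LI_g; exact: ltnW.
by rewrite /Dl !IH// ltnW.
Qed.

(** (Theta) is given for the derivatives only. The decay of [phi] follows from that of its first
    derivative, which makes [phi] nearly constant far out, together with integrability; one power is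
    lost. The two half-lines are treated separately. *)
Lemma Theta_phi : condition_Theta (th - 1) phi.
Proof.
have r1 : (0 < r)%N by [].
have th1 : 1 < th by have := ler0n R r.+1; move: hth; rewrite -!natr1; have := ler0n R r'; lra.
have [C [U HG]] : condition_Theta th (g 1%N) by exact: hg.
have iphi : integrableR phi by case: hk => _ [].
have mphi : measurable_fun setT phi by case: (integrable_LI iphi).
have g0 : g 0%N = phi by case: hs.
have bnd u z : 1 <= `|u| - 1 -> U <= `|u| - 1 -> 0 <= z <= 1 ->
    `|phi (u + z) - phi u| <= `|C| * 2 `^ th * `|u| `^ (- th).
  move=> u1 uU /andP[z0 z1]; rewrite -g0 -[X in `|X|]/(Dl z (g 0%N) u) -Ir_g//.
  rewrite -lee_fin; apply: le_trans (norm_Ir_le _ _ (LI_g r1)) _.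
  have u0 : 0 < `|u| by lra.
  have pw : 0 <= `|C| * 2 `^ th * `|u| `^ (- th) by rewrite !mulr_ge0// powR_ge0.
  apply: (@le_trans _ _ (\int[mu]_(y in `[0%R, z]) cst (`|C| * 2 `^ th * `|u| `^ (- th))%:E y)%E).
    apply: ge0_le_integral => //=.
    - by apply: mabsD; have [] := LI_shift u (LI_g r1).
    - move=> y; rewrite in_itv/= => /andP[y0 yz]; rewrite lee_fin.
      have uy : `|u| - 1 <= `|u + y|.
        by have := lerB_normD u y; rewrite (ger0_norm y0); lra.
      apply: le_trans (HG _ (le_trans uU uy)) _.
      apply: (@le_trans _ _ (`|C| * `|u + y| `^ (- th))); first by rewrite ler_wpM2r ?powR_ge0 ?ler_norm.
      rewrite -mulrA ler_wpM2l//.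
      rewrite (_ : 2 `^ th = 2^-1 `^ (- th)); last by rewrite -powR_inv1// -powRrM mulrNN mul1r.
      rewrite -powRM//; apply: ler_powRN; lra.
  rewrite integral_cst//= lebesgue_measure_itv/= lte_fin.
  case: ifPn => _; last by rewrite mule0 lee_fin.
  by rewrite -EFinB subr0 -EFinM lee_fin ler_piMr.
have [C1 [U1 H1]] : exists C' U', forall x, U' <= x -> `|phi x| <= C' * x `^ (1 - th).
  apply: (@integrable_decay R th phi (`|C| * 2 `^ th) (Num.max 2 (U + 1))) => // v z.
  rewrite ge_max => /andP[v2 vU] z01.
  have vn : `|v| = v by rewrite ger0_norm//; lra.
  by have := bnd v z; rewrite vn => H; apply: H => //; lra.
have [C2 [U2 H2]] : exists C' U', forall x, U' <= x -> `|phi (- x)| <= C' * x `^ (1 - th).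
  apply: (@integrable_decay R th (fun x => phi (- x)) (`|C| * 2 `^ th) (Num.max 4 (2 * `|U| + 4))) => //.
  - apply/integrableP; split.
      by apply/measurable_EFinP; apply: measurableT_comp => //; exact: measurable_funN.
    have := @ge0_integral_opp R (fun x => `|phi x|%:E) (mabs mphi) (fun x => normr_ge0 _).
    move=> /= ->; by case/integrableP : iphi.
  - move=> v z; rewrite ge_max => /andP[v2 vU] /andP[z0 z1].
    have vz : `|- (v + z)| = v + z by rewrite normrN ger0_norm//; lra.
    have UU := ler_norm U; have U0 := normr_ge0 U.
    rewrite distrC (_ : - v = - (v + z) + z); last by lra.
    apply: le_trans (bnd (- (v + z)) z _ _ _) _; rewrite ?vz; [lra|lra|by rewrite z0 z1|].
    by rewrite ler_wpM2l ?mulr_ge0 ?powR_ge0//; apply: ler_powRN; lra.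
exists (`|C1| + `|C2|), (Num.max (`|U1| + 1) (`|U2| + 1)) => u.
rewrite ge_max => /andP[u1 u2].
have pw := powR_ge0 `|u| (- (th - 1)).
rewrite mulrDl (_ : - (th - 1) = 1 - th) in pw *; last by lra.
case: (lerP 0 u) => u0.
  apply: (@le_trans _ _ (`|C1| * `|u| `^ (1 - th))).
    rewrite (ger0_norm u0) in u1 *; apply: le_trans (H1 _ _) _; first by have := ler_norm U1; lra.
    by rewrite ler_wpM2r ?powR_ge0 ?ler_norm.
  by rewrite lerDl mulr_ge0.
apply: (@le_trans _ _ (`|C2| * `|u| `^ (1 - th))).
  rewrite (ltr0_norm u0) in u2 *; rewrite -[X in phi X]opprK.
  apply: le_trans (H2 _ _) _; first by have := ler_norm U2; lra.
  by rewrite ler_wpM2r ?powR_ge0 ?ler_norm.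
by rewrite lerDr mulr_ge0.
Qed.

(** The polynomial extension of [Hseq r'] to all integers; the difference of the two sequences lives
    on [k <= 0]. *)
Let pc (k : int) : R := (fallp r').[k%:~R - 1].

Lemma pgrow_pc : pgrow r' pc.
Proof. exact: (pgrow_poly (-1) (size_fallp r')). Qed.

Lemma hth1 : r'%:R + 1 < th - 1.
Proof. by move: hth; rewrite -!natr1; lra. Qed.

Lemma LI_phi : LI phi. Proof. by case: hk => _ [/integrable_LI]. Qed.

(** Expand [P] at [u]: every power of [k - u] sums to a constant, by condition (i) for positive
    exponents and by the partition of unity for exponent 0. *)
Lemma moment_poly (P : {poly R}) : (size P <= r)%N ->
  exists Q : {poly R}, (size Q <= r)%N /\ forall u, Sop (fun k => P.[k%:~R]) phi u = Q.[u].
Proof.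
move=> Pr.
have [m Hm] : exists m : nat -> R, forall i, (i < r)%N ->
    forall u, zseries_to (fun k => phi (u - k%:~R) * (k%:~R - u) ^+ i) (m i).
  suff : forall i, exists mi, (i < r)%N -> forall u, zseries_to (fun k => phi (u - k%:~R) * (k%:~R - u) ^+ i) mi.
    by move=> /choice[m Hm]; exists m.
  case=> [|i].
    exists 1 => _ u; have [_ [_ /(_ u)]] := hk.
    by congr zseries_to; apply/funext => k; rewrite expr0 mulr1.
  have [ir|ir] := boolP (i.+1 < r)%N; last by exists 0.
  have [|c Hc] := @hi i.+1; first by rewrite /= ltnW.
  by exists c.
exists (\sum_(i < r) m i *: P^`N(i)); split.
  apply: (leq_trans (size_sum _ _ _)); apply/bigmax_leqP => i _.
  apply: (leq_trans (size_scale_leq _ _)); apply/leq_sizeP => j nj.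
  rewrite coef_nderivn nth_default ?mul0rn//; apply: leq_trans Pr _.
  by rewrite (leq_trans nj)// leq_addl.
move=> u; rewrite /Sop.
have S (i : nat) : (i < r)%N -> summZ (fun k => phi (u - k%:~R) * (k%:~R - u) ^+ i).
  move=> ir; apply: (Sop_summ u LI_phi Theta_phi hth1).
  have := @pgrow_poly R r' ('X^i) (- u); rewrite size_polyXn => /(_ ir).
  by congr pgrow; apply/funext => k; rewrite hornerXn.
rewrite (eq_zsum (b := fun k => \sum_(i <- index_enum 'I_r) P^`N(i).[u] * (phi (u - k%:~R) * (k%:~R - u) ^+ i))); last first.
  move=> k; rewrite [X in P.[X]](_ : _ = u + (k%:~R - u)); last by rewrite addrC subrK.
  rewrite (nderiv_taylor_wide (n := r))//; last exact: mulrC.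
  by rewrite mulr_sumr; apply: eq_bigr => i _; ring.
rewrite zsum_sum; last by move=> i; apply: summZZ; exact: S.
rewrite horner_sum; apply: eq_bigr => i _; rewrite zsumZ; last exact: S.
rewrite (zseries_zsum (S i (ltn_ord i)) (Hm i (ltn_ord i) u)).
by rewrite hornerZ mulrC.
Qed.

Lemma Dl_Sop sg d c G s u : LI G -> condition_Theta sg G -> d%:R + 1 < sg -> pgrow d c ->
  Dl s (Sop c G) u = Sop c (Dl s G) u.
Proof.
move=> GL GT ds cd; rewrite /Dl /Sop -mulN1r -zsumZ; last exact: (Sop_summ u GL GT ds).
rewrite -zsumD; [|exact: (Sop_summ (u + s) GL GT ds)|apply: summZZ; exact: (Sop_summ u GL GT ds)].
by apply: eq_zsum => k; rewrite mulN1r mulrBl addrAC.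
Qed.

Lemma Theta_Dl sg G s : 0 <= sg -> condition_Theta sg G -> condition_Theta sg (Dl s G).
Proof.
move=> sg0 [C [U GT]].
exists (`|C| * 2^-1 `^ (- sg) + `|C|), (2 * `|U| + 2 * `|s| + 1) => u uU.
have u0 : 0 < `|u| by have := normr_ge0 U; have := normr_ge0 s; lra.
have UU := ler_norm U; have U0 := normr_ge0 U; have s0 := normr_ge0 s.
apply: le_trans (ler_normB _ _) _; rewrite mulrDl; apply: lerD; last first.
  apply: le_trans (GT _ _) _; first by lra.
  by rewrite ler_wpM2r ?powR_ge0 ?ler_norm.
have us : 2^-1 * `|u| <= `|u + s| by have := lerB_normD u s; lra.
apply: le_trans (GT _ _) _; first by lra.
apply: (@le_trans _ _ (`|C| * `|u + s| `^ (- sg))); first by rewrite ler_wpM2r ?powR_ge0 ?ler_norm.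
rewrite -mulrA ler_wpM2l// -powRM//.
by apply: ler_powRN => //; rewrite mulr_gt0.
Qed.

Lemma Theta_Dn n sg G s : 0 <= sg -> condition_Theta sg G -> condition_Theta sg (Dn n s G).
Proof. by move=> sg0 GT; elim: n => //= n; exact: Theta_Dl. Qed.

Lemma Dn_Sop n sg d c G s u : LI G -> condition_Theta sg G -> d%:R + 1 < sg -> pgrow d c ->
  Dn n s (Sop c G) u = Sop c (Dn n s G) u.
Proof.
move=> GL GT ds cd; have sg0 : 0 <= sg by have := ler0n R d; lra.
elim: n u => // n IH u.
rewrite [RHS]/= -(Dl_Sop _ _ (LI_Dn n s GL) (Theta_Dn n s sg0 GT) ds cd).
by rewrite [LHS]/= /Dl !IH.
Qed.

Lemma hth2 : r'%:R + 1 < th. Proof. by have := hth1; lra. Qed.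
Lemma gr_Theta : condition_Theta th (g r). Proof. by apply: hg; rewrite leqnn. Qed.
Lemma gr_LI : LI (g r). Proof. exact: LI_g. Qed.

(** The r-fold integral with step [s] is the r-th difference of [Sop pc phi], a polynomial of degree
    less than [r]; it vanishes for every [s], and differentiation gives the claim. *)
Lemma Sop_pc_ae0 : {ae mu, forall x, Sop pc (g r) x = 0}.
Proof.
have LZ : LI (Sop pc (g r)) := LI_Sop gr_LI gr_Theta hth2 pgrow_pc.
have Z0 s u : 0 <= s -> Irn r s (Sop pc (g r)) u = 0.
  move=> s0; rewrite (Irn_Sop r u s0 gr_LI gr_Theta hth2 pgrow_pc).
  rewrite (_ : Irn r s (g r) = Dn r s phi); last by apply/funext => x; exact: Irn_g.
  rewrite -(Dn_Sop _ _ _ LI_phi Theta_phi hth1 pgrow_pc).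
  have [|Q [Qr HQ]] := @moment_poly (fallp r' \Po ('X - 1%:P)).
    have := size_comp_poly (fallp (R := R) r') ('X - 1%:P).
    rewrite size_XsubC muln1 => e; apply: (leq_trans (leqSpred _)); rewrite e.
    by move: (size_fallp (R := R) r'); case: (size (fallp r')).
  rewrite (_ : Sop pc phi = fun x => Q.[x]); first exact: Dn_poly.
  by apply/funext => x; rewrite -HQ; apply: eq_zsum => k; rewrite /pc horner_comp hornerXsubC.
have := Irn_differentiation r' LZ; apply: aeS => x H.
apply/eqP; rewrite -normr_le0; apply/ler_addgt0Pl => e e0; rewrite addr0.
have [d [d0 Hd]] := H _ e0.
have := Hd (d / 2); rewrite Z0 ?mulr0 ?sub0r ?normrN; last by rewrite divr_ge0 ?ltW.
by apply; apply/andP; split; lra.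
Qed.

(* The moment conditions make [Sop pc (g r)] vanish a.e.; where it does, the one-sided sum
   [Sop (Hseq r') (g r)] equals minus the sum over the other half-line, and so decays at both ends. *)
Definition Gam u := if Sop pc (g r) u == 0 then Sop (Hseq r') (g r) u else 0.

Lemma Gam_ae : {ae mu, forall x, Gam x = Sop (Hseq r') (g r) x}.
Proof. by apply: aeS Sop_pc_ae0 => x; rewrite /Gam => ->; rewrite eqxx. Qed.

Lemma LI_SH : LI (Sop (Hseq r') (g r)).
Proof. exact: (LI_Sop gr_LI gr_Theta hth2 (pgrow_Hseq r')). Qed.

Lemma LI_Gam : LI Gam.
Proof.
have [mZ _] := LI_Sop gr_LI gr_Theta hth2 pgrow_pc; have [mH _] := LI_SH.
apply: LI_le LI_SH; last by move=> x; rewrite /Gam; case: ifP => // _; rewrite normr0.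
apply: measurable_fun_ifT => //.
exact: measurable_fun_eqr.
Qed.

(** The one-sided sum runs over [k >= 1] and decays as [u -> -oo]. For [u > 0] the two-sided sum,
    which is 0, is subtracted: what remains runs over [k <= 0]. The loss [r = r' + 1] is that of
    [Sop_decay] for coefficients of degree [r']. *)
Lemma Theta_Gam : condition_Theta (th - r%:R) Gam.
Proof.
have pD : pgrow r' (fun k => Hseq r' k + -1 * pc k).
  by apply: pgrowD; [exact: pgrow_Hseq|apply: pgrowZ; exact: pgrow_pc].
have [C1 [U1 [C10 H1]]] := Sop_decay hth2 gr_LI gr_Theta (@pgrow_Hseq R r').
have [C2 [U2 [C20 H2]]] := Sop_decay hth2 gr_LI gr_Theta pD.
exists (C1 + C2), (Num.max U1 U2) => u; rewrite ge_max => /andP[u1 u2].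
have pw := powR_ge0 `|u| (- (th - r%:R)).
rewrite /Gam; case: ifPn => [/eqP Z0|_]; last by rewrite normr0 mulr_ge0// addr_ge0.
rewrite mulrDl; case: (lerP u 0) => u0.
  apply: (@le_trans _ _ (C1 * `|u| `^ (- (th - r%:R)))); last by rewrite lerDl mulr_ge0.
  apply: H1 => // k; rewrite /Hseq; case: ifP => [k1 _|]; last by rewrite eqxx.
  have k0 : 0 <= k%:~R :> R by rewrite ler0z; lia.
  by rewrite (ler0_norm u0) (ger0_norm k0) ler0_norm; lra.
apply: (@le_trans _ _ (C2 * `|u| `^ (- (th - r%:R)))); last by rewrite lerDr mulr_ge0.
rewrite -[Sop _ _ u]addr0 -[0](mulr0 (-1)) -Z0 -(SopZ (-1) u gr_LI gr_Theta hth2 pgrow_pc).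
rewrite -(SopD u gr_LI gr_Theta hth2 (@pgrow_Hseq R r') (pgrowZ (-1) pgrow_pc)).
apply: H2 => // k; rewrite /Hseq; case: ifPn => [k1|k1 _]; first by rewrite mulN1r subrr eqxx.
have k0 : k%:~R <= 0 :> R by rewrite lerz0; lia.
by rewrite (gtr0_norm u0) (ler0_norm k0) ger0_norm; lra.
Qed.

(** A unit difference in [u] becomes a unit difference of the coefficients, and [r] of them reduce
    [Hseq r'] to the unit sequence. *)
Lemma Dn_SH u : Dn r 1 (Sop (Hseq r') (g r)) u = g r u.
Proof.
have H (j : nat) v : (j <= r')%N -> Dn j 1 (Sop (Hseq j) (g r)) v = Sop (Hseq 0) (g r) v.
  elim: j v => // j IH v jr; rewrite DnSr -IH; last exact: ltnW.
  apply: eq_Dn => x; rewrite /Dl.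
  have dj : j.+1%:R + 1 < th by apply: le_lt_trans hth2; rewrite lerD2r ler_nat.
  rewrite (Sop_shift1 x gr_LI gr_Theta dj (@pgrow_Hseq R j.+1)).
  rewrite -[- Sop _ _ x]mulN1r -(SopZ (-1) x gr_LI gr_Theta dj (@pgrow_Hseq R j.+1)).
  rewrite -(SopD x gr_LI gr_Theta dj).
  - by apply: eq_zsum => k; rewrite mulN1r Hseq_diff.
  - exact/pgrow_shift/pgrow_Hseq.
  - exact/pgrowZ/pgrow_Hseq.
have d0 : 0%:R + 1 < th by apply: le_lt_trans hth2; rewrite lerD2r ler0n.
rewrite [LHS]/= /Dl !H//.
rewrite (Sop_shift1 u gr_LI gr_Theta d0 (@pgrow_Hseq R 0)).
rewrite -[- Sop _ _ u]mulN1r -(SopZ (-1) u gr_LI gr_Theta d0 (@pgrow_Hseq R 0)).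
rewrite -(SopD u gr_LI gr_Theta d0); [|exact/pgrow_shift/pgrow_Hseq|exact/pgrowZ/pgrow_Hseq].
rewrite (_ : (fun k => _) = (fun k => (k == 0)%:R)); last first.
  by apply/funext => k; rewrite mulN1r Hseq0_diff.
apply/cvg_lim => //; apply: cvg_near_cst; near=> N.
have Ni : N \in index_iota 0 N.*2.+1 by rewrite mem_index_iota -addnn ltnS leq_addr.
rewrite /zpartial (bigD1_seq N Ni (iota_uniq _ _))/=.
rewrite subrr eqxx mulr1 subr0 big1 ?addr0// => i iN.
by rewrite subr_eq0 eqz_nat (negbTE iN) mulr0.
Unshelve. all: by end_near. Qed.

Definition Phi s := Irn r s Gam.

(** Both sides are r-fold integrals, of [Dn r 1 Gam] and of [g r], which agree almost everywhere;
    after integration the equality holds at every [u]. *)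
Lemma Dn_Phi s u : 0 <= s -> Dn r 1 (Phi s) u = Dn r s phi u.
Proof.
move=> s0; rewrite /Phi -(Irn_Dn r s r 1 u LI_Gam) -Irn_g//; apply: ae_eq_Irn.
- by have [] := LI_Dn r 1 LI_Gam.
- by case: gr_LI.
rewrite (_ : g r = Dn r 1 (Sop (Hseq r') (g r))); last by apply/funext => x; rewrite Dn_SH.
exact: ae_Dn Gam_ae.
Qed.

Lemma Theta_Phi s : 0 <= s -> condition_Theta (th - r%:R) (Phi s).
Proof.
move=> s0; apply: Theta_Irn => //; [|exact: LI_Gam|exact: Theta_Gam].
by have := hth1; rewrite -natr1; have := ler0n R r'; lra.
Qed.

Lemma LI_Phi s : LI (Phi s). Proof. exact: LI_Irn LI_Gam. Qed.

End Gamma_kernel.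

(** * Uniform envelopes, dominated sums and subspaces of finite dimension *)

Section uniform_envelope.
Context {R : realType}.
Local Notation mu := (@lebesgue_measure R).
Variables (n : nat) (sg : R) (G : R -> R).
Hypotheses (GL : LI G) (GT : condition_Theta sg G) (sg1 : 1 < sg).
Implicit Types (s u K S : R) (k : int).

(** After at least one integration the translates in the finite window are bounded too, by the
    integral of [|G|] over a fixed interval, so that one summable envelope serves all [k], all
    [|u| <= K] and all steps up to [S]. *)
Lemma Irn_env S K : 0 <= S -> exists e : int -> R, [/\ forall k, 0 <= e k,
  (esZ (fun k => (e k)%:E) < +oo)%E &
  forall s u k, 0 <= s <= S -> `|u| <= K -> `|Irn n.+1 s G (u - k%:~R)| <= e k].
Proof.
move=> S0; pose K' := `|K| + n.+1%:R * S.
have nS0 : 0 <= n.+1%:R * S by rewrite mulr_ge0.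
have d1 : 0%:R + 1 < sg by rewrite add0r.
have [N [e0 [e00 e0fin He0]]] := @Theta_env R sg 0 G K' GT d1.
pose I : R := fine (\int[mu]_(x in `[(- (K' + N%:R))%R, (K' + N%:R)%R]) `|G x|%:E)%E.
have I0 : 0 <= I by rewrite fine_ge0// integral_ge0.
have If : ((\int[mu]_(x in `[(- (K' + N%:R))%R, (K' + N%:R)%R]) `|G x|%:E)%E = I%:E)%E.
  by rewrite fineK// ge0_fin_numE ?integral_ge0//; case: GL => _; exact.
pose c := S ^+ n * (n.+1%:R * S).
have c0 : 0 <= c by rewrite mulr_ge0 ?exprn_ge0.
pose e k := if k \in ints N then S ^+ n * I else c * e0 k.
have e_ge0 k : 0 <= e k by rewrite /e; case: ifP => _; rewrite mulr_ge0 ?exprn_ge0.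
exists e; split => //.
  apply: (@le_lt_trans _ _ (\sum_(k <- ints N) (e k)%:E + esZ (fun k => c%:E * (e0 k)%:E))%E).
    apply: esZ_split; first exact: ints_uniq.
    - by move=> k; rewrite lee_fin.
    - by move=> k; rewrite -EFinM lee_fin mulr_ge0.
    - by move=> k /negbTE kN; rewrite /e kN -EFinM.
  rewrite esZZl//.
  by rewrite sumEFin; apply: lte_add_pinfty; rewrite ?ltry//; apply: lte_mul_pinfty; rewrite ?lee_fin.
move=> s u k /andP[s0 sS] uK.
have mG : measurable_fun setT (fun x => `|G x|%:E) by apply: mabs; case: GL.
have uK' : `|u| <= `|K| by apply: le_trans uK (ler_norm _).
have ns : n.+1%:R * s <= n.+1%:R * S by rewrite ler_wpM2l.
rewrite -lee_fin; apply: le_trans (norm_Irn_le n _ s0 GL) _; rewrite /e.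
have sn : ((s ^+ n)%:E <= (S ^+ n)%:E)%E by rewrite lee_fin lerXn2r.
case: ifPn => kN.
  rewrite EFinM; apply: lee_pmul => //; rewrite ?lee_fin ?exprn_ge0//; first exact: integral_ge0.
  rewrite -If (ge0_integral_shift 0 _ _ mG)//; apply: ge0_subset_integral => //=.
    exact: measurable_funTS.
  have kN' : `|k%:~R| <= N%:R :> R.
    by move: kN; rewrite mem_ints -intr_norm -natr_absz ler_nat.
  move: kN' uK'; rewrite !ler_norml => /andP[k1 k2] /andP[u1 u2].
  by move=> x /=; rewrite !in_itv/= add0r => /andP[x1 x2]; rewrite /K'; apply/andP; split; lra.
rewrite /c -mulrA EFinM; apply: lee_pmul => //; rewrite ?lee_fin ?exprn_ge0//; first exact: integral_ge0.
apply: (@le_trans _ _ (\int[mu]_(z in `[0%R, (n.+1%:R * s)%R]) cst (e0 k)%:E z)%E).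
  apply: ge0_le_integral => //=.
  - by apply: mabsD; have [] := LI_shift (u - k%:~R) GL.
  - move=> z; rewrite in_itv/= => /andP[z0 zs]; rewrite lee_fin.
    have := He0 (u + z) k; rewrite expr0 mulr1 addrAC; apply => //.
    by rewrite (le_trans (ler_normD _ _))// (ger0_norm z0) /K' lerD// (le_trans zs).
rewrite integral_cst//= lebesgue_measure_itv/= lte_fin.
case: ifPn => h; last by rewrite mule0 lee_fin mulr_ge0.
by rewrite -EFinB subr0 -EFinM lee_fin mulrC ler_wpM2r.
Qed.

End uniform_envelope.

Section dominated_sums.
Context {R : realType} (T : Type) (F : set_system T).
Context {FF : Filter F}.
Implicit Types (e : int -> R) (b : T -> int -> R) (be : int -> R).

Lemma near_big_seq (s : seq int) (P : int -> T -> Prop) :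
  (forall k, \forall i \near F, P k i) -> \forall i \near F, forall k, k \in s -> P k i.
Proof.
move=> H; elim: s => [|k s IH]; first by near=> i.
near=> i => j; rewrite inE => /orP[/eqP ->|js]; first by near: i.
by move: j js; near: i.
Unshelve. all: by end_near. Qed.

(** Stated for an arbitrary filter because the limits are taken along an ultrafilter. Half of [eps]
    goes to the finitely many terms in a window, half to the tail of [e]. *)
Lemma dominated_esZ e b be C eps : (forall k, 0 <= e k) -> (esZ (fun k => (e k)%:E) < +oo)%E ->
  0 < eps -> 0 <= C -> (\forall i \near F, forall k, `|b i k| <= C) -> (forall k, `|be k| <= C) ->
  (forall k, b i k @[i --> F] --> be k) ->
  \forall i \near F, (esZ (fun k => (e k * `|b i k - be k|)%:E) <= eps%:E)%E.
Proof.
move=> e0 efin eps0 C0 bC beC cv.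
have h : 0 < eps / (4 * (C + 1)) by rewrite divr_gt0// mulr_gt0// ltr_wpDl.
have [N HN] := esZ_tail0 e0 efin h.
pose A := \sum_(k <- ints N) e k.
have A0 : 0 <= A by apply: sumr_ge0 => k _.
have hd : 0 < eps / (2 * (A + 1)) by rewrite divr_gt0// mulr_gt0// ltr_wpDl.
have cl : \forall i \near F, forall k, k \in ints N -> `|be k - b i k| < eps / (2 * (A + 1)).
  by apply: near_big_seq => k; move/cvgrPdist_lt : (cv k); apply.
near=> i.
have biC : forall k, `|b i k| <= C by near: i.
have cli : forall k, k \in ints N -> `|be k - b i k| < eps / (2 * (A + 1)) by near: i.
apply: (@le_trans _ _ (\sum_(k <- ints N) (e k * `|b i k - be k|)%:E +
   esZ (fun k => (2 * C)%:E * (if k \in ints N then 0 else (e k)%:E)))%E).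
  apply: esZ_split; first exact: ints_uniq.
  - by move=> k; rewrite lee_fin mulr_ge0.
  - by move=> k; rewrite mule_ge0 ?lee_fin ?mulr_ge0//; case: ifP; rewrite ?lee_fin.
  - move=> k /negbTE ->; rewrite -EFinM lee_fin mulrC ler_wpM2r//.
    by rewrite (le_trans (ler_normB _ _))// mulr_natl mulr2n lerD.
rewrite esZZl ?mulr_ge0//; last by move=> k; case: ifP; rewrite ?lee_fin.
apply: (@le_trans _ _ (A * (eps / (2 * (A + 1))) + 2 * C * (eps / (4 * (C + 1))))%:E)%E.
  rewrite EFinD; apply: leeD; last by rewrite (EFinM (2 * C)) lee_wpmul2l// lee_fin mulr_ge0.
  rewrite sumEFin lee_fin /A mulr_suml big_seq [leRHS]big_seq; apply: ler_sum => k kN.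
  by rewrite ler_wpM2l// distrC ltW// cli.
rewrite lee_fin.
have a1 : A / (A + 1) <= 1 by rewrite ler_pdivrMr ?ltr_wpDl// mul1r lerDl.
have c1 : C / (C + 1) <= 1 by rewrite ler_pdivrMr ?ltr_wpDl// mul1r lerDl.
have -> : A * (eps / (2 * (A + 1))) = eps / 2 * (A / (A + 1)) by field; rewrite gt_eqF// ltr_wpDl.
have -> : 2 * C * (eps / (4 * (C + 1))) = eps / 2 * (C / (C + 1)) by field; rewrite gt_eqF// ltr_wpDl.
have e2 : 0 <= eps / 2 by rewrite divr_ge0// ltW.
have := ler_wpM2l e2 a1; have := ler_wpM2l e2 c1; lra.
Unshelve. all: by end_near. Qed.

End dominated_sums.

Section finite_dimension.
Context {F : fieldType}.

(* Take a matrix of maximal rank whose rows all lie in the subspace. *)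
Lemma subspace_basis d (P : 'rV[F]_d -> Prop) : P 0 ->
  (forall u v, P u -> P v -> P (u + v)) -> (forall a u, P u -> P (a *: u)) ->
  exists B : 'M[F]_d, forall v, P v <-> (v <= B)%MS.
Proof.
move=> P0 PD PZ.
have Psum (I : Type) (s : seq I) (f : I -> 'rV[F]_d) : (forall i, P (f i)) -> P (\sum_(i <- s) f i).
  by move=> Pf; elim: s => [|i s IH]; rewrite ?big_nil// big_cons; exact: PD.
pose Q (B : 'M[F]_d) := forall v : 'rV_d, (v <= B)%MS -> P v.
have [n Hn] : exists n, (exists B, Q B /\ \rank B = n) /\ forall B, Q B -> (\rank B <= n)%N.
  pose q n := `[< exists B, Q B /\ \rank B = n >].
  have q0 : exists n, q n.
    exists 0%N; apply/asboolP; exists 0; split; last by rewrite mxrank0.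
    by move=> v; rewrite submx0 => /eqP ->.
  have qd n : q n -> (n <= d)%N by move=> /asboolP[B [_ <-]]; exact: rank_leq_row.
  have [n qn nmax] := ex_maxnP q0 qd.
  exists n; split; first by move/asboolP : qn.
  by move=> B QB; apply: nmax; apply/asboolP; exists B.
case: Hn => -[B [QB rB]] Bmax; exists B => v; split; last exact: QB.
move=> Pv.
have QBv : Q (B + v)%MS.
  move=> u /sub_addsmxP[[x1 x2] /= ->]; apply: PD; first by apply: QB; exact: submxMl.
  by rewrite (mx11_scalar x2) mul_scalar_mx; exact: PZ.
have sB : (B <= B + v)%MS by exact: addsmxSl.
have := mxrank_leqif_sup sB => /leqifP; case: ifP => [vB _|_].
  by apply: submx_trans vB; exact: addsmxSr.
by rewrite rB ltnNge Bmax.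
Qed.

(** A nonzero column of the cokernel of a basis matrix. It supplies the coefficients of the
    recurrence in [classification]. *)
Lemma subspace_annihilator d (P : 'rV[F]_d -> Prop) : P 0 ->
  (forall u v, P u -> P v -> P (u + v)) -> (forall a u, P u -> P (a *: u)) ->
  (exists v, ~ P v) -> exists a : 'cV[F]_d, a != 0 /\ forall v, P v -> v *m a = 0.
Proof.
move=> P0 PD PZ [v0 Pv0]; have [B HB] := subspace_basis P0 PD PZ.
have : cokermx B != 0.
  apply/eqP => cB; apply: Pv0; apply/HB; rewrite submxE cB mulmx0//.
move=> cB; have [j cj] : exists j, col j (cokermx B) != 0.
  apply: contrapT => /forallNP H; move/eqP : cB; apply.
  apply/matrixP => i j; have /negP/negPn/eqP/matrixP/(_ i 0) := H j.
  by rewrite !mxE.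
exists (col j (cokermx B)); split => // v /HB.
by rewrite submxE colE mulmxA => /eqP ->; rewrite mul0mx.
Qed.

End finite_dimension.

(** * Seminorms and recurrences in finite dimension *)

Lemma coord_le_norm (R : realType) d (x : 'rV[R]_d) i : `|x 0 i| <= `|x|.
Proof. by rewrite [leRHS]/Num.norm/= mx_normrE; apply/bigmax_geP; right => /=; exists (0, i). Qed.

Section finite_dimensional_norms.
Context {R : realType}.
Variables (d : nat) (q : 'rV[R]_d -> R).
Hypotheses (qD : forall x y, q (x + y) <= q x + q y)
  (qZ : forall a x, q (a *: x) = `|a| * q x).

Lemma seminorm0 : q 0 = 0.
Proof. by rewrite -(scale0r 0) qZ normr0 mul0r. Qed.

Lemma seminormN x : q (- x) = q x.
Proof. by rewrite -scaleN1r qZ normrN1 mul1r. Qed.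

Lemma seminorm_ge0 x : 0 <= q x.
Proof.
have := qD x (- x); rewrite subrr seminorm0 seminormN -mulr2n -mulr_natl.
by rewrite pmulr_rge0.
Qed.

Lemma seminorm_sum (I : Type) (s : seq I) (F : I -> 'rV[R]_d) :
  q (\sum_(i <- s) F i) <= \sum_(i <- s) q (F i).
Proof.
elim: s => [|i s IH]; first by rewrite !big_nil seminorm0.
by rewrite !big_cons (le_trans (qD _ _))// lerD2l.
Qed.

Lemma seminorm_le x : q x <= (\sum_i q (delta_mx 0 i)) * `|x|.
Proof.
rewrite {1}[x]row_sum_delta (le_trans (seminorm_sum _ _))// mulr_suml.
apply: ler_sum => i _; rewrite qZ mulrC ler_wpM2l ?seminorm_ge0//.
exact: coord_le_norm.
Qed.

Lemma seminorm_continuous : continuous q.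
Proof.
pose K := \sum_i q (delta_mx 0 i).
have K0 : 0 <= K by apply: sumr_ge0 => i _; exact: seminorm_ge0.
move=> x; apply/(@cvgrPdist_lt _ R^o _ (nbhs (x : 'rV[R]_d)) (nbhs_filter _)) => e e0.
apply: (@filterS _ (nbhs (x : 'rV[R]_d)) (nbhs_filter _) (ball (x : 'rV[R]_d) (e / (K + 1)))); last first.
  by apply: nbhsx_ballx; rewrite divr_gt0// ltr_wpDl.
rewrite -ball_normE => y /= h.
apply: (@le_lt_trans _ _ (q (x - y))).
  rewrite ler_norml; apply/andP; split.
    by rewrite lerNl opprB lerBlDl -[q (x - y)]seminormN opprB (le_trans _ (qD _ _))// addrC subrK.
  by rewrite lerBlDl (le_trans _ (qD _ _))// addrC subrK.
apply: le_lt_trans (seminorm_le _) _.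
rewrite ltr_pdivlMr ?ltr_wpDl// in h.
by apply: le_lt_trans h; rewrite mulrC ler_wpM2l// lerDl.
Qed.

(** Equivalence of norms: a definite seminorm is continuous, and attains a positive minimum on the
    compact unit sphere. An empty sphere means that the only vector is 0. *)
Lemma norm_coord_le : (forall x, q x = 0 -> x = 0) ->
  exists C : R, 0 <= C /\ forall (x : 'rV[R]_d) i, `|x 0 i| <= C * q x.
Proof.
move=> q0; pose S := [set x : 'rV[R]_d | `|x| = 1].
have [[x0 Sx0]|S0] := pselect (S !=set0); last first.
  exists 0; split => // x i; rewrite mul0r normr_le0.
  have [->|x0] := eqVneq x 0; first by rewrite mxE.
  exfalso; apply: S0; exists (`|x|^-1 *: x).
  by rewrite /S/= normrZ normfV normr_id mulVf// normr_eq0.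
have Sc : compact S.
  apply: bounded_closed_compact.
    by exists 1; split => // M M1 x; rewrite /S/= => ->; exact: ltW.
  rewrite (_ : S = (fun x : 'rV[R]_d => `|x|) @^-1` [set 1])//.
  by apply: closed_comp => [x _|]; [exact: norm_continuous|exact: closed_eq].
have [c Sc1 Hc] := EVT_min_rV (ex_intro _ x0 Sx0) Sc (continuous_subspaceT seminorm_continuous).
have qc : 0 < q c.
  rewrite lt_neqAle seminorm_ge0 andbT eq_sym; apply/eqP => /q0 c0.
  move: Sc1; rewrite inE /S/= c0 normr0 => /eqP; rewrite eq_sym oner_eq0//.
exists (q c)^-1; split; first by rewrite invr_ge0 ltW.
move=> x i; apply: (@le_trans _ _ `|x|).
  exact: coord_le_norm.
have [->|x1] := eqVneq x 0; first by rewrite normr0 mulr_ge0 ?seminorm_ge0// invr_ge0 ltW.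
have x2 : 0 < `|x| by rewrite normr_gt0.
have := Hc (`|x|^-1 *: x); rewrite qZ inE /S/= normrZ normfV normr_id mulVf ?normr_eq0// => /(_ erefl).
by rewrite mulrC ler_pdivlMr// -ler_pdivlMl.
Qed.

End finite_dimensional_norms.

(* On a complement of the null space the seminorm is a norm, and adding the size of the
   null space component turns it into a norm on the whole space. *)
Lemma seminorm_coord_le (R : realType) d (q : 'rV[R]_d -> R) :
  (forall x y, q (x + y) <= q x + q y) -> (forall a x, q (a *: x) = `|a| * q x) ->
  exists C : R, 0 <= C /\ forall x, exists z : 'rV[R]_d, q (x - z) = 0 /\ forall i, `|z 0 i| <= C * q x.
Proof.
move=> qD qZ; have q_ge0 := seminorm_ge0 qD qZ; have q00 := seminorm0 qZ.
have [|||B HB] := @subspace_basis R d (fun x => q x = 0) => //.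
- move=> u v u0 v0; apply/le_anti; rewrite q_ge0 andbT.
  by rewrite (le_trans (qD _ _))// u0 v0 addr0.
- by move=> a u u0; rewrite qZ u0 mulr0.
pose P := proj_mx B (B^C)%MS; pose q2 x := q x + \sum_i `|(x *m P) 0 i|.
have BC := capmx_compl B.
have s0 (x : 'rV[R]_d) : 0 <= \sum_i `|(x *m P) 0 i| by apply: sumr_ge0 => i _.
have [||x q2x|C [C0 HC]] := @norm_coord_le R d q2.
- move=> x y; rewrite /q2 addrACA lerD// -big_split/=; apply: ler_sum => i _.
  by rewrite mulmxDl mxE ler_normD.
- move=> a x; rewrite /q2 qZ mulrDr; congr (_ + _); rewrite mulr_sumr.
  by apply: eq_bigr => i _; rewrite -scalemxAl mxE normrM.
- have /andP[/eqP x1 /eqP x2] : (q x == 0) && (\sum_i `|(x *m P) 0 i| == 0).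
    by rewrite -paddr_eq0//; apply/eqP.
  have xP : x *m P = x by apply: proj_mx_id => //; apply/HB.
  apply/rowP => i; rewrite mxE -xP; apply/eqP; rewrite -normr_eq0 eq_le normr_ge0 andbT.
  by rewrite -x2 (bigD1 i)//= lerDl sumr_ge0.
exists C; split => // x; exists (x - x *m P).
have xP0 : q (x *m P) = 0 by apply/HB; exact: proj_mx_sub.
rewrite subKr; split => // i; apply: le_trans (HC _ _) _; rewrite ler_wpM2l// /q2.
have PP : x *m P *m P = x *m P by apply: proj_mx_id => //; exact: proj_mx_sub.
rewrite mulmxBl PP subrr big1 ?addr0; last by move=> j _; rewrite mxE normr0.
by rewrite (le_trans (qD _ _))// (seminormN qZ) xP0 addr0.
Qed.

Section recurrences.
Context {R : realType}.
Variables (L : nat) (a : nat -> R).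
Hypothesis aL : a L != 0.
Implicit Types (x y : nat -> R).

Definition recur x := forall n, \sum_(j < L.+1) a j * x (n + j)%N = 0.
Definition rdec x := recur x /\ x n @[n --> \oo] --> 0.
Definition window x : 'rV[R]_L := \row_j x j.
Definition wnorm x n := \sum_(j < L) `|x (n + j)%N|.

Lemma recur_uniq x : recur x -> window x = 0 -> forall n, x n = 0.
Proof.
move=> rx wx n; have [m] := ubnP n; elim: m n => // m IH n; rewrite ltnS => nm.
have [nL|Ln] := ltnP n L.
  by move/rowP : wx => /(_ (Ordinal nL)); rewrite !mxE.
have := rx (n - L)%N; rewrite big_ord_recr/= subnK// big1 ?add0r; last first.
  move=> j _; rewrite IH ?mulr0//; apply: leq_trans nm; have := ltn_ord j; lia.
by move/eqP; rewrite mulf_eq0 (negbTE aL)/= => /eqP.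
Qed.

Lemma rdecD x y : rdec x -> rdec y -> rdec (fun n => x n + y n).
Proof.
move=> [rx x0] [ry y0]; split.
  by move=> n; under eq_bigr do rewrite mulrDr; rewrite big_split/= rx ry addr0.
by rewrite -(addr0 0); apply: cvgD.
Qed.

Lemma rdecZ r x : rdec x -> rdec (fun n => r * x n).
Proof.
move=> [rx x0]; split.
  by move=> n; under eq_bigr do rewrite mulrCA; rewrite -mulr_sumr rx mulr0.
by rewrite -(mulr0 r); apply: cvgMr.
Qed.

Lemma rdec_sum (I : Type) (s : seq I) (F : I -> nat -> R) : (forall i, rdec (F i)) ->
  rdec (fun n => \sum_(i <- s) F i n).
Proof.
move=> rF; elim: s => [|i s IH].
  rewrite (funext (fun n => big_nil _ _ _ _)); split; last exact: cvg_cst.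
  by move=> n; apply: big1 => j _; rewrite mulr0.
rewrite (funext (fun n => big_cons _ _ _ _ _ _)); exact: rdecD.
Qed.

Lemma rdec_shift m x : rdec x -> rdec (fun n => x (m + n)%N).
Proof.
move=> [rx x0]; split; first by move=> n; under eq_bigr do rewrite addnA; exact: rx.
by rewrite (funext (fun n => congr1 x (addnC m n))) (cvg_shiftn m x).
Qed.

(** A solution is determined by its first [L] values, so decaying solutions correspond to a subspace
    of windows. The coordinates come from a pseudo-inverse of a basis matrix and are therefore
    bounded by the initial window. *)
Lemma rdec_basis : exists (F : 'I_L -> nat -> R) (C : R), [/\ forall i, rdec (F i), 0 <= C &
  forall x, rdec x -> exists c : 'I_L -> R, (forall i, `|c i| <= C * wnorm x 0) /\
    forall n, x n = \sum_i c i * F i n].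
Proof.
pose P v := exists x, rdec x /\ window x = v.
have [|||B HB] := @subspace_basis R L P.
- exists (fun=> 0); split; last by apply/rowP => j; rewrite !mxE.
  by split; [move=> n; apply: big1 => j _; rewrite mulr0|exact: cvg_cst].
- move=> u v [x [rx <-]] [y [ry <-]]; exists (fun n => x n + y n); split; first exact: rdecD.
  by apply/rowP => j; rewrite !mxE.
- move=> r u [x [rx <-]]; exists (fun n => r * x n); split; first exact: rdecZ.
  by apply/rowP => j; rewrite !mxE.
have /choice[F HF] : forall i, P (row i B) by move=> i; apply/HB; exact: row_sub.
pose Q := pinvmx B; pose C := \sum_i \sum_j `|Q i j|.
exists F, C; split; first by move=> i; have [] := HF i.
  by apply: sumr_ge0 => i _; apply: sumr_ge0 => j _.
move=> x rx; exists (fun i => (window x *m Q) 0 i); split.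
  move=> i; rewrite mxE (le_trans (ler_norm_sum _ _ _))// /wnorm mulr_sumr; apply: ler_sum => j _.
  rewrite normrM mulrC [window x 0 j]mxE add0n ler_wpM2r//.
  by rewrite /C (bigD1 j)//= (bigD1 i)//= -addrA lerDl addr_ge0 ?sumr_ge0// => k _; apply: sumr_ge0.
move=> n; apply/eqP; rewrite -subr_eq0; apply/eqP.
have ry : rdec (fun n => x n + (-1) * \sum_i (window x *m Q) 0 i * F i n).
  by apply: rdecD => //; apply: rdecZ; apply: rdec_sum => i; apply: rdecZ; have [] := HF i.
have := recur_uniq ry.1 _ n; rewrite mulN1r; apply.
have wx : (window x <= B)%MS by apply/HB; exists x.
apply/rowP => j; rewrite mxE [RHS]mxE mulN1r.
have e : (window x *m Q *m B) 0 j = window x 0 j by rewrite mulmxKpV.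
move: e; rewrite mxE [window x 0 j]mxE => <-; apply/eqP; rewrite subr_eq0; apply/eqP.
by apply: eq_bigr => i _; congr (_ * _); have [_ /rowP/(_ j)] := HF i; rewrite !mxE => ->.
Qed.

(* On the finite-dimensional space of decaying solutions a fixed shift is a contraction. *)
Lemma rdec_sum_le : exists C : R, 0 <= C /\
  forall x, rdec x -> forall N, \sum_(n < N) `|x n| <= C * wnorm x 0.
Proof.
have [F [C [rF C0 HF]]] := rdec_basis.
have w_ge0 x n : 0 <= wnorm x n by apply: sumr_ge0.
have Fb : exists M : R, 0 <= M /\ forall i n, wnorm (F i) n <= M.
  have /choice[M HM] : forall i, exists M : R, forall n, wnorm (F i) n <= M.
    move=> i; have /cvgP/cvg_seq_bounded [M [_ HM]] := (rF i).2.
    exists (L%:R * (`|M| + 1)) => n; rewrite /wnorm -[X in X%:R](card_ord L) mulr_natl -sumr_const.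
    apply: ler_sum => j _; apply: (HM (`|M| + 1)) => //.
    by rewrite (le_lt_trans (ler_norm _))// ltrDl.
  exists (\sum_i `|M i|); split; first exact: sumr_ge0.
  by move=> i n; rewrite (le_trans (HM i n))// (le_trans (ler_norm _))// (bigD1 i)//= lerDl sumr_ge0.
have [M [M0 HM]] := Fb.
have wx x n : rdec x -> forall K, (forall i, wnorm (F i) n <= K) -> wnorm x n <= L%:R * C * K * wnorm x 0.
  move=> rx K HK; have [c [Hc Hx]] := HF x rx.
  apply: (@le_trans _ _ (\sum_i `|c i| * wnorm (F i) n)).
    under [leRHS]eq_bigr do rewrite /wnorm mulr_sumr.
    rewrite exchange_big/=; apply: ler_sum => j _; rewrite Hx (le_trans (ler_norm_sum _ _ _))//.
    by apply: ler_sum => i _; rewrite normrM.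
  rewrite -[X in X%:R](card_ord L) -!mulrA mulr_natl -sumr_const; apply: ler_sum => i _.
  by rewrite [leRHS]mulrCA mulrC; apply: ler_pM.
pose K := L%:R * C * M; have K0 : 0 <= K by rewrite !mulr_ge0.
(* Each of the [L] basis solutions tends to 0, so that one [n0] works for all of them, hence for all
   decaying solutions. *)
have [n0 n00 Hn0] : exists2 n0, (0 < n0)%N & forall x, rdec x -> wnorm x n0 <= 2^-1 * wnorm x 0.
  have e0 : 0 < (2 * (L%:R * C + 1))^-1 :> R by rewrite invr_gt0 mulr_gt0// ltr_wpDl// mulr_ge0.
  have cv : \forall n \near \oo, forall i, wnorm (F i) n <= (2 * (L%:R * C + 1))^-1.
    have : forall i, \forall n \near \oo, wnorm (F i) n <= (2 * (L%:R * C + 1))^-1.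
      move=> i; have : wnorm (F i) n @[n --> \oo] --> 0.
        rewrite -[X in _ --> X](_ : \sum_(j < L) `|0 : R| = 0); last by rewrite normr0 big1.
        apply: cvg_big => [|j _]; first exact: add_continuous.
        apply: cvg_norm; rewrite (cvg_shiftn j (F i)); exact: (rF i).2.
      move=> /cvgrPdist_le/(_ _ e0); apply: filterS => n; rewrite sub0r normrN.
      exact: le_trans (ler_norm _).
    by move=> /(@filter_forall _ _ _ _ _); apply.
  near \oo => n; exists n; first by near: n; exact: nbhs_infty_gt.
  move=> x rx; have nF : forall i, wnorm (F i) n <= (2 * (L%:R * C + 1))^-1 by near: n.
  apply: le_trans (wx x n rx _ nF) _; rewrite ler_wpM2r// invfM mulrCA -[leRHS]mulr1 ler_wpM2l ?invr_ge0//.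
  by rewrite ler_pdivrMr ?ltr_wpDl ?mulr_ge0// mul1r lerDl.
pose S x N := \sum_(n < N) wnorm x n.
(* The first [n0] terms cost [n0 K] times the initial window; the rest is the sum for the shifted
   solution, whose window is half as large. The constant solves [c = n0 K + c / 2]. *)
have HS x N : rdec x -> S x N <= 2 * (n0%:R * K) * wnorm x 0.
  have [m] := ubnP N; elim: m x N => // m IH x N; rewrite ltnS => Nm rx.
  have h1 (k : nat) : \sum_(n < k) wnorm x n <= k%:R * K * wnorm x 0.
    rewrite -[X in X%:R](card_ord k) -mulrA mulr_natl -sumr_const; apply: ler_sum => i _.
    exact: wx.
  have [Nn|nN] := leqP N n0.
    apply: le_trans (h1 N) _; rewrite ler_wpM2r//.
    rewrite (@le_trans _ _ (n0%:R * K))//; first by rewrite ler_wpM2r// ler_nat.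
    by rewrite ler_peMl ?mulr_ge0// ler1n.
  rewrite /S -(subnKC (ltnW nN)) big_split_ord/=.
  have -> : \sum_(i < N - n0) wnorm x (n0 + i) = S (fun n => x (n0 + n)%N) (N - n0)%N.
    by apply: eq_bigr => i _; apply: eq_bigr => j _; rewrite addnA.
  have h2 : S (fun n => x (n0 + n)%N) (N - n0)%N <= 2 * (n0%:R * K) * wnorm x n0.
    apply: IH; [by lia|exact: rdec_shift].
  have h3 := h1 n0; have := Hn0 x rx; have nK : 0 <= n0%:R * K by rewrite mulr_ge0.
  move=> /(ler_wpM2l nK); lra.
have [L0|L0] := posnP L.
  exists 0; split => // x [rx _] N; rewrite mul0r big1// => n _.
  rewrite (recur_uniq rx) ?normr0//; apply/rowP => j; exfalso; move: (ltn_ord j); rewrite [X in (_ < X)%N]L0 ltn0; done.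
exists (2 * (n0%:R * K)); split; first by rewrite !mulr_ge0.
move=> x rx N; apply: le_trans (HS x N rx); apply: ler_sum => n _.
by rewrite /wnorm (bigD1 (Ordinal L0))//= addn0 lerDl sumr_ge0.
Unshelve. all: by end_near. Qed.

End recurrences.

Section two_sided_recurrences.
Context {R : realType}.
Implicit Types (x : int -> R) (a : nat -> R).

Definition zdec x := x n%:Z @[n --> \oo] --> 0 /\ x (- n%:Z) @[n --> \oo] --> 0.

Lemma zdec_shift x (m : int) : zdec x -> zdec (fun k => x (k + m)).
Proof.
move=> [xp xn]; have h (y : int -> R) : y n%:Z @[n --> \oo] --> 0 -> forall m : int, y (n%:Z + m) @[n --> \oo] --> 0.
  move=> yp k; apply/cvgrPdist_lt => e e0.
  move/cvgrPdist_lt : yp => /(_ _ e0)[N _ HN].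
  exists (N + `|k|)%N => // n /= Nn.
  have [n' nn'] : exists n' : nat, n%:Z + k = n'%:Z by exists (absz (n%:Z + k)%R); lia.
  by rewrite nn'; apply: HN => /=; lia.
split; first exact: h.
have := h (fun k => x (- k)) xn (- m); apply: cvg_trans; apply: near_eq_cvg.
by near=> n; congr x; lia.
Unshelve. all: by end_near. Qed.

Lemma zdec_forward x (m : int) : zdec x -> x (m + n%:Z) @[n --> \oo] --> 0.
Proof. by move=> /(zdec_shift m)[+ _]; under eq_fun do rewrite addrC. Qed.

Lemma zdec_backward x (m : int) : zdec x -> x (m - n%:Z) @[n --> \oo] --> 0.
Proof. by move=> /(zdec_shift m)[_ +]; under eq_fun do rewrite addrC. Qed.

(** The forward estimate started at [n - N] bounds [x n] by a multiple of the window there, which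
    tends to 0 as [N] grows. *)
Lemma recurrence_eq0 L a x : a L != 0 -> zdec x ->
  (forall n : int, \sum_(j < L.+1) a j * x (n + j%:Z) = 0) -> forall n, x n = 0.
Proof.
move=> aL xd rx n; have [C [C0 HC]] := rdec_sum_le aL.
have rd m : rdec L a (fun k => x (m + k%:Z)).
  split; last exact: zdec_forward.
  by move=> k; rewrite -[RHS](rx (m + k%:Z)); apply: eq_bigr => j _; rewrite PoszD addrA.
have xle (N : nat) : `|x n| <= C * \sum_(j < L) `|x (n - N%:Z + j%:Z)|.
  apply: le_trans (HC _ (rd (n - N%:Z)) N.+1).
  rewrite big_ord_recr/= subrK lerDr; exact: sumr_ge0.
have cv : (C * \sum_(j < L) `|x (n - N%:Z + j%:Z)|) @[N --> \oo] --> C * \sum_(j < L) `|0 : R|.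
  apply: cvgMr; apply: cvg_big => [|j _]; first exact: add_continuous.
  apply: cvg_norm; have := zdec_backward (n + j%:Z) xd; apply: cvg_trans.
  by apply: near_eq_cvg; near=> N; congr x; lia.
apply/eqP; rewrite -normr_le0.
have -> : 0 = C * \sum_(j < L) `|0 : R| by rewrite normr0 big1 ?mulr0.
rewrite -(cvg_lim _ cv)//; apply: limr_ge; first exact: cvgP cv.
by near=> N.
Unshelve. all: by end_near. Qed.

(** Along each coset [u + Z] the values of [G] solve a recurrence, whose leading coefficient becomes
    nonzero once the relation is cut at its last nonzero coefficient. *)
Lemma translates_independent L a (G : R -> R) : (exists2 j, (j <= L)%N & a j != 0) ->
  (forall u, zdec (fun k => G (u + k%:~R))) ->
  (forall u, \sum_(j < L.+1) a j * G (u + j%:R) = 0) -> forall u, G u = 0.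
Proof.
move=> [j jL aj] Gd rG u.
have ex : exists j, (j <= L)%N && (a j != 0) by exists j; rewrite jL.
have ub j' : (j' <= L)%N && (a j' != 0) -> (j' <= L)%N by case/andP.
have [M /andP[ML aM] Mmax] := ex_maxnP ex ub.
have := @recurrence_eq0 M a (fun k => G (u + k%:~R)) aM (Gd u) _ 0; rewrite addr0; apply => n.
rewrite -[RHS](rG (u + n%:~R)) -(subnKC (leq_ltn_trans ML (ltnSn L))).
rewrite big_split_ord/= [X in _ = _ + X]big1 ?addr0; last first.
  move=> i _; apply/eqP; rewrite mulf_eq0; apply/orP; left; apply/eqP/eqP; apply: contraT => ai.
  have := ltn_ord i; have := Mmax (M.+1 + i)%N; rewrite ai andbT => H ilt.
  by have := H ltac:(lia); lia.
by apply: eq_bigr => i _; rewrite intrD addrA.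
Qed.

Lemma summZ_half x (m : int) (C : R) : (forall N, \sum_(n < N) `|x (m + n%:Z)| <= C) ->
  summZ (fun k => if (m <= k)%R then x k else 0).
Proof.
move=> xC; rewrite /summZ; apply: (@le_lt_trans _ _ C%:E); last exact: ltry.
apply: esZ_le_zpartial => // N; rewrite /zpartial.
have C0 : 0 <= C by have := xC 0%N; rewrite big_ord0.
pose g (k : int) := `|if (m <= k)%R then x k else 0|.
have h (N' : nat) (k : int) : \sum_(0 <= i < N') g (k + i%:Z) <= C.
  elim: N' k => [|N' IH] k; first by rewrite big_geq.
  have [mk|km] := lerP m k.
    apply: le_trans (xC (absz (k - m)%R + N'.+1)%N).
    rewrite big_split_ord/= -[leLHS]add0r; apply: lerD; first exact: sumr_ge0.
    rewrite big_mkord; apply: ler_sum => i _; rewrite /g.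
    rewrite (_ : (m <= k + i%:Z)%R = true); last by lia.
    by rewrite (_ : m + _ = k + i%:Z)//; lia.
  rewrite big_nat_recl// addr0 /g (lt_geF km)/= normr0 add0r.
  rewrite (eq_bigr (fun i : nat => g (k + 1 + i%:Z))); last first.
    by move=> i _; rewrite /g -addrA (_ : 1 + i%:Z = i.+1%:Z)//; lia.
  exact: IH.
have := h (N.*2.+1) (- N%:Z); apply: le_trans; rewrite le_eqVlt; apply/orP; left; apply/eqP.
by apply: eq_bigr => i _; rewrite /g addrC.
Qed.

(* Solutions of a two-sided recurrence with one gap are glued from a forward and a backward
   solution. *)
Lemma recurrence_span L a (n0 : int) : a 0%N != 0 -> a L != 0 ->
  exists (D : nat) (e : 'I_D -> int -> R), (forall i, summZ (e i)) /\
    forall x, zdec x -> (forall n, n != n0 -> \sum_(j < L.+1) a j * x (n + j%:Z) = 0) ->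
    exists c : 'I_D -> R, forall k, x k = \sum_i c i * e i k.
Proof.
move=> a0 aL.
have [F [C [rF C0 HF]]] := rdec_basis aL; have [CF [CF0 HCF]] := rdec_sum_le aL.
(* Read backwards, the sequence solves the recurrence with reversed coefficients. *)
pose a' j := a (L - j)%N; have aL' : a' L != 0 by rewrite /a' subnn.
have [F' [C' [rF' C'0 HF']]] := rdec_basis aL'; have [CF' [CF'0 HCF']] := rdec_sum_le aL'.
(* Forward solutions serve [k > n0] and backward ones [k < n0], while [k = n0] is a separate
   coordinate. The backward sequences start at [n0 + L - 1], the last index in the relation at
   [n0 - 1]. *)
pose e1 i k := if (n0 + 1 <= k)%R then F i (absz (k - (n0 + 1))%R) else 0.
pose e2 i k := if (1 - n0 <= k)%R then F' i (absz (n0 + L%:Z - 1 + k)%R) else 0.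
pose e3 (k : int) : R := (k == n0)%:R.
exists (L + L + 1)%N, (fun i => match fintype.split i with
  | inl j => match fintype.split j with inl j' => e1 j' | inr j' => fun k => e2 j' (- k) end
  | inr _ => e3 end); split.
  move=> i; case: (fintype.split i) => [j|_].
    case: (fintype.split j) => {}j.
      apply: (@summZ_half _ _ (CF * wnorm L (F j) 0)) => N.
      apply: le_trans (HCF _ (rF j) N); apply: ler_sum => n _.
      by rewrite (_ : absz _ = n)//; lia.
    apply: (@summZN _ (e2 j)).
    apply: (@summZ_half _ _ (CF' * wnorm L (F' j) 0)) => N.
    apply: le_trans (HCF' _ (rF' j) (L + N)%N); rewrite big_split_ord/=.
    rewrite -[leLHS]add0r; apply: lerD; first exact: sumr_ge0.
    apply: ler_sum => n _.
    by rewrite (_ : absz _ = L + n)%N//; lia.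
  rewrite /summZ; apply: (@le_lt_trans _ _ 1%:E); last exact: ltry.
  rewrite /e3 (_ : (fun k => _) = (fun k => if k == n0 then 1%:E else 0%E)) ?esZ1//.
  by apply/funext => k; case: eqP => _; rewrite ?normr1 ?normr0.
move=> x xd rx.
have rd1 : rdec L a (fun k => x (n0 + 1 + k%:Z)).
  split; last exact: zdec_forward.
  move=> k; rewrite -[RHS](rx (n0 + 1 + k%:Z)); last by lia.
  by apply: eq_bigr => j _; rewrite PoszD addrA.
have rd2 : rdec L a' (fun k => x (n0 + L%:Z - 1 - k%:Z)).
  split; last exact: zdec_backward.
  move=> k; rewrite -[RHS](rx (n0 - 1 - k%:Z)); last by lia.
  rewrite (reindex_inj rev_ord_inj)/=; apply: eq_bigr => j _; have := ltn_ord j; rewrite ltnS => jL.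
  rewrite /a' (_ : (L - (L.+1 - j.+1))%N = j); last by lia.
  by congr (_ * x _); lia.
have [c [_ Hc]] := HF _ rd1; have [c' [_ Hc']] := HF' _ rd2.
exists (fun i => match fintype.split i with
  | inl j => match fintype.split j with inl j' => c j' | inr j' => c' j' end | inr _ => x n0 end) => k.
rewrite big_split_ord/= big_ord1 (unsplitK (inr _)) big_split_ord/=.
under eq_bigr do rewrite (unsplitK (inl _)) (unsplitK (inl _)).
under [X in _ + X + _]eq_bigr do rewrite (unsplitK (inl _)) (unsplitK (inr _)).
have [k1|k1] := lerP (n0 + 1) k.
  rewrite [X in _ + X + _]big1 ?addr0; last first.
    by move=> i _; rewrite /e2 (_ : (1 - n0 <= - k) = false) ?mulr0//; lia.
  rewrite /e3 (_ : k == n0 = false) ?mulr0 ?addr0; last by lia.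
  have := Hc (absz (k - (n0 + 1))%R); rewrite (_ : n0 + 1 + _ = k); last by lia.
  by move=> ->; apply: eq_bigr => i _; rewrite /e1 k1.
rewrite big1 ?add0r; last by move=> i _; rewrite /e1 leNgt k1/= mulr0.
have [->|kn] := eqVneq k n0.
  rewrite /e3 eqxx mulr1 big1 ?add0r// => i _; rewrite /e2 (_ : (1 - n0 <= - n0) = false) ?mulr0//; lia.
rewrite /e3 (negbTE kn) mulr0 addr0.
have := Hc' (absz (n0 + L%:Z - 1 - k)%R).
rewrite (_ : n0 + L%:Z - 1 - (absz (n0 + L%:Z - 1 - k)%R)%:Z = k); last by lia.
by move=> ->; apply: eq_bigr => i _; rewrite /e2 (_ : (1 - n0 <= - k)); last by lia.
Qed.

End two_sided_recurrences.

(** * Norms on subsets of the line *)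

Section norm_bounds.
Context {R : realType}.
Local Notation mu := (@lebesgue_measure R).
Local Notation mR := (measurableTypeR R).
Variable pm : option R.
Hypothesis pm_ge1 : if pm is Some p then 1 <= p else true.
Implicit Types (A : set R) (G : R -> R) (B : R).

(* [bnd A G B] bounds the norm of [G] in [L^p(A)] by [B], with [None] standing for [p = oo]
   and the essential supremum; [ep] is [1/p]. *)
Definition bnd A G B : Prop := match pm with
  | None => {ae mu, forall x, A x -> `|G x| <= B}
  | Some p => (\int[mu]_(x in A) (`|G x| `^ p)%:E <= (B `^ p)%:E)%E end.

Definition ep : R := if pm is Some p then p^-1 else 0.

Lemma measurable_normpow G p : measurable_fun [set: R] G ->
  measurable_fun [set: R] (fun x : R => (`|G x| `^ p)%:E).
Proof.
move=> mG; apply/measurable_EFinP.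
apply: (measurableT_comp (measurable_powR p)); exact: measurableT_comp.
Qed.

Lemma measurable_normpowD (D : set mR) G p : measurable_fun [set: R] G ->
  measurable_fun D (fun x : mR => (`|G x| `^ p)%:E).
Proof. by move=> mG; apply: (measurable_funS _ _ (measurable_normpow p mG)). Qed.

Lemma bnd_le A G B B' : 0 <= B -> B <= B' -> bnd A G B -> bnd A G B'.
Proof.
move=> B0 BB; rewrite /bnd; case: pm pm_ge1 => [p p1|_].
  move=> /le_trans; apply; rewrite lee_fin; apply: ge0_ler_powR; rewrite ?nnegrE//.
  - by rewrite (le_trans _ p1).
  - exact: le_trans BB.
by apply: aeS => x H /H/le_trans; apply.
Qed.

Lemma bnd_dom A A' G G' B : measurable (A : set mR) -> measurable (A' : set mR) ->
  measurable_fun [set: R] G -> measurable_fun [set: R] G' -> A `<=` A' ->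
  {ae mu, forall x, A x -> `|G x| <= `|G' x|} -> bnd A' G' B -> bnd A G B.
Proof.
move=> mA mA' mG mG' AA GG; rewrite /bnd; case: pm pm_ge1 => [p p1|_].
  apply: le_trans; apply: (@le_trans _ _ (\int[mu]_(x in A) (`|G' x| `^ p)%:E)%E).
    apply: ae_ge0_le_integral => //.
    - exact: measurable_normpowD.
    - exact: measurable_normpowD.
    apply: aeS GG => x H /H {}H; rewrite lee_fin; apply: ge0_ler_powR; rewrite ?nnegrE//.
    by rewrite (le_trans _ p1).
  by apply: ge0_subset_integral => //; exact: measurable_normpowD.
by move=> H; apply: aeS (aeI GG H) => x [h1 h2] Ax; apply: le_trans (h1 Ax) (h2 (AA _ Ax)).
Qed.

Lemma bnd_sub A A' G B : measurable (A : set mR) -> measurable (A' : set mR) ->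
  measurable_fun [set: R] G -> A `<=` A' -> bnd A' G B -> bnd A G B.
Proof. by move=> mA mA' mG AA; apply: bnd_dom => //; apply/nearW => x. Qed.

Lemma bnd_Lnorm p A G B : pm = Some p -> measurable (A : set mR) -> 0 <= B ->
  bnd A G B <-> (Lnorm mu p%:E (EFin \o (G \_ A)) <= B%:E)%E.
Proof.
move=> e mA B0; rewrite /bnd e; have p1 : 1 <= p by move: pm_ge1; rewrite e.
have p0 : 0 < p by exact: lt_le_trans p1.
have -> : (\int[mu]_(x in A) (`|G x| `^ p)%:E = Lnorm mu p%:E (EFin \o (G \_ A)) `^ p)%E.
  rewrite poweR_Lnorm; last by rewrite gt_eqF.
  rewrite [LHS]integral_mkcond/=; apply: eq_integral => x _.
  by rewrite /patch/=; case: ifP => // _; rewrite normr0 powR0// gt_eqF.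
have mono (x y : \bar R) q : 0 < q -> (0 <= x -> 0 <= y -> x <= y -> x `^ q <= y `^ q)%E.
  by move=> q0 x0 y0; apply: gt0_ler_poweR; [exact: ltW|rewrite in_itv/= x0 leey|rewrite in_itv/= y0 leey].
rewrite -poweR_EFin; split => [H|H]; last by apply: mono; rewrite ?lee_fin ?Lnorm_ge0.
have := mono _ _ p^-1 _ _ _ H; rewrite -!poweRrM mulfV ?gt_eqF// !poweRe1 ?lee_fin ?Lnorm_ge0//.
by apply; rewrite ?invr_gt0 ?poweR_ge0 ?powR_ge0.
Qed.

Lemma bndD A G1 G2 B1 B2 : measurable (A : set mR) ->
  measurable_fun [set: R] G1 -> measurable_fun [set: R] G2 -> 0 <= B1 -> 0 <= B2 ->
  bnd A G1 B1 -> bnd A G2 B2 -> bnd A (fun x => G1 x + G2 x) (B1 + B2).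
Proof.
move=> mA mG1 mG2 B10 B20; case e : pm pm_ge1 => [p|].
  move=> p1 /(bnd_Lnorm G1 e mA B10) H1 /(bnd_Lnorm G2 e mA B20) H2.
  apply/(bnd_Lnorm _ e mA); first exact: addr_ge0.
  rewrite EFinD; apply: le_trans (leeD H1 H2).
  rewrite (_ : (fun x => G1 x + G2 x) \_ A = (G1 \_ A) \+ (G2 \_ A)); last first.
    by apply/funext => x; rewrite /patch/=; case: ifP; rewrite ?addr0.
  by apply: minkowski_EFin => //; apply/(measurable_restrictT _ mA); exact: measurable_funTS.
rewrite /bnd e => _ H1 H2; apply: aeS (aeI H1 H2) => x [h1 h2] Ax.
by apply: le_trans (ler_normD _ _) _; rewrite lerD ?h1 ?h2.
Qed.

Lemma bndZ A G r B : measurable (A : set mR) -> measurable_fun [set: R] G -> 0 <= B ->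
  bnd A G B -> bnd A (fun x => r * G x) (`|r| * B).
Proof.
move=> mA mG B0; rewrite /bnd; case: pm pm_ge1 => [p p1|_ H].
  move=> H; under eq_integral do rewrite normrM powRM// EFinM.
  rewrite ge0_integralZl//; last exact: measurable_normpowD.
  by rewrite powRM// EFinM lee_wpmul2l// lee_fin powR_ge0.
by apply: aeS H => x h Ax; rewrite normrM ler_wpM2l// h.
Qed.

Lemma bndN A G B : bnd A G B -> bnd A (fun x => - G x) B.
Proof.
rewrite /bnd; case: pm => [p|]; last by apply: aeS => x; rewrite normrN.
have -> : (fun x : R => (`|- G x| `^ p)%:E) = (fun x => (`|G x| `^ p)%:E).
  by apply/funext => x; rewrite normrN.
by [].
Qed.

Lemma bndB A G1 G2 B1 B2 : measurable (A : set mR) ->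
  measurable_fun [set: R] G1 -> measurable_fun [set: R] G2 -> 0 <= B1 -> 0 <= B2 ->
  bnd A G1 B1 -> bnd A G2 B2 -> bnd A (fun x => G1 x - G2 x) (B1 + B2).
Proof.
by move=> mA m1 m2 ? ? ? ?; apply: bndD => //; [exact: measurableT_comp|exact: bndN].
Qed.

Lemma bndU A A' G B1 B2 : measurable (A : set mR) -> measurable (A' : set mR) ->
  measurable_fun [set: R] G -> 0 <= B1 -> 0 <= B2 ->
  bnd A G B1 -> bnd A' G B2 -> bnd (A `|` A') G (B1 + B2).
Proof.
move=> mA mA' mG B10 B20; case e : pm pm_ge1 => [p|].
  move=> p1 /(bnd_Lnorm G e mA B10) H1 /(bnd_Lnorm G e mA' B20) H2.
  have mAA : measurable (A `|` A') by exact: measurableU.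
  have mT (D : set R) : measurable (D : set mR) -> measurable_fun setT (fun x : R => `|(G \_ D) x|).
    move=> mD; have mP : measurable_fun setT (G \_ D).
      by apply/(measurable_restrictT _ mD); exact: measurable_funTS.
    exact: measurableT_comp.
  apply: (@bnd_dom _ setT _ (fun x => `|(G \_ A) x| + `|(G \_ A') x|)) => //.
  - by apply: measurable_funD; exact: mT.
  - apply/nearW => x; rewrite [leRHS]ger0_norm ?addr_ge0//; rewrite /patch.
    by case=> /mem_set ->; [rewrite lerDl|rewrite lerDr].
  apply: bndD => //; try exact: mT.
  - apply/(bnd_Lnorm _ e) => //; rewrite patch_setT; move: H1; rewrite -Lnorm_abse; exact.
  - apply/(bnd_Lnorm _ e) => //; rewrite patch_setT; move: H2; rewrite -Lnorm_abse; exact.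
rewrite /bnd e => _ H1 H2; apply: aeS (aeI H1 H2) => x [h1 h2] [Ax|Ax].
  by apply: le_trans (h1 Ax) _; rewrite lerDl.
by apply: le_trans (h2 Ax) _; rewrite lerDr.
Qed.

Lemma bnd_unif A G K e : 0 <= K -> 0 <= e -> measurable (A : set mR) -> measurable_fun [set: R] G ->
  (forall x, A x -> `|x| <= K /\ `|G x| <= e) -> bnd A G (e * (2 * K) `^ ep).
Proof.
move=> K0 e0 mA mG H; have eK : 0 <= e * (2 * K) `^ ep by rewrite mulr_ge0 ?powR_ge0.
rewrite /bnd /ep; case: pm pm_ge1 => [p p1|_]; last first.
  by apply/nearW => x /H[_]; rewrite powRr0 mulr1.
have p0 : 0 < p by exact: lt_le_trans p1.
have mK : measurable (`[- K, K] : set mR) by exact: measurable_itv.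
apply: (@le_trans _ _ (\int[mu]_(x in `[(- K)%R, K]) (cst (e `^ p)%:E x))%E).
  apply: (@le_trans _ _ (\int[mu]_(x in A) (cst (e `^ p)%:E x))%E).
    apply: ge0_le_integral => //=.
    - exact: measurable_normpowD.
    move=> x /H[_ h]; rewrite lee_fin; apply: ge0_ler_powR; rewrite ?nnegrE//; exact: ltW.
  apply: ge0_subset_integral => //=.
    by move=> x _; rewrite lee_fin powR_ge0.
  by move=> x /H[h _]; move: h; rewrite ler_norml /= in_itv.
rewrite integral_cst//= lebesgue_measure_itv/= lte_fin.
rewrite powRM ?powR_ge0 ?mulr_ge0// -powRrM mulVf ?gt_eqF// powRr1 ?mulr_ge0//.
case: ifPn => h; last by rewrite mule0 lee_fin mulr_ge0 ?powR_ge0 ?mulr_ge0.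
by rewrite -EFinB -EFinM lee_fin opprK mulr_natl mulr2n.
Qed.

Lemma bnd_affine A G (a b : R) B : 0 < a -> measurable (A : set mR) -> measurable_fun [set: R] G -> 0 <= B ->
  bnd A G B -> bnd [set x | A (a * x + b)] (fun x => G (a * x + b)) (B * a `^ (- ep)).
Proof.
move=> a0 mA mG B0; rewrite /bnd /ep; case: pm pm_ge1 => [p p1|_] H; last first.
  rewrite oppr0 powRr0 mulr1.
  exact: (ae_affine b (lt0r_neq0 a0) H).
have p0 : 0 < p by exact: lt_le_trans p1.
rewrite (ge0_integral_affine_in (F := fun x => (`|G x| `^ p)%:E))//.
- rewrite gtr0_norm// powRM ?powR_ge0// -powRrM mulNr mulVf ?gt_eqF// powR_inv1 ?(ltW a0)// mulrC EFinM.
  by rewrite lee_wpmul2l// lee_fin invr_ge0 ltW.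
- by rewrite gt_eqF.
- exact: measurable_normpowD.
Qed.

Lemma bnd_fatou A (G_ : nat -> R -> R) G B : measurable (A : set mR) ->
  (forall n, measurable_fun [set: R] (G_ n)) -> measurable_fun [set: R] G ->
  {ae mu, forall x, A x -> G_ n x @[n --> \oo] --> G x} ->
  (forall n, bnd A (G_ n) B) -> bnd A G B.
Proof.
move=> mA mGn mG cv; rewrite /bnd; case: pm pm_ge1 => [p p1|_] H; last first.
  have {}H : {ae mu, forall x, forall n, A x -> `|G_ n x| <= B} by apply: ae_foralln.
  apply: aeS (aeI cv H) => x [cx hx] Ax.
  have /cvg_norm c := cx Ax; rewrite -(cvg_lim _ c)//; apply: limr_le; first exact: cvgP c.
  by near=> n; exact: hx.
have p0 : 0 < p by exact: lt_le_trans p1.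
apply: (@le_trans _ _ (limn_einf (fun n => \int[mu]_(x in A) (`|G_ n x| `^ p)%:E))%E); last first.
  rewrite limn_einf_lim; apply: lime_le; first exact: is_cvg_einfs.
  by near=> n; apply: le_trans (H n); apply: ereal_inf_lbound; exists n => /=.
apply: (@le_trans _ _ (\int[mu]_(x in A) limn_einf (fun n => (`|G_ n x| `^ p)%:E))%E); last first.
  by apply: fatou => // n; exact: measurable_normpowD.
have ge0 x : (0 <= limn_einf (fun n => (`|G_ n x| `^ p)%:E))%E.
  rewrite limn_einf_lim; apply: lime_ge; first exact: is_cvg_einfs.
  by near=> n; apply: le_ereal_inf_tmp => _ [m _ <-]; rewrite lee_fin powR_ge0.
apply: ae_ge0_le_integral => //.
- exact: measurable_normpowD.
- have -> : (fun x : mR => limn_einf (fun n => (`|G_ n x| `^ p)%:E)) =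
      (fun x : mR => - limn_esup (fun n => - (`|G_ n x| `^ p)%:E))%E.
    by apply/funext => x; rewrite (limn_esupN (fun n => (`|G_ n x| `^ p)%:E)) oppeK.
  apply: measurableT_comp => //; apply: measurable_fun_limn_esup => // n.
  by apply: measurableT_comp => //; exact: measurable_normpowD.
apply: aeS cv => x cx Ax.
have [Gx0|Gx0] := eqVneq (G x) 0; first by rewrite Gx0 normr0 powR0 ?gt_eqF.
have {}Gx0 : 0 < `|G x| by rewrite normr_gt0.
have cn : `|G_ n x| @[n --> \oo] --> `|G x| by apply: cvg_norm; exact: cx.
have nz : \forall n \near \oo, 0 < `|G_ n x|.
  move/cvgrPdist_lt : cn => /(_ _ Gx0); apply: filterS => n.
  by rewrite ltr_norml => /andP[_]; rewrite ltrBlDr -ltrBlDl subrr.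
have c : (`|G_ n x| `^ p)%:E @[n --> \oo] --> (`|G x| `^ p)%:E.
  apply: cvg_EFin; first by near=> n.
  have c1 : expR (p * ln `|G_ n x|) @[n --> \oo] --> expR (p * ln `|G x|).
    apply: continuous_cvg; first exact: continuous_expR.
    by apply: cvgMr; apply: continuous_cvg cn; exact: continuous_ln.
  have -> : `|G x| `^ p = expR (p * ln `|G x|) by rewrite /powR gt_eqF.
  apply: cvg_trans c1; apply: near_eq_cvg; near=> n.
  have nn : 0 < `|G_ n x| by near: n.
  by rewrite /= /powR gt_eqF.
by have [-> _] := cvg_limn_einf_sup c.
Unshelve. all: by end_near. Qed.

Lemma bnd_all0 A G : measurable (A : set mR) -> measurable_fun [set: R] G ->
  (forall e, 0 < e -> bnd A G e) -> {ae mu, forall x, A x -> G x = 0}.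
Proof.
move=> mA mG; rewrite /bnd; case: pm pm_ge1 => [p p1|_] H; last first.
  have {}H : {ae mu, forall x, forall n : nat, A x -> `|G x| <= n.+1%:R^-1}.
    by apply: ae_foralln => n; apply: H.
  apply: aeS H => x hx Ax; apply/eqP; rewrite -normr_le0; apply/ler_addgt0Pr => e e0.
  rewrite add0r; have [n _ Hn] := near_infty_natSinv_lt (PosNum e0).
  by apply: le_trans (hx n Ax) _; apply/ltW/(Hn n) => /=.
have p0 : 0 < p by exact: lt_le_trans p1.
have I0 : (\int[mu]_(x in A) (`|G x| `^ p)%:E = 0)%E.
  apply/eqP; rewrite eq_le integral_ge0 ?andbT; last by move=> x _; rewrite lee_fin powR_ge0.
  apply/lee_addgt0Pr => e e0; rewrite add0e.
  have := H _ (powR_gt0 p^-1 e0); rewrite -powRrM mulVf ?gt_eqF// powRr1 ?(ltW e0)//.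
have : (\int[mu]_(x in A) `|(`|G x| `^ p)%:E| = 0)%E.
  by rewrite -[RHS]I0; apply: eq_integral => x _; rewrite gee0_abs// lee_fin powR_ge0.
move=> /(ae_eq_integral_abs mu mA (measurable_normpowD p mG)).
apply: aeS => x h /h [] /powR_eq0_eq0 /eqP; rewrite normr_eq0 => /eqP//.
Qed.

End norm_bounds.

(** * Vanishing of the limit function *)

Section summation_tools.
Context {R : realType}.
Local Notation mu := (@lebesgue_measure R).
Local Notation mR := (measurableTypeR R).
Implicit Types (a c : int -> R) (G F : R -> R).

Lemma zsum_fin a N : (forall k, k \notin ints N -> a k = 0) -> zsum a = zpartial a N.
Proof.
move=> a0; have H M : zpartial a (N + M) = zpartial a N.
  elim: M => [|M IH]; rewrite ?addn0// addnS zpartialS IH !a0 ?addr0// mem_ints; lia.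
apply/cvg_lim => //; apply: cvg_near_cst; near=> M.
by rewrite -(subnKC (_ : (N <= M)%N)) ?H//; near: M; exact: nbhs_infty_ge.
Unshelve. all: by end_near. Qed.

Lemma bounded_pgrow c M : (forall k, `|c k| <= M) -> pgrow 0 c.
Proof. by move=> cM; exists M => k; rewrite expr0 mulr1. Qed.

Lemma summZ_bounded c : summZ c -> exists M, 0 <= M /\ forall k, `|c k| <= M.
Proof.
move=> sc; pose M := fine (esZ (fun k => `|c k|%:E)).
have EM : (esZ (fun k => `|c k|%:E) = M%:E)%E.
  by rewrite fineK// ge0_fin_numE// esZ_ge0// => k; rewrite lee_fin.
exists M; split; first by rewrite -lee_fin -EM esZ_ge0// => k; rewrite lee_fin.
by move=> k; rewrite -lee_fin -EM; apply: (@term_le_esZ _ (fun k => `|c k|%:E)) => j; rewrite lee_fin.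
Qed.

Lemma Sop_fin c G u N : (forall k, k \notin ints N -> c k = 0) ->
  Sop c G u = \sum_(i < N.*2.+1) c (i%:Z - N%:Z) * G (u - (i%:Z - N%:Z)%:~R).
Proof.
move=> c0; rewrite /Sop (@zsum_fin _ N) => [|k /c0 ->]; last by rewrite mulr0.
by rewrite /zpartial big_mkord; apply: eq_bigr => i _; rewrite mulrC.
Qed.

Lemma Sop_translate sg c G u (n : int) : LI G -> condition_Theta sg G -> 0%:R + 1 < sg -> pgrow 0 c ->
  Sop c G (u + n%:~R) = Sop (fun k => c (k + n)) G u.
Proof.
move=> GL GT ds cd; rewrite /Sop -[LHS](zsum_shift n (Sop_summ (u + n%:~R) GL GT ds cd)).
by apply: eq_zsum => k; congr (G _ * _); rewrite intrD; lra.
Qed.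

Lemma le_norm_Sop c G u M : (forall k, `|c k| <= M) -> 0 <= M ->
  (`|Sop c G u|%:E <= M%:E * esZ (fun k => `|G (u - k%:~R)|%:E))%E.
Proof.
move=> cM M0; apply: le_trans (le_norm_zsum _) _; rewrite -esZZl//.
by apply: le_esZ => k; [rewrite lee_fin|rewrite -EFinM lee_fin normrM mulrC ler_wpM2r].
Qed.

Lemma ge0_integral_periodize (F : R -> \bar R) : measurable_fun [set: R] F ->
  (forall x, 0 <= F x)%E ->
  (\int[mu]_x F x = \int[mu]_(x in `[0%R, 1%R[) esZ (fun k => F (x - k%:~R)%R))%E.
Proof.
move=> mF F0; have mFk k : measurable_fun [set: R] (fun x : R => F (x - k%:~R)).
  by apply: measurableT_comp => //; exact: measurable_funB.
rewrite [RHS](@integral_esZ _ mR R mu _ (fun k (x : mR) => F (x - k%:~R)))//; last by move=> k; apply: measurable_funTS; exact: mFk.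
pose I n : set R := `[(- (zen n)%:~R)%R, (1 - (zen n)%:~R)%R[%classic.
have -> : [set: R] = \bigcup_n I n.
  apply/seteqP; split => x //= _.
  exists (zne (- Num.floor x)) => //=; rewrite /I/= in_itv/= zneK mulrNz opprK.
  by rewrite ge_floor/= addrC; have := floorD1_gt x; rewrite intrD.
rewrite ge0_integral_bigcup//.
- apply: eq_eseriesr => n _; rewrite /I.
  have := @ge0_integral_affine_in R F 1 (- (zen n)%:~R) (I n) (oner_neq0 _).
  rewrite normr1 invr1 mul1e => <- //; [|exact: measurable_itv|exact: measurable_funTS].
  rewrite (_ : [set x | _] = `[0%R, 1%R[%classic); last first.
    rewrite /I; move: (zen n)%:~R => t.
    by apply/seteqP; split => z /=; rewrite !in_itv/= mul1r => /andP[h1 h2]; apply/andP; split; lra.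
  by apply: eq_integral => z _; rewrite mul1r.
- by move=> n; exact: measurable_itv.
- exact: measurable_funTS.
- apply/trivIsetP => i j _ _ ij; rewrite -subset0 => x [] /=.
  rewrite /I/= !in_itv/= => /andP[h1 h2] /andP[h3 h4].
  have : zen i != zen j by apply: contra ij => /eqP /(can_inj zenK) ->.
  case/negP; rewrite eq_le -!ltzD1; apply/andP; split; rewrite -(ltr_int R) intrD; lra.
Qed.

(** The integral equals that of the periodization over a unit interval, which is finite by
    [Sop_major] with constant coefficients. *)
Lemma Theta_integrable sg G : LI G -> condition_Theta sg G -> 1 < sg -> integrableR G.
Proof.
move=> GL GT sg1; have mG : measurable_fun [set: R] G by case: GL.
apply/integrableP; split; first exact/measurable_EFinP.
rewrite (@ge0_integral_periodize (fun x => `|G x|%:E))//; last exact: mabs.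
have s1 : 0%:R + 1 < sg by rewrite add0r.
have p0 : pgrow 0 (fun=> 1 : R) by apply: (@bounded_pgrow _ 1) => k; rewrite normr1.
have [_] := Sop_major 1 GL GT s1 p0; apply: le_lt_trans.
under [X in (_ <= X)%E]eq_integral do under eq_fun do rewrite mulr1.
apply: ge0_subset_integral => //.
- apply: (@measurable_funS _ _ _ _ setT) => //; apply: measurable_esZ => [k x _|k]; first by rewrite lee_fin.
  by apply: mabs; apply: measurableT_comp => //; exact: measurable_funB.
- by move=> x _; apply: esZ_ge0 => k; rewrite lee_fin.
- by move=> x /=; rewrite !in_itv/= => /andP[h1 h2]; apply/andP; split; lra.
Qed.

Lemma Sop_integrable sg c G : LI G -> condition_Theta sg G -> 1 < sg -> summZ c ->
  integrableR (Sop c G).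
Proof.
move=> GL GT sg1 sc; have [M [M0 cM]] := summZ_bounded sc.
have s1 : 0%:R + 1 < sg by rewrite add0r.
have [mS _] := LI_Sop GL GT s1 (bounded_pgrow cM).
have mG : measurable_fun [set: R] G by case: GL.
apply/integrableP; split; first exact/measurable_EFinP.
apply: (@le_lt_trans _ _ (\int[mu]_x esZ (fun k => `|c k|%:E * `|G (x - k%:~R)|%:E)))%E.
  apply: ge0_le_integral => //=.
  - exact: mabs.
  - apply: measurable_esZ => [k x _|k]; first by rewrite mule_ge0 ?lee_fin.
    apply: measurable_funeM; apply: mabs; apply: measurableT_comp => //; exact: measurable_funB.
  move=> x _; apply: le_trans (le_norm_zsum _) _; apply: le_esZ => k; first by rewrite lee_fin.
  by rewrite -EFinM lee_fin normrM mulrC.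
rewrite integral_esZ//; last first.
  move=> k; apply: measurable_funeM; apply: mabs; apply: measurableT_comp => //; exact: measurable_funB.
have /integrableP[_ iG] := Theta_integrable GL GT sg1.
pose I := fine (\int[mu]_x `|G x|%:E)%E.
have EI : (\int[mu]_x `|G x|%:E = I%:E)%E by rewrite fineK// ge0_fin_numE// integral_ge0.
have I0 : 0 <= I by rewrite -lee_fin -EI integral_ge0.
rewrite (_ : (fun k => _) = (fun k => I%:E * `|c k|%:E)%E); last first.
  apply/funext => k; rewrite ge0_integralZl//; last first.
    by apply: mabs; apply: measurableT_comp => //; exact: measurable_funB.
  have := @ge0_integral_affine R (fun x => `|G x|%:E) 1 (- k%:~R) (oner_neq0 _) (mabs mG).
  rewrite normr1 invr1 mul1e EI muleC => <- //.
  by congr (_ * _)%E; apply: eq_integral => x _; rewrite mul1r.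
by rewrite esZZl// lte_mul_pinfty.
Qed.

Lemma integrable_sumZ D (G_ : 'I_D -> R -> R) (v : 'I_D -> R) : (forall i, integrableR (G_ i)) ->
  integrableR (fun x => \sum_i v i * G_ i x).
Proof.
move=> iG; rewrite /integrableR (_ : EFin \o _ = (fun x => \sum_i (v i)%:E * (EFin \o G_ i) x)%E); last first.
  by apply/funext => x /=; rewrite sumEFin.
by apply: integrable_sum => // i _; apply: integrableZl => //; exact: iG.
Qed.

Lemma integrable_small G e : integrableR G -> 0 < e ->
  exists d : R, 0 < d /\ (\int[mu]_(x in `[(- d)%R, d]) `|G x|%:E <= e%:E)%E.
Proof.
move=> iG e0; have [d [d0 Hd]] := integral_normr_continuous iG e0.
have d4 : 0 < d / 4 by rewrite divr_gt0.
exists (d / 4); split => //; pose A := `[(- (d / 4))%R, (d / 4)%R]%classic : set R.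
have mA : measurable (A : set mR) by exact: measurable_itv.
have : (mu A < d%:E)%E.
  rewrite lebesgue_measure_itv/= lte_fin ifT; last by lra.
  by rewrite -EFinB lte_fin; lra.
move=> /(Hd _ mA) /ltW; rewrite -lee_fin /Rintegral fineK//.
rewrite ge0_fin_numE ?integral_ge0//; have /integrableP[mG] := iG; apply: le_lt_trans.
by apply: ge0_subset_integral => //=; apply: mabs; exact/measurable_EFinP.
Qed.

(** In a finite-dimensional subspace of L^1 no function can concentrate at the origin: its
    coordinates are bounded by its norm, and each of the finitely many [G_ i] has a small integral
    near 0. The [G_ i] may be dependent, so the coordinates are first changed to others that
    represent the same function almost everywhere. *)
Lemma finite_span_concentration D (G_ : 'I_D -> R -> R) : (forall i, integrableR (G_ i)) ->
  exists d : R, 0 < d /\ forall v : 'I_D -> R,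
    (\int[mu]_(x in `[(- d)%R, d]) `|\sum_i v i * G_ i x|%:E <=
     (2^-1)%:E * \int[mu]_x `|\sum_i v i * G_ i x|%:E)%E.
Proof.
move=> iG; pose F (v : 'rV[R]_D) x := \sum_i v 0 i * G_ i x.
have iF v : integrableR (F v) by exact: integrable_sumZ.
have mF v : measurable_fun [set: R] (F v) by have /integrableP[/measurable_EFinP] := iF v.
pose q v := fine (\int[mu]_x `|F v x|%:E)%E.
have qE v : (\int[mu]_x `|F v x|%:E = (q v)%:E)%E.
  by rewrite fineK// ge0_fin_numE ?integral_ge0//; have /integrableP[] := iF v.
have [||C [C0 HC]] := @seminorm_coord_le R D q.
- move=> x y; rewrite -lee_fin EFinD -!qE -ge0_integralD//; try exact: mabs.
  apply: ge0_le_integral => //; try exact: mabs.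
    by apply: emeasurable_funD; exact: mabs.
  move=> z _; rewrite -EFinD lee_fin (_ : F (x + y) z = F x z + F y z) ?ler_normD//.
  by rewrite /F -big_split/=; apply: eq_bigr => i _; rewrite mxE mulrDl.
- move=> r x; apply: EFin_inj; rewrite EFinM -!qE -ge0_integralZl//; last exact: mabs.
  apply: eq_integral => z _; rewrite -EFinM -normrM; congr (`|_|%:E).
  by rewrite /F mulr_sumr; apply: eq_bigr => i _; rewrite mxE mulrA.
pose e := (2 * (D%:R * C + 1))^-1.
have DC : 0 < D%:R * C + 1 by rewrite ltr_wpDl// mulr_ge0.
have e0 : 0 < e by rewrite invr_gt0 mulr_gt0.
have [d [d0 Hd]] : exists d : R, 0 < d /\ forall i, (\int[mu]_(x in `[(- d)%R, d]) `|G_ i x|%:E <= e%:E)%E.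
  have /choice[d Hd] : forall i, exists d : R, 0 < d /\ (\int[mu]_(x in `[(- d)%R, d]) `|G_ i x|%:E <= e%:E)%E.
    by move=> i; exact: integrable_small.
  exists (\big[Num.min/1]_i d i); split; first by apply/bigmin_gtP; split => // i _; case: (Hd i).
  move=> i; apply: le_trans (Hd i).2; apply: ge0_subset_integral => //.
    by apply: mabsD; have /integrableP[/measurable_EFinP] := iG i.
  have h : \big[Num.min/1]_i d i <= d i by exact: bigmin_le_cond.
  by move=> x /=; rewrite !in_itv/= => /andP[h1 h2]; apply/andP; split; lra.
exists d; split => // v; pose v' := \row_i v i.
have Ev : (fun x => \sum_i v i * G_ i x) = F v' by apply/funext => x; apply: eq_bigr => i _; rewrite mxE.
rewrite [X in (_ <= _ * X)%E](_ : _ = (q v')%:E)%E; last by rewrite -qE -Ev.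
have [z [qz Hz]] := HC v'.
have q0 : 0 <= q v' by rewrite -lee_fin -qE integral_ge0.
apply: (@le_trans _ _ (\int[mu]_(x in `[(- d)%R, d]) `|F z x|%:E)%E).
  apply: ae_ge0_le_integral => //.
  - by apply: mabsD; rewrite Ev.
  - exact: mabsD.
  have : (\int[mu]_x `|(F (v' - z) x)%:E| = 0)%E by rewrite /= qE qz.
  move/(ae_eq_integral_abs mu measurableT).
  have mE : measurable_fun [set: R] (EFin \o F (v' - z)) by exact/measurable_EFinP.
  move=> /(_ mE); apply: aeS => x /(_ I)/= [] Fx _.
  rewrite lee_fin (_ : \sum_i _ = F z x)//.
  rewrite (_ : \sum_i _ = F v' x); last by rewrite -Ev.
  apply/eqP; rewrite -subr_eq0 -Fx /F -sumrB; apply/eqP; apply: eq_bigr => i _.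
  by rewrite !mxE mulrBl.
apply: (@le_trans _ _ (\int[mu]_(x in `[(- d)%R, d]) \sum_i (`|z 0 i|%:E * `|G_ i x|%:E))%E).
  apply: ge0_le_integral => //; first exact: mabsD.
    apply: emeasurable_sum => i; apply: measurable_funeM; apply: mabsD.
    by have /integrableP[/measurable_EFinP] := iG i.
  move=> x _; under eq_bigr do rewrite -EFinM -normrM.
  by rewrite sumEFin lee_fin ler_norm_sum.
rewrite ge0_integral_sum//; last first.
  move=> i; apply: measurable_funeM; apply: mabsD; by have /integrableP[/measurable_EFinP] := iG i.
apply: (@le_trans _ _ (\sum_(i < D) (C * q v' * e)%:E)%E).
  apply: lee_sum => i _; rewrite ge0_integralZl//; last first.
    by apply: mabsD; have /integrableP[/measurable_EFinP] := iG i.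
  rewrite EFinM; apply: lee_pmul => //; rewrite ?lee_fin//; exact: integral_ge0.
rewrite sumEFin sumr_const card_ord -[_ *+ D]mulr_natl -EFinM lee_fin.
rewrite (_ : _%:R * _ = (D%:R * C) * e * q v'); last by ring.
rewrite ler_wpM2r// /e invfM mulrCA -[leRHS]mulr1 ler_wpM2l// ler_pdivrMr// mul1r lerDl//.
Qed.

End summation_tools.

(** Both end coefficients have to be nonzero for the recurrence to be solved in both directions. *)
Lemma trim_recurrence (R : realType) N (a : nat -> R) : (exists j, (j <= N)%N && (a j != 0)) ->
  exists (l L : nat) (a2 : nat -> R), [/\ a2 0%N != 0, a2 L != 0 &
    forall (b : int -> R) (n : int),
      \sum_(j < L.+1) a2 j * b (n + j%:Z) = \sum_(i < N.+1) a i * b (n - l%:Z + i%:Z)].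
Proof.
move=> exj; have ubj j : (j <= N)%N && (a j != 0) -> (j <= N)%N by case/andP.
have [l /andP[lN al] lmin] := ex_minnP exj.
have [h /andP[hN ah] hmax] := ex_maxnP exj ubj.
have lh : (l <= h)%N by apply: lmin; rewrite hN.
exists l, (h - l)%N, (fun j => a (l + j)%N); rewrite addn0 subnKC//; split => // b n.
have al0 i : (i < l)%N -> a i = 0.
  move=> il; apply/eqP; apply: contraT => ai.
  have := lmin i; rewrite ai andbT (leq_trans (ltnW il) lN) => /(_ isT).
  by rewrite leqNgt il.
have ah0 i : (h < i <= N)%N -> a i = 0.
  move=> /andP[hi iN]; apply/eqP; apply: contraT => ai.
  by have := hmax i; rewrite ai andbT iN => /(_ isT); rewrite leqNgt hi.
rewrite -(big_mkord xpredT (fun i => a i * b (n - l%:Z + i%:Z))).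
have -> : N.+1 = (l + ((h - l).+1 + (N - h)))%N.
  by move: lh hN; clear; lia.
rewrite big_mkord big_split_ord/= [X in _ = X + _]big1 ?add0r; last first.
  by move=> i _; rewrite al0 ?mul0r.
rewrite big_split_ord/= [X in _ = _ + X]big1 ?addr0; last first.
  move=> i _; rewrite ah0 ?mul0r//; have := ltn_ord i; move: lh hN; clear; lia.
by apply: eq_bigr => i _; congr (_ * b _); clear; lia.
Qed.

Section classification.
Context {R : realType}.
Local Notation mu := (@lebesgue_measure R).
Local Notation mR := (measurableTypeR R).
Variables (pm : option R) (r : nat) (sg : R) (G H : R -> R) (om : nat -> R) (be : nat -> int -> R)
  (Cm : nat -> R) (R0 : R).
Hypotheses (pm_ge1 : if pm is Some p then 1 <= p else true) (r1 : (1 <= r)%N)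
  (GL : LI G) (GT : condition_Theta sg G) (sg1 : 1 < sg) (mH : measurable_fun [set: R] H)
  (om0 : forall m, 0 < om m) (omcv : om n @[n --> \oo] --> 0)
  (HE : forall m, {ae mu, forall x, H x = om m ^+ r * Sop (be m) G (om m * x)})
  (beC : forall m k, `|be m k| <= Cm m)
  (Cmcv : om m ^+ r * (Cm m * om m `^ (- ep pm)) @[m --> \oo] --> 0)
  (bedec : forall m, zdec (be m)) (R00 : 0 < R0)
  (HR : forall K, exists B, 0 <= B /\ bnd pm [set x | R0 <= `|x| /\ `|x| <= K] H B).

Let s1 : 0%:R + 1 < sg. Proof. by rewrite add0r. Qed.
Let I : set R := `[- 2^-1, 2^-1]%classic.
Let mI : measurable (I : set mR). Proof. exact: measurable_itv. Qed.
Let mG : measurable_fun [set: R] G. Proof. by case: GL. Qed.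
Let mGk k : measurable_fun [set: R] (fun u => G (u - k%:~R)).
Proof. by apply: measurableT_comp => //; exact: measurable_funB. Qed.
Let mS c M : (forall k, `|c k| <= M) -> measurable_fun [set: R] (Sop c G).
Proof. by move=> cM; have [] := LI_Sop GL GT s1 (bounded_pgrow cM). Qed.
Let Cm0 m : 0 <= Cm m. Proof. by apply: le_trans (beC m 0). Qed.
Let mband a b : measurable ([set x : R | a <= `|x| /\ `|x| <= b] : set mR).
Proof.
rewrite (_ : [set x : R | _] = (fun x : R => `|x|) @^-1` `[a, b]); last first.
  by apply/seteqP; split => x /=; rewrite in_itv/= => /andP.
by rewrite -[X in measurable X]setTI; exact: (normr_measurable measurableT (measurable_itv _)).
Qed.

(** For [u] in [I] only the translates with index in a fixed window can be singular; the others
    contribute at most their envelope times the bound on the coefficients. *)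
Lemma classification_remainder : exists (N : nat) (E : R), 0 <= E /\
  forall c M, 0 <= M -> (forall k, `|c k| <= M) -> forall u, I u ->
  `|Sop c G u - \sum_(i < N.*2.+1) c (i%:Z - N%:Z) * G (u - (i%:Z - N%:Z)%:~R)| <= M * E.
Proof.
have [N [e [e0 efin He]]] := Theta_env (2^-1) GT s1.
pose E := fine (esZ (fun k => (e k)%:E)).
have EE : (esZ (fun k => (e k)%:E) = E%:E)%E.
  by rewrite fineK// ge0_fin_numE// esZ_ge0// => k; rewrite lee_fin.
have E0 : 0 <= E by rewrite -lee_fin -EE esZ_ge0// => k; rewrite lee_fin.
exists N, E; split => // c M M0 cM u Iu.
pose c1 k := if k \in ints N then c k else 0; pose c2 k := if k \in ints N then 0 else c k.
have b1 k : `|c1 k| <= M by rewrite /c1; case: ifP => // _; rewrite normr0.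
have b2 k : `|c2 k| <= M by rewrite /c2; case: ifP => // _; rewrite normr0.
have -> : Sop c G u = Sop c1 G u + Sop c2 G u.
  rewrite -(SopD u GL GT s1 (bounded_pgrow b1) (bounded_pgrow b2)); apply: eq_zsum => k.
  by rewrite /c1 /c2; case: ifP; rewrite ?addr0 ?add0r.
rewrite (@Sop_fin _ c1 _ _ N) => [|k /negbTE kN]; last by rewrite /c1 kN.
rewrite (eq_bigr (fun i : 'I_N.*2.+1 => c (i%:Z - N%:Z) * G (u - (i%:Z - N%:Z)%:~R))); last first.
  move=> i _; rewrite /c1 ifT// mem_ints; move: (ltn_ord i); clear; lia.
rewrite [X in X - _]addrC addrK -lee_fin; apply: le_trans (le_norm_zsum _) _.
rewrite EFinM -EE -esZZl//.
apply: le_esZ => k; first by rewrite lee_fin.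
rewrite -EFinM lee_fin normrM mulrC /c2; case: ifPn => kN; first by rewrite normr0 mul0r mulr_ge0.
apply: ler_pM => //; have := He u k; rewrite expr0 mulr1; apply => //.
by rewrite ler_norml; move: Iu; rewrite /I/= in_itv.
Qed.

(** The norm of [H] over [|x| <= 1 / (2 om m)] is at most [om m ^+ r * (Cm m * om m ^ (-1/p)) * T]
    with [T] independent of [m]. The bound tends to 0 while the intervals exhaust the line. *)
Lemma classification_bounded N : (forall i : 'I_N.*2.+1, exists B, 0 <= B /\
    bnd pm I (fun u => G (u - (i%:Z - N%:Z)%:~R)) B) ->
  (exists E : R, 0 <= E /\ forall c M, 0 <= M -> (forall k, `|c k| <= M) -> forall u, I u ->
  `|Sop c G u - \sum_(i < N.*2.+1) c (i%:Z - N%:Z) * G (u - (i%:Z - N%:Z)%:~R)| <= M * E) ->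
  {ae mu, forall x, H x = 0}.
Proof.
move=> /choice[B HB] [E [E0 HE']].
pose T := \sum_i B i + E.
have B0 i : 0 <= B i by case: (HB i).
have T0 : 0 <= T by rewrite addr_ge0// sumr_ge0.
have Sb c M : 0 <= M -> (forall k, `|c k| <= M) -> bnd pm I (Sop c G) (M * T).
  move=> M0 cM; rewrite /T mulrDr.
  have mf (s : seq 'I_N.*2.+1) : measurable_fun [set: R]
      (fun u : R => \sum_(i <- s) c (i%:Z - N%:Z) * G (u - (i%:Z - N%:Z)%:~R)).
    by apply: measurable_sum => i; apply: measurable_funM.
  have h (s : seq 'I_N.*2.+1) : bnd pm I (fun u => \sum_(i <- s) c (i%:Z - N%:Z) * G (u - (i%:Z - N%:Z)%:~R))
      (\sum_(i <- s) M * B i).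
    elim: s => [|i s IH].
      rewrite big_nil; under eq_fun do rewrite big_nil.
      have := @bnd_unif _ pm pm_ge1 I (fun=> 0) 2^-1 0; rewrite mul0r; apply => //.
      by move=> x; rewrite /I/= in_itv/= normr0 ler_norml.
    rewrite big_cons; under eq_fun do rewrite big_cons.
    apply: bndD => //.
    - exact: measurable_funM.
    - exact: mulr_ge0.
    - by apply: sumr_ge0 => j _; exact: mulr_ge0.
    have [_ Bi] := HB i.
    by have := bndZ pm_ge1 (c (i%:Z - N%:Z)) mI (mGk _) (B0 i) Bi; apply: bnd_le => //; rewrite ?mulr_ge0// ler_wpM2r.
  have e1 : Sop c G = (fun u => \sum_(i < N.*2.+1) c (i%:Z - N%:Z) * G (u - (i%:Z - N%:Z)%:~R) +
      (Sop c G u - \sum_(i < N.*2.+1) c (i%:Z - N%:Z) * G (u - (i%:Z - N%:Z)%:~R))).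
    by apply/funext => u; rewrite addrC subrK.
  have mD : measurable_fun [set: R] (fun u : R => Sop c G u - \sum_(i < N.*2.+1) c (i%:Z - N%:Z) * G (u - (i%:Z - N%:Z)%:~R)).
    by apply: measurable_funB => //; exact: mS cM.
  rewrite e1; apply: bndD => //; rewrite ?mulr_sumr//.
  - by apply: sumr_ge0 => j _; exact: mulr_ge0.
  - exact: mulr_ge0.
  have := @bnd_unif _ pm pm_ge1 I _ 2^-1 (M * E) _ _ mI mD; rewrite mulfV// powR1 mulr1; apply => //.
    exact: mulr_ge0.
  move=> x Ix; split; last exact: HE'.
  by move: Ix; rewrite /I/= in_itv/= ler_norml.
have Hb m : bnd pm [set x | I (om m * x + 0)] H (om m ^+ r * (Cm m * om m `^ (- ep pm)) * T).
  have h1 := bnd_affine pm_ge1 0 (om0 m) mI (mS (beC m)) (mulr_ge0 (Cm0 m) T0) (Sb _ _ (Cm0 m) (beC m)).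
  have mA : measurable ([set x | I (om m * x + 0)] : set mR).
    rewrite -[X in measurable X]setTI; apply: measurable_affine => //.
  have mS' : measurable_fun [set: R] (fun x => Sop (be m) G (om m * x + 0)).
    by apply: measurableT_comp; [exact: mS (beC m)|exact: measurable_affine].
  have h2 := bndZ pm_ge1 (om m ^+ r) mA mS' (mulr_ge0 (mulr_ge0 (Cm0 m) T0) (powR_ge0 _ _)) h1.
  rewrite (_ : _ * T = `|om m ^+ r| * (Cm m * T * om m `^ (- ep pm))); last first.
    by rewrite ger0_norm ?exprn_ge0 ?ltW//; ring.
  apply: (bnd_dom pm_ge1 mA mA mH _ _ _ h2) => //; first exact: measurable_funM.
  by apply: aeS (HE m) => x -> _; rewrite addr0.
have Hall (K : nat) : {ae mu, forall x, (`|x| <= K%:R) -> H x = 0}.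
  have mK : measurable ([set x : R | `|x| <= K%:R] : set mR).
    rewrite (_ : [set x : R | _] = [set x : R | 0 <= `|x| /\ `|x| <= K%:R])//.
    by apply/seteqP; split => x /=; [move=> ?; split|case].
  apply: (bnd_all0 pm_ge1 mK mH) => e e0.
  have c1 : \forall m \near \oo, om m * K%:R <= 2^-1.
    have cv : om m * K%:R @[m --> \oo] --> (0 * K%:R : R) by apply: cvgMl.
    have h2 : 0 < 2^-1 :> R by rewrite invr_gt0.
    rewrite mul0r in cv; move/cvgrPdist_le : cv => /(_ _ h2).
    by apply: filterS => m; rewrite sub0r normrN => /(le_trans (ler_norm _)).
  have c2 : \forall m \near \oo, om m ^+ r * (Cm m * om m `^ (- ep pm)) * T <= e.
    have cv : om m ^+ r * (Cm m * om m `^ (- ep pm)) * T @[m --> \oo] --> (0 * T : R) by apply: cvgMl.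
    rewrite mul0r in cv; move/cvgrPdist_le : cv => /(_ e e0).
    by apply: filterS => m; rewrite sub0r normrN => /(le_trans (ler_norm _)).
  near \oo => m.
  have m1 : om m * K%:R <= 2^-1 by near: m.
  have m2 : om m ^+ r * (Cm m * om m `^ (- ep pm)) * T <= e by near: m.
  have T1 : 0 <= om m ^+ r * (Cm m * om m `^ (- ep pm)) * T.
    by rewrite !mulr_ge0 ?exprn_ge0 ?powR_ge0 ?(ltW (om0 m)).
  apply: (bnd_le pm_ge1 T1 m2); apply: (bnd_sub pm_ge1 _ _ _ _ (Hb m)) => //.
    rewrite -[X in measurable X]setTI; apply: measurable_affine => //.
  move=> x /= xK; rewrite addr0 /I/= in_itv/= -ler_norml normrM gtr0_norm//.
  by apply: le_trans m1; rewrite ler_wpM2l// ltW.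
have := ae_foralln Hall; apply: aeS => x hx.
by apply: (hx (Num.truncn `|x|).+1); apply/ltW/truncnS_gt.
Unshelve. all: by end_near. Qed.

(* If some combination of the translates of [G] fails to be p-integrable at the origin, the
   p-integrability of [H] at the nodes [n / om m], [n <> 0], forces a linear recurrence on
   [be m]; the decaying solutions form a finite-dimensional subspace of l^1, so that the
   dilates [H (. / om m)] stay in a finite-dimensional subspace of L^1, although they
   concentrate at the origin. *)
Lemma classification : {ae mu, forall x, H x = 0}.
Proof.
have [N [E [E0 HE']]] := classification_remainder.
pose F (v : 'rV[R]_N.*2.+1) u := \sum_i v 0 i * G (u - (i%:Z - N%:Z)%:~R).
have mF v : measurable_fun [set: R] (F v).
  by apply: measurable_sum => i; apply: measurable_funM.
pose P v := exists B, 0 <= B /\ bnd pm I (F v) B.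
have [allP|/existsNP exN] := pselect (forall v, P v).
  apply: (@classification_bounded N); last by exists E.
  move=> i; have [B [B0 HB]] := allP (delta_mx 0 i); exists B; split => //.
  rewrite (_ : (fun u => _) = F (delta_mx 0 i))//; apply/funext => u.
  rewrite /F (bigD1 i)//= mxE !eqxx mul1r big1 ?addr0// => j ji.
  by rewrite mxE (negbTE ji) andbF mul0r.
have [|||a [a0 Ha]] := @subspace_annihilator R _ P _ _ _ exN.
- exists 0; split => //; have := @bnd_unif _ pm pm_ge1 I (F 0) 2^-1 0; rewrite mul0r; apply => //.
  move=> x; rewrite /I/= in_itv/= -ler_norml => xI; split => //.
  by rewrite /F big1 ?normr0// => i _; rewrite mxE mul0r.
- move=> u v [B1 [B10 h1]] [B2 [B20 h2]]; exists (B1 + B2); split; first exact: addr_ge0.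
  rewrite (_ : F (u + v) = (fun x => F u x + F v x)); first exact: bndD.
  by apply/funext => x; rewrite /F -big_split/=; apply: eq_bigr => i _; rewrite mxE mulrDl.
- move=> t u [B1 [B10 h1]]; exists (`|t| * B1); split; first exact: mulr_ge0.
  rewrite (_ : F (t *: u) = (fun x => t * F u x)); first exact: bndZ.
  by apply/funext => x; rewrite /F mulr_sumr; apply: eq_bigr => i _; rewrite mxE mulrA.
(* For [|x| <= 1/2] and [n != 0] the point [(x + n) / om m] has absolute value at least
   [1 / (2 om m) >= R0], so [HR] applies around every nonzero node. The local combination of
   translates is then p-integrable, and [a] annihilates its coefficients. *)
have rec m (n : int) : om m * R0 <= 2^-1 -> n != 0 ->
    \sum_(i < N.*2.+1) a i 0 * be m (n + (i%:Z - N%:Z)) = 0.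
  move=> omR n0; pose v : 'rV[R]_N.*2.+1 := \row_i be m (n + (i%:Z - N%:Z)).
  have : P v.
    have nR : 1 <= `|n%:~R| :> R by rewrite -intr_norm ler1z; lia.
    have [B [B0 HB]] := HR ((om m)^-1 * (`|n%:~R| + 2^-1)).
    have oV : 0 < (om m)^-1 by rewrite invr_gt0.
    have mA := mband R0 ((om m)^-1 * (`|n%:~R| + 2^-1)).
    have h1 := bnd_affine pm_ge1 ((om m)^-1 * n%:~R) oV mA mH B0 HB.
    have b1 k : `|be m (k + n)| <= Cm m by [].
    have mSn : measurable_fun [set: R] (Sop (fun k => be m (k + n)) G) := mS b1.
    have h2 : bnd pm I (Sop (fun k => be m (k + n)) G) ((om m ^+ r)^-1 * (B * (om m)^-1 `^ (- ep pm))).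
      have mHa : measurable_fun [set: R] (fun x => H ((om m)^-1 * x + (om m)^-1 * n%:~R)).
        by apply: measurableT_comp => //; exact: measurable_affine.
      have mB : measurable ([set x | R0 <= `|(om m)^-1 * x + (om m)^-1 * n%:~R| /\
           `|(om m)^-1 * x + (om m)^-1 * n%:~R| <= (om m)^-1 * (`|n%:~R| + 2^-1)] : set mR).
        rewrite -[X in measurable X]setTI.
        exact: (measurable_affine (om m)^-1 ((om m)^-1 * n%:~R) measurableT mA).
      have := bndZ pm_ge1 (om m ^+ r)^-1 mB mHa (mulr_ge0 B0 (powR_ge0 _ _)) h1.
      have ov : 0 <= om m ^- r by rewrite invr_ge0 exprn_ge0// (ltW (om0 m)).
      rewrite (ger0_norm ov); apply: (bnd_dom pm_ge1) => //.
      - exact: measurable_funM.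
      - move=> x; rewrite /I/= in_itv/= -ler_norml => xI.
        rewrite -mulrDr normrM gtr0_norm// ler_pM2l//; split; last first.
          by rewrite (le_trans (ler_normD _ _))// addrC lerD2l.
        rewrite ler_pdivlMl//; apply: le_trans omR _.
        have := ler_normB (x + n%:~R) x; rewrite addrAC subrr add0r; lra.
      have := ae_affine ((om m)^-1 * n%:~R) (lt0r_neq0 oV) (HE m).
      apply: aeS => x -> _; rewrite mulKf ?expf_neq0 ?gt_eqF//.
      rewrite -(Sop_translate x n GL GT s1 (bounded_pgrow (beC m))) mulrDr !mulVKf ?gt_eqF//.
    exists ((om m ^+ r)^-1 * (B * (om m)^-1 `^ (- ep pm)) + Cm m * E); split.
      by rewrite addr_ge0 ?mulr_ge0 ?invr_ge0 ?exprn_ge0 ?powR_ge0 ?(ltW (om0 m)).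
    have Fv : F v = (fun u => Sop (fun k => be m (k + n)) G u -
        (Sop (fun k => be m (k + n)) G u - F v u)) by apply/funext => u; rewrite subKr.
    rewrite Fv; apply: bndB => //.
    - exact: measurable_funB.
    - by rewrite ?mulr_ge0 ?invr_ge0 ?exprn_ge0 ?powR_ge0 ?(ltW (om0 m)).
    - exact: mulr_ge0.
    have mD : measurable_fun [set: R] (fun u => Sop (fun k => be m (k + n)) G u - F v u) by exact: measurable_funB.
    have := @bnd_unif _ pm pm_ge1 I _ 2^-1 (Cm m * E) _ _ mI mD; rewrite mulfV// powR1 mulr1; apply => //.
      exact: mulr_ge0.
    move=> x Ix; split; first by move: Ix; rewrite /I/= in_itv/= ler_norml.
    have := HE' _ _ (Cm0 m) b1 x Ix; rewrite /F; congr (`|_ - _| <= _).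
    by apply: eq_bigr => i _; rewrite mxE addrC.
  move=> /Ha /matrixP/(_ 0 0); rewrite !mxE => h; rewrite -[RHS]h.
  by apply: eq_bigr => i _; rewrite mxE mulrC.
pose a' (j : nat) := a (inord j) 0.
have exj : exists j, (j <= N.*2)%N && (a' j != 0).
  have [i ai] : exists i, a i 0 != 0.
    apply: contrapT => /forallNP h; move/eqP : a0; apply; apply/matrixP => i j.
    by rewrite ord1 mxE; apply/eqP/negPn/negP/h.
  by exists i; rewrite /a' inord_val ai andbT -ltnS.
have [l [L [a2 [a20 a2L Ha2]]]] := trim_recurrence exj.
(* The window starts at [- N] and trimming shifts the index by [l], so the relation missing at the
   node 0 is now the one at [l - N]. *)
have rec2 m (n : int) : om m * R0 <= 2^-1 -> n != l%:Z - N%:Z ->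
    \sum_(j < L.+1) a2 j * be m (n + j%:Z) = 0.
  move=> omR nl; have nl0 : n - l%:Z + N%:Z != 0 by move: nl; clear; lia.
  rewrite Ha2 -[RHS](rec m _ omR nl0); apply: eq_bigr => i _.
  by rewrite /a' inord_val; congr (_ * be m _); clear; lia.
have [D [e [se He]]] := recurrence_span (l%:Z - N%:Z) a20 a2L.
have iG i : integrableR (Sop (e i) G) by exact: (Sop_integrable GL GT sg1 (se i)).
have [d [d0 Hd]] := finite_span_concentration iG.
have mH1 : measurable_fun [set: R] (fun x => `|H x|%:E) by exact: mabs.
have [m0 Hm0] : exists m0, forall m, (m0 <= m)%N -> om m * R0 <= 2^-1.
  have cv : om m * R0 @[m --> \oo] --> (0 * R0 : R) by apply: cvgMl.
  have h2 : 0 < 2^-1 :> R by rewrite invr_gt0.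
  rewrite mul0r in cv; move/cvgrPdist_le : cv => /(_ _ h2) [m0 _ Hm].
  by exists m0 => m /Hm /=; rewrite sub0r normrN => /(le_trans (ler_norm _)).
have HX m : (m0 <= m)%N -> exists c : 'I_D -> R, {ae mu, forall x, H x = om m ^+ r * \sum_i c i * Sop (e i) G (om m * x)}.
  move=> mm; have [c Hc] := He (be m) (bedec m) (fun n => rec2 m n (Hm0 m mm)).
  exists c; apply: aeS (HE m) => x ->; congr (_ * _).
  rewrite {1}/Sop (eq_zsum (b := fun k => \sum_i c i * (G (om m * x - k%:~R) * e i k))); last first.
    by move=> k; rewrite Hc mulr_sumr; apply: eq_bigr => i _; rewrite mulrCA.
  have sm i : summZ (fun k => G (om m * x - k%:~R) * e i k).
    have [M [M0 eM]] := summZ_bounded (se i).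
    exact: Sop_summ GL GT s1 (bounded_pgrow eM).
  rewrite zsum_sum; last by move=> i; exact: summZZ.
  by apply: eq_bigr => i _; rewrite zsumZ.
(* In the variable [om m * x] the function [H] lies in a fixed finite-dimensional span, no element
   of which has more than half of its mass on [[-d, d]]. *)
have half m (c : 'I_D -> R) : {ae mu, forall x, H x = om m ^+ r * \sum_i c i * Sop (e i) G (om m * x)} ->
    (\int[mu]_x `|H x|%:E < +oo)%E /\
    (\int[mu]_(x in [set x : R | `[(- d)%R, d]%classic (om m * x + 0)%R]) `|H x|%:E <= (2^-1)%:E * \int[mu]_x `|H x|%:E)%E.
  move=> Hc; pose X u := \sum_i c i * Sop (e i) G u.
  have iX : integrableR X by exact: integrable_sumZ.
  have mX : measurable_fun [set: R] X by have /integrableP[/measurable_EFinP] := iX.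
  have key (A : set R) : measurable (A : set mR) ->
     (\int[mu]_(x in [set x | A (om m * x + 0)%R]) `|H x|%:E = (om m ^+ r)%:E * ((`|om m|^-1)%:E * \int[mu]_(x in A) `|X x|%:E))%E.
    move=> mA; rewrite -(@ge0_integral_affine_in _ (fun x => `|X x|%:E) (om m) 0 A)//; last 2 first.
    - by rewrite gt_eqF.
    - exact: mabsD.
    have mA' : measurable ([set x | A (om m * x + 0)] : set mR).
      by rewrite -[X in measurable X]setTI; exact: (measurable_affine (om m) 0 measurableT mA).
    have mX' : measurable_fun [set: R] (fun x => X (om m * x + 0)).
      by apply: measurableT_comp => //; exact: measurable_affine.
    rewrite -ge0_integralZl//; last 2 first.
    - exact: mabsD.
    - by rewrite lee_fin exprn_ge0// ltW.
    apply: ae_eq_integral => //.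
    - exact: mabsD.
    - by apply: measurable_funeM; exact: mabsD.
    by apply: aeS Hc => x -> _; rewrite addr0 normrM ger0_norm ?exprn_ge0 ?ltW// EFinM.
  have := key setT measurableT; rewrite (_ : [set x | _] = setT)// => kT; split.
    rewrite kT; apply: lte_mul_pinfty; rewrite ?lee_fin ?exprn_ge0 ?ltW//.
    apply: lte_mul_pinfty; rewrite ?lee_fin ?invr_ge0//.
    by have /integrableP[] := iX.
  rewrite (key _ (measurable_itv _)) kT [leRHS]muleCA lee_wpmul2l ?lee_fin ?exprn_ge0 ?(ltW (om0 m))//.
  by rewrite [leRHS]muleCA lee_wpmul2l ?lee_fin ?invr_ge0// Hd.
pose IH := fine (\int[mu]_x `|H x|%:E)%E.
have EH : (\int[mu]_x `|H x|%:E = IH%:E)%E.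
  have [c Hc] := HX m0 (leqnn _); have [h1 _] := half m0 c Hc.
  by rewrite fineK// ge0_fin_numE// integral_ge0.
have IH0 : 0 <= IH by rewrite -lee_fin -EH integral_ge0.
(* The sets [om m |x| <= d] exhaust the line as [om m -> 0], so the finite integral of [|H|] is at
   most half of itself. *)
have le2 : (IH%:E <= (2^-1 * IH)%:E)%E.
  have cvI := @ge0_nondecreasing_set_cvg_integral _ mR R (fun n : nat => `[(- n%:R : R), n%:R]%classic) (fun x => `|H x|%:E) mu.
  have EU : \bigcup_i `[(- i%:R : R), i%:R]%classic = [set: R].
    apply/seteqP; split => x //= _; exists (Num.truncn `|x|).+1 => //=.
    by rewrite in_itv/= -ler_norml; apply/ltW/truncnS_gt.
  have nd : {homo (fun n : nat => `[(- n%:R : R), n%:R]%classic) : n m / (n <= m)%N >-> (n <= m)%O}.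
    move=> i j ij; apply/subsetPset => x /=; rewrite !in_itv/= -!ler_norml => /le_trans; apply.
    by rewrite ler_nat.
  have h0 (i : nat) (x : mR) : `[(- i%:R : R), i%:R]%classic x -> (0 <= `|H x|%:E)%E by rewrite lee_fin.
  have {}cvI := cvI nd (fun i => measurable_itv _) (fun i => mabsD mH) h0.
  rewrite EU in cvI; rewrite -EH -(cvg_lim _ cvI)//; apply: lime_le; first exact: cvgP cvI.
  near=> n.
  have [m [mm mn]] : exists m, (m0 <= m)%N /\ om m * n%:R <= d.
    have cv : om m * n%:R @[m --> \oo] --> (0 * n%:R : R) by apply: cvgMl.
    rewrite mul0r in cv; move/cvgrPdist_le : cv => /(_ _ d0) cv.
    near \oo => m; exists m; split; first by near: m; exact: nbhs_infty_ge.
    have mle : `|0 - om m * n%:R| <= d by near: m; exact: cv.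
    by apply: le_trans mle; rewrite sub0r normrN; exact: ler_norm.
  have [c Hc] := HX m mm; have [_] := half m c Hc; rewrite EH -EFinM; apply: le_trans.
  apply: ge0_subset_integral => //.
  - rewrite -[X in measurable X]setTI; apply: (measurable_affine (om m) 0 measurableT); exact: measurable_itv.
  - exact: mabsD.
  move=> x /=; rewrite !in_itv/= -!ler_norml addr0 normrM gtr0_norm// => xn.
  by apply: le_trans mn; rewrite ler_wpM2l// ltW.
have IH00 : IH = 0 by apply/le_anti; rewrite IH0 andbT; move: le2; rewrite lee_fin; lra.
have : (\int[mu]_x `|(H x)%:E| = 0)%E by rewrite -[RHS]/(0%:E) -IH00 -EH.
have mHE : measurable_fun [set: R] (EFin \o H) by exact/measurable_EFinP.
move/(ae_eq_integral_abs mu measurableT mHE); apply: aeS => x /(_ Logic.I) [] //.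
Unshelve. all: by end_near. Qed.

End classification.

(** * Rescaling at almost extremal scales *)

Section core.
Context {R : realType}.
Local Notation mu := (@lebesgue_measure R).
Local Notation mR := (measurableTypeR R).

Lemma filter_ex2 (T : Type) (F : set_system T) (P Q : set T) : ProperFilter F ->
  F P -> F Q -> exists x, P x /\ Q x.
Proof. by move=> PF FP FQ; have [x []] := filter_ex (filterI FP FQ); exists x. Qed.

Lemma ultraFilter_fmap (T T' : Type) (F : set_system T) (h : T -> T') :
  UltraFilter F -> UltraFilter (fmap h F).
Proof.
move=> UF; split=> [|G' GP FG]; first exact: fmap_proper_filter.
apply/seteqP; split => A; last exact: FG.
move=> GA; have [//|FA] := in_ultra_setVsetC (h @^-1` A) UF.
have GnA : G' (~` A) by exact: FG.
by have [x []] := filter_ex2 GP GA GnA.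
Qed.

Lemma measurable_Dn n s (f : R -> R) : measurable_fun [set: R] f -> measurable_fun [set: R] (Dn n s f).
Proof.
elim: n f => // n IH f mf; rewrite DnSr; apply: IH; apply: measurable_funB => //.
by apply: measurableT_comp => //; exact: measurable_funD.
Qed.

(** Take a set of indices of maximal size on which [|x| > e]; beyond it no further index can
    qualify. *)
Lemma count_decay (x : int -> R) (e : R) (n : nat) :
  (forall s : seq int, uniq s -> (forall k, k \in s -> e < `|x k|) -> (size s <= n)%N) ->
  exists N : nat, forall k : int, (N <= `|k|)%N -> `|x k| <= e.
Proof.
move=> Hn; pose q j := `[< exists s : seq int, [/\ uniq s, forall k, k \in s -> e < `|x k| & size s = j] >].
have q0 : exists j, q j by exists 0%N; apply/asboolP; exists [::].
have qn j : q j -> (j <= n)%N by move=> /asboolP[s [us sx <-]]; exact: Hn.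
have [j /asboolP[s [us sx sj]] jmax] := ex_maxnP q0 qn.
exists (\max_(k <- s) `|k|).+1 => k kN; rewrite leNgt; apply/negP => xk.
have ks : k \notin s.
  apply/negP => ks; move: kN; rewrite ltnNge => /negP; apply.
  exact: (@leq_bigmax_seq _ s xpredT (fun k : int => `|k|%N)).
have : q j.+1.
  apply/asboolP; exists (k :: s); split; rewrite /= ?ks ?sj// => i; rewrite inE => /orP[/eqP ->//|].
  exact: sx.
by move=> /jmax; rewrite ltnn.
Qed.

(** A uniform bound on the number of large terms passes to the limit along an ultrafilter even
    though their positions are not controlled, and it still forces decay. *)
Lemma count_zdec (x : int -> R) : (forall e : R, 0 < e -> exists n : nat,
    forall s : seq int, uniq s -> (forall k, k \in s -> e < `|x k|) -> (size s <= n)%N) -> zdec x.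
Proof.
move=> H; have key e : 0 < e -> exists N : nat, forall k : int, (N <= `|k|)%N -> `|x k| <= e.
  by move=> /H[n]; exact: count_decay.
split; apply/cvgrPdist_le => e /key[N HN]; near=> n; rewrite sub0r normrN; apply: HN.
  rewrite absz_nat; near: n; exact: nbhs_infty_ge.
rewrite abszN absz_nat; near: n; exact: nbhs_infty_ge.
Unshelve. all: by end_near. Qed.

(** [f_ i] is the function rescaled at the i-th extremal scale and normalised, [b i m] its
    differenced coefficients at frequency [om m]. [H1] is the asymptotic representation, [H2] and
    [H3] bound the size of the coefficients and the number of large ones, and [H4] with [CWcv] makes
    the differences small away from the origin. *)
Variables (pm : option R) (r' : nat) (sg : R) (G : R -> R) (om : nat -> R)
  (f_ : nat -> R -> R) (b : nat -> nat -> int -> R) (Cm : nat -> R) (C0 W1 : R) (CW : R -> R).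
Local Notation r := r'.+1.
Local Notation far c := [set x : R | c <= `|x|].
Hypotheses (pm_ge1 : if pm is Some p then 1 <= p else true)
  (GL : LI G) (GT : condition_Theta sg G) (sg1 : 1 < sg)
  (om0 : forall m, 0 < om m) (omcv : om n @[n --> \oo] --> 0)
  (mf : forall i, measurable_fun [set: R] (f_ i))
  (H1 : forall m e, 0 < e -> \forall i \near \oo, forall s, 0 <= s <= 1 ->
     bnd pm setT (fun x => Dn r s (f_ i) x - Sop (b i m) (Irn r (om m * s) G) (om m * x)) e)
  (H2 : forall m, \forall i \near \oo, forall k, `|b i m k| <= Cm m)
  (Cmcv : om m ^+ r * (Cm m * om m `^ (- ep pm)) @[m --> \oo] --> 0)
  (H3 : forall m e, 0 < e -> exists n : nat, \forall i \near \oo, forall s : seq int, uniq s ->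
     (forall k, k \in s -> e < `|b i m k|) -> (size s <= n)%N)
  (C00 : 0 < C0) (W10 : 0 < W1) (CW0 : forall W, 0 < W -> 0 <= CW W)
  (H4 : forall W e, 0 < W <= W1 -> 0 < e -> \forall i \near \oo, forall s, 0 < s <= 1 ->
     bnd pm (far (C0 / W)) (Dn r s (f_ i)) (CW W * s ^+ r + e))
  (CWcv : forall e, 0 < e -> exists2 W, 0 < W <= W1 & CW W <= e).

Let s1 : 0%:R + 1 < sg. Proof. by rewrite add0r. Qed.

Let mfar c : measurable (far c : set mR).
Proof.
rewrite (_ : far c = (fun x : R => `|x|) @^-1` `[c, +oo[); last first.
  by apply/seteqP; split => x /=; rewrite in_itv/= andbT.
by rewrite -[X in measurable X]setTI; exact: (normr_measurable measurableT (measurable_itv _)).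
Qed.

Let mitv K : measurable (`[- K, K]%classic : set mR). Proof. exact: measurable_itv. Qed.

Let Cm0 m : 0 <= Cm m.
Proof. by near \oo => i; apply: (@le_trans _ _ `|b i m 0|) => //; near: i; apply: filterS (H2 m) => i; apply.
Unshelve. all: by end_near. Qed.

Section ultralimit.
Variable U : set_system nat.
Context {UU : UltraFilter U}.
Hypothesis UI : \oo `<=` U.

(** By compactness of [[-Cm, Cm]] one ultrafilter provides all the limits at once, without a
    diagonal extraction. *)
Lemma ultra_coef : exists be : nat -> int -> R, forall m k,
  `|be m k| <= Cm m /\ b i m k @[i --> U] --> be m k.
Proof.
suff /choice[be Hbe] : forall mk : nat * int, exists y : R, `|y| <= Cm mk.1 /\ b i mk.1 mk.2 @[i --> U] --> y.
  by exists (fun m k => be (m, k)) => m k; exact: (Hbe (m, k)).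
move=> [m k] /=; have := @segment_compact R (- Cm m) (Cm m); rewrite compact_ultra => cpt.
have UB : U [set i | `[- Cm m, Cm m]%classic (b i m k)].
  by apply: UI; apply: filterS (H2 m) => i /(_ k); rewrite ler_norml /= in_itv.
have [y [yC cv]] := cpt (b i m k @[i --> U]) (ultraFilter_fmap (fun i => b i m k) UU) UB.
by exists y; split => //; rewrite ler_norml; move: yC; rewrite /= in_itv.
Qed.

Variable be : nat -> int -> R.
Hypothesis Hbe : forall m k, `|be m k| <= Cm m /\ b i m k @[i --> U] --> be m k.

Let beC m k : `|be m k| <= Cm m. Proof. by case: (Hbe m k). Qed.
Let becv m k : b i m k @[i --> U] --> be m k. Proof. by case: (Hbe m k). Qed.

Definition Hlim m x := om m ^+ r * Sop (be m) G (om m * x).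

Lemma zdec_be m : zdec (be m).
Proof.
apply: count_zdec => e e0; have [n /UI Hn] := H3 m e0; exists n => s us sx.
have h : \forall i \near U, forall k, k \in s -> k \in s -> e < `|b i m k|.
  apply: near_big_seq => k; have [ks|ks] := boolP (k \in s); last by near=> i.
  have /cvg_norm c := @becv m k.
  by apply: filterS (cvgr_gt _ c _ (sx k ks)).
near U => i; have hi : forall k, k \in s -> k \in s -> e < `|b i m k| by near: i.
have : forall s : seq int, uniq s -> (forall k, k \in s -> e < `|b i m k|) -> (size s <= n)%N by near: i; exact: Hn.
by apply => // k ks; exact: hi.
Unshelve. all: by end_near. Qed.

Let LI_S m : LI (Sop (be m) G).
Proof. exact: LI_Sop GL GT s1 (bounded_pgrow (beC m)). Qed.

Lemma LI_Hlim m : LI (Hlim m).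
Proof.
apply: LIZ; rewrite (_ : (fun x => _) = (fun x => Sop (be m) G (om m * x + 0))).
  by apply: LI_affine => //; rewrite gt_eqF.
by apply/funext => x; rewrite addr0.
Qed.

Lemma Irn_Hlim m s x : 0 <= s -> Irn r s (Hlim m) x = Sop (be m) (Irn r (om m * s) G) (om m * x).
Proof.
move=> s0; have oms : 0 <= om m * s by rewrite mulr_ge0// ltW.
have LA : LI (fun x => Sop (be m) G (om m * x + 0)) by apply: LI_affine => //; rewrite gt_eqF.
rewrite /Hlim (_ : (fun x => _) = (fun x => om m ^+ r * Sop (be m) G (om m * x + 0))); last first.
  by apply/funext => y; rewrite addr0.
rewrite IrnZ// Irn_scale// mulVKf ?expf_neq0 ?gt_eqF// addr0.
exact: Irn_Sop oms GL GT s1 (bounded_pgrow (beC m)).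
Qed.

(** The limit is uniform in [s] because the envelope of [Irn_env] serves all steps up to [om m]; the
    convergence of the coefficients is only termwise. Half of [e] is spent on the representation
    error. *)
Lemma Dn_limit m K e : 0 < K -> 0 < e -> \forall i \near U, forall s, 0 <= s <= 1 ->
  bnd pm `[- K, K] (fun x => Dn r s (f_ i) x - Irn r s (Hlim m) x) e.
Proof.
move=> K0 e0; pose cK := (2 * K) `^ ep pm.
have cK0 : 0 < cK by rewrite powR_gt0// mulr_gt0.
have [env [env0 envfin Henv]] := Irn_env r' GL GT sg1 (om m * K) (ltW (om0 m)).
pose d := e / 2 / cK; have d0 : 0 < d by rewrite !divr_gt0.
have e2 : 0 < e / 2 by rewrite divr_gt0.
have := UI (H1 m e2); have := UI (H2 m).
move=> h2 h1; near=> i => s /andP[s0 sl].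
have h2i : forall k, `|b i m k| <= Cm m by near: i; exact: h2.
have h1i : forall s, 0 <= s <= 1 ->
     bnd pm setT (fun x => Dn r s (f_ i) x - Sop (b i m) (Irn r (om m * s) G) (om m * x)) (e / 2).
  by near: i; exact: h1.
have ci : (esZ (fun k => (env k * `|b i m k - be m k|)%:E) <= d%:E)%E.
  near: i; exact: (dominated_esZ env0 envfin d0 (Cm0 m) h2 (beC m) (fun k => @becv m k)).
have oms : 0 <= om m * s <= om m by rewrite mulr_ge0 ?(ltW (om0 m))//= ler_piMr// ltW.
have oms0 : 0 <= om m * s by case/andP: oms.
have GT' : condition_Theta sg (Irn r (om m * s) G).
  by apply: Theta_Irn => //; rewrite (le_trans _ (ltW sg1)).
have GL' : LI (Irn r (om m * s) G) by exact: LI_Irn.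
have mSb c M : (forall k, `|c k| <= M) -> measurable_fun [set: R] (fun x => Sop c (Irn r (om m * s) G) (om m * x)).
  move=> cM; have [mS _] := LI_Sop GL' GT' s1 (bounded_pgrow cM).
  by apply: measurableT_comp => //; exact: measurable_funM.
have mD := measurable_Dn r s (mf i).
have m1 : measurable_fun [set: R] (fun x => Dn r s (f_ i) x - Sop (b i m) (Irn r (om m * s) G) (om m * x)).
  by apply: measurable_funB => //; exact: mSb h2i.
have m2 : measurable_fun [set: R] (fun x => Sop (b i m) (Irn r (om m * s) G) (om m * x)
      - Sop (be m) (Irn r (om m * s) G) (om m * x)).
  by apply: measurable_funB; [exact: mSb h2i|exact: mSb (beC m)].
rewrite (_ : (fun x => _) = (fun x => (Dn r s (f_ i) x - Sop (b i m) (Irn r (om m * s) G) (om m * x)) +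
    (Sop (b i m) (Irn r (om m * s) G) (om m * x) - Sop (be m) (Irn r (om m * s) G) (om m * x)))); last first.
  by apply/funext => x; rewrite Irn_Hlim// addrA subrK.
rewrite [X in bnd _ _ _ X](splitr e); apply: bndD => //; try exact: ltW.
  apply: (bnd_sub pm_ge1 (mitv K) measurableT m1 _ (h1i s _)) => //; exact/andP.
have -> : e / 2 = d * cK by rewrite /d divfK// gt_eqF.
apply: bnd_unif => //; try exact: ltW.
move=> x; rewrite /= in_itv/= -ler_norml => xK; split => //.
have b1 := bounded_pgrow h2i; have b2 := bounded_pgrow (beC m).
have -> : Sop (b i m) (Irn r (om m * s) G) (om m * x) - Sop (be m) (Irn r (om m * s) G) (om m * x) =
    Sop (fun k => b i m k + (-1) * be m k) (Irn r (om m * s) G) (om m * x).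
  by rewrite (SopD _ GL' GT' s1 b1 (pgrowZ (-1) b2)) (SopZ (-1) _ GL' GT' s1 b2) mulN1r.
rewrite -lee_fin; apply: le_trans ci; apply: le_trans (le_norm_zsum _) _.
apply: le_esZ => k; first by rewrite lee_fin.
rewrite lee_fin normrM mulN1r ler_wpM2r//; apply: Henv => //.
by rewrite normrM gtr0_norm// ler_pM2l.
Unshelve. all: by end_near. Qed.

(** For every step in [[0, 1]] the r-fold integrals of both functions are limits of the same
    differences of [f_ i], hence agree almost everywhere; differentiation along the steps
    [1 / (n + 1)] removes the integrals. *)
Lemma Hlim_indep m : {ae mu, forall x, Hlim 0 x = Hlim m x}.
Proof.
have mI s : measurable_fun [set: R] (fun x => Irn r s (Hlim 0) x - Irn r s (Hlim m) x).
  by apply: measurable_funB; [have [] := LI_Irn r s (LI_Hlim 0)|have [] := LI_Irn r s (LI_Hlim m)].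
have h1 (s : R) (K : nat) : 0 <= s <= 1 -> {ae mu, forall x, `[- K.+1%:R, K.+1%:R]%classic x ->
    Irn r s (Hlim 0) x - Irn r s (Hlim m) x = 0}.
  move=> s01; apply: (bnd_all0 pm_ge1 (mitv _) (mI s)) => e e0.
  have e2 : 0 < e / 2 by rewrite divr_gt0.
  have K0 : 0 < K.+1%:R :> R by rewrite ltr0n.
  have [i [i0 im]] := filter_ex2 (@ultra_proper _ _ UU) (Dn_limit 0 K0 e2) (Dn_limit m K0 e2).
  have mm j : measurable_fun [set: R] (fun x => Dn r s (f_ i) x - Irn r s (Hlim j) x).
    by apply: measurable_funB; [exact: measurable_Dn|have [] := LI_Irn r s (LI_Hlim j)].
  rewrite (_ : (fun x => _) = (fun x => (Dn r s (f_ i) x - Irn r s (Hlim m) x) - (Dn r s (f_ i) x - Irn r s (Hlim 0) x))); last first.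
    by apply/funext => x; ring.
  by rewrite [X in bnd _ _ _ X](splitr e); apply: bndB => //; [exact: ltW|exact: ltW|exact: im|exact: i0].
have h2 : {ae mu, forall x, forall n : nat, Irn r n.+1%:R^-1 (Hlim 0) x = Irn r n.+1%:R^-1 (Hlim m) x}.
  apply: ae_foralln => n.
  have n01 : 0 <= (n.+1%:R^-1 : R) <= 1 by rewrite invr_ge0 ler0n/= invf_le1 ?ltr0n// ler1n.
  have /ae_foralln := fun K => h1 _ K n01; apply: aeS => x hx; apply/eqP; rewrite -subr_eq0; apply/eqP.
  by apply: (hx (Num.truncn `|x|)); rewrite /= in_itv/= -ler_norml; apply/ltW/truncnS_gt.
have d0 := Irn_differentiation r' (LI_Hlim 0); have dm := Irn_differentiation r' (LI_Hlim m).
apply: aeS (aeI h2 (aeI d0 dm)) => x [hx [x0 xm]].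
apply/eqP; rewrite -subr_eq0 -normr_le0; apply/ler_addgt0Pr => e e0; rewrite add0r.
have e2 : 0 < e / 2 by rewrite divr_gt0.
have [d1 [d10 hd1]] := x0 _ e2; have [d2 [d20 hd2]] := xm _ e2.
have dd : 0 < Num.min d1 d2 by rewrite lt_min d10.
have [n _ Hn] := near_infty_natSinv_lt (PosNum dd).
have /= := Hn n (leqnn n); rewrite lt_min => /andP[n1 n2].
have n0 : 0 < n.+1%:R^-1 :> R by rewrite invr_gt0 ltr0n.
have := hd1 _ (introT andP (conj n0 n1)); have := hd2 _ (introT andP (conj n0 n2)); rewrite hx.
set t := _ * _ => t2 t1.
have -> : Hlim 0 x - Hlim m x = (t - Hlim m x) - (t - Hlim 0 x) by lra.
by rewrite (splitr e) (le_trans (ler_normB _ _))// lerD.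
Unshelve. all: by end_near. Qed.

(** For fixed [s] choose [i] so late that both errors are at most [s ^ r]. Division by [s ^ r] gives
    a bound independent of [s], which survives [s -> 0] by Fatou's lemma. *)
Lemma Hlim_far K : exists B, 0 <= B /\ bnd pm [set x | C0 / W1 <= `|x| /\ `|x| <= K] (Hlim 0) B.
Proof.
have W11 : 0 < W1 <= W1 by rewrite W10 lexx.
have CW10 := CW0 W10.
exists (CW W1 + 2); split; first exact: addr_ge0.
pose K' := `|K| + 1; have K'0 : 0 < K' by rewrite ltr_wpDl.
have EA : [set x : R | C0 / W1 <= `|x| /\ `|x| <= K] = far (C0 / W1) `&` `[- K, K]%classic.
  by apply/seteqP; split => x /=; rewrite in_itv/= -ler_norml.
have mA : measurable ([set x : R | C0 / W1 <= `|x| /\ `|x| <= K] : set mR).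
  by rewrite EA; exact: measurableI.
have AK : [set x : R | C0 / W1 <= `|x| /\ `|x| <= K] `<=` `[- K', K'].
  move=> x /= [_ xK]; rewrite in_itv/= -ler_norml (le_trans xK)// (le_trans (ler_norm _))// lerDl//.
have mI s : measurable_fun [set: R] (Irn r s (Hlim 0)) by have [] := LI_Irn r s (LI_Hlim 0).
have h (s : R) : 0 < s <= 1 -> bnd pm [set x | C0 / W1 <= `|x| /\ `|x| <= K] (Irn r s (Hlim 0)) ((CW W1 + 2) * s ^+ r).
  move=> s01; have s0 : 0 < s by case/andP: s01.
  have sr : 0 < s ^+ r by rewrite exprn_gt0.
  near U => i.
  have i0 : forall t, 0 <= t <= 1 -> bnd pm `[- K', K'] (fun x => Dn r t (f_ i) x - Irn r t (Hlim 0) x) (s ^+ r).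
    by near: i; exact: (Dn_limit 0 K'0 sr).
  have i1 : forall t, 0 < t <= 1 -> bnd pm (far (C0 / W1)) (Dn r t (f_ i)) (CW W1 * t ^+ r + s ^+ r).
    by near: i; apply: UI; exact: H4.
  have mm : measurable_fun [set: R] (fun x => Dn r s (f_ i) x - Irn r s (Hlim 0) x).
    by apply: measurable_funB; [exact: measurable_Dn|].
  rewrite (_ : Irn r s (Hlim 0) = (fun x => Dn r s (f_ i) x - (Dn r s (f_ i) x - Irn r s (Hlim 0) x))); last first.
    by apply/funext => x; ring.
  rewrite (_ : (CW W1 + 2) * s ^+ r = (CW W1 * s ^+ r + s ^+ r) + s ^+ r); last by ring.
  apply: bndB => //.
  - exact: measurable_Dn.
  - by rewrite addr_ge0 ?mulr_ge0// ltW.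
  - exact: ltW.
  - apply: (bnd_sub pm_ge1 mA (mfar _) (measurable_Dn _ _ (mf i)) _ (i1 s s01)) => x [] //.
  - apply: (bnd_sub pm_ge1 mA (mitv _) mm AK); apply: i0; by case/andP: s01 => /ltW -> ->.
apply: (@bnd_fatou _ _ pm_ge1 _ (fun n x => n.+1%:R^-1 ^- r * Irn r n.+1%:R^-1 (Hlim 0) x)) => //.
- by move=> n; exact: measurable_funM.
- by have [] := LI_Hlim 0.
- apply: aeS (Irn_differentiation r' (LI_Hlim 0)) => x hx _.
  apply/cvgrPdist_le => e e0; have [d [d0 hd]] := hx _ e0.
  have [n _ Hn] := near_infty_natSinv_lt (PosNum d0); exists n => // j /= nj.
  rewrite distrC; apply: hd; rewrite invr_gt0 ltr0n/=; exact: Hn.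
move=> n; have n01 : 0 < (n.+1%:R^-1 : R) <= 1 by rewrite invr_gt0 ltr0n/= invf_le1 ?ltr0n// ler1n.
have n0 : 0 < n.+1%:R^-1 :> R by case/andP: n01.
have := bndZ pm_ge1 (n.+1%:R^-1 ^- r) mA (mI _) _ (h _ n01).
rewrite ger0_norm ?invr_ge0 ?exprn_ge0 ?(ltW n0)// mulrCA mulVf ?mulr1 ?expf_neq0 ?gt_eqF//.
by apply; rewrite mulr_ge0 ?exprn_ge0 ?(ltW n0)// addr_ge0.
Unshelve. all: by end_near. Qed.

Lemma Hlim_eq0 : {ae mu, forall x, Hlim 0 x = 0}.
Proof.
have [mH _] := LI_Hlim 0.
have C1 : 0 < C0 / W1 by rewrite divr_gt0.
apply: (@classification R pm r sg G (Hlim 0) om be Cm (C0 / W1)) => //.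
- exact: Hlim_indep.
- exact: zdec_be.
- exact: Hlim_far.
Qed.

(** The line is covered by [|x| >= C0 / W], where [H4] with a small [CW W] applies, and a bounded
    interval, where the limit of the differences is 0. The three errors of size [1/16] stay below
    [1/2]. *)
Lemma Dn_small : \forall i \near U, bnd pm setT (Dn r 1 (f_ i)) (2^-1).
Proof.
have e16 : 0 < 16^-1 :> R by rewrite invr_gt0.
have [W W01 CWe] := CWcv e16; have W0 : 0 < W by case/andP: W01.
have K0 : 0 < C0 / W by rewrite divr_gt0.
have h1 := UI (H4 W01 e16); have h2 := Dn_limit 0 K0 e16.
near=> i.
have i1 : forall s, 0 < s <= 1 -> bnd pm (far (C0 / W)) (Dn r s (f_ i)) (CW W * s ^+ r + 16^-1).
  by near: i; exact: h1.
have i2 : forall s, 0 <= s <= 1 -> bnd pm `[- (C0 / W), C0 / W] (fun x => Dn r s (f_ i) x - Irn r s (Hlim 0) x) 16^-1.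
  by near: i; exact: h2.
have I0 x : Irn r 1 (Hlim 0) x = 0.
  have [mH _] := LI_Hlim 0.
  rewrite (@ae_eq_Irn _ r' 1 (Hlim 0) (cst 0) x mH)//; last exact: Hlim_eq0.
  by rewrite Irn_cst// mulr0.
have {}i2 : bnd pm `[- (C0 / W), C0 / W] (Dn r 1 (f_ i)) 16^-1.
  have := i2 1; rewrite ler01 lexx => /(_ isT).
  by rewrite (_ : (fun x => _) = Dn r 1 (f_ i))//; apply/funext => x; rewrite I0 subr0.
have {}i1 := i1 1; rewrite ltr01 lexx expr1n mulr1 in i1.
have mD := measurable_Dn r 1 (mf i).
have CWW := CW0 W0.
have := bndU pm_ge1 (mfar _) (mitv _) mD _ _ (i1 isT) i2.
rewrite (_ : far _ `|` _ = setT); last first.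
  apply/seteqP; split => x //= _; rewrite in_itv/= -ler_norml.
  by have [|/ltW] := lerP (C0 / W) `|x|; [left|right].
move=> /(_ (addr_ge0 CWW (ltW e16)) (ltW e16)); apply: bnd_le => //.
  by rewrite !addr_ge0// ltW.
lra.
Unshelve. all: by end_near. Qed.

End ultralimit.

Theorem core_contradiction : ~ \forall i \near \oo, ~ bnd pm setT (Dn r 1 (f_ i)) (2^-1).
Proof.
move=> H5; have [U [UU UI]] := @ultraFilterLemma nat \oo _.
have [be Hbe] := ultra_coef UI.
have h := @Dn_small U UU UI be Hbe; have h5 := UI _ H5.
by have [i []] := filter_ex2 (@ultra_proper _ _ UU) h h5.
Qed.

End core.

Section norm_infimum.
Context {R : realType}.
Local Notation mu := (@lebesgue_measure R).
Local Notation mR := (measurableTypeR R).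
Variable pm : option R.
Hypothesis pm_ge1 : if pm is Some p then 1 <= p else true.

Lemma bnd_closed (A : set R) (G : R -> R) B : measurable (A : set mR) -> 0 <= B ->
  (forall e, 0 < e -> bnd pm A G (B + e)) -> bnd pm A G B.
Proof.
move=> mA B0 H; have [[p e]|e] : (exists p, pm = Some p) \/ pm = None.
  by case: pm => [p|]; [left; exists p|right].
  apply/(bnd_Lnorm pm_ge1 G e mA B0); apply/lee_addgt0Pr => d d0.
  by rewrite -EFinD; apply/(bnd_Lnorm pm_ge1 G e mA); [rewrite addr_ge0// ltW|exact: H].
rewrite /bnd e.
have : {ae mu, forall x, forall n : nat, A x -> `|G x| <= B + n.+1%:R^-1}.
  apply: ae_foralln => n; have := H n.+1%:R^-1; rewrite /bnd e; apply.
  by rewrite invr_gt0 ltr0n.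
apply: aeS => x hx Ax; apply/ler_addgt0Pr => d d0.
have [n _ Hn] := near_infty_natSinv_lt (PosNum d0).
by apply: le_trans (hx n Ax) _; rewrite lerD2l; apply/ltW/(Hn n) => /=.
Qed.

(** The norm as a least real bound, from which the function [a] of the step is obtained by
    choice. *)
Lemma bnd_inf (A : set R) (G : R -> R) B0 : measurable (A : set mR) -> 0 <= B0 -> bnd pm A G B0 ->
  exists a, [/\ 0 <= a, a <= B0, bnd pm A G a & forall B, 0 <= B -> bnd pm A G B -> a <= B].
Proof.
move=> mA B00 HB0; pose S := [set B | 0 <= B /\ bnd pm A G B].
have S0 : S B0 by split.
have lbS : lbound S 0 by move=> B [].
have hS : has_inf S by split; [exists B0|exists 0].
have i0 : 0 <= inf S by apply: lb_le_inf => //; exists B0.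
exists (inf S); split => //; first by apply: ge_inf => //; exists 0.
  apply: bnd_closed => // e e0; have [B [B0' HB] Be] := inf_adherent e0 hS.
  by apply: (bnd_le pm_ge1 B0' _ HB); apply: ltW.
by move=> B B1 HB; apply: ge_inf; [exists 0|split].
Qed.

End norm_infimum.

Lemma powR_div (R : realType) (x y a : R) : 0 <= x -> 0 < y -> (x / y) `^ a = x `^ a / y `^ a.
Proof.
move=> x0 y0; apply/(@mulIf _ (y `^ a)); first by rewrite gt_eqF ?powR_gt0.
by rewrite -powRM ?divr_ge0 ?(ltW y0)// !divfK ?gt_eqF ?powR_gt0.
Qed.

Section selection.
Context {R : realType}.

(* Almost extremal scales for the ratio [a s / s^al], so that [a] is controlled at all coarser
   scales by its value at the selected one. *)
Lemma extremal_scales (a : R -> R) (al B0 : R) : 0 < al -> (forall s, 0 < s -> 0 <= a s <= B0) ->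
  ~ (exists C, forall s, 0 < s <= 1 -> a s <= C * s `^ al) ->
  exists t : nat -> R, forall i, [/\ 0 < t i, i.+1%:R * t i `^ al <= a (t i) &
    forall s, t i <= s -> a s <= 2 * a (t i) * (s / t i) `^ al].
Proof.
move=> al0 aB nC; have B00 : 0 <= B0 by have /andP[h1 h2] := aB 1 ltr01; exact: le_trans h2.
suff /choice[t Ht] : forall i : nat, exists t, [/\ 0 < t, i.+1%:R * t `^ al <= a t &
    forall s, t <= s -> a s <= 2 * a t * (s / t) `^ al] by exists t.
(* [M / 2 >= i + 1] gives the growth of the ratio at the selected scale, and [M >= B0] settles the
   steps [s > 1], where only the trivial bound on [a] is available. *)
move=> i; pose M := 2 * (i.+1%:R + B0).
have i1 : 1 <= i.+1%:R :> R by rewrite ler1n.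
have [tau [tau0 tau1 Mtau]] : exists tau, [/\ 0 < tau, tau <= 1 & M * tau `^ al < a tau].
  apply: contrapT => H; apply: nC; exists M => s /andP[s0 s1].
  by rewrite leNgt; apply/negP => Hs; apply: H; exists s.
pose S := [set a s / s `^ al | s in [set s | tau <= s <= 1]].
have S0 : S (a tau / tau `^ al) by exists tau => //=; rewrite lexx.
have ub : ubound S (B0 / tau `^ al).
  move=> _ [s /= /andP[s1 s2] <-]; have s0 : 0 < s by exact: lt_le_trans s1.
  have /andP[h1 h2] := aB s s0; apply: ler_pM => //; rewrite ?invr_ge0 ?powR_ge0//.
  rewrite lef_pV2 ?posrE ?powR_gt0//; apply: ge0_ler_powR; rewrite ?nnegrE//; exact: ltW.
have hS : has_sup S by split; [exists (a tau / tau `^ al)|exists (B0 / tau `^ al)].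
have Mle : M < sup S.
  apply: lt_le_trans (ub_le_sup _ S0); last by exists (B0 / tau `^ al).
  by rewrite ltr_pdivlMr ?powR_gt0.
have M0 : 0 < M by rewrite /M; lra.
have sup0 : 0 < sup S by exact: lt_trans Mle.
have h2 : 0 < sup S / 2 by rewrite divr_gt0.
have [_ [t /= /andP[t1 t2] <-] Ht] := sup_adherent h2 hS.
have t0 : 0 < t by exact: lt_le_trans t1.
have tal : 0 < t `^ al by rewrite powR_gt0.
have Ht' : sup S / 2 * t `^ al < a t.
  by rewrite -ltr_pdivlMr//; apply: le_lt_trans Ht; lra.
have Mt : M / 2 * t `^ al <= a t.
  by apply: le_trans (ltW Ht'); rewrite ler_wpM2r ?powR_ge0//; lra.
exists t; split => //.
  by apply: le_trans Mt; rewrite ler_wpM2r ?powR_ge0// /M; lra.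
move=> s ts; have s0 : 0 < s by exact: lt_le_trans ts.
have sal : 0 < s `^ al by rewrite powR_gt0.
rewrite powR_div ?(ltW s0)// mulrA mulrAC; set q := 2 * a t / t `^ al.
have Sq : sup S <= q by rewrite ler_pdivlMr//; lra.
have [s1|s1] := lerP s 1.
  have aS : a s / s `^ al <= sup S.
    apply: ub_le_sup; first by exists (B0 / tau `^ al).
    by exists s => //=; rewrite s1 (le_trans t1).
  by apply: (@le_trans _ _ (sup S * s `^ al)); [rewrite -ler_pdivrMr|rewrite ler_wpM2r// ltW].
have /andP[_ aB0] := aB s s0; apply: le_trans aB0 _.
have s1' : 1 <= s `^ al by rewrite -(powRr0 s) ler_powR// ltW.
have qM : B0 <= q by apply: le_trans (le_trans (ltW Mle) Sq); rewrite /M; have := ler0n R i.+1; lra.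
by rewrite (le_trans qM)// ler_peMr// (le_trans _ qM).
Qed.

End selection.

Section transfer.
Context {R : realType}.
Local Notation mu := (@lebesgue_measure R).
Local Notation mR := (measurableTypeR R).
(** The interface between the compactness argument and the two cases of the exponent. [Good] singles
    out the frequencies at which the representation [rep] is valid; [farb] is the averaged bound
    away from the origin, and [sel] selects frequencies and a subsequence of scales along which the
    coefficients are controlled. *)
Variables (pm : option R) (r' : nat) (sg al B0 CE C0 c2 CF w0 : R) (G f : R -> R) (a : R -> R)
  (b : R -> int -> R) (Good : R -> Prop).
Local Notation r := r'.+1.
Local Notation far c := [set x : R | c <= `|x|].
Hypotheses (pm_ge1 : if pm is Some p then 1 <= p else true)
  (GL : LI G) (GT : condition_Theta sg G) (sg1 : 1 < sg) (al0 : 0 < al) (alr : al < r%:R)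
  (mf : measurable_fun [set: R] f)
  (aB : forall s, 0 < s -> 0 <= a s <= B0)
  (ab : forall s, 0 < s -> bnd pm setT (Dn r s f) (a s))
  (amin : forall s B, 0 < s -> 0 <= B -> bnd pm setT (Dn r s f) B -> a s <= B)
  (CE0 : 0 <= CE) (C00 : 0 < C0) (c20 : 0 < c2) (CF0 : 0 <= CF) (w00 : 0 < w0)
  (rep : forall w s, w0 <= w -> Good w -> 0 <= s ->
     bnd pm setT (fun x => Dn r s f x - Sop (b w) (Irn r (w * s) G) (w * x)) (CE * w `^ (- al)))
  (farb : forall W A s, w0 <= W -> 0 <= A -> (forall s', (2 * W)^-1 <= s' <= c2 / W -> a s' <= A) ->
     0 < s <= W^-1 -> bnd pm (far (C0 / W)) (Dn r s f) (CF * ((s * W) ^+ r * (A + W `^ (- al)) + W `^ (- al))))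
  (sel : forall t : nat -> R, (forall i, 0 < t i) -> (forall i, 0 < a (t i)) ->
     (forall i, i.+1%:R * t i `^ al <= a (t i)) -> t n @[n --> \oo] --> 0 ->
     (forall i s, t i <= s -> a s <= 2 * a (t i) * (s / t i) `^ al) ->
     exists (om : nat -> R) (I : nat -> nat) (Cm : nat -> R),
     [/\ forall m, 0 < om m, om m @[m --> \oo] --> 0, forall j, (j <= I j)%N &
       om m ^+ r * (Cm m * om m `^ (- ep pm)) @[m --> \oo] --> 0] /\
     [/\ forall m, \forall j \near \oo, Good (om m / t (I j)),
      forall m, \forall j \near \oo, forall k, `|t (I j) `^ ep pm / a (t (I j)) * b (om m / t (I j)) k| <= Cm m &
      forall m e, 0 < e -> exists n : nat, \forall j \near \oo, forall s : seq int, uniq s ->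
        (forall k, k \in s -> e < `|t (I j) `^ ep pm / a (t (I j)) * b (om m / t (I j)) k|) -> (size s <= n)%N]).

(** The factor [t^(1/p)] makes the dilation by [t] an isometry, and [k] is the normalisation. *)
Lemma scaled_bnd (A : set R) (F : R -> R) (t k B : R) : 0 < t -> 0 < k -> measurable (A : set mR) ->
  measurable_fun [set: R] F -> 0 <= B ->
  bnd pm A F B -> bnd pm [set x | A (t * x)] (fun x => t `^ ep pm / k * F (t * x)) (B / k).
Proof.
move=> t0 k0 mA mF B00 HB.
have mFt : measurable_fun [set: R] (fun x => F (t * x + 0)).
  by apply: measurableT_comp => //; exact: measurable_affine.
have mA' : measurable ([set x | A (t * x + 0)] : set mR).
  by rewrite -[X in measurable X]setTI; exact: (measurable_affine t 0 measurableT mA).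
have tk : 0 <= t `^ ep pm / k by rewrite divr_ge0 ?powR_ge0// ltW.
have := bndZ pm_ge1 (t `^ ep pm / k) mA' mFt _ (bnd_affine pm_ge1 0 t0 mA mF B00 HB).
rewrite (ger0_norm tk) (_ : _ / k * _ = B / k); last first.
  by rewrite powRN; field; rewrite !gt_eqF ?powR_gt0.
rewrite (_ : (fun x => _) = (fun x => t `^ ep pm / k * F (t * x))); last first.
  by apply/funext => x; rewrite addr0.
rewrite (_ : [set x | A (t * x + 0)] = [set x | A (t * x)]); last first.
  by apply/seteqP; split => x /=; rewrite addr0.
by apply; rewrite mulr_ge0 ?powR_ge0.
Qed.

Let Dn_scaled t k s x : Dn r s (fun y => k * f (t * y)) x = k * Dn r (t * s) f (t * x).
Proof.
rewrite DnZ -[t * x in RHS]addr0 -Dn_scale; congr (_ * _).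
by apply: eq_Dn => y; rewrite addr0.
Qed.

Theorem transfer : exists C, 0 <= C /\ forall s, 0 < s <= 1 -> bnd pm setT (Dn r s f) (C * s `^ al).
Proof.
suff [C HC] : exists C, forall s, 0 < s <= 1 -> a s <= C * s `^ al.
  exists C; split.
    have h01 : (0 < 1 :> R) && (1 <= 1 :> R) by rewrite ltr01 lexx.
    have := HC 1 h01; rewrite powR1 mulr1; apply: le_trans.
    by have /andP[] := aB ltr01.
  move=> s s01; have s0 : 0 < s by case/andP: s01.
  have /andP[as0 _] := aB s0.
  exact: (bnd_le pm_ge1 as0 (HC s s01) (ab s0)).
apply: contrapT => nC.
have [t Ht] := extremal_scales al0 aB nC.
have t0 i : 0 < t i by case: (Ht i).
have tal i : 0 < t i `^ al by rewrite powR_gt0.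
have ta i : i.+1%:R * t i `^ al <= a (t i) by case: (Ht i).
have ats i s : t i <= s -> a s <= 2 * a (t i) * (s / t i) `^ al by case: (Ht i) => _ _; apply.
have a0 i : 0 < a (t i) by apply: lt_le_trans (ta i); rewrite mulr_gt0 ?ltr0n.
have ratio i : t i `^ al / a (t i) <= i.+1%:R^-1.
  by rewrite ler_pdivrMr// ler_pdivlMl ?ltr0n.
have tcv : t n @[n --> \oo] --> 0.
  apply/cvgrPdist_le => e e0.
  have eal : 0 < e `^ al / (B0 + 1).
    have /andP[h1 h2] := aB ltr01; by rewrite divr_gt0 ?powR_gt0// ltr_wpDl// (le_trans h1).
  have [n _ Hn] := near_infty_natSinv_lt (PosNum eal); exists n => // i /= ni.
  rewrite sub0r normrN gtr0_norm// leNgt; apply/negP => et.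
  have B1 : 0 < B0 + 1 by have /andP[h1 h2] := aB ltr01; rewrite ltr_wpDl// (le_trans h1).
  have h1 : e `^ al <= t i `^ al by apply: ge0_ler_powR; rewrite ?nnegrE ?(ltW e0) ?(ltW al0) ?(ltW (t0 i)) ?(ltW et).
  have /andP[_ h2] := aB (t0 i).
  have := Hn i ni; rewrite /= ltr_pdivlMr//; have := ta i.
  have i0 : 0 < i.+1%:R :> R by rewrite ltr0n.
  move=> h3 h4; have h5 : i.+1%:R * e `^ al <= B0 by rewrite (le_trans _ h2)// (le_trans _ h3)// ler_wpM2l// ltW.
  rewrite mulrC ltr_pdivrMr// mulrC in h4; lra.
have [om [I [Cm [[om0 omcv Ij Cmcv] [good bC bcount]]]]] := sel t0 a0 ta tcv ats.
(* With this factor the least bound of [Dn r 1 (f_ j)] is 1; the bound [1/2] would contradict the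
   minimality of [a]. *)
pose ka j := t (I j) `^ ep pm / a (t (I j)).
pose f_ j x := ka j * f (t (I j) * x).
pose b_ j m k := ka j * b (om m / t (I j)) k.
have tIcv : t (I j) @[j --> \oo] --> 0.
  apply/cvgrPdist_le => e e0; move/cvgrPdist_le : tcv => /(_ _ e0) [n _ Hn]; exists n => // j /= nj.
  by apply: Hn => /=; exact: leq_trans (Ij j).
have wnear c : 0 < c -> \forall j \near \oo, w0 <= c / t (I j).
  move=> c0; have cw : 0 < c / w0 by rewrite divr_gt0.
  move/cvgrPdist_le : tIcv => /(_ _ cw); apply: filterS => j.
  rewrite sub0r normrN gtr0_norm// => h; rewrite ler_pdivlMr//.
  by rewrite mulrC -ler_pdivlMr.
have rnear e : 0 < e -> \forall j \near \oo, t (I j) `^ al / a (t (I j)) <= e.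
  move=> e0; have [n _ Hn] := near_infty_natSinv_lt (PosNum e0); exists n => // j /= nj.
  by apply: le_trans (ratio _) _; apply/ltW/Hn => /=; exact: leq_trans (Ij j).
have mf_ j : measurable_fun [set: R] (f_ j).
  by apply: measurable_funM => //; apply: measurableT_comp => //; exact: measurable_funM.
(* This is [farb] at frequency [W / t], divided by [a t]. The summand without the factor [s ^ r]
   carries the ratio [t ^ al / a t], which tends to 0, and becomes the error [e]. Only [W <= 1/2] is
   used below, so that all steps from [1 / (2 (W / t))] on are coarser than [t] and the extremal
   property of [t] bounds [a] there. *)
pose CW W := CF * (W ^+ r * (2 * (c2 / W) `^ al + W `^ (- al))).
apply: (@core_contradiction R pm r' sg G om f_ b_ Cm C0 (2^-1) CW) => //.
- move=> m e e0; have e1 : 0 < e / (CE * om m `^ (- al) + 1).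
    by rewrite divr_gt0// ltr_wpDl// mulr_ge0 ?powR_ge0.
  near=> j => s /andP[s0 s1].
  have ww : w0 <= om m / t (I j) by near: j; exact: wnear.
  have gw : Good (om m / t (I j)) by near: j; exact: good.
  have bc : forall k, `|b_ j m k| <= Cm m by near: j; exact: bC.
  have rj : t (I j) `^ al / a (t (I j)) <= e / (CE * om m `^ (- al) + 1) by near: j; exact: rnear.
  have ts0 : 0 <= t (I j) * s by rewrite mulr_ge0// ltW.
  have bb : pgrow 0 (b (om m / t (I j))).
    apply: (@bounded_pgrow _ _ (Cm m / ka j)) => k; rewrite ler_pdivlMr ?divr_gt0 ?powR_gt0//.
    by have := bc k; rewrite normrM gtr0_norm ?divr_gt0 ?powR_gt0// mulrC.
  have s10 : 0%:R + 1 < sg by rewrite add0r.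
  have oms : 0 <= om m * s by rewrite mulr_ge0// ltW.
  have GT' : condition_Theta sg (Irn r (om m * s) G).
    by apply: Theta_Irn => //; rewrite (le_trans _ (ltW sg1)).
  have GL' : LI (Irn r (om m * s) G) by exact: LI_Irn.
  have wt : om m / t (I j) * (t (I j) * s) = om m * s by rewrite mulrA divfK// gt_eqF.
  have h := rep ww gw ts0; rewrite wt in h.
  have mF : measurable_fun [set: R] (fun x => Dn r (t (I j) * s) f x -
      Sop (b (om m / t (I j))) (Irn r (om m * s) G) (om m / t (I j) * x)).
    apply: measurable_funB; first exact: measurable_Dn.
    have [mS _] := LI_Sop GL' GT' s10 bb.
    by apply: measurableT_comp => //; exact: measurable_funM.
  have w0' : 0 <= CE * (om m / t (I j)) `^ (- al) by rewrite mulr_ge0 ?powR_ge0.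
  have := scaled_bnd (t0 (I j)) (a0 (I j)) measurableT mF w0' h.
  rewrite (_ : [set x | setT _] = setT)// => {}h.
  rewrite (_ : (fun x => _) = (fun x => ka j * (Dn r (t (I j) * s) f (t (I j) * x) -
      Sop (b (om m / t (I j))) (Irn r (om m * s) G) (om m / t (I j) * (t (I j) * x))))); last first.
    apply/funext => x; rewrite mulrBr -(SopZ (ka j) _ GL' GT' s10 bb) mulrA divfK ?gt_eqF//.
    by congr (_ + _); exact: Dn_scaled.
  apply: (bnd_le pm_ge1 _ _ h); first by rewrite divr_ge0// ltW.
  rewrite powR_div ?(ltW (om0 m))// [t (I j) `^ (- al)]powRN invrK.
  rewrite -mulrA -[X in _ * X]mulrA mulrA.
  have cp : 0 <= CE * om m `^ (- al) by rewrite mulr_ge0 ?powR_ge0.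
  apply: (@le_trans _ _ (CE * om m `^ (- al) * (e / (CE * om m `^ (- al) + 1)))); first by rewrite ler_wpM2l.
  rewrite mulrCA -[leRHS]mulr1 ler_wpM2l ?(ltW e0)// ler_pdivrMr ?ltr_wpDl// mul1r lerDl//.
- move=> W W0; rewrite /CW mulr_ge0// mulr_ge0 ?exprn_ge0 ?(ltW W0)// addr_ge0 ?mulr_ge0 ?powR_ge0//.
- move=> W e /andP[W0 W2] e0.
  have cp : 0 < CF * W `^ (- al) + 1 by rewrite ltr_wpDl// mulr_ge0 ?powR_ge0.
  have e1 : 0 < e / (CF * W `^ (- al) + 1) by rewrite divr_gt0.
  near=> j => s /andP[s0 s1].
  have ww : w0 <= W / t (I j) by near: j; exact: wnear.
  have rj : t (I j) `^ al / a (t (I j)) <= e / (CF * W `^ (- al) + 1) by near: j; exact: rnear.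
  have rj1 : t (I j) `^ al / a (t (I j)) <= 1 by near: j; apply: rnear.
  set T := t (I j) in ww rj rj1 *; have T0 : 0 < T by exact: t0.
  have aT0 : 0 < a T by exact: a0.
  pose A := 2 * a T * (c2 / W) `^ al.
  have A0 : 0 <= A by rewrite !mulr_ge0 ?powR_ge0// ltW.
  have hA s' : (2 * (W / T))^-1 <= s' <= c2 / (W / T) -> a s' <= A.
    move=> /andP[h1 h2]; have Ts : T <= s'.
      apply: le_trans h1; rewrite (_ : (2 * (W / T))^-1 = T * (2 * W)^-1); last by field; rewrite !gt_eqF.
      have W3 : 0 < 2 * W by rewrite mulr_gt0.
      rewrite ler_peMr ?(ltW T0)// invf_ge1//; lra.
    apply: le_trans (ats _ _ Ts) _; rewrite ler_wpM2l ?mulr_ge0 ?(ltW aT0)//.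
    have s'0 : 0 < s' by exact: lt_le_trans Ts.
    apply: ge0_ler_powR; rewrite ?nnegrE ?divr_ge0 ?(ltW al0) ?(ltW s'0) ?(ltW T0) ?(ltW c20) ?(ltW W0)//.
    by rewrite ler_pdivrMr// (le_trans h2)// invf_div mulrA mulrAC.
  have Ts : 0 < T * s <= (W / T)^-1.
    rewrite mulr_gt0//= invf_div ler_pdivlMr// -mulrA ler_piMr ?(ltW T0)//.
    rewrite (le_trans (ler_pM (ltW s0) (ltW W0) s1 W2))// mul1r invf_le1//; lra.
  have h := farb ww A0 hA Ts.
  have wal : 0 <= (W / T) `^ (- al) by rewrite powR_ge0.
  have sW : T * s * (W / T) = s * W by field; rewrite gt_eqF.
  rewrite sW in h.
  have mfar (c : R) : measurable (far c : set mR).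
    rewrite (_ : far c = (fun x : R => `|x|) @^-1` `[c, +oo[); last first.
      by apply/seteqP; split => x /=; rewrite in_itv/= andbT.
    by rewrite -[X in measurable X]setTI; exact: (normr_measurable measurableT (measurable_itv _)).
  have sWr : 0 <= (s * W) ^+ r by rewrite exprn_ge0// mulr_ge0// ltW.
  have B1 : 0 <= CF * ((s * W) ^+ r * (A + (W / T) `^ (- al)) + (W / T) `^ (- al)).
    by rewrite mulr_ge0// addr_ge0// mulr_ge0// addr_ge0.
  have := scaled_bnd T0 aT0 (mfar _) (measurable_Dn r (T * s) mf) B1 h.
  rewrite (_ : [set x | far _ (T * x)] = far (C0 / W)); last first.
    have e3 : C0 / (W / T) = T * (C0 / W) by field; rewrite !gt_eqF.
    by apply/seteqP; split => x /=; rewrite e3 normrM gtr0_norm// ler_pM2l.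
  rewrite (_ : (fun x => _) = Dn r s (f_ j)); last by apply/funext => x; rewrite Dn_scaled.
  move=> {}h; apply: (bnd_le pm_ge1 _ _ h); first by rewrite divr_ge0// ltW.
  rewrite powR_div ?(ltW W0)// [T `^ (- al)]powRN invrK.
  have -> : CF * ((s * W) ^+ r * (A + W `^ (- al) * T `^ al) + W `^ (- al) * T `^ al) / a T =
     CF * (s * W) ^+ r * (2 * (c2 / W) `^ al + W `^ (- al) * (T `^ al / a T)) + CF * W `^ (- al) * (T `^ al / a T).
    by rewrite /A; field; rewrite gt_eqF.
  apply: lerD.
    rewrite /CW exprMn [leRHS]mulrC [leLHS](_ : _ = s ^+ r * (CF * (W ^+ r * (2 * (c2 / W) `^ al + W `^ (- al) * (T `^ al / a T))))); last by ring.
    rewrite ler_wpM2l ?exprn_ge0 ?(ltW s0)// ler_wpM2l// ler_wpM2l ?exprn_ge0 ?(ltW W0)//.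
    by rewrite lerD2l ler_piMr// powR_ge0.
  apply: (@le_trans _ _ (CF * W `^ (- al) * (e / (CF * W `^ (- al) + 1)))).
    by rewrite ler_wpM2l// mulr_ge0// powR_ge0.
  rewrite mulrCA -[leRHS]mulr1 ler_wpM2l ?(ltW e0)// ler_pdivrMr// mul1r lerDl//.
- move=> e e0; pose K := CF * (2 * c2 `^ al + 1).
  have K0 : 0 <= K by rewrite mulr_ge0// addr_ge0// mulr_ge0// powR_ge0.
  have ra : 0 < r%:R - al by rewrite subr_gt0.
  (* [CW W] is a multiple of [W ^ (r - al)], which is small with [W] because [al < r]. *)
  pose W := Num.min 2^-1 ((e / (K + 1)) `^ (r%:R - al)^-1).
  have K1 : 0 < K + 1 by rewrite ltr_wpDl.
  have W0 : 0 < W by rewrite lt_min invr_gt0 ltr0n/= powR_gt0// divr_gt0.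
  exists W; first by rewrite W0/= ge_min lexx.
  have WK : CW W = K * W `^ (r%:R - al).
    rewrite /CW powR_div ?(ltW c20)// powRB; last by rewrite gt_eqF ?implybT.
    rewrite powRN -(powR_mulrn r (ltW W0)) /K; field; by rewrite gt_eqF ?powR_gt0.
  rewrite WK; apply: (@le_trans _ _ (K * (e / (K + 1)))).
    rewrite ler_wpM2l//; apply: (@le_trans _ _ (((e / (K + 1)) `^ (r%:R - al)^-1) `^ (r%:R - al))).
      apply: ge0_ler_powR; rewrite ?nnegrE ?powR_ge0 ?(ltW ra) ?(ltW W0)//.
      by rewrite /W ge_min lexx orbT.
    by rewrite -powRrM mulVf ?gt_eqF// powRr1// divr_ge0// ltW.
  rewrite mulrCA -[leRHS]mulr1 ler_wpM2l ?(ltW e0)// ler_pdivrMr// mul1r lerDl//.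
near=> j => h; set T := t (I j) in h *; have T0 : 0 < T by exact: t0.
have aT : 0 < a T by exact: a0.
have a2 : 0 <= a T / 2 by rewrite divr_ge0// ltW.
have h1 : bnd pm setT (Dn r T f) (a T / 2).
  have mD : measurable_fun [set: R] (Dn r 1 (f_ j)) by exact: measurable_Dn.
  have Ti : 0 < T^-1 by rewrite invr_gt0.
  have aTi : 0 < (a T)^-1 by rewrite invr_gt0.
  have i2 : 0 <= 2^-1 :> R by rewrite invr_ge0.
  have := scaled_bnd Ti aTi measurableT mD i2 h.
  rewrite (_ : [set x | setT _] = setT)// invrK [2^-1 * _]mulrC.
  have -> : (fun x => T^-1 `^ ep pm * a T * Dn r 1 (f_ j) (T^-1 * x)) = Dn r T f.
    have Te : T^-1 `^ ep pm = (T `^ ep pm)^-1 by rewrite -[T^-1]mul1r powR_div// powR1 mul1r.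
    have k1 : T^-1 `^ ep pm * a T * ka j = 1.
      rewrite Te /ka -/T; move: (T `^ ep pm) (powR_gt0 (ep pm) T0) (a T) aT => P P0 q q0.
      by field; rewrite !gt_eqF.
    apply/funext => x; rewrite (Dn_scaled T (ka j)) mulr1 mulVKf ?gt_eqF//.
    by rewrite mulrA k1 mul1r.
  by [].
have := amin T0 a2 h1; lra.
Unshelve. all: by end_near. Qed.

End transfer.

(** * Summation by parts and averages over dilations *)

Section sequence_differences.
Context {R : realType}.
Implicit Types (c : int -> R) (G : R -> R).

Definition Dz c k := c (k + 1) - c k.

Lemma Dz_bounded c M : (forall k, `|c k| <= M) -> forall k, `|Dz c k| <= 2 * M.
Proof. by move=> cM k; rewrite mulr_natl mulr2n (le_trans (ler_normB _ _))// lerD. Qed.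

Lemma iter_Dz_bounded n c M : (forall k, `|c k| <= M) -> forall k, `|iter n Dz c k| <= 2 ^+ n * M.
Proof.
move=> cM; elim: n => [|n IH] k; first by rewrite expr0 mul1r.
by rewrite iterS exprS -mulrA; exact: Dz_bounded.
Qed.

Lemma Dn1_Sop n sg c M G u : LI G -> condition_Theta sg G -> 0%:R + 1 < sg -> (forall k, `|c k| <= M) ->
  Dn n 1 (Sop c G) u = Sop (iter n Dz c) G u.
Proof.
move=> GL GT s1; elim: n c M u => // n IH c M u cM.
rewrite DnSr iterSr -(IH _ _ _ (Dz_bounded cM)); apply: eq_Dn => x.
have bc := bounded_pgrow cM.
rewrite /Dl (Sop_shift1 x GL GT s1 bc) -mulN1r -(SopZ (-1) x GL GT s1 bc).
rewrite -(SopD x GL GT s1 (pgrow_shift 1 bc) (pgrowZ (-1) bc)).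
by apply: eq_zsum => k; rewrite mulN1r.
Qed.

End sequence_differences.

Section dilation_average.
Context {R : realType}.
Local Notation mu := (@lebesgue_measure R).
Local Notation mR := (measurableTypeR R).
Variable (F : R -> \bar R).
Hypotheses (mF : measurable_fun [set: R] F) (F0 : forall x, (0 <= F x)%E).

Definition periodized (y : R) : \bar R := esZ (fun k => F (y - k%:~R)).

Lemma periodized_ge0 y : (0 <= periodized y)%E.
Proof. exact: esZ_ge0. Qed.

Lemma measurable_periodized : measurable_fun [set: R] periodized.
Proof.
apply: measurable_esZ => [//|k]; apply: measurableT_comp => //; exact: measurable_funB.
Qed.

Lemma integral_periodized a : (\int[mu]_(x in `[a, (a + 1)%R[) periodized x = \int[mu]_x F x)%E.
Proof.
have mFa : measurable_fun [set: R] (fun x => F (1 * x + a)%R).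
  by apply: measurableT_comp => //; exact: measurable_affine.
have := @ge0_integral_affine R F 1 a (oner_neq0 _) mF F0; rewrite normr1 invr1 mul1e => <-.
rewrite (@ge0_integral_periodize _ (fun x => F (1 * x + a)%R) mFa)//.
have := @ge0_integral_affine_in R periodized 1 a `[a, (a + 1)[%classic (oner_neq0 _) (measurable_itv _)
  (measurable_funTS measurable_periodized) (fun x _ => periodized_ge0 x).
rewrite normr1 invr1 mul1e => <-.
rewrite (_ : [set x | _] = `[0%R, 1%R[%classic); last first.
  by apply/seteqP; split => x /=; rewrite !in_itv/= mul1r => /andP[h1 h2]; apply/andP; split; lra.
apply: eq_integral => x _; rewrite /periodized; congr esZ; apply/funext => k.
by congr F; lra.
Qed.

Lemma integral_periodized_le a (L : R) : 1 <= L ->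
  (\int[mu]_(x in `[a, (a + L)%R]) periodized x <= (2 * L)%:E * \int[mu]_x F x)%E.
Proof.
move=> L1; pose N := (Num.truncn L).+1.
have key (n : nat) : (\int[mu]_(x in `[a, (a + n%:R)%R[) periodized x = n%:R%:E * \int[mu]_x F x)%E.
  elim: n => [|n IH]; first by rewrite addr0 set_itv_ge ?integral_set0 ?mul0e// -leNgt bnd_simp.
  rewrite (@itv_bndbnd_setU _ _ (BLeft a) (BLeft (a + n%:R)) (BLeft (a + n.+1%:R))) ?bnd_simp ?lerDl ?lerD2l ?ler_nat//.
  rewrite ge0_integral_setU//=; last 3 first.
  - exact: measurable_funTS measurable_periodized.
  - by move=> x _; exact: periodized_ge0.
  - apply/disj_setPS => x /= [] /[!in_itv]/= /andP[_ h1] /andP[h2 _]; lra.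
  rewrite IH (_ : a + n.+1%:R = a + n%:R + 1) ?integral_periodized; last by rewrite -natr1 addrA.
  by rewrite -natr1 EFinD ge0_muleDl ?mul1e ?lee_fin.
apply: (@le_trans _ _ (\int[mu]_(x in `[a, (a + N%:R)%R[) periodized x)%E).
  apply: ge0_subset_integral => //.
  - exact: measurable_funTS measurable_periodized.
  - by move=> x _; exact: periodized_ge0.
  move=> x /=; rewrite !in_itv/= => /andP[-> h]/=; apply: (le_lt_trans h).
  by rewrite ltrD2l; exact: truncnS_gt.
rewrite key lee_wpmul2r ?integral_ge0// lee_fin /N -natr1 mulr_natl mulr2n lerD//.
by rewrite truncn_le// (le_trans _ L1).
Qed.

(** For [w] in [[W, 2 W]] the point [w y] sweeps an interval of length [W |y| >= 1] with speed
    [|y|], and over such an interval a periodic function is controlled by its mean over a period.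
    This replaces a pointwise bound on the periodization; for [|y| < 1 / W] less than a period is
    swept. *)
Lemma dilation_average W y : 0 < W -> W^-1 <= `|y| ->
  (\int[mu]_(w in `[W, (2 * W)%R]) periodized (w * y) <= (2 * W)%:E * \int[mu]_x F x)%E.
Proof.
move=> W0 yW; have y0 : 0 < `|y| by apply: lt_le_trans yW; rewrite invr_gt0.
have yn0 : y != 0 by rewrite -normr_gt0.
pose A := if 0 < y then W * y else 2 * W * y; pose L := W * `|y|.
have L1 : 1 <= L by rewrite /L -ler_pdivrMl// mulr1.
pose B := `[A, (A + L)]%classic : set R.
have := @ge0_integral_affine_in R periodized y 0 B yn0 (measurable_itv _)
  (measurable_funTS measurable_periodized) (fun x _ => periodized_ge0 x).
rewrite (_ : [set x | B _] = `[W, (2 * W)]%classic); last first.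
  apply/seteqP; split => x /=; rewrite /B/= !in_itv/= addr0 /A /L.
    case: ltP => yy; [rewrite (gtr0_norm yy)|rewrite (ler0_norm yy)].
      rewrite -mulrDl [y * x]mulrC !ler_pM2r// => /andP[-> h]/=; lra.
    have ny : 0 < - y by rewrite oppr_gt0 lt_neqAle yn0.
    move=> /andP[h1 h2]; apply/andP; split; rewrite -(ler_pM2r ny); lra.
  case: ltP => yy; [rewrite (gtr0_norm yy)|rewrite (ler0_norm yy)].
    rewrite -mulrDl [y * x]mulrC !ler_pM2r// => /andP[-> h]/=; lra.
  have ny : 0 < - y by rewrite oppr_gt0 lt_neqAle yn0.
  rewrite -(ler_pM2r ny) -[x <= _](ler_pM2r ny) => /andP[h1 h2]; apply/andP; split; lra.
under eq_integral do rewrite addr0 mulrC.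
move=> ->; have -> : (2 * W)%:E = ((`|y|^-1)%:E * (2 * L)%:E)%E.
  by rewrite -EFinM /L; congr (_%:E); field; rewrite gt_eqF.
by rewrite -muleA lee_wpmul2l ?lee_fin ?invr_ge0//; exact: integral_periodized_le.
Qed.

End dilation_average.

Section tonelli_in.
Context {R : realType}.
Local Notation mu := (@lebesgue_measure R).
Local Notation mR := (measurableTypeR R).

Lemma tonelli_in (K : mR * mR -> \bar R) (A B : set R) : measurable (A : set mR) -> measurable (B : set mR) ->
  measurable_fun [set: mR * mR] K -> (forall z, 0 <= K z)%E ->
  (\int[mu]_(x in A) \int[mu]_(y in B) K (x, y) = \int[mu]_(y in B) \int[mu]_(x in A) K (x, y))%E.
Proof.
move=> mA mB mK K0; pose K' := K \_ (A `*` B).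
have mK' : measurable_fun setT K'.
  by apply/(measurable_restrictT _ _).1; [exact: measurableX|exact: measurable_funTS].
have K'0 z : (0 <= K' z)%E by rewrite /K' /patch; case: ifP.
have K'E x y : K' (x, y) = if (x \in A) && (y \in B) then K (x, y) else 0%E.
  rewrite /K' /patch; congr (if _ then _ else _).
  by apply/idP/andP => [/set_mem[/= h1 h2]|[/set_mem h1 /set_mem h2]]; [split; exact: mem_set|exact: mem_set].
have := @fubini_tonelli _ _ mR mR R mu mu K' mK' K'0.
have -> : (\int[mu]_x \int[mu]_y K' (x, y) = \int[mu]_(x in A) \int[mu]_(y in B) K (x, y))%E.
  rewrite [RHS]integral_mkcond; apply: eq_integral => x _; rewrite /patch.
  case: ifPn => xA; last by rewrite integral0_eq// => y _; rewrite K'E (negbTE xA).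
  by rewrite [RHS]integral_mkcond; apply: eq_integral => y _; rewrite K'E xA /patch.
move=> ->; rewrite [RHS]integral_mkcond; apply: eq_integral => y _; rewrite /patch.
case: ifPn => yB; last by rewrite integral0_eq// => x _; rewrite K'E (negbTE yB) andbF.
by rewrite [RHS]integral_mkcond; apply: eq_integral => x _; rewrite K'E yB andbT /patch.
Qed.

End tonelli_in.

Section kernel_average.
Context {R : realType}.
Local Notation mu := (@lebesgue_measure R).
Local Notation mR := (measurableTypeR R).
Variables (r' : nat) (sg : R) (G : R -> R).
Local Notation r := r'.+1.
Hypotheses (GL : LI G) (GT : condition_Theta sg G) (sg1 : 1 < sg).
Let mG : measurable_fun [set: R] G. Proof. by case: GL. Qed.

(* [kmaj] majorizes the kernel values [Phi_(w s) (w x - k)], up to the factor [(w s)^(r-1) w]. *)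
Definition kmaj (s : R) (k : int) (w x : R) : \bar R :=
  (\int[mu]_(z in `[0%R, (r%:R * s)%R]) `|G (w * (x + z) - k%:~R)|%:E)%E.

Lemma kmaj_ge0 s k w x : (0 <= kmaj s k w x)%E.
Proof. exact: integral_ge0. Qed.

Lemma norm_Irn_kmaj s k w x : 0 <= s -> 0 < w ->
  (`|Irn r (w * s) G (w * x - k%:~R)|%:E <= ((w * s) ^+ r' * w)%:E * kmaj s k w x)%E.
Proof.
move=> s0 w0; have ws : 0 <= w * s by rewrite mulr_ge0// ltW.
apply: le_trans (norm_Irn_le r' _ ws GL) _.
rewrite EFinM -muleA lee_wpmul2l ?lee_fin ?exprn_ge0//.
have mGs : measurable_fun `[0, (r%:R * (w * s))] (fun z : R => `|G (w * x - k%:~R + z)|%:E).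
  by apply: mabsD; have [] := LI_shift (w * x - k%:~R) GL.
have p0 z : `[0, (r%:R * (w * s))]%classic z -> (0 <= `|G (w * x - k%:~R + z)|%:E)%E by rewrite lee_fin.
have := @ge0_integral_affine_in R (fun z => `|G (w * x - k%:~R + z)|%:E) w 0 `[0, (r%:R * (w * s))]%classic
  (lt0r_neq0 w0) (measurable_itv _) mGs p0.
rewrite (gtr0_norm w0) => H; apply/le_of_eq.
rewrite (_ : kmaj s k w x = \int[mu]_(x0 in [set x0 | `[0%R, (r%:R * (w * s))%R]%classic (w * x0 + 0)%R])
    `|G (w * x - k%:~R + (w * x0 + 0))|%:E)%E; last first.
  rewrite /kmaj (_ : [set x0 | `[0%R, (r%:R * (w * s))%R]%classic (w * x0 + 0)%R] = `[0%R, (r%:R * s)]%classic); last first.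
    by apply/seteqP; split => z /=; rewrite !in_itv/= addr0 pmulr_rge0// mulrCA ler_pM2l.
  by apply: eq_integral => z _; congr (`|G _|%:E); lra.
by rewrite H muleA -EFinM mulfV ?gt_eqF// mul1e.
Qed.

(** The threshold [(r + 1) / W] leaves [|x + z| >= 1 / W] for all [z] up to [r s <= r / W], so that
    dilations average over at least one period. *)
Lemma sum_kmaj_average W s x : 0 < W -> 0 <= s -> s <= W^-1 -> (r%:R + 1) / W <= `|x| ->
  (\int[mu]_(w in `[W, (2 * W)%R]) esZ (fun k => kmaj s k w x) <=
     (r%:R * s * (2 * W))%:E * \int[mu]_x `|G x|%:E)%E.
Proof.
move=> W0 s0 sW xW; pose P := periodized (fun u => `|G u|%:E).
have mabsG : measurable_fun [set: R] (fun u => `|G u|%:E) by exact: mabs.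
have mP : measurable_fun [set: R] P by exact: measurable_periodized.
have P0 y : (0 <= P y)%E by exact: periodized_ge0.
have mPwz : measurable_fun [set: mR * mR] (fun wz : mR * mR => P (wz.1 * (x + wz.2))).
  apply: (measurableT_comp mP); apply: measurable_funM; first exact: measurable_fst.
  by apply: measurable_funD => //; exact: measurable_snd.
have E1 (w : R) : esZ (fun k => kmaj s k w x) = (\int[mu]_(z in `[0%R, (r%:R * s)%R]) P (w * (x + z))%R)%E.
  rewrite /kmaj -(@integral_esZ _ mR R mu _ (fun k (z : mR) => `|G (w * (x + z) - k%:~R)|%:E))//.
  move=> k; apply: mabsD; apply: measurableT_comp => //; apply: measurable_funB => //.
  by apply: measurable_funM => //; exact: measurable_funD.
under eq_integral do rewrite E1.
rewrite (@tonelli_in R (fun wz : mR * mR => P (wz.1 * (x + wz.2))) `[W, (2 * W)%R]%classic `[0%R, (r%:R * s)%R]%classic)//=.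
apply: (@le_trans _ _ (\int[mu]_(z in `[0%R, (r%:R * s)%R]) cst ((2 * W)%:E * \int[mu]_x `|G x|%:E) z)%E).
  apply: ge0_le_integral => //.
  - by move=> z _; exact: integral_ge0.
  - apply: (@measurable_funS _ _ _ _ setT) => //.
    apply: (@measurable_param_integral R (fun zw : mR * mR => P (zw.2 * (x + zw.1)))) => //.
    apply: (measurableT_comp mP); apply: measurable_funM; first exact: measurable_snd.
    by apply: measurable_funD => //; exact: measurable_fst.
  move=> z; rewrite /= in_itv/= => /andP[z0 zs]; apply: dilation_average => //.
  have h : r%:R * s <= r%:R / W by rewrite ler_wpM2l.
  have : (r%:R + 1) / W <= `|x + z| + `|z| by rewrite (le_trans xW)// -{1}(addrK z x) ler_normB.
  rewrite (ger0_norm z0) mulrDl mul1r; lra.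
rewrite integral_cst//= lebesgue_measure_itv/= lte_fin.
have rs : 0 <= r%:R * s by rewrite mulr_ge0.
case: ifPn => h.
  by rewrite -EFinB subr0 muleC muleA -EFinM.
by rewrite mule0 mule_ge0 ?integral_ge0 ?lee_fin ?mulr_ge0// ltW.
Qed.

End kernel_average.

(** * Coefficients of the sampling operator *)

Section coefficients.
Context {R : realType}.
Local Notation mu := (@lebesgue_measure R).
Local Notation mR := (measurableTypeR R).
Variable psi : R -> R.
Hypothesis ipsi : integrableR psi.
Implicit Types (f g : R -> R) (w : R) (k : int).

Definition coef w f k := w * Rintegral mu setT (fun u => psi (w * u - k%:~R) * f u).
(** Recorded separately because [coef] is defined for every [f]: without integrability its value
    carries no information. *)
Definition icoef w f k := integrableR (fun u => psi (w * u - k%:~R) * f u).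

Lemma measurable_psi : measurable_fun [set: R] psi.
Proof. by have /integrableP[/measurable_EFinP] := ipsi. Qed.

Lemma measurable_psik w k : measurable_fun [set: R] (fun u => psi (w * u - k%:~R)).
Proof.
apply: measurableT_comp; first exact: measurable_psi.
exact: (measurable_affine w (- k%:~R)).
Qed.

Lemma integral_abs_psik w k : 0 < w ->
  (\int[mu]_u `|psi (w * u - k%:~R)|%:E = (w^-1)%:E * \int[mu]_u `|psi u|%:E)%E.
Proof.
move=> w0; rewrite (@ge0_integral_affine R (fun v => `|psi v|%:E) w (- k%:~R)) ?gt_eqF ?gtr0_norm//.
exact: mabs measurable_psi.
Qed.

Lemma integrable_shift (F : R -> R) c : integrableR F -> integrableR (fun u => F (u + c)).
Proof.
move=> /integrableP[/measurable_EFinP mF iF]; have mFc : measurable_fun [set: R] (fun u => F (u + c)).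
  by apply: measurableT_comp => //; exact: measurable_funD.
apply/integrableP; split; first exact/measurable_EFinP.
have := @ge0_integral_affine R (fun v => `|F v|%:E) 1 c (oner_neq0 _) (mabs mF).
rewrite normr1 invr1 mul1e => H; under eq_integral do rewrite /= -[u in u + c]mul1r.
by rewrite H.
Qed.

Lemma icoef_shift w f k : 0 < w -> icoef w f (k + 1) -> icoef w (fun u => f (u + w^-1)) k.
Proof.
move=> w0 /(integrable_shift w^-1); rewrite /icoef; congr integrableR; apply/funext => u.
by congr (psi _ * _); rewrite intrD; field; rewrite gt_eqF.
Qed.

Lemma coef_shift w f k : 0 < w -> measurable_fun [set: R] f ->
  coef w f (k + 1) = coef w (fun u => f (u + w^-1)) k.
Proof.
move=> w0 mf; rewrite /coef; congr (_ * _).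
have mF : measurable_fun [set: R] (fun u => psi (w * u - (k + 1)%:~R) * f u).
  by apply: measurable_funM => //; exact: measurable_psik.
have := @Rintegral_affine_in R _ 1 w^-1 setT (oner_neq0 _) measurableT mF.
rewrite normr1 invr1 mul1r => <-; rewrite (_ : [set x | setT _] = setT)//.
apply: eq_Rintegral => u _; rewrite mul1r; congr (psi _ * _).
by rewrite intrD; field; rewrite gt_eqF.
Qed.

Lemma icoefB w f g k : icoef w f k -> icoef w g k -> icoef w (fun u => f u - g u) k.
Proof.
move=> i1 i2; have := integrableB measurableT i1 i2; rewrite /icoef /integrableR.
by congr (_.-integrable _ _); apply/funext => u; rewrite /= -EFinB mulrBr.
Qed.

Lemma coefB w f g k : icoef w f k -> icoef w g k -> coef w (fun u => f u - g u) k = coef w f k - coef w g k.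
Proof.
move=> i1 i2; rewrite /coef -mulrBr -RintegralB//; congr (_ * _).
by apply: eq_Rintegral => u _; rewrite mulrBr.
Qed.

(** A shift of [k] by one amounts to a shift of [f] by [1 / w]. Integrability is required only at
    the nodes [k, ..., k + n], so that nodes with an undefined coefficient can be avoided. *)
Lemma iter_Dz_coef n w f k : 0 < w -> measurable_fun [set: R] f ->
  (forall j : nat, (j <= n)%N -> icoef w f (k + j%:Z)) ->
  icoef w (Dn n w^-1 f) k /\ iter n Dz (coef w f) k = coef w (Dn n w^-1 f) k.
Proof.
move=> w0 mf; elim: n k => [|n IH] k H; first by split => //; have := H 0%N (leqnn _); rewrite addr0.
have [i1 e1] : icoef w (Dn n w^-1 f) k /\ iter n Dz (coef w f) k = coef w (Dn n w^-1 f) k.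
  by apply: IH => j jn; apply: H; exact: leqW.
have [i2 e2] : icoef w (Dn n w^-1 f) (k + 1) /\ iter n Dz (coef w f) (k + 1) = coef w (Dn n w^-1 f) (k + 1).
  by apply: IH => j jn; rewrite -addrA; exact: (H j.+1).
have i3 := icoef_shift w0 i2; split; first exact: icoefB.
by rewrite iterS /Dz e1 e2 coef_shift//; [rewrite -coefB|exact: measurable_Dn].
Qed.

Lemma norm_coef_le w g k : 0 < w -> icoef w g k ->
  (`|coef w g k|%:E <= w%:E * \int[mu]_u (`|psi (w * u - k%:~R)| * `|g u|)%:E)%E.
Proof.
move=> w0 ig; rewrite /coef normrM gtr0_norm// EFinM lee_wpmul2l ?lee_fin ?(ltW w0)//.
have /integrableP[mg ig'] := ig.
have EI : (\int[mu]_u (`|psi (w * u - k%:~R)| * `|g u|)%:E =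
    (Rintegral mu setT (fun u => `|psi (w * u - k%:~R) * g u|))%:E)%E.
  rewrite /Rintegral fineK.
    by apply: eq_integral => u _; rewrite normrM.
  rewrite ge0_fin_numE ?integral_ge0//.
by rewrite EI lee_fin; exact: le_normr_Rintegral.
Qed.

Definition Kpsi := fine (\int[mu]_u `|psi u|%:E)%E.

Lemma KpsiE : (\int[mu]_u `|psi u|%:E = Kpsi%:E)%E.
Proof. by rewrite fineK// ge0_fin_numE ?integral_ge0//; have /integrableP[] := ipsi. Qed.

Lemma Kpsi_ge0 : 0 <= Kpsi.
Proof. by rewrite fine_ge0// integral_ge0. Qed.

Lemma icoef_bounded w f k M : 0 < w -> measurable_fun [set: R] f -> (forall u, `|f u| <= M) -> icoef w f k.
Proof.
move=> w0 mf fM; have M0 : 0 <= M by apply: le_trans (fM 0).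
have mm : measurable_fun [set: R] (fun u => psi (w * u - k%:~R) * f u).
  by apply: measurable_funM => //; exact: measurable_psik.
apply/integrableP; split; first exact/measurable_EFinP.
apply: (@le_lt_trans _ _ (\int[mu]_u (M%:E * `|psi (w * u - k%:~R)|%:E)))%E.
  apply: ge0_le_integral => //=.
  - exact: mabs mm.
  - by apply: measurable_funeM; apply: mabs; exact: measurable_psik.
  by move=> u _; rewrite -EFinM lee_fin normrM mulrC ler_wpM2r.
rewrite ge0_integralZl//; last by apply: mabs; exact: measurable_psik.
by rewrite integral_abs_psik// KpsiE -!EFinM ltry.
Qed.

Lemma coef_ae_bound w g k B : 0 < w -> measurable_fun [set: R] g -> 0 <= B -> icoef w g k ->
  {ae mu, forall u, `|g u| <= B} -> `|coef w g k| <= Kpsi * B.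
Proof.
move=> w0 mg B0 ig gB; rewrite -lee_fin; apply: le_trans (norm_coef_le w0 ig) _.
apply: (@le_trans _ _ (w%:E * \int[mu]_u (B%:E * `|psi (w * u - k%:~R)|%:E))%E).
  rewrite lee_wpmul2l ?lee_fin ?(ltW w0)//; apply: ae_ge0_le_integral => //.
  - apply/measurable_EFinP; apply: measurable_funM; apply: measurableT_comp => //; exact: measurable_psik.
  - by move=> u _; rewrite mule_ge0 ?lee_fin.
  - by apply: measurable_funeM; apply: mabs; exact: measurable_psik.
  by apply: aeS gB => u gu _; rewrite -EFinM lee_fin mulrC ler_wpM2r.
rewrite ge0_integralZl ?lee_fin//; last by apply: mabs; exact: measurable_psik.
rewrite integral_abs_psik// KpsiE -!EFinM lee_fin.
by rewrite (_ : w * _ = Kpsi * B)//; field; rewrite gt_eqF.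
Qed.

End coefficients.

Section kernel_representation.
Context {R : realType}.
Variables (r' : nat) (phi : R -> R) (g : nat -> R -> R) (th : R).
Local Notation r := r'.+1.
Hypotheses (hr : (1 <= r')%N) (hs : sobolev_rep r phi g) (hk : discrete_kernel phi)
  (hi : condition_i r phi) (hth : r.+1%:R < th)
  (hg : forall i, (1 <= i <= r)%N -> condition_Theta th (g i)).
Local Notation Gm := (Gam r' g).

Lemma th_gt1 : 1 < th - r%:R.
Proof. by move: hth; rewrite -natr1; lra. Qed.

Lemma Dn_Sop_kernel (c : int -> R) M w s x : (forall k, `|c k| <= M) -> 0 < w -> 0 <= s ->
  Dn r s (fun x => Sop c phi (w * x)) x = Sop (iter r Dz c) (Irn r (w * s) Gm) (w * x).
Proof.
move=> cM w0 s0; have ws : 0 <= w * s by rewrite mulr_ge0// ltW.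
have r0 : 0 <= r'%:R :> R := ler0n _ _.
have h1 : 0%:R + 1 < th - 1 by move: hth; rewrite -!natr1; lra.
have h2 : 0%:R + 1 < th - r%:R by rewrite add0r th_gt1.
have LP : LI phi := LI_phi hk.
rewrite -[LHS](_ : Dn r s (fun x => Sop c phi (w * x + 0)) x = _); last first.
  by apply: eq_Dn => y; rewrite addr0.
rewrite Dn_scale addr0 (Dn_Sop _ _ _ LP (Theta_phi hs hk hth hg) h1 (bounded_pgrow cM)).
rewrite (_ : Dn r (w * s) phi = Dn r 1 (Irn r (w * s) Gm)); last first.
  by apply/funext => y; rewrite -(Dn_Phi hs hk hi hth hg).
have LPh : LI (Irn r (w * s) Gm) := LI_Phi hs hth hg (w * s).
have TPh : condition_Theta (th - r%:R) (Irn r (w * s) Gm) := Theta_Phi hr hs hth hg ws.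
rewrite -(Dn_Sop _ _ _ LPh TPh h2 (bounded_pgrow cM)).
exact: Dn1_Sop LPh TPh h2 cM.
Qed.

End kernel_representation.

(** * Interpolation with powers and averaged differences *)

Section power_interpolation.
Context {R : realType}.
Implicit Types (p x y L D K : R).

(** For [y > L] write [y = y^(1-p) y^p] and use [1 - p <= 0]. The inequality is linear in [y^p], can
    be integrated against any weight, and after optimisation in [L] does the work of Jensen's
    inequality. *)
Lemma le_powR_interp p y L : 1 <= p -> 0 <= y -> 0 < L -> y <= L + L `^ (1 - p) * y `^ p.
Proof.
move=> p1 y0 L0; have [yL|Ly] := lerP y L.
  by apply: le_trans yL _; rewrite lerDl mulr_ge0 ?powR_ge0.
have y1 : 0 < y by exact: lt_trans Ly.
apply: (@le_trans _ _ (L `^ (1 - p) * y `^ p)); last by rewrite lerDr ltW.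
rewrite [X in X <= _](_ : y = y `^ (1 - p) * y `^ p); last first.
  by rewrite -powRD ?subrK ?powRr1 ?(ltW y1)// gt_eqF// implybT.
rewrite ler_wpM2r ?powR_ge0//.
have -> : 1 - p = - (p - 1) by rewrite opprB.
by apply: ler_powRN => //; [rewrite subr_ge0|exact: ltW].
Qed.

(* Take [L = D / (2 K)]. *)
Lemma powR_le_of_interp p D K (Q : \bar R) : 1 <= p -> 0 <= D -> 0 < K -> (0 <= Q)%E ->
  (forall L : R, 0 < L -> (D%:E <= (K * L)%:E + (L `^ (1 - p))%:E * Q)%E) ->
  ((D `^ p)%:E <= (2 * (2 * K) `^ (p - 1))%:E * Q)%E.
Proof.
move=> p1 D0 K0; have pn0 : p != 0 by rewrite gt_eqF// (lt_le_trans ltr01).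
have K20 : 0 < 2 * K by rewrite mulr_gt0.
have c0 : 0 < 2 * (2 * K) `^ (p - 1) by rewrite mulr_gt0// powR_gt0.
have [->|Dn0] := eqVneq D 0.
  by move=> Q0 _; rewrite powR0// mule_ge0// lee_fin ltW.
have D1 : 0 < D by rewrite lt_neqAle eq_sym Dn0.
case: Q => [q| |] //= Q0 H; last by rewrite gt0_muley ?leey// lte_fin.
have L0 : 0 < D / (2 * K) by rewrite divr_gt0.
have := H _ L0; rewrite -!EFinM -EFinD !lee_fin (_ : K * _ = D / 2); last by field; rewrite gt_eqF.
set l := _ `^ _ => hD; have {}hD : D / 2 <= l * q by move: hD; move: (l * q) => z; lra.
have lE : l = (2 * K) `^ (p - 1) / D `^ (p - 1).
  by rewrite /l -(opprB p) powRN powR_div ?(ltW D1)// ?(ltW K20)// invf_div.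
have DE : D `^ p = D * D `^ (p - 1).
  by rewrite -{2}(powRr1 D0) -powRD ?subrKC// Dn0 implybT.
have P0 : 0 < D `^ (p - 1) by rewrite powR_gt0.
rewrite DE -ler_pdivlMr// (_ : _ / _ = 2 * (l * q)); last by rewrite lE; field; rewrite gt_eqF.
by move: hD; move: (l * q) => z; lra.
Qed.

End power_interpolation.

Lemma bin_le_expn n m : ('C(n, m) <= 2 ^ n)%N.
Proof.
elim: n m => [|n IH] [|m] //; first by rewrite bin0 expn_gt0.
by rewrite binS expnS mul2n -addnn leq_add.
Qed.

Section kemperman.
Context {R : realType}.
Implicit Types (f : R -> R) (h s x : R) (r : nat).

(* Both double sums run over the same nodes [x + i h + i j s]. *)
Lemma kemperman_identity r h s f x :
  \sum_(i < r.+1) (-1) ^+ i * 'C(r, i)%:R * diffm r (i%:R * s) f (x + i%:R * h) =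
  \sum_(i < r.+1) (-1) ^+ i * 'C(r, i)%:R * diffm r (h + i%:R * s) f x.
Proof.
rewrite /diffm; under eq_bigr do rewrite big_distrr/=.
under [RHS]eq_bigr do rewrite big_distrr/=.
rewrite [RHS]exchange_big/=; apply: eq_bigr => i _; apply: eq_bigr => j _.
have sg (k l : 'I_r.+1) : (-1 : R) ^+ k * (-1) ^+ (r - l) = (-1) ^+ r * ((-1) ^+ k * (-1) ^+ l).
  rewrite mulrCA; congr (_ * _); apply: (@mulIf _ ((-1) ^+ l)); first by rewrite signr_eq0.
  by rewrite -exprD subnK -1?ltnS// -mulrA -expr2 sqrr_sign mulr1.
rewrite (_ : x + i%:R * h + j%:R * (i%:R * s) = x + i%:R * (h + j%:R * s)); last by ring.
have := sg i j; have := sg j i; move: ((-1) ^+ i) ((-1) ^+ j) ((-1) ^+ (r - i)) ((-1) ^+ (r - j)) ((-1) ^+ r).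
move=> a b c d e E1 E2; set F := f _; move: ('C(r, i)%:R) ('C(r, j)%:R) => u v.
have -> : a * u * (v * d * F) = (a * d) * (u * v * F) by ring.
have -> : b * v * (u * c * F) = (b * c) * (u * v * F) by ring.
by rewrite E1 E2 [b * a]mulrC.
Qed.

Lemma kemperman_le r h s f x : (0 < r)%N -> `|Dn r h f x| <=
  \sum_(i < r) 'C(r, i.+1)%:R * (`|Dn r (i.+1%:R * s) f (x + i.+1%:R * h)| + `|Dn r (h + i.+1%:R * s) f x|).
Proof.
move=> r0; have := kemperman_identity r h s f x; rewrite !big_ord_recl/= bin0 expr0 !mul1r !mul0r !addr0.
rewrite [diffm r 0 f x](_ : _ = 0); last first.
  by case: r r0 => // r _; rewrite diffmS addr0 subrr.
rewrite !diffmE add0r; set S1 := \sum_(_ < _) _; set S2 := \sum_(_ < _) _ => E.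
have -> : Dn r h f x = S1 - S2 by rewrite E addrK.
rewrite /S1 /S2 -sumrB; apply: le_trans (ler_norm_sum _ _ _) _; apply: ler_sum => i _.
rewrite !diffmE /bump/= !add1n -mulrBr !normrM normrX normrN1 expr1n mul1r ger0_norm//.
by rewrite ler_wpM2l// ler_normB.
Qed.

End kemperman.

Section averaged_differences.
Context {R : realType}.
Local Notation mu := (@lebesgue_measure R).
Local Notation mR := (measurableTypeR R).
Variables (r' : nat) (p W : R) (f : R -> R).
Local Notation r := r'.+1.
Hypotheses (p1 : 1 <= p) (W0 : 0 < W) (mf : measurable_fun [set: R] f).
Local Notation steps := (`[W^-1, ((2 * r%:R + 1) / W)]%classic : set R).

Lemma measurable_Dn2 : measurable_fun [set: mR * mR] (fun xs : mR * mR => Dn r xs.2 f xs.1).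
Proof.
have E : (fun xs : mR * mR => Dn r xs.2 f xs.1) =
    fun xs => \sum_(j < r.+1) 'C(r, j)%:R * (-1) ^+ (r - j) * f (xs.1 + j%:R * xs.2).
  by apply/funext => xs; rewrite -diffmE.
rewrite E; apply: measurable_sum => j; apply: measurable_funM => //.
apply: measurableT_comp => //; apply: measurable_funD; first exact: measurable_fst.
by apply: measurable_funM => //; exact: measurable_snd.
Qed.

Lemma measurable_Dn2_pow : measurable_fun [set: mR * mR] (fun xs : mR * mR => (`|Dn r xs.2 f xs.1| `^ p)%:E).
Proof.
apply/measurable_EFinP; apply: (measurableT_comp (measurable_powR p)).
by apply: measurableT_comp => //; exact: measurable_Dn2.
Qed.

(** The interval [steps] contains [i s] and [h + i s] for [s] in [[1/W, 2/W]], [1 <= i <= r] and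
    [0 <= h <= 1/W]. The density depends on [W] alone, so it stays fixed while [w] is averaged over
    [[W, 2 W]] and the step [1/w] varies. *)
Definition Qavg (u : R) : \bar R := (W%:E * \int[mu]_(s in steps) (`|Dn r s f u| `^ p)%:E)%E.

Lemma Qavg_ge0 u : (0 <= Qavg u)%E.
Proof. by rewrite mule_ge0 ?lee_fin ?(ltW W0)// integral_ge0// => s _; rewrite lee_fin powR_ge0. Qed.

Lemma measurable_Qavg : measurable_fun [set: R] Qavg.
Proof.
apply: measurable_funeM; apply: (@measurable_param_integral R (fun xs : mR * mR => (`|Dn r xs.2 f xs.1| `^ p)%:E)) => //.
exact: measurable_Dn2_pow.
Qed.

Lemma integral_Qavg A : 0 <= A -> (forall s, steps s -> bnd (Some p) setT (Dn r s f) A) ->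
  (\int[mu]_u Qavg u <= (2 * r%:R * A `^ p)%:E)%E.
Proof.
move=> A0 H; rewrite /Qavg ge0_integralZl//; last 3 first.
- apply: (@measurable_param_integral R (fun xs : mR * mR => (`|Dn r xs.2 f xs.1| `^ p)%:E)) => //.
  exact: measurable_Dn2_pow.
- by move=> u _; apply: integral_ge0 => s _; rewrite lee_fin powR_ge0.
- by rewrite lee_fin ltW.
rewrite (@tonelli_in R (fun xs : mR * mR => (`|Dn r xs.2 f xs.1| `^ p)%:E) setT)//; last exact: measurable_Dn2_pow.
apply: (@le_trans _ _ (W%:E * \int[mu]_(s in steps) cst (A `^ p)%:E s)%E).
  rewrite lee_wpmul2l ?lee_fin ?(ltW W0)//; apply: ge0_le_integral => //.
  - by move=> s _; apply: integral_ge0 => x _; rewrite lee_fin powR_ge0.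
  - apply: (@measurable_funS _ _ _ _ setT) => //.
    apply: (@measurable_param_integral R (fun xs : mR * mR => (`|Dn r xs.1 f xs.2| `^ p)%:E)) => //.
      have E : (fun xs : mR * mR => (`|Dn r xs.1 f xs.2| `^ p)%:E) =
        (fun xs : mR * mR => (`|Dn r xs.2 f xs.1| `^ p)%:E) \o (fun z => (z.2, z.1)) by apply/funext => -[].
      rewrite E; apply: measurableT_comp; first exact: measurable_Dn2_pow.
      by apply: measurable_fun_pair; [exact: measurable_snd|exact: measurable_fst].
rewrite integral_cst//= lebesgue_measure_itv/= lte_fin ltr_pdivlMr// mulVf ?gt_eqF//.
rewrite ltrDr mulr_gt0// -EFinB -!EFinM lee_fin; apply/le_of_eq.
by field; rewrite gt_eqF.
Qed.

(** The mean of [kemperman_le] over [s] in [[1/W, 2/W]], after each difference has been split by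
    [le_powR_interp]. *)
Lemma Dn_interp h L x : 0 <= h -> h <= W^-1 -> 0 < L ->
  (`|Dn r h f x|%:E <= (2 * 2 ^+ r * r%:R * L)%:E +
     (2 ^+ r * L `^ (1 - p))%:E * (\sum_(i < r) (Qavg (x + i.+1%:R * h) + Qavg x)))%E.
Proof.
move=> h0 hW L0; pose I := `[W^-1, (2 / W)]%classic : set R.
have Wi : 0 < W^-1 by rewrite invr_gt0.
have lI : mu I = (W^-1)%:E.
  rewrite lebesgue_measure_itv/= lte_fin ltr_pdivlMr// mulVf ?gt_eqF// ltrDl ltr01 -EFinB.
  by congr (_%:E); field; rewrite gt_eqF.
have cI (c : R) : (\int[mu]_(s in I) cst c%:E s = c%:E * (W^-1)%:E)%E.
  by rewrite -lI; apply: integral_cst; exact: measurable_itv.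
pose q s y := `|Dn r s f y| `^ p; have q0 s y : 0 <= q s y by rewrite powR_ge0.
have mq (c d y : R) : measurable_fun [set: R] (fun s => (q (c * s + d) y)%:E).
  have := measurable_Dn2_pow => H.
  apply: (measurableT_comp (f := fun xs : mR * mR => (`|Dn r xs.2 f xs.1| `^ p)%:E) (g := fun s => (y, c * s + d))) => //.
  by apply: measurable_fun_pair => //; exact: measurable_affine.
(* The substitution [s |-> i s + d] maps [I] into [steps], with Jacobian factor [1/i <= 1]. *)
have sub (i : nat) (d y : R) : (1 <= i <= r)%N -> 0 <= d <= W^-1 ->
    (W%:E * \int[mu]_(s in I) (q (i%:R * s + d) y)%:E <= Qavg y)%E.
  move=> /andP[i1 ir] /andP[d0 dW]; apply: lee_wpmul2l; first by rewrite lee_fin ltW.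
  have i0 : 0 < i%:R :> R by rewrite ltr0n.
  have i1R : 1 <= i%:R :> R by rewrite ler1n.
  have irR : i%:R <= r%:R :> R by rewrite ler_nat.
  have mq1 : measurable_fun `[W^-1, ((2 * r%:R + 1) / W)] (fun s : mR => (q s y)%:E).
    apply: (@measurable_funS _ _ _ _ setT) => //; have := mq 1 0 y.
    by apply: eq_measurable_fun => s _; rewrite mul1r addr0.
  have := @ge0_integral_affine_in R (fun s => (q s y)%:E) i%:R d `[W^-1, ((2 * r%:R + 1) / W)]%classic
    (lt0r_neq0 i0) (measurable_itv _) mq1 (fun s _ => q0 s y).
  rewrite (gtr0_norm i0) => H.
  pose J : set R := `[W^-1, ((2 * r%:R + 1) / W)]%classic; rewrite -/J in H *.
  apply: (@le_trans _ _ (\int[mu]_(s in [set s | J (i%:R * s + d)%R]) (q (i%:R * s + d) y)%:E)%E).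
    apply: ge0_subset_integral => //.
    - exact: measurable_itv.
    - rewrite -[X in measurable X]setTI; apply: (measurable_affine i%:R d measurableT); exact: measurable_itv.
    - exact: (measurable_funS _ _ (mq _ _ _)).
    - by move=> s _; rewrite lee_fin.
    move=> s /=; rewrite /I /J/= !in_itv/= => /andP[s1 s2]; apply/andP; split.
      by apply: (le_trans s1); rewrite -[s in s <= _]mul1r ler_wpDr// ler_wpM2r// (le_trans _ s1)// ltW.
    rewrite (mulrDl _ _ W^-1) mul1r lerD// (_ : _ / W = r%:R * (2 / W)); last by field; rewrite gt_eqF.
    by apply: ler_pM; rewrite ?ler0n// (le_trans _ s1)// ltW.
  rewrite H -[X in (_ <= X)%E]mul1e lee_wpmul2r ?lee_fin ?invf_le1//.
  by apply: integral_ge0 => s _; rewrite lee_fin.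
have step s : `|Dn r h f x| <= 2 * 2 ^+ r * r%:R * L +
    2 ^+ r * L `^ (1 - p) * \sum_(i < r) (q (i.+1%:R * s + 0) (x + i.+1%:R * h) + q (i.+1%:R * s + h) x).
  apply: le_trans (kemperman_le h s f x (ltn0Sn r')) _.
  rewrite (_ : 2 * 2 ^+ r * r%:R * L = \sum_(i < r) 2 ^+ r * (2 * L)); last first.
    by rewrite sumr_const card_ord -mulr_natl; ring.
  rewrite big_distrr/= -big_split/=; apply: ler_sum => i _; rewrite -mulrA -mulrDr.
  apply: ler_pM => //.
    by rewrite -natrX ler_nat bin_le_expn.
  rewrite addr0 [h + _]addrC (_ : 2 * L = L + L) ?mulr_natl// mulrDr addrACA.
  by apply: lerD; exact: le_powR_interp.
have : (`|Dn r h f x|%:E = W%:E * \int[mu]_(s in I) cst `|Dn r h f x|%:E s)%E.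
  by rewrite cI -!EFinM (mulrCA W) mulfV ?mulr1// gt_eqF.
move=> ->.
pose c1 := 2 * 2 ^+ r * r%:R * L; pose c2 := 2 ^+ r * L `^ (1 - p).
have c10 : 0 <= c1 by rewrite !mulr_ge0 ?exprn_ge0// ltW.
have c20 : 0 <= c2 by rewrite mulr_ge0 ?exprn_ge0 ?powR_ge0.
pose F (i : 'I_r) s := ((q (i.+1%:R * s + 0) (x + i.+1%:R * h))%:E + (q (i.+1%:R * s + h) x)%:E)%E.
have F0 i s : (0 <= F i s)%E by rewrite adde_ge0 ?lee_fin.
have mF i : measurable_fun (I : set mR) (F i).
  by apply: (@measurable_funS _ _ _ _ setT) => //; apply: emeasurable_funD; exact: mq.
have mS : measurable_fun (I : set mR) (fun s => \sum_(i < r) F i s)%E by exact: emeasurable_sum.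
have mI : measurable (I : set mR) by exact: measurable_itv.
have S0 s : (0 <= \sum_(i < r) F i s)%E by exact: sume_ge0.
apply: (@le_trans _ _ (W%:E * \int[mu]_(s in I) (cst c1%:E s + c2%:E * (\sum_(i < r) F i s)))%E).
  rewrite lee_wpmul2l ?lee_fin ?(ltW W0)//; apply: ge0_le_integral => //.
  - by move=> s _; rewrite /cst lee_fin.
  - by apply: emeasurable_funD => //; exact: measurable_funeM.
  by move=> s _; rewrite /cst /F sumEFin -EFinM -EFinD lee_fin; exact: step.
rewrite ge0_integralD//; last 2 first.
- by move=> s _; rewrite mule_ge0 ?lee_fin.
- exact: measurable_funeM.
rewrite cI ge0_integralZl// ge0_muleDr; last 2 first.
- by rewrite mule_ge0 ?lee_fin// ltW.
- by rewrite mule_ge0 ?lee_fin// integral_ge0.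
rewrite -!EFinM (mulrCA W) mulfV ?gt_eqF// mulr1; apply: leeD2l.
rewrite muleCA; apply: lee_wpmul2l; first by rewrite lee_fin.
rewrite ge0_integral_sum// ge0_sume_distrr; last by move=> i _; exact: integral_ge0.
apply: lee_sum => i _; rewrite ge0_integralD//; last 4 first.
- by move=> s _; rewrite lee_fin.
- exact: (measurable_funS _ _ (mq _ _ _)).
- by move=> s _; rewrite lee_fin.
- exact: (measurable_funS _ _ (mq _ _ _)).
rewrite ge0_muleDr; try by apply: integral_ge0 => s _; rewrite lee_fin.
by apply: leeD; apply: sub; rewrite ?ltn_ord ?lexx ?(ltW Wi)// ?h0.
Qed.

End averaged_differences.

Lemma esZZr {R : realType} (a : int -> \bar R) (x : \bar R) : (forall k, 0 <= a k)%E -> (0 <= x)%E ->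
  esZ (fun k => a k * x)%E = (esZ a * x)%E.
Proof.
move=> a0; case: x => [x| |] //= x0.
  by rewrite muleC -esZZl//; congr esZ; apply/funext => k; rewrite muleC.
have [a00|an0] := eqVneq (esZ a) 0%E.
  rewrite a00 mul0e; have ak k : a k = 0%E.
    by apply/eqP; rewrite eq_le a0 andbT -a00; exact: term_le_esZ.
  by rewrite -[RHS]a00; congr esZ; apply/funext => k; rewrite ak mul0e.
have a1 : (0 < esZ a)%E by rewrite lt_neqAle eq_sym an0 esZ_ge0.
rewrite gt0_muley//; apply/eqP; rewrite -leye_eq.
have [k ak] : exists k, (0 < a k)%E.
  apply: contrapT => H; move/eqP: an0; apply; apply/eqP; rewrite eq_le esZ_ge0// andbT.
  apply: esZ_le_sums => // s _; rewrite big1// => k _; apply/eqP; rewrite eq_le a0 andbT leNgt.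
  by apply/negP => ak; apply: H; exists k.
have := @term_le_esZ R (fun k => a k * +oo)%E k; rewrite gt0_muley//; apply => j.
by rewrite mule_ge0.
Qed.

(** * Averages of the coefficients over the frequency *)

Section sampling_averages.
Context {R : realType}.
Local Notation mu := (@lebesgue_measure R).
Local Notation mR := (measurableTypeR R).
Variables (psi : R -> R) (th : R).
Hypotheses (ipsi : integrableR psi) (psiT : condition_Theta th psi) (th1 : 1 < th).
Implicit Types (F : R -> \bar R) (w W : R) (k : int).
Let mpsi : measurable_fun [set: R] psi := measurable_psi ipsi.

Definition Zk F k w : \bar R := (w%:E * \int[mu]_u (`|psi (w * u - k%:~R)|%:E * F u))%E.

Definition Zout K F w : \bar R := esZ (fun k => if k \in ints K then 0%E else Zk F k w).

Section fixed_density.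
Variable F : R -> \bar R.
Hypotheses (mF : measurable_fun [set: R] F) (F0 : forall u, (0 <= F u)%E).

Lemma measurable_psik_mul k w : measurable_fun [set: R] (fun u => `|psi (w * u - k%:~R)|%:E * F u)%E.
Proof. by apply: emeasurable_funM => //; apply: mabs; exact: measurable_psik. Qed.

Let int0 k w u : (0 <= `|psi (w * u - k%:~R)|%:E * F u)%E.
Proof. by rewrite mule_ge0. Qed.

Lemma Zk_ge0 k w : 0 <= w -> (0 <= Zk F k w)%E.
Proof. by move=> w0; rewrite mule_ge0 ?lee_fin// integral_ge0. Qed.

Lemma Zout_ge0 K w : 0 <= w -> (0 <= Zout K F w)%E.
Proof. by move=> w0; apply: esZ_ge0 => k; case: ifP => // _; exact: Zk_ge0. Qed.

Lemma Zk_le_Zout K k w : 0 <= w -> k \notin ints K -> (Zk F k w <= Zout K F w)%E.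
Proof.
move=> w0 kK; have := @term_le_esZ R (fun k => if k \in ints K then 0%E else Zk F k w) k.
by rewrite (negbTE kK); apply => j; case: ifP => // _; exact: Zk_ge0.
Qed.

Lemma measurable_Zk k : measurable_fun [set: R] (Zk F k).
Proof.
apply: emeasurable_funM; first exact/measurable_EFinP.
apply: (@measurable_param_integral R (fun wu : mR * mR => `|psi (wu.1 * wu.2 - k%:~R)|%:E * F wu.2)%E) => //.
  apply: emeasurable_funM; last by apply: (measurableT_comp mF); exact: measurable_snd.
  apply/measurable_EFinP; apply: measurableT_comp => //; apply: (measurableT_comp mpsi).
  by apply: measurable_funB => //; apply: measurable_funM; [exact: measurable_fst|exact: measurable_snd].
Qed.

Lemma measurable_Zout K W : 0 <= W -> measurable_fun (`[W, (2 * W)]%classic : set mR) (Zout K F).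
Proof.
move=> W0; apply: measurable_esZ => [k w /=|k].
  by rewrite in_itv/= => /andP[/(le_trans W0) w0 _]; case: ifP => // _; exact: Zk_ge0.
by case: (k \in ints K) => //; apply: (@measurable_funS _ _ _ _ setT) => //; exact: measurable_Zk.
Qed.

Lemma Zk_shift (i : int) k w : 0 < w -> Zk (fun u => F (u + i%:~R / w)) k w = Zk F (k + i) w.
Proof.
move=> w0; rewrite /Zk; congr (_ * _)%E.
have := @ge0_integral_affine R (fun u => `|psi (w * u - (k + i)%:~R)|%:E * F u)%E 1 (i%:~R / w)
  (oner_neq0 _) (measurable_psik_mul _ _) (int0 _ _).
rewrite normr1 invr1 mul1e => <-; apply: eq_integral => u _; rewrite mul1r; congr (`|psi _|%:E * _)%E.
by rewrite intrD; field; rewrite gt_eqF.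
Qed.

Lemma Zk_sum_shifts n k w : 0 < w ->
  Zk (fun u => \sum_(i < n) (F (u + i.+1%:R * w^-1)%R + F u))%E k w =
  (\sum_(i < n) (Zk F (k + i.+1%:Z)%R w + Zk F k w))%E.
Proof.
move=> w0; have mFi (i : nat) : measurable_fun [set: R] (fun u : R => F (u + i.+1%:R * w^-1)).
  by apply: (measurableT_comp mF); exact: measurable_funD.
pose pk u := `|psi (w * u - k%:~R)|%:E.
have pk0 u : (0 <= pk u)%E by rewrite lee_fin.
have mpk (G : R -> \bar R) : measurable_fun [set: R] G -> measurable_fun [set: R] (fun u => pk u * G u)%E.
  by move=> mG; apply: emeasurable_funM => //; apply: mabs; exact: measurable_psik.
rewrite /Zk -/pk (_ : (\int[mu]_u _ = \sum_(i < n)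
   \int[mu]_u (pk u * F (u + i.+1%:R * w^-1)%R + pk u * F u))%E).
  rewrite ge0_sume_distrr; last by move=> i _; apply: integral_ge0 => u _; rewrite adde_ge0// mule_ge0.
  apply: eq_bigr => i _; rewrite ge0_integralD//.
  - rewrite ge0_muleDr; try by apply: integral_ge0 => u _; rewrite mule_ge0.
    by have := Zk_shift i.+1 k w0; rewrite /Zk => <-.
  - by move=> u _; rewrite mule_ge0.
  - by apply: mpk; exact: mFi.
  - by move=> u _; rewrite mule_ge0.
  - exact: mpk.
rewrite -ge0_integral_sum//; last 2 first.
- by move=> i; apply: emeasurable_funD; apply: mpk => //; exact: mFi.
- by move=> i u _; rewrite adde_ge0// mule_ge0.
apply: eq_integral => u _; rewrite ge0_sume_distrr; last by move=> i _; rewrite adde_ge0.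
by apply: eq_bigr => i _; rewrite ge0_muleDr.
Qed.

End fixed_density.

(** For [|u| >= 1 / W] the dilations average [psi] by [dilation_average]. For [|u| < 1 / W] and
    [w <= 2 W] the point [w u] stays in [[-2, 2]], where only the decay of [psi] helps, hence only
    for [k] outside the window [K] that [Theta_env] provides. *)
Lemma Zout_average : exists (K : nat) (C : R), 0 <= C /\ forall F W, measurable_fun [set: R] F ->
  (forall u, 0 <= F u)%E -> 0 < W ->
  (\int[mu]_(w in `[W, (2 * W)%R]) Zout K F w <= (C * W ^+ 2)%:E * \int[mu]_u F u)%E.
Proof.
have [|K [e [e0 eS Hpsi]]] := @Theta_env R th 0 psi 2 psiT; first by rewrite add0r.
pose E := fine (esZ (fun k => (e k)%:E)).
have EE : esZ (fun k => (e k)%:E) = E%:E.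
  by rewrite fineK// ge0_fin_numE//; apply: esZ_ge0 => k; rewrite lee_fin.
have E0 : 0 <= E by rewrite -lee_fin -EE; apply: esZ_ge0 => k; rewrite lee_fin.
pose P y := esZ (fun k => if k \in ints K then 0%E else `|psi (y - k%:~R)|%:E).
have P0 y : (0 <= P y)%E by apply: esZ_ge0 => k; case: ifP.
have mP : measurable_fun [set: R] P.
  apply: measurable_esZ => [k x _|k]; first by case: ifP.
  by case: (k \in ints K) => //; apply: mabs; apply: (measurableT_comp mpsi); exact: measurable_funB.
have PE y : `|y| <= 2 -> (P y <= E%:E)%E.
  move=> y2; rewrite -EE; apply: le_esZ => k; first by case: ifP.
  case: ifPn => [_|kK]; first by rewrite lee_fin.
  by rewrite lee_fin; have := Hpsi _ _ y2 kK; rewrite expr0 mulr1.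
have PP y : (P y <= periodized (fun u => `|psi u|%:E) y)%E.
  by apply: le_esZ => k; case: ifP.
have Pavg W u : 0 < W -> (\int[mu]_(w in `[W, (2 * W)%R]) P (w * u)%R <= ((2 * Kpsi psi + E) * W)%:E)%E.
  move=> W0; have K0 := Kpsi_ge0 psi.
  have mPu : measurable_fun (`[W, (2 * W)]%classic : set mR) (fun w : mR => P (w * u)).
    apply: (@measurable_funS _ _ _ _ setT) => //; apply: (measurableT_comp mP); exact: measurable_funM.
  have [uW|uW] := lerP W^-1 `|u|.
    apply: (@le_trans _ _ (\int[mu]_(w in `[W, (2 * W)%R]) periodized (fun u => `|psi u|%:E) (w * u)%R)%E).
      apply: ge0_le_integral => //.
      apply: (@measurable_funS _ _ _ _ setT) => //.
      by apply: (measurableT_comp (measurable_periodized (mabs mpsi) _)) => //; exact: measurable_funM.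
    apply: le_trans (dilation_average (mabs mpsi) _ W0 uW) _ => //.
    rewrite KpsiE// -EFinM lee_fin -mulrA [W * _]mulrC mulrA ler_wpM2r ?(ltW W0)//.
    by rewrite lerDl.
  apply: (@le_trans _ _ (\int[mu]_(w in `[W, (2 * W)%R]) cst E%:E w)%E).
    apply: ge0_le_integral => //.
    move=> w /=; rewrite in_itv/= => /andP[w1 w2]; apply: PE.
    have w0 : 0 < w by exact: lt_le_trans w1.
    rewrite normrM (gtr0_norm w0) (le_trans (ler_pM (ltW w0) _ w2 (ltW uW)))//.
    by rewrite mulfK// gt_eqF.
  rewrite integral_cst//= lebesgue_measure_itv/= lte_fin ltr_pMl// ltr1n -EFinB -EFinM lee_fin.
  by rewrite (_ : 2 * W - W = W) ?ler_wpM2r ?(ltW W0)// ?lerDr ?mulr_ge0//; ring.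
exists K, (2 * (2 * Kpsi psi + E)).
have K0 := Kpsi_ge0 psi.
have C0 : 0 <= 2 * (2 * Kpsi psi + E) by rewrite mulr_ge0// addr_ge0// mulr_ge0.
split => // F W mF F0 W0.
have ZE w : 0 <= w -> Zout K F w = (w%:E * \int[mu]_u (P (w * u)%R * F u))%E.
  move=> w0; rewrite (_ : (\int[mu]_u (P (w * u)%R * F u) =
      \int[mu]_u esZ (fun k => (if k \in ints K then 0 else `|psi (w * u - k%:~R)|%:E) * F u))%E); last first.
    by apply: eq_integral => u _; rewrite esZZr// => k; case: ifP.
  rewrite (@integral_esZ _ mR R mu setT (fun k (u : mR) => ((if k \in ints K then 0 else `|psi (w * u - k%:~R)|%:E) * F u)%E))//; last 2 first.
  - move=> k; case: (k \in ints K); last exact: measurable_psik_mul.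
    exact: measurable_funeM.
  - by move=> k u _; rewrite mule_ge0//; case: ifP.
  rewrite -esZZl//; last by move=> k; apply: integral_ge0 => u _; rewrite mule_ge0//; case: ifP.
  congr esZ; apply/funext => k; rewrite /Zk; case: (k \in ints K) => //.
  by under eq_integral do rewrite mul0e; rewrite integral0 mule0.
have mPw : measurable_fun [set: mR * mR] (fun wu : mR * mR => P (wu.1 * wu.2)%R * F wu.2)%E.
  apply: emeasurable_funM; last by apply: (measurableT_comp mF); exact: measurable_snd.
  by apply: (measurableT_comp mP); apply: measurable_funM; [exact: measurable_fst|exact: measurable_snd].
have PF0 (z : mR * mR) : (0 <= P (z.1 * z.2)%R * F z.2)%E by rewrite mule_ge0.
have mI : measurable_fun (`[W, (2 * W)]%classic : set mR) (fun w : mR => \int[mu]_u (P (w * u)%R * F u))%E.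
  apply: (@measurable_funS _ _ _ _ setT) => //.
  exact: (@measurable_param_integral R (fun wu : mR * mR => P (wu.1 * wu.2)%R * F wu.2)%E).
have I0 (w : R) : (0 <= \int[mu]_u (P (w * u)%R * F u))%E by apply: integral_ge0 => u _; rewrite mule_ge0.
apply: (@le_trans _ _ (\int[mu]_(w in `[W, (2 * W)%R]) ((2 * W)%:E * \int[mu]_u (P (w * u)%R * F u)))%E).
  apply: ge0_le_integral => //.
  - by move=> w /=; rewrite in_itv/= => /andP[w1 _]; apply: Zout_ge0 => //; exact: le_trans (ltW W0) w1.
  - exact: measurable_Zout (ltW W0).
  - exact: measurable_funeM.
  move=> w /=; rewrite in_itv/= => /andP[w1 w2]; rewrite ZE ?(le_trans (ltW W0))//.
  by rewrite lee_wpmul2r// lee_fin.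
rewrite ge0_integralZl//; last by rewrite lee_fin mulr_ge0// ltW.
rewrite (@tonelli_in R (fun wu : mR * mR => P (wu.1 * wu.2)%R * F wu.2)%E `[W, (2 * W)]%classic setT)//=.
rewrite (_ : 2 * _ * _ = 2 * W * ((2 * Kpsi psi + E) * W)); last by ring.
rewrite [(2 * W * _)%:E]EFinM -[X in (_ <= X)%E]muleA; apply: lee_wpmul2l; first by rewrite lee_fin mulr_ge0// ltW.
have c0 : 0 <= (2 * Kpsi psi + E) * W by rewrite mulr_ge0 ?(ltW W0)// addr_ge0// mulr_ge0.
rewrite -ge0_integralZl//; apply: ge0_le_integral => //.
- by move=> u _; apply: integral_ge0 => w _; rewrite mule_ge0.
- apply: (@measurable_param_integral R (fun uw : mR * mR => P (uw.2 * uw.1)%R * F uw.1)%E) => //.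
  apply: emeasurable_funM; last by apply: (measurableT_comp mF); exact: measurable_fst.
  by apply: (measurableT_comp mP); apply: measurable_funM; [exact: measurable_snd|exact: measurable_fst].
- by move=> z; rewrite mule_ge0.
- exact: measurable_funeM.
move=> u _; rewrite ge0_integralZr//; first by apply: lee_wpmul2r => //; exact: Pavg.
apply: (@measurable_funS _ _ _ _ setT) => //; apply: (measurableT_comp mP); exact: measurable_funM.
Qed.

Lemma coef_le_Zk F w (g : R -> R) k a b : 0 < w -> measurable_fun [set: R] F -> (forall u, 0 <= F u)%E ->
  measurable_fun [set: R] g -> 0 <= a -> 0 <= b -> (forall u, (`|g u|%:E <= a%:E + b%:E * F u)%E) ->
  (w%:E * \int[mu]_u (`|psi (w * u - k%:~R)| * `|g u|)%:E <= (a * Kpsi psi)%:E + b%:E * Zk F k w)%E.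
Proof.
move=> w0 mF F0 mg a0 b0 H.
have mk : measurable_fun [set: R] (fun u => `|psi (w * u - k%:~R)|%:E).
  by apply: mabs; exact: measurable_psik.
have m1 : measurable_fun [set: R] (fun u => a%:E * `|psi (w * u - k%:~R)|%:E)%E by exact: measurable_funeM.
have m3 : measurable_fun [set: R] (fun u => `|psi (w * u - k%:~R)|%:E * F u)%E by exact: emeasurable_funM.
have m2 : measurable_fun [set: R] (fun u => b%:E * (`|psi (w * u - k%:~R)|%:E * F u))%E by exact: measurable_funeM.
have p3 u : (0 <= `|psi (w * u - k%:~R)|%:E * F u)%E by rewrite mule_ge0.
apply: (@le_trans _ _ (w%:E * \int[mu]_u (a%:E * `|psi (w * u - k%:~R)|%:E + b%:E * (`|psi (w * u - k%:~R)|%:E * F u)))%E).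
  rewrite lee_wpmul2l ?lee_fin ?(ltW w0)//; apply: ge0_le_integral => //.
  - apply/measurable_EFinP; apply: measurable_funM; apply: measurableT_comp => //.
    exact: measurable_psik.
  - exact: emeasurable_funD.
  move=> u _; rewrite EFinM [X in (_ <= X + _)%E]muleC muleCA -ge0_muleDr ?mule_ge0 ?lee_fin//.
  by rewrite lee_wpmul2l.
rewrite ge0_integralD//; last 2 first.
- by move=> u _; rewrite mule_ge0 ?lee_fin.
- by move=> u _; rewrite mule_ge0 ?lee_fin.
rewrite ge0_integralZl// ge0_integralZl// integral_abs_psik// KpsiE// ge0_muleDr; last 2 first.
- by rewrite -!EFinM lee_fin !mulr_ge0 ?invr_ge0 ?(ltW w0) ?Kpsi_ge0.
- by rewrite mule_ge0 ?integral_ge0 ?lee_fin.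
rewrite -!EFinM muleCA; apply/le_of_eq; congr (_%:E + _)%E.
by field; rewrite gt_eqF.
Qed.

Section pth_power_density.
Variables (p : R) (f : R -> R) (K : nat).
Hypotheses (p1 : 1 <= p) (mf : measurable_fun [set: R] f).
Local Notation P := (fun u => (`|f u| `^ p)%:E).
Let mP : measurable_fun [set: R] P := measurable_normpow p mf.
Let P0 u : (0 <= P u)%E. Proof. by rewrite lee_fin powR_ge0. Qed.

Let fP u : (`|f u|%:E <= 1%:E + 1%:E * P u)%E.
Proof.
by rewrite -EFinM -EFinD lee_fin; have := @le_powR_interp R p `|f u| 1 p1 (normr_ge0 _) ltr01; rewrite powR1.
Qed.

Lemma icoef_Zout w k : 0 < w -> (Zout K P w < +oo)%E -> k \notin ints K -> icoef psi w f k.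
Proof.
move=> w0 Zw kK; have mm : measurable_fun [set: R] (fun u => psi (w * u - k%:~R) * f u).
  by apply: measurable_funM => //; exact: measurable_psik.
apply/integrableP; split; first exact/measurable_EFinP.
have H := coef_le_Zk k w0 mP P0 mf ler01 ler01 fP.
pose G := EFin \o (fun u : R => psi (w * u - k%:~R) * f u).
have h : (w%:E * \int[mu]_u `|G u| < +oo)%E.
  rewrite (_ : (\int[mu]_u `|G u| = \int[mu]_u (`|psi (w * u - k%:~R)| * `|f u|)%:E)%E); last first.
    by apply: eq_integral => u _; rewrite -normrM.
  apply: le_lt_trans H _; rewrite mul1e lte_add_pinfty ?ltry//.
  exact: le_lt_trans (Zk_le_Zout P0 (ltW w0) kK) Zw.
have : (0 <= \int[mu]_u `|G u|)%E by exact: integral_ge0.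
rewrite -/G; move: h; set I := (\int[mu]_u _)%E => h I0.
by move: I I0 h => [x _ _| |] //; rewrite ?ltry// gt0_muley ?lte_fin.
Qed.

(** The nodes of the window contribute finitely many numbers, which need not come from integrable
    products. *)
Lemma coef_bounded w : 0 < w -> (Zout K P w < +oo)%E -> exists M, forall k, `|coef psi w f k| <= M.
Proof.
move=> w0 Zw; pose z := fine (Zout K P w).
have Ez : Zout K P w = z%:E by rewrite fineK// ge0_fin_numE// Zout_ge0// ltW.
exists (Kpsi psi + z + \sum_(k <- ints K) `|coef psi w f k|) => k.
have z0 : 0 <= z by rewrite -lee_fin -Ez Zout_ge0// ltW.
have [kK|kK] := boolP (k \in ints K).
  apply: (@le_trans _ _ (\sum_(k <- ints K) `|coef psi w f k|)).
    by rewrite (big_rem k)//= lerDl sumr_ge0.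
  by rewrite lerDr addr_ge0// Kpsi_ge0.
apply: (@le_trans _ _ (Kpsi psi + z)); last by rewrite lerDl sumr_ge0.
rewrite -lee_fin; apply: le_trans (norm_coef_le w0 (icoef_Zout w0 Zw kK)) _.
apply: le_trans (coef_le_Zk k w0 mP P0 mf ler01 ler01 fP) _.
by rewrite mul1r mul1e EFinD leeD2l// -Ez Zk_le_Zout// ltW.
Qed.

End pth_power_density.

Section difference_coefficients.
Variables (r' : nat) (p W : R) (f : R -> R) (K : nat).
Local Notation r := r'.+1.
Hypotheses (p1 : 1 <= p) (W0 : 0 < W) (mf : measurable_fun [set: R] f).
Local Notation Q := (Qavg r' p W f).
Let mQ : measurable_fun [set: R] Q := measurable_Qavg r' p W mf.
Let Q0 : forall u, (0 <= Q u)%E := Qavg_ge0 r' p f W0.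

Definition Ymaj k w := (\sum_(i < r) (Zk Q (k + i.+1%:Z) w + Zk Q k w))%E.

Lemma Ymaj_ge0 k w : 0 <= w -> (0 <= Ymaj k w)%E.
Proof. by move=> w0; apply: sume_ge0 => i _; rewrite adde_ge0// Zk_ge0. Qed.

Lemma measurable_Ymaj k : measurable_fun [set: R] (Ymaj k).
Proof. by apply: emeasurable_sum => i; apply: emeasurable_funD; exact: measurable_Zk. Qed.

Let c1 := 2 * 2 ^+ r * r%:R * Kpsi psi + 1.
Definition Ccoef := 2 * (2 * c1) `^ (p - 1) * 2 ^+ r.

Lemma Ccoef_ge0 : 0 <= Ccoef.
Proof. by rewrite !mulr_ge0 ?powR_ge0 ?exprn_ge0. Qed.

(** The differenced coefficient is the coefficient of [Dn r w^-1 f]. The interpolated bound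
    [Dn_interp] is integrated against [|psi|] for every [L], and [L] is then eliminated by
    [powR_le_of_interp]. *)
Lemma coef_pow_le w k : W <= w ->
  (forall j : nat, (j <= r)%N -> icoef psi w f (k + j%:Z)) ->
  ((`|iter r Dz (coef psi w f) k| `^ p)%:E <= Ccoef%:E * Ymaj k w)%E.
Proof.
have c10 : 0 < c1 by rewrite ltr_wpDl// !mulr_ge0// ?exprn_ge0// Kpsi_ge0.
move=> Ww ik; have w0 : 0 < w by exact: lt_le_trans Ww.
have [i1 ->] := iter_Dz_coef ipsi w0 mf ik.
have Y0 := Ymaj_ge0 k (ltW w0).
rewrite /Ccoef EFinM -muleA; apply: powR_le_of_interp => //; first by rewrite mule_ge0// lee_fin exprn_ge0.
move=> L L0; apply: le_trans (norm_coef_le w0 i1) _.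
pose H (u : R) := (\sum_(i < r) (Q (u + i.+1%:R * w^-1) + Q u))%E.
have mQi (i : nat) : measurable_fun [set: R] (fun u : R => Q (u + i.+1%:R * w^-1)).
  by apply: (measurableT_comp mQ); exact: measurable_funD.
have mH : measurable_fun [set: R] H.
  by apply: emeasurable_sum => i; apply: emeasurable_funD; [exact: mQi|exact: mQ].
have H0 u : (0 <= H u)%E by apply: sume_ge0 => i _; rewrite adde_ge0.
have a0 : 0 <= 2 * 2 ^+ r * r%:R * L by rewrite !mulr_ge0// ?exprn_ge0// ltW.
have b0 : 0 <= 2 ^+ r * L `^ (1 - p) by rewrite mulr_ge0 ?exprn_ge0 ?powR_ge0.
have wW : w^-1 <= W^-1 by rewrite lef_pV2.
have iw : 0 <= w^-1 by rewrite invr_ge0 ltW.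
have D u := Dn_interp r' p1 W0 mf u iw wW L0.
apply: le_trans (coef_le_Zk k w0 mH H0 (measurable_Dn _ _ mf) a0 b0 D) _.
have EY : Zk H k w = Ymaj k w by exact: Zk_sum_shifts.
rewrite EY [(2 ^+ r * _)%:E]EFinM [X in (_ + X <= _)%E](_ : _ = (L `^ (1 - p))%:E * ((2 ^+ r)%:E * Ymaj k w))%E; last first.
  by rewrite muleA; congr (_ * _)%E; rewrite muleC.
apply: leeD2r; rewrite lee_fin.
rewrite (_ : c1 * L = 2 * 2 ^+ r * r%:R * L * Kpsi psi + L) ?lerDl ?(ltW L0)//.
by rewrite /c1; ring.
Qed.

(** [Ymaj k] involves the nodes [k, ..., k + r]; the window is enlarged by [r] so that all of them
    lie outside [ints K]. *)
Lemma sum_Ymaj_le w : 0 < w ->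
  (esZ (fun k => if k \in ints (K + r) then 0%E else Ymaj k w) <= (2 * r%:R)%:E * Zout K Q w)%E.
Proof.
move=> w0; pose z k := if k \in ints K then 0%E else Zk Q k w.
have z0 k : (0 <= z k)%E by rewrite /z; case: ifP => // _; apply: Zk_ge0 => //; exact: ltW.
apply: (@le_trans _ _ (esZ (fun k => \sum_(i < r) (z (k + i.+1%:Z)%R + z k))%E)).
  apply: le_esZ => k; first by case: ifP => // _; exact: Ymaj_ge0 (ltW w0).
  case: ifPn => [_|]; first by apply: sume_ge0 => i _; rewrite adde_ge0.
  rewrite mem_ints => kK; apply: lee_sum => i _; rewrite /z !mem_ints.
  have h1 : (`|(k + i.+1%:Z)%R| <= K)%N = false by move: (ltn_ord i) kK; clear; lia.
  have h2 : (`|k| <= K)%N = false by move: kK; clear; lia.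
  by rewrite h1 h2.
rewrite esZ_sum; last by move=> i k; rewrite adde_ge0.
rewrite (eq_bigr (fun=> 2%:E * esZ z)%E); last first.
  move=> i _; rewrite (esZD (fun k => z0 (k + i.+1%:Z)) z0) esZ_shift//.
  by rewrite (_ : 2 = 1 + 1 :> R)// EFinD ge0_muleDl ?mul1e// lee_fin.
rewrite -ge0_sume_distrl; last by move=> i _; rewrite lee_fin.
by rewrite sumEFin sumr_const card_ord mulr_natr.
Qed.

End difference_coefficients.

End sampling_averages.

(** * Coefficients at the nodes near the origin *)

Section translates_independent_ae.
Context {R : realType}.
Local Notation mu := (@lebesgue_measure R).

(* Where the relation holds along the whole coset [u + Z], the everywhere version applies. *)
Lemma translates_independent_ae L a (G : R -> R) : (exists2 j, (j <= L)%N & a j != 0) ->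
  (forall u, zdec (fun k => G (u + k%:~R))) ->
  {ae mu, forall u, \sum_(j < L.+1) a j * G (u + j%:R) = 0} -> {ae mu, forall u, G u = 0}.
Proof.
move=> aL Gd rG; pose good u := forall k : int, \sum_(j < L.+1) a j * G (u + k%:~R + j%:R) = 0.
have goodae : {ae mu, forall u, good u}.
  have : {ae mu, forall u, forall n, \sum_(j < L.+1) a j * G (u + (zen n)%:~R + j%:R) = 0}.
    by apply: ae_foralln => n; exact: (ae_shift (zen n)%:~R rG).
  by apply: aeS => u H k; have := H (zne k); rewrite zneK.
have goodZ u (n : int) : good (u + n%:~R) <-> good u.
  split=> H k; last by have := H (n + k); rewrite intrD addrA.
  have := H (k - n); rewrite (_ : u + n%:~R + (k - n)%:~R = u + k%:~R)//.
  by rewrite intrB; move: n%:~R k%:~R => x y; lra.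
pose G' u := if `[< good u >] then G u else 0.
suff H u : G' u = 0 by apply: aeS goodae => u gu; have := H u; rewrite /G' asboolT.
apply: (translates_independent aL) => {}u.
  rewrite /G' (_ : (fun k => _) = (fun k : int => if `[< good u >] then G (u + k%:~R) else 0)); last first.
    by apply/funext => k; congr (if _ then _ else _); apply: asbool_equiv_eq; exact: goodZ.
  by case: (`[< good u >]); [exact: Gd|split; exact: cvg_cst].
rewrite /G'; have [gu|ngu] := pselect (good u).
  rewrite -[RHS](gu 0) addr0; apply: eq_bigr => j _; rewrite asboolT//.
  exact/(goodZ u j%:Z).
rewrite big1// => j _; rewrite asboolF ?mulr0// => gu; apply: ngu; exact/(goodZ u j%:Z).
Qed.

End translates_independent_ae.

Section node_control.
Context {R : realType}.
Local Notation mu := (@lebesgue_measure R).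
Local Notation mR := (measurableTypeR R).
Variables (p sg : R) (P : R -> R) (E : R) (K : nat).
Hypotheses (p1 : 1 <= p) (PL : LI P) (PT : condition_Theta sg P) (sg1 : 1 < sg) (E0 : 0 <= E)
  (PE : forall u, (esZ (fun k => `|P (u - k%:~R)|%:E) <= E%:E)%E)
  (Pn0 : ~ {ae mu, forall u, P u = 0}).

Let s1 : 0%:R + 1 < sg. Proof. by rewrite add0r. Qed.
(** A Gaussian weight. It is integrable, so the weighted L^1 seminorm [q] is finite on bounded
    functions; it is bounded, so [q] is controlled by the L^p norm through interpolation; and it is
    positive, so [q] vanishes only when the combination is 0 almost everywhere. *)
Let om : R -> R := normal_pdf 0 1.
Let om_gt0 x : 0 < om x.
Proof. by rewrite /om normal_pdfE ?oner_eq0// mulr_gt0 ?expR_gt0// normal_peak_gt0 ?oner_eq0. Qed.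
Let om0 x : 0 <= om x. Proof. exact: ltW. Qed.
Let omM := @normal_peak R 1.
Let omM0 : 0 <= omM. Proof. exact: normal_peak_ge0. Qed.
Let om_le x : om x <= omM. Proof. by apply: normal_pdf_ub; rewrite oner_eq0. Qed.
Let mom : measurable_fun [set: R] om. Proof. exact: measurable_normal_pdf. Qed.
Let iom : (\int[mu]_x (om x)%:E = 1)%E. Proof. exact: integral_normal_pdf. Qed.
Let mP : measurable_fun [set: R] P. Proof. by case: PL. Qed.

Let d := K.*2.+1.
Let comb (x : 'rV[R]_d) u := \sum_(j < d) x 0 j * P (u - (j%:Z - K%:Z)%:~R).

Let integrable_om (G : R -> R) B : measurable_fun [set: R] G -> (forall u, `|G u| <= B) ->
  integrableR (fun u => om u * G u).
Proof.
move=> mG GB; apply/integrableP; split; first exact/measurable_EFinP/measurable_funM.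
apply: (@le_lt_trans _ _ (\int[mu]_u (B%:E * (om u)%:E)))%E.
  apply: ge0_le_integral => //.
  - by apply/measurable_EFinP; apply: measurableT_comp => //; exact: measurable_funM.
  - by apply: measurable_funeM; exact/measurable_EFinP.
  by move=> u _; rewrite -EFinM lee_fin normrM (ger0_norm (om0 u)) mulrC ler_wpM2r.
have B0 : 0 <= B by exact: le_trans (GB 0).
rewrite ge0_integralZl//; first by rewrite iom mule1 ltry.
  exact/measurable_EFinP.
by move=> u _; rewrite lee_fin.
Qed.

Let Pb u : `|P u| <= E.
Proof.
rewrite -lee_fin; apply: le_trans (PE u).
by have := @term_le_esZ R (fun k => `|P (u - k%:~R)|%:E) 0; rewrite subr0; apply => k; rewrite lee_fin.
Qed.

Let mcomb x : measurable_fun [set: R] (comb x).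
Proof.
apply: measurable_sum => j; apply: measurable_funM => //; apply: (measurableT_comp mP).
exact: measurable_funB.
Qed.

Let comb_bounded x u : `|comb x u| <= \sum_(j < d) `|x 0 j| * E.
Proof. by apply: le_trans (ler_norm_sum _ _ _) _; apply: ler_sum => j _; rewrite normrM ler_wpM2l. Qed.

Let q x := Rintegral mu setT (fun u => om u * `|comb x u|).

Let iq x : integrableR (fun u => om u * `|comb x u|).
Proof. by apply: integrable_om => [|u]; [exact: measurableT_comp|rewrite normr_id; exact: comb_bounded]. Qed.

Let qD x y : q (x + y) <= q x + q y.
Proof.
rewrite /q -(RintegralD measurableT (iq x) (iq y)); apply: (le_Rintegral measurableT (iq _)).
  exact: (integrableD measurableT (iq x) (iq y)).
move=> u _; rewrite -mulrDr ler_wpM2l//; apply: le_trans (ler_normD _ _); rewrite /comb -big_split/=.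
by under eq_bigr do rewrite mxE mulrDl.
Qed.

Let qZ a x : q (a *: x) = `|a| * q x.
Proof.
rewrite /q -(RintegralZl _ measurableT (iq x)); apply: eq_Rintegral => u _; rewrite mulrCA; congr (_ * _).
by rewrite -normrM /comb big_distrr/=; congr (`|_|); apply: eq_bigr => j _; rewrite mxE mulrA.
Qed.

Let zdecP u : zdec (fun k => P (- (u + k%:~R))).
Proof.
have p0 : pgrow 0 (fun=> 1 : R) by apply: (@bounded_pgrow _ _ 1) => k; rewrite normr1.
have sP := Sop_summ (- u) PL PT s1 p0.
rewrite (_ : (fun k => _) = (fun k : int => P (- u - k%:~R) * 1)); last first.
  by apply/funext => k; rewrite mulr1 opprD.
by split; [exact: (summZ_cvgr sP)|exact: (summZ_cvgl sP)].
Qed.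

Let q0 x : q x = 0 -> x = 0.
Proof.
move=> qx; apply/rowP => j; rewrite mxE; apply/eqP; apply: contraT => xj; exfalso; apply: Pn0.
have H0 : {ae mu, forall u, comb x u = 0}.
  have mI : measurable_fun [set: R] (fun u => (om u * `|comb x u|)%:E).
    by apply/measurable_EFinP; apply: measurable_funM => //; exact: measurableT_comp.
  have := (@ae_eq_integral_abs _ _ R mu setT measurableT (fun u => (om u * `|comb x u|)%:E) mI).1.
  have -> : (\int[mu]_u `|(om u * `|comb x u|)%:E| = 0)%E.
    rewrite (_ : (\int[mu]_u _ = \int[mu]_u (om u * `|comb x u|)%:E)%E); last first.
      by apply: eq_integral => u _; rewrite gee0_abs// lee_fin mulr_ge0.
    have /integrableP[_ fin] := iq x.
    have f0 : (0 <= \int[mu]_u (om u * `|comb x u|)%:E)%E.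
      by apply: integral_ge0 => u _; rewrite lee_fin mulr_ge0.
    rewrite -[LHS]fineK; first by rewrite -[fine _]/(q x) qx.
    rewrite ge0_fin_numE//; apply: le_lt_trans fin; apply/le_of_eq; apply: eq_integral => u _ /=.
    by congr (_%:E); apply/esym/ger0_norm; rewrite mulr_ge0.
  move=> /(_ erefl); apply: aeS => u /(_ Logic.I) [] /eqP.
  by rewrite mulf_eq0 gt_eqF//= normr_eq0 => /eqP.
have H1 : {ae mu, forall u, \sum_(i < K.*2.+1) x 0 i * P (- (u + i%:R)) = 0}.
  have m1 : -1 != 0 :> R by rewrite oppr_eq0 oner_eq0.
  have := ae_affine (- K%:R) m1 H0; apply: aeS => u H; rewrite -[RHS]H; apply: eq_bigr => i _; congr (_ * P _).
  by rewrite intrB -!pmulrn; lra.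
have aE : exists2 i, (i <= K.*2)%N & (fun n => x 0 (inord n)) i != 0.
  by exists j; [rewrite -ltnS|rewrite inord_val].
have := @translates_independent_ae R K.*2 (fun n => x 0 (inord n)) (fun u => P (- u)) aE zdecP _.
have m1 : -1 != 0 :> R by rewrite oppr_eq0 oner_eq0.
move=> H; have : {ae mu, forall u, P (- u) = 0}.
  by apply: H; apply: aeS H1 => u H1u; rewrite -[RHS]H1u; apply: eq_bigr => i _; rewrite inord_val.
by move=> /(ae_affine 0 m1); apply: aeS => u H2; rewrite -[RHS]H2; congr P; lra.
Qed.

(** The [2 K + 1] translates of [P] in the window are linearly independent, so their coefficients
    are bounded by the weighted norm [q] of the combination. This combination is [Sop b P] minus the
    contribution of the other nodes, which is at most [S E] everywhere. *)
Lemma node_control : exists C, 0 <= C /\ forall (b : int -> R) B S, (exists M, forall k, `|b k| <= M) ->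
  0 < B -> 0 <= S -> (forall k, k \notin ints K -> `|b k| <= S) -> bnd (Some p) setT (Sop b P) B ->
  forall k, `|b k| <= C * (B + S).
Proof.
have [C [C0 HC]] := norm_coord_le qD qZ q0.
have E1 : 0 <= C * (1 + omM + E) by rewrite mulr_ge0// !addr_ge0.
exists (C * (1 + omM + E) + 1); split; first by rewrite addr_ge0.
move=> b B S [M bM] B0 S0 bS bndb k.
have [kK|kK] := boolP (k \in ints K); last first.
  apply: le_trans (bS k kK) _; rewrite mulrDl mul1r.
  have BS : 0 <= B + S by rewrite addr_ge0// ltW.
  by have := mulr_ge0 E1 BS; lra.
pose x : 'rV[R]_d := \row_j b (j%:Z - K%:Z).
have xk : b k = x 0 (inord `|(k + K%:Z)%R|%N).
  by have [kd kE] := ints_index kK; rewrite mxE inordK ?kE.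
pose b1 k := if k \in ints K then b k else 0; pose b2 k := if k \in ints K then 0 else b k.
have cE u : comb x u = Sop b P u - Sop b2 P u.
  have pg1 : pgrow 0 b1.
    apply: (@bounded_pgrow _ b1 `|M|) => j; rewrite /b1; case: ifP => _; last by rewrite normr0.
    exact: le_trans (bM j) (ler_norm _).
  have pg2 : pgrow 0 b2.
    apply: (@bounded_pgrow _ b2 `|M|) => j; rewrite /b2; case: ifP => _; first by rewrite normr0.
    exact: le_trans (bM j) (ler_norm _).
  have -> : Sop b P u = Sop (fun k => b1 k + b2 k) P u.
    by apply: eq_zsum => j; rewrite /b1 /b2; case: ifP; rewrite ?addr0 ?add0r.
  rewrite (SopD u PL PT s1 pg1 pg2) addrK (@Sop_fin _ b1 P u K); last by move=> j; rewrite /b1 => /negbTE->.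
  apply: eq_bigr => j _; rewrite mxE /b1; case: ifPn => //; rewrite mem_ints => /negP[].
  by move: (ltn_ord j); rewrite /d; clear; lia.
have S2 u : `|Sop b2 P u| <= S * E.
  rewrite -lee_fin EFinM.
  apply: (@le_trans _ _ (S%:E * esZ (fun k => `|P (u - k%:~R)|%:E))%E); last by rewrite lee_wpmul2l// lee_fin.
  by apply: le_norm_Sop => // j; rewrite /b2; case: ifPn => [_|/bS//]; rewrite normr0.
have [mS _] := LI_Sop PL PT s1 (bounded_pgrow bM).
have qx : q x <= B * (1 + omM) + S * E.
  have B1 : 0 <= B + S * E by rewrite addr_ge0 ?mulr_ge0// ltW.
  have c2 : 0 <= B `^ (1 - p) * omM by rewrite mulr_ge0 ?powR_ge0.
  rewrite -lee_fin /q /Rintegral fineK; last first.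
    have /integrableP[_ fin] := iq x; rewrite ge0_fin_numE; last by apply: integral_ge0 => u _; rewrite lee_fin mulr_ge0.
    apply: le_lt_trans fin; apply/le_of_eq; apply: eq_integral => u _ /=.
    by congr (_%:E); apply/esym/ger0_norm; rewrite mulr_ge0.
  apply: (@le_trans _ _ (\int[mu]_u ((B + S * E)%:E * (om u)%:E + (B `^ (1 - p) * omM)%:E * (`|Sop b P u| `^ p)%:E))%E).
    apply: ge0_le_integral => //.
    - by move=> u _; rewrite lee_fin mulr_ge0.
    - by have /integrableP[m _] := iq x.
    - apply: emeasurable_funD; apply: measurable_funeM; first exact/measurable_EFinP.
      exact: measurable_normpow.
    move=> u _; rewrite -!EFinM -EFinD lee_fin cE.
    have h1 : `|Sop b P u - Sop b2 P u| <= B + B `^ (1 - p) * `|Sop b P u| `^ p + S * E.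
      by apply: le_trans (ler_normB _ _) _; apply: lerD => //; exact: le_powR_interp.
    apply: le_trans (ler_wpM2l (om0 u) h1) _.
    have h2 : om u * (B `^ (1 - p) * `|Sop b P u| `^ p) <= omM * (B `^ (1 - p) * `|Sop b P u| `^ p).
      by rewrite ler_wpM2r// mulr_ge0 ?powR_ge0.
    move: h2; rewrite !mulrDr mulrDl; move: (_ `^ _) (_ `^ _) => y z; lra.
  rewrite ge0_integralD//; last 4 first.
  - by move=> u _; rewrite -EFinM lee_fin mulr_ge0.
  - by apply: measurable_funeM; exact/measurable_EFinP.
  - by move=> u _; rewrite -EFinM lee_fin mulr_ge0 ?powR_ge0.
  - by apply: measurable_funeM; exact: measurable_normpow.
  have -> : (\int[mu]_u ((B + S * E)%:E * (om u)%:E) = (B + S * E)%:E)%E.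
    rewrite ge0_integralZl//; first by rewrite iom mule1.
      exact/measurable_EFinP.
    by move=> u _; rewrite lee_fin.
  rewrite ge0_integralZl//; last exact: measurable_normpow.
  apply: (@le_trans _ _ ((B + S * E)%:E + (B `^ (1 - p) * omM)%:E * (B `^ p)%:E)%E).
    by rewrite leeD2l// lee_wpmul2l// lee_fin.
  rewrite -EFinM -EFinD lee_fin (_ : B `^ (1 - p) * omM * B `^ p = omM * B); first by lra.
  rewrite mulrAC -powRD ?subrK ?powRr1 ?(ltW B0)// 1?mulrC//.
  by rewrite (gt_eqF B0) implybT.
rewrite xk; apply: le_trans (HC x _) _; apply: le_trans (ler_wpM2l C0 qx) _.
have t1 : 0 <= C * (omM * S) by rewrite !mulr_ge0.
have t2 : 0 <= C * (B * E) by rewrite !mulr_ge0// ltW.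
have t3 : 0 <= C * S by rewrite mulr_ge0.
by move: t1 t2 t3; rewrite !mulrDr !mulrDl; lra.
Qed.

End node_control.

Lemma ae_ex {R : realType} (P : R -> Prop) (a b : R) : a < b ->
  {ae @lebesgue_measure R, forall x, P x} -> exists x, a <= x <= b /\ P x.
Proof.
move=> ab [N [mN N0 NP]]; apply: contrapT => H.
have : (@lebesgue_measure R `[a, b]%classic <= @lebesgue_measure R N)%E.
  apply: le_measure; rewrite ?inE//.
  by move=> x /=; rewrite in_itv/= => xab; apply: NP => Px; apply: H; exists x.
by rewrite N0 lebesgue_measure_itv/= lte_fin ab -EFinB lee_fin subr_le0 leNgt ab.
Qed.

Section powers.
Context {R : realType}.
Implicit Types (p x y : R).

Lemma le_powR_root p x y : 0 < p -> 0 <= x -> x `^ p <= y -> x <= y `^ p^-1.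
Proof.
move=> p0 x0 H; have xp : 0 <= x `^ p by exact: powR_ge0.
rewrite -[x in x <= _]powRr1// -(mulfV (lt0r_neq0 p0)) powRrM.
by apply: ge0_ler_powR => //; rewrite ?nnegrE ?invr_ge0 ?(ltW p0)// (le_trans xp).
Qed.

Lemma powR_root p y : 0 < p -> 0 <= y -> (y `^ p^-1) `^ p = y.
Proof. by move=> p0 y0; rewrite -powRrM mulVf ?powRr1// gt_eqF. Qed.

Lemma powRD_le p x y : 0 <= p -> 0 <= x -> 0 <= y -> (x + y) `^ p <= 2 `^ p * (x `^ p + y `^ p).
Proof.
move=> p0 x0 y0; wlog xy : x y x0 y0 / x <= y.
  move=> H; have [xy|/ltW yx] := lerP x y; first exact: H.
  by rewrite addrC [x `^ p + _]addrC; exact: H.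
apply: (@le_trans _ _ ((2 * y) `^ p)).
  by apply: ge0_ler_powR => //; rewrite ?nnegrE ?addr_ge0 ?mulr_ge0//; lra.
by rewrite powRM// ler_wpM2l ?powR_ge0// lerDr powR_ge0.
Qed.

End powers.

Lemma sume_const_seq {R : realType} (T : Type) (s : seq T) (x : \bar R) : (0 <= x)%E ->
  (\sum_(k <- s) x = (size s)%:R%:E * x)%E.
Proof.
move=> x0; elim: s => [|k s IH]; first by rewrite big_nil mul0e.
by rewrite big_cons IH /= -natr1 EFinD ge0_muleDl ?lee_fin// mul1e addeC.
Qed.

Section norms_of_differences.
Context {R : realType}.
Local Notation mu := (@lebesgue_measure R).
Variable pm : option R.
Hypothesis pm_ge1 : if pm is Some p then 1 <= p else true.

Lemma bnd_shift (G : R -> R) (c B : R) : measurable_fun [set: R] G -> 0 <= B ->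
  bnd pm setT G B -> bnd pm setT (fun x => G (x + c)) B.
Proof.
move=> mG B0 /(bnd_affine pm_ge1 c ltr01 measurableT mG B0); rewrite powR1 mulr1.
rewrite (_ : [set x | setT _] = setT)//; by under eq_fun do rewrite mul1r.
Qed.

Lemma bnd_dilate (G : R -> R) (c B : R) : 0 < c -> measurable_fun [set: R] G -> 0 <= B ->
  bnd pm setT (fun x => G (c * x)) B -> bnd pm setT G (B * c `^ ep pm).
Proof.
move=> c0 mG B0; have ci : 0 < c^-1 by rewrite invr_gt0.
have mGc : measurable_fun [set: R] (fun x => G (c * x)) by apply: (measurableT_comp mG); exact: measurable_funM.
move=> /(bnd_affine pm_ge1 0 ci measurableT mGc B0).
have -> : c^-1 `^ (- ep pm) = c `^ ep pm by rewrite -powR_inv1 ?(ltW c0)// -powRrM mulrNN mul1r.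
rewrite (_ : [set x | setT _] = setT)// (_ : (fun x => _) = G)//.
by apply/funext => x; rewrite addr0 mulrA mulfV ?mul1r ?gt_eqF.
Qed.

Lemma bnd_Dn n s (h : R -> R) (B : R) : measurable_fun [set: R] h -> 0 <= B ->
  bnd pm setT h B -> bnd pm setT (Dn n s h) (2 ^+ n * B).
Proof.
move=> mh B0 hB; elim: n => [|n IH]; first by rewrite expr0 mul1r.
have B1 : 0 <= 2 ^+ n * B by rewrite mulr_ge0 ?exprn_ge0.
have mD := measurable_Dn n s mh.
have mDs : measurable_fun [set: R] (fun x => Dn n s h (x + s)).
  by apply: (measurableT_comp mD); exact: measurable_funD.
have := bndB pm_ge1 measurableT mDs mD B1 B1 (bnd_shift s mD B1 IH) IH.
by rewrite exprS -mulrA mulr_natl mulr2n.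
Qed.

End norms_of_differences.

Section rate_representation.
Context {R : realType}.
Local Notation mu := (@lebesgue_measure R).
Variables (pm : option R) (r' : nat) (phi psi : R -> R) (g : nat -> R -> R) (th : R) (f : R -> R).
Local Notation r := r'.+1.
Hypotheses (pm_ge1 : if pm is Some p then 1 <= p else true)
  (hr : (1 <= r')%N) (hs : sobolev_rep r phi g) (hk : discrete_kernel phi)
  (hi : condition_i r phi) (hth : r.+1%:R < th)
  (hg : forall i, (1 <= i <= r)%N -> condition_Theta th (g i)) (mf : measurable_fun [set: R] f).
Local Notation Gm := (Gam r' g).

Let h1 : 0%:R + 1 < th - 1.
Proof. by move: hth; rewrite -!natr1; have := ler0n R r'; lra. Qed.

Lemma measurable_durrmeyer w : (exists M, forall k, `|coef psi w f k| <= M) ->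
  measurable_fun [set: R] (durrmeyer phi psi f w).
Proof.
move=> [M cM]; have [mS _] := LI_Sop (LI_phi hk) (Theta_phi hs hk hth hg) h1 (bounded_pgrow cM).
by apply: (measurableT_comp mS); exact: measurable_funM.
Qed.

(** The discrepancy is exactly the r-th difference of the approximation error. Bounded coefficients
    are enough, whether or not each of them comes from an integrable product. *)
Lemma representation_identity w s x : 0 < w -> 0 <= s -> (exists M, forall k, `|coef psi w f k| <= M) ->
  Dn r s f x - Sop (iter r Dz (coef psi w f)) (Irn r (w * s) Gm) (w * x) =
  - Dn r s (fun x => durrmeyer phi psi f w x - f x) x.
Proof.
move=> w0 s0 [M cM].
apply/esym; rewrite DnD -(Dn_Sop_kernel hr hs hk hi hth hg x cM w0 s0) opprD addrC; congr (_ + _).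
have -> : Dn r s (fun y => - f y) x = - Dn r s f x.
  by rewrite -[RHS]mulN1r -DnZ; apply: eq_Dn => y; rewrite mulN1r.
by rewrite opprK.
Qed.

Lemma representation_of_rate w s B : 0 < w -> 0 <= s -> 0 <= B ->
  (exists M, forall k, `|coef psi w f k| <= M) ->
  bnd pm setT (fun x => durrmeyer phi psi f w x - f x) B ->
  bnd pm setT (fun x => Dn r s f x - Sop (iter r Dz (coef psi w f)) (Irn r (w * s) Gm) (w * x)) (2 ^+ r * B).
Proof.
move=> w0 s0 B0 cM HB.
have mh : measurable_fun [set: R] (fun x => durrmeyer phi psi f w x - f x).
  by apply: measurable_funB => //; exact: measurable_durrmeyer.
have := bndN (bnd_Dn pm_ge1 r s mh B0 HB); congr (bnd pm setT _ _); apply/funext => x.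
by rewrite representation_identity.
Qed.

End rate_representation.

Section coefficient_majorants.
Context {R : realType}.
Local Notation mu := (@lebesgue_measure R).
Local Notation mR := (measurableTypeR R).
Variables (r' : nat) (phi psi : R -> R) (g : nat -> R -> R) (p th al M w0 : R) (f a : R -> R) (K : nat) (CZ : R).
Local Notation r := r'.+1.
Hypotheses (p1 : 1 <= p) (hr : (1 <= r')%N) (hs : sobolev_rep r phi g) (hk : discrete_kernel phi)
  (hi : condition_i r phi) (hth : r.+1%:R < th)
  (hg : forall i, (1 <= i <= r)%N -> condition_Theta th (g i)) (mf : measurable_fun [set: R] f)
  (ipsi : integrableR psi) (al0 : 0 < al) (M0 : 0 <= M) (w00 : 0 < w0)
  (rate : forall w, w0 <= w -> bnd (Some p) setT (fun x => durrmeyer phi psi f w x - f x) (M * w `^ (- al)))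
  (ab : forall s, 0 < s -> bnd (Some p) setT (Dn r s f) (a s))
  (a0 : forall s, 0 < s -> 0 <= a s) (CZ0 : 0 <= CZ)
  (Zavg : forall F W, measurable_fun [set: R] F -> (forall u, 0 <= F u)%E -> 0 < W ->
    (\int[mu]_(w in `[W, (2 * W)%R]) Zout psi K F w <= (CZ * W ^+ 2)%:E * \int[mu]_u F u)%E).
Local Notation Gm := (Gam r' g).
Local Notation b w := (iter r Dz (coef psi w f)).
Local Notation Good w := (Zout psi K (fun u => (`|f u| `^ p)%:E) w < +oo)%E.

Let sg1 : 1 < th - r%:R := th_gt1 hth.
Let Ph1 := Irn r 1 Gm.

(** The r-th unit difference of [Ph1] is that of [phi]. If it vanished, independence of translates
    with binomial coefficients would give [phi = 0] almost everywhere, hence on a whole coset of the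
    integers, against the partition of unity. *)
Let Ph1_n0 : ~ {ae mu, forall u, Ph1 u = 0}.
Proof.
move=> P0; have D0 : {ae mu, forall u, Dn r 1 phi u = 0}.
  have : {ae mu, forall u, Dn r 1 Ph1 u = Dn r 1 (fun=> 0) u} by exact: ae_Dn.
  apply: aeS => u; rewrite (Dn_Phi hs hk hi hth hg u ler01) => ->.
  by have := @Dn_poly R r 1 0 u; rewrite size_poly0 => /(_ isT); under eq_Dn => y do rewrite horner0.
pose aj (j : nat) : R := 'C(r, j)%:R * (-1) ^+ (r - j).
have phi0 : {ae mu, forall u, phi u = 0}.
  apply: (@translates_independent_ae R r aj).
  - by exists 0%N => //; rewrite /aj bin0 mul1r signr_eq0.
  - move=> u; have h1 : 0%:R + 1 < th - 1.
      by move: hth; rewrite -!natr1; have := ler0n R r'; lra.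
    have p0 : pgrow 0 (fun=> 1 : R) by apply: (@bounded_pgrow _ _ 1) => k; rewrite normr1.
    have sP := Sop_summ u (LI_phi hk) (Theta_phi hs hk hth hg) h1 p0.
    have := summZN sP; rewrite (_ : (fun k => _) = (fun k : int => phi (u + k%:~R))); last first.
      by apply/funext => k; rewrite mulr1 mulrNz opprK.
    by move=> sP'; split; [exact: (summZ_cvgr sP')|exact: (summZ_cvgl sP')].
  apply: aeS D0 => u D0u; rewrite -[RHS]D0u -diffmE /diffm; apply: eq_bigr => j _.
  by rewrite mulr1.
have : {ae mu, forall u, forall n, phi (u - (zen n)%:~R) = 0}.
  by apply: ae_foralln => n; exact: (ae_shift (- (zen n)%:~R) phi0).
move=> /(ae_ex ltr01)[u [_ Hu]]; have := (hk.2.2 u); rewrite /zseries_to (_ : zpartial _ = fun=> 0); last first.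
  apply/funext => N; rewrite zpartial_series big1// => i _; exact: Hu.
by move=> /cvg_lim => /(_ (@norm_hausdorff _ _)); rewrite lim_cst// => /eqP; rewrite eq_sym oner_eq0.
Qed.

(** Outside the window [beta] is [Ymaj]; inside, [node_control] with step [1/w], for which the
    kernel is [Ph1], bounds the coefficients by [A], the rate and the nodes outside. The steps
    required of [a] are those of [Qavg] together with all [1/w]. The majorants are measurable in [w]
    by construction, while the coefficients enter only at good [w]. *)
Lemma majorants : exists C, 0 <= C /\ forall W A, w0 <= W -> 0 <= A ->
  (forall s, (2 * W)^-1 <= s <= (2 * r%:R + 1) / W -> a s <= A) ->
  exists beta : int -> R -> \bar R, let I := `[W, (2 * W)]%classic : set R in
  [/\ forall k, measurable_fun (I : set mR) (beta k),
    forall k w, I w -> (0 <= beta k w)%E,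
    forall w k, I w -> Good w -> ((`|b w k| `^ p)%:E <= beta k w)%E &
    (\int[mu]_(w in I) esZ (beta ^~ w) <= (C * W ^+ 2 * (A + W `^ (- al)) `^ p)%:E)%E].
Proof.
have p0 : 0 < p by exact: lt_le_trans p1.
have pn0 : p != 0 by rewrite gt_eqF.
have LPh : LI Ph1 := LI_Phi hs hth hg 1.
have TPh : condition_Theta (th - r%:R) Ph1 := Theta_Phi hr hs hth hg ler01.
have [E [E0 PE]] : exists E, 0 <= E /\ forall u, (esZ (fun k => `|Ph1 (u - k%:~R)|%:E) <= E%:E)%E.
  have [e [e0 eS He]] := Irn_env r' (LI_Gam hs hth hg) (Theta_Gam hr hs hth hg) sg1 1 ler01.
  exists (fine (esZ (fun k => (e k)%:E))).
  have EE : (fine (esZ (fun k => (e k)%:E)))%:E = esZ (fun k => (e k)%:E).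
    by rewrite fineK// ge0_fin_numE// esZ_ge0// => k; rewrite lee_fin.
  split; first by rewrite fine_ge0// esZ_ge0// => k; rewrite lee_fin.
  move=> u; rewrite EE; pose n := Num.floor u.
  rewrite -(@esZ_shift R (fun k => `|Ph1 (u - k%:~R)|%:E) n)//.
  apply: le_esZ => // k; rewrite lee_fin.
  rewrite (_ : u - (k + n)%:~R = u - n%:~R - k%:~R); last by rewrite intrD; lra.
  apply: He; rewrite ?ler01 ?lexx//.
  have := ge_floor u; have := floorD1_gt u; rewrite -/n intrD => h1 h2.
  by rewrite ler_norml; apply/andP; split; lra.
have [C2 [C20 HC2]] := @node_control R p (th - r%:R) Ph1 E (K + r) p1 LPh TPh sg1 E0 PE Ph1_n0.
pose CE := 2 ^+ r * M + 1.
have CE0 : 0 < CE by rewrite ltr_wpDl// mulr_ge0// exprn_ge0.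
have CE1 : 1 <= CE by rewrite lerDr mulr_ge0// exprn_ge0.
have r0 : 0 <= 2 * r%:R :> R by rewrite mulr_ge0.
have [c1 [c1E c10]] : exists c1, c1 = Ccoef psi r' p /\ 0 <= c1.
  by exists (Ccoef psi r' p); split => //; exact: Ccoef_ge0.
(* The summand 1 keeps [c3] positive, so that the majorant is infinite whenever [Zq w] is, a case in
   which nothing can be estimated. *)
pose c3 := (2 * C2) `^ p * (2 * CE `^ p + c1 * (2 * r%:R)) + 1.
have c31 : 0 < c3 by rewrite ltr_wpDl// mulr_ge0 ?addr_ge0 ?powR_ge0// mulr_ge0// powR_ge0.
have c30 : 0 <= c3 by exact: ltW.
pose n0 : R := (size (ints (K + r)))%:R; have n00 : 0 <= n0 by rewrite ler0n.
pose c4 := n0 * c3 + c1 * (2 * r%:R).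
have c40 : 0 <= c4 by rewrite addr_ge0// mulr_ge0.
exists (n0 * c3 + c4 * (CZ * (2 * r%:R))).
split; first by rewrite addr_ge0// mulr_ge0// mulr_ge0.
move=> W A w0W A0 aA; have W0 : 0 < W by exact: lt_le_trans w0W.
pose N := A + W `^ (- al); have Wal : 0 < W `^ (- al) by rewrite powR_gt0.
have N0 : 0 < N by rewrite ltr_wpDl.
have AN : A <= N by rewrite lerDl ltW.
pose Q := Qavg r' p W f; pose Zq w := Zout psi K Q w.
have mQ : measurable_fun [set: R] Q := measurable_Qavg r' p W mf.
have Q0 : forall u, (0 <= Q u)%E := Qavg_ge0 r' p f W0.
pose I := `[W, (2 * W)]%classic : set R.
have IE w : I w -> W <= w /\ w <= 2 * W by rewrite /I/= in_itv/= => /andP[].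
have Iw0 w : I w -> 0 < w by move=> /IE[h _]; exact: lt_le_trans h.
have Zq0 w : I w -> (0 <= Zq w)%E by move=> /Iw0 w1; apply: Zout_ge0 => //; exact: ltW.
have mZq : measurable_fun (I : set mR) Zq by apply: (measurable_Zout ipsi mQ Q0); exact: ltW.
have Y0 k w : I w -> (0 <= Ymaj psi r' p W f k w)%E by move=> /Iw0/ltW w1; exact: (Ymaj_ge0 psi r' p f W0 k w1).
have WN0 : 0 <= W * N `^ p by rewrite mulr_ge0 ?powR_ge0// ltW.
pose beta k w := if k \in ints (K + r) then (c3%:E * ((W * N `^ p)%:E + Zq w))%E
   else (c1%:E * Ymaj psi r' p W f k w)%E.
have mY k : measurable_fun [set: R] (Ymaj psi r' p W f k) by exact: measurable_Ymaj.
have mb k : measurable_fun (I : set mR) (beta k).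
  rewrite /beta; case: (k \in ints (K + r)); apply: measurable_funeM; first exact: emeasurable_funD.
  by apply: (@measurable_funS _ _ _ _ setT) => //; exact: mY.
have b0 k w : I w -> (0 <= beta k w)%E.
  move=> Iw; rewrite /beta; case: ifP => _; rewrite mule_ge0 ?lee_fin ?Y0//.
  by rewrite adde_ge0 ?Zq0// lee_fin.
have bnear w k : I w -> Good w -> k \notin ints (K + r) ->
    ((`|b w k| `^ p)%:E <= c1%:E * Ymaj psi r' p W f k w)%E.
  move=> Iw Gw kK; have [Ww _] := IE w Iw; rewrite c1E; apply: coef_pow_le => // j jr.
  apply: (icoef_Zout ipsi p1 mf (Iw0 w Iw) Gw); move: kK; rewrite !mem_ints.
  by move: jr; clear; lia.
have sumY w : I w -> (esZ (fun k => if k \in ints (K + r) then 0 else c1%:E * Ymaj psi r' p W f k w) <=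
    (c1 * (2 * r%:R))%:E * Zq w)%E.
  move=> Iw; rewrite (EFinM c1 (2 * r%:R)) -muleA.
  have := sum_Ymaj_le psi r' p f K W0 (Iw0 w Iw) => H.
  have c1' : (0 <= c1%:E)%E by rewrite lee_fin.
  apply: le_trans (lee_wpmul2l c1' H); rewrite -esZZl//; last by move=> k; case: ifP => // _; exact: Y0.
  by apply: le_esZ => k; case: ifP => // _; rewrite ?mule0// mule_ge0 ?lee_fin ?Y0.
have ball w k : I w -> Good w -> ((`|b w k| `^ p)%:E <= beta k w)%E.
  move=> Iw Gw; rewrite /beta; case: ifPn => kK; last exact: bnear.
  have [Ww W2] := IE w Iw; have w1 := Iw0 w Iw.
  have [/eqP ZI|Zfin] := boolP (Zq w == +oo%E).
    by rewrite ZI addey// ?gt0_muley ?leey// lte_fin.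
  pose z := fine (Zq w); have Ez : Zq w = z%:E.
    by apply/esym/fineK; rewrite ge0_fin_numE ?lt_neqAle ?Zfin ?leey//; exact: Zq0.
  have z0 : 0 <= z by rewrite -lee_fin -Ez Zq0.
  pose S := (c1 * (2 * r%:R) * z) `^ p^-1; have S0 : 0 <= S by exact: powR_ge0.
  have cz0 : 0 <= c1 * (2 * r%:R) * z := mulr_ge0 (mulr_ge0 c10 r0) z0.
  have bS j : j \notin ints (K + r) -> `|b w j| <= S.
    move=> jK; apply: le_powR_root => //; rewrite -lee_fin; apply: le_trans (bnear w j Iw Gw jK) _.
    rewrite EFinM -Ez; apply: le_trans (sumY w Iw).
    have := @term_le_esZ R (fun k => if k \in ints (K + r) then 0%E else (c1%:E * Ymaj psi r' p W f k w)%E) j.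
    by rewrite (negbTE jK); apply => i; case: ifP => // _; rewrite mule_ge0 ?lee_fin ?Y0.
  (* [CE * N] bounds the difference of step [1/w] together with the representation error; passing
     from [w x] to [x] costs [w^(1/p) <= (2 W)^(1/p)]. *)
  pose B := CE * N * (2 * W) `^ p^-1.
  have B0 : 0 < B by rewrite !mulr_gt0// powR_gt0// mulr_gt0.
  have [Mc cM] := coef_bounded ipsi p1 mf w1 Gw.
  have bb : exists M, forall k, `|b w k| <= M by exists (2 ^+ r * Mc); exact: iter_Dz_bounded.
  have wi : 0 < w^-1 by rewrite invr_gt0.
  have wA : a w^-1 <= A.
    apply: aA; apply/andP; split; first by rewrite lef_pV2 ?posrE// mulr_gt0.
    apply: (@le_trans _ _ W^-1); first by rewrite lef_pV2.
    by rewrite -[leLHS]mul1r ler_wpM2r ?lerDr// invr_ge0 ltW.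
  have wal : w `^ (- al) <= W `^ (- al) by apply: ler_powRN => //; exact: ltW.
  have HB : bnd (Some p) setT (Sop (b w) Ph1) B.
    have [M' bM'] := bb; have s1 : 0%:R + 1 < th - r%:R by rewrite add0r.
    have [mS _] := LI_Sop LPh TPh s1 (bounded_pgrow bM').
    have mSw : measurable_fun [set: R] (fun x => Sop (b w) Ph1 (w * x)).
      by apply: (measurableT_comp mS); exact: measurable_funM.
    have mD := measurable_Dn r w^-1 mf.
    have B1 : 0 <= M * w `^ (- al) by rewrite mulr_ge0 ?powR_ge0.
    have := representation_of_rate (pm := Some p) p1 hr hs hk hi hth hg mf w1 (ltW wi) B1
      (ex_intro _ Mc cM) (rate (le_trans w0W Ww)).
    rewrite mulfV ?gt_eqF// -/Ph1 => Hrep.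
    have B2 : 0 <= 2 ^+ r * (M * w `^ (- al)) by rewrite mulr_ge0 ?exprn_ge0.
    have := bndB (pm := Some p) p1 measurableT mD (measurable_funB mD mSw) (a0 wi) B2 (ab wi) Hrep.
    rewrite (_ : (fun x => _) = (fun x => Sop (b w) Ph1 (w * x))); last first.
      by apply/funext => x; rewrite opprB addrC subrK.
    move=> /(bnd_dilate (pm := Some p) p1 w1 mS (addr_ge0 (a0 wi) B2)).
    apply: (bnd_le (pm := Some p) p1); first by rewrite mulr_ge0 ?powR_ge0// addr_ge0// a0.
    apply: ler_pM; rewrite ?powR_ge0 ?addr_ge0 ?a0//; last first.
      apply: ge0_ler_powR; rewrite ?nnegrE ?invr_ge0 ?(ltW p0) ?(ltW w1)//.
      by rewrite mulr_ge0// ltW.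
    apply: (@le_trans _ _ (A + CE * W `^ (- al))).
      apply: lerD => //; rewrite mulrA; apply: ler_pM => //; rewrite ?powR_ge0 ?mulr_ge0 ?exprn_ge0//.
      by rewrite lerDl.
    by rewrite mulrDr lerD2r ler_peMl.
  apply: (@le_trans _ _ (((2 * C2) `^ p * (B `^ p + S `^ p))%:E)).
    rewrite lee_fin; apply: (@le_trans _ _ ((C2 * (B + S)) `^ p)).
      apply: ge0_ler_powR; rewrite ?nnegrE ?(ltW p0)//; last exact: HC2.
      by rewrite mulr_ge0// addr_ge0// ltW.
    rewrite powRM ?addr_ge0 ?(ltW B0)// [2 * C2]mulrC powRM// -mulrA ler_wpM2l ?powR_ge0//.
    by apply: powRD_le => //; exact: ltW.
  have Bp : B `^ p = CE `^ p * N `^ p * (2 * W).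
    rewrite powRM ?powR_ge0 ?mulr_ge0 ?(ltW CE0) ?(ltW N0)//.
    by rewrite powRM ?(ltW CE0) ?(ltW N0)// powR_root// mulr_ge0// ltW.
  rewrite Ez -EFinD -EFinM lee_fin Bp powR_root//.
  have k0 : 0 <= (2 * C2) `^ p by exact: powR_ge0.
  have e0 : 0 <= CE `^ p by exact: powR_ge0.
  have t1 := mulr_ge0 (mulr_ge0 k0 e0) z0.
  have t2 := mulr_ge0 (mulr_ge0 k0 (mulr_ge0 c10 r0)) WN0.
  rewrite /c3; move: t1 t2 WN0 z0; move: (_ `^ p) (CE `^ p) (N `^ p) (2 * r%:R) => x1 x2 x3 x4.
  clear; move=> t1 t2 t3 t4; rewrite -subr_ge0.
  rewrite (_ : _ - _ = 2 * (x1 * x2 * z) + x1 * (c1 * x4) * (W * x3) + W * x3 + z); last by ring.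
  by rewrite !addr_ge0// mulr_ge0.
exists beta; split => //.
apply: (@le_trans _ _ (\int[mu]_(w in I) ((n0 * c3 * (W * N `^ p))%:E + c4%:E * Zq w))%E).
  apply: ge0_le_integral => //.
  - by move=> w Iw; apply: esZ_ge0 => k; exact: b0.
  - by apply: measurable_esZ => // k w; exact: b0.
  - by apply: emeasurable_funD => //; exact: measurable_funeM.
  move=> w Iw; apply: le_trans (@esZ_split R (beta ^~ w) (fun k => if k \in ints (K + r) then 0%E else
    (c1%:E * Ymaj psi r' p W f k w)%E) (ints (K + r)) (ints_uniq _) (b0 ^~ w ^~ Iw) _ _) _.
  - by move=> k; case: ifP => // _; rewrite mule_ge0 ?lee_fin ?Y0.
  - by move=> k /negbTE kK; rewrite /beta kK.
  apply: le_trans (leeD2l _ (sumY w Iw)) _.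
  have WZ : (0 <= (W * N `^ p)%:E + Zq w)%E by rewrite adde_ge0 ?Zq0// lee_fin.
  rewrite (_ : (\sum_(k <- ints (K + r)) beta k w)%E = (n0%:E * (c3%:E * ((W * N `^ p)%:E + Zq w)))%E); last first.
    rewrite -sume_const_seq; last by rewrite mule_ge0// lee_fin.
    by rewrite big_seq [RHS]big_seq; apply: eq_bigr => k kK; rewrite /beta kK.
  rewrite muleA -EFinM ge0_muleDr ?Zq0 ?lee_fin// -EFinM -addeA leeD2l//.
  by rewrite -ge0_muleDl ?lee_fin ?mulr_ge0// -EFinD.
have k0 : 0 <= n0 * c3 * (W * N `^ p) by rewrite mulr_ge0// mulr_ge0.
have mI : measurable (I : set mR) by exact: measurable_itv.
rewrite ge0_integralD//; last 2 first.
- by move=> w Iw; rewrite mule_ge0 ?Zq0// lee_fin.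
- exact: measurable_funeM.
have -> : (\int[mu]_(w in I) (n0 * c3 * (W * N `^ p))%:E = (n0 * c3 * (W * N `^ p) * W)%:E)%E.
  rewrite integral_cst//= lebesgue_measure_itv/= lte_fin ltr_pMl// ltr1n -EFinB -EFinM.
  by congr (_%:E); ring.
rewrite ge0_integralZl//.
have h1 : (\int[mu]_(w in I) Zq w <= (CZ * W ^+ 2 * (2 * r%:R * N `^ p))%:E)%E.
  apply: le_trans (Zavg mQ Q0 W0) _; rewrite (EFinM (CZ * W ^+ 2) (2 * r%:R * N `^ p)); apply: lee_wpmul2l.
    by rewrite lee_fin mulr_ge0// exprn_ge0// ltW.
  apply: integral_Qavg => //; first exact: ltW.
  move=> s; rewrite /= in_itv/= => /andP[s1 s2].
  have s0 : 0 < s by apply: lt_le_trans s1; rewrite invr_gt0.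
  apply: (bnd_le (pm := Some p) p1 (a0 s0) _ (ab s0)); apply: le_trans AN; apply: aA; rewrite s2 andbT.
  by apply: le_trans s1; rewrite lef_pV2 ?posrE// ?mulr_gt0// ler_pMl// ler1n.
have c4' : (0 <= c4%:E)%E by rewrite lee_fin.
apply: (le_trans (leeD2l _ (lee_wpmul2l c4' h1))).
by rewrite -EFinM -EFinD lee_fin; apply/le_of_eq; ring.
Qed.

End coefficient_majorants.

(** * Bounds away from the origin *)

Section parametric_integrals.
Context {R : realType}.
Local Notation mu := (@lebesgue_measure R).
Local Notation mR := (measurableTypeR R).

Lemma measurable_parametric d (T : measurableType d) (F : T * mR -> \bar R) (D : set R) : measurable (D : set mR) ->
  measurable_fun setT F -> (forall z, 0 <= F z)%E ->
  measurable_fun setT (fun x => \int[mu]_(y in D) F (x, y))%E.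
Proof.
move=> mD mF F0; pose F' := F \_ (setT `*` D).
have mF' : measurable_fun setT F'.
  by apply/(measurable_restrictT _ _).1; [exact: measurableX|exact: measurable_funTS].
have F'0 z : (0 <= F' z)%E by rewrite /F' /patch; case: ifP.
have := @measurable_fun_fubini_tonelli_F _ _ T mR R mu F' mF' F'0.
apply: eq_measurable_fun => x _; rewrite [RHS]integral_mkcond; apply: eq_integral => y _.
by rewrite /F' /patch; congr (if _ then _ else _); rewrite in_setX in_setT.
Qed.

Lemma measurable_far (c : R) : measurable ([set x : R | c <= `|x|] : set mR).
Proof.
rewrite (_ : [set x : R | c <= `|x|] = (fun x : R => `|x|) @^-1` `[c, +oo[); last first.
  by apply/seteqP; split => x /=; rewrite in_itv/= andbT.
by rewrite -[X in measurable X]setTI; exact: (normr_measurable measurableT (measurable_itv _)).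
Qed.

Lemma measurable_slice (F : mR * mR -> \bar R) (I : set R) x : measurable (I : set mR) ->
  measurable_fun setT F -> measurable_fun (I : set mR) (fun w => F (x, w)).
Proof.
move=> mI mF; apply: (@measurable_funS _ _ _ _ setT) => //.
by apply: (measurableT_comp mF); exact: measurable_pair1.
Qed.

(** The inner bound is required for almost every [w] only, which is how the good frequencies are
    known. *)
Lemma le_tonelli (F : mR * mR -> \bar R) (A I : set R) (c : R -> \bar R) :
  measurable (A : set mR) -> measurable (I : set mR) -> measurable_fun setT F -> (forall z, 0 <= F z)%E ->
  measurable_fun (I : set mR) c -> (forall w, I w -> 0 <= c w)%E ->
  {ae mu, forall w, I w -> (\int[mu]_x F (x, w) <= c w)%E} ->
  (\int[mu]_(x in A) \int[mu]_(w in I) F (x, w) <= \int[mu]_(w in I) c w)%E.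
Proof.
move=> mA mI mF F0 mc c0 H; rewrite tonelli_in//.
have mF' : measurable_fun setT (fun z : mR * mR => F (z.2, z.1)).
  by apply: (measurableT_comp mF); apply: measurable_fun_pair; [exact: measurable_snd|exact: measurable_fst].
have mG : measurable_fun (I : set mR) (fun w => \int[mu]_(x in A) F (x, w))%E.
  apply: (@measurable_funS _ _ _ _ setT) => //.
  exact: (@measurable_parametric _ mR (fun z => F (z.2, z.1))).
have mGx w : measurable_fun setT (fun x : mR => F (x, w)).
  by apply: (measurableT_comp mF); exact: measurable_pair2.
apply: ae_ge0_le_integral => //; first by move=> w _; exact: integral_ge0.
apply: aeS H => w H Iw; apply: le_trans (H Iw).
exact: ge0_subset_integral.
Qed.

Lemma ge0_integral_combination (I : set R) (a c1 c2 : R) (m q : R -> \bar R) : measurable (I : set mR) ->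
  measurable_fun (I : set mR) m -> measurable_fun (I : set mR) q -> (forall w, 0 <= m w)%E -> (forall w, 0 <= q w)%E ->
  0 <= a -> 0 <= c1 -> 0 <= c2 ->
  (\int[mu]_(w in I) (a%:E * (c1%:E * m w + c2%:E * q w)) =
   (a * c1)%:E * \int[mu]_(w in I) m w + (a * c2)%:E * \int[mu]_(w in I) q w)%E.
Proof.
move=> mI mm mq m0 q0 a0 c10 c20.
have h1 w : (0 <= c1%:E * m w)%E by rewrite mule_ge0 ?lee_fin.
have h2 w : (0 <= c2%:E * q w)%E by rewrite mule_ge0 ?lee_fin.
have mh1 : measurable_fun (I : set mR) (fun w => c1%:E * m w)%E by exact: measurable_funeM.
have mh2 : measurable_fun (I : set mR) (fun w => c2%:E * q w)%E by exact: measurable_funeM.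
rewrite ge0_integralZl//; last 2 first.
- exact: emeasurable_funD.
- by move=> w _; rewrite adde_ge0.
rewrite ge0_integralD// !ge0_integralZl// ge0_muleDr ?mule_ge0 ?integral_ge0 ?lee_fin//.
by rewrite !muleA -!EFinM.
Qed.

End parametric_integrals.

Section far_estimate.
Context {R : realType}.
Local Notation mu := (@lebesgue_measure R).
Local Notation mR := (measurableTypeR R).
Variables (p sg W s E B : R) (r' : nat) (G D : R -> R) (b : R -> int -> R) (Good : R -> Prop)
  (beta : int -> R -> \bar R).
Local Notation r := r'.+1.
Let I := `[W, (2 * W)]%classic : set R.
Hypotheses (p1 : 1 <= p) (GL : LI G) (GT : condition_Theta sg G) (sg1 : 1 < sg) (W0 : 0 < W)
  (s0 : 0 < s) (sW : s <= W^-1) (mD : measurable_fun [set: R] D) (E0 : 0 <= E)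
  (Hrep : forall w, I w -> Good w -> bnd (Some p) setT (fun x => D x - Sop (b w) (Irn r (w * s) G) (w * x)) E)
  (mb : forall w, I w -> Good w -> exists M, forall k, `|b w k| <= M)
  (HGood : {ae mu, forall w, I w -> Good w})
  (mbeta : forall k, measurable_fun (I : set mR) (beta k))
  (beta0 : forall k w, I w -> (0 <= beta k w)%E)
  (bbeta : forall w k, I w -> Good w -> ((`|b w k| `^ p)%:E <= beta k w)%E)
  (intbeta : (\int[mu]_(w in I) esZ (beta ^~ w) <= B%:E)%E).

Let KG := fine (\int[mu]_x `|G x|%:E).
Let mG : measurable_fun [set: R] G. Proof. by case: GL. Qed.
Let KGE : (\int[mu]_x `|G x|%:E = KG%:E)%E.
Proof.
have /integrableP[_ fin] := Theta_integrable GL GT sg1.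
by rewrite fineK// ge0_fin_numE// integral_ge0.
Qed.
Let KG0 : 0 <= KG. Proof. by rewrite fine_ge0// integral_ge0. Qed.

(** [k0] bounds the factor [(w s)^(r - 1) w] of [kmaj] for [w] in [I], and [kap] bounds [k0] times
    the mean over [I] of the summed [kmaj]. [KG + 1] in place of [KG] keeps [kap] positive, as it is
    divided by. *)
Let k0 := (2 * W * s) ^+ r' * (2 * W).
Let kap := k0 * (2 * r%:R * s * (KG + 1)).
Let k00 : 0 < k0. Proof. by rewrite mulr_gt0 ?exprn_gt0 ?mulr_gt0. Qed.
Let kap0 : 0 < kap. Proof. by rewrite /kap mulr_gt0// mulr_gt0 ?ltr_wpDl// !mulr_gt0. Qed.

Let IE w : I w -> W <= w /\ w <= 2 * W. Proof. by rewrite /I/= in_itv/= => /andP[]. Qed.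
Let Iw0 w : I w -> 0 < w. Proof. by move=> /IE[h _]; exact: lt_le_trans h. Qed.
Let mI : measurable (I : set mR). Proof. exact: measurable_itv. Qed.
Let muI : mu I = W%:E.
Proof. by rewrite /I lebesgue_measure_itv/= lte_fin ltr_pMl// ltr1n -EFinB; congr (_%:E); ring. Qed.

Let cstI (c : R) : (\int[mu]_(w in I) cst c%:E w = (c * W)%:E)%E.
Proof. by rewrite EFinM -muI; exact: integral_cst. Qed.

Let be k := (beta k) \_ I.
Let be0 k w : (0 <= be k w)%E.
Proof. by rewrite /be /patch; case: ifPn => // /set_mem; exact: beta0. Qed.
Let mbe k : measurable_fun [set: R] (be k).
Proof. by apply/(measurable_restrictT _ _).1 => //; exact: mbeta. Qed.
Let beE k w : I w -> be k w = beta k w. Proof. by move=> Iw; rewrite /be /patch mem_set. Qed.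

Let km k (z : mR * mR) := kmaj r' G s k z.2 z.1.
Let km0 k z : (0 <= km k z)%E. Proof. exact: kmaj_ge0. Qed.
Let mkm k : measurable_fun [set: mR * mR] (km k).
Proof.
apply: (@measurable_parametric R _ (mR * mR)%type (fun yz => `|G (yz.1.2 * (yz.1.1 + yz.2) - k%:~R)|%:E)) => //.
apply/measurable_EFinP; apply: measurableT_comp => //; apply: (measurableT_comp mG).
apply: measurable_funB => //; apply: measurable_funM; first exact: (measurableT_comp measurable_snd measurable_fst).
by apply: measurable_funD; [exact: (measurableT_comp measurable_fst measurable_fst)|exact: measurable_snd].
Qed.

Let m z := esZ (fun k => km k z).
Let q (z : mR * mR) := esZ (fun k => be k z.2 * km k z)%E.
Let m0 z : (0 <= m z)%E. Proof. by apply: esZ_ge0. Qed.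
Let q0 z : (0 <= q z)%E. Proof. by apply: esZ_ge0 => k; rewrite mule_ge0. Qed.
Let mm : measurable_fun [set: mR * mR] m. Proof. by apply: measurable_esZ. Qed.
Let mbek k : measurable_fun [set: mR * mR] (fun z : mR * mR => be k z.2 * km k z)%E.
Proof. by apply: emeasurable_funM => //; apply: (measurableT_comp (mbe k)); exact: measurable_snd. Qed.
Let mq : measurable_fun [set: mR * mR] q.
Proof. by apply: measurable_esZ => [k z _|k]; [rewrite mule_ge0|exact: mbek]. Qed.

Let P x := `|D x| `^ p.
Let P0 x : 0 <= P x. Proof. exact: powR_ge0. Qed.
Let mP : measurable_fun [set: mR * mR] (fun z : mR * mR => (P z.1)%:E).
Proof. apply: (measurableT_comp (measurable_normpow p mD)); exact: measurable_fst. Qed.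

Let V (z : mR * mR) := ((2 * k0)%:E * (((4 * kap)^-1 * P z.1)%:E * m z + ((4 * kap) `^ (p - 1))%:E * q z))%E.
Let k20 : 0 <= 2 * k0. Proof. by rewrite mulr_ge0// ltW. Qed.
Let c10 x : 0 <= (4 * kap)^-1 * P x. Proof. by rewrite mulr_ge0 ?P0// invr_ge0 mulr_ge0// ltW. Qed.
Let c20 : 0 <= (4 * kap) `^ (p - 1). Proof. exact: powR_ge0. Qed.
Let V0 z : (0 <= V z)%E.
Proof. by rewrite mule_ge0 ?lee_fin// adde_ge0// mule_ge0 ?lee_fin. Qed.
Let mV : measurable_fun [set: mR * mR] V.
Proof.
apply: measurable_funeM; apply: emeasurable_funD; last exact: measurable_funeM.
apply: emeasurable_funM => //; under eq_fun do rewrite EFinM; exact: measurable_funeM.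
Qed.

(** The p-th power of [|D|] at the points where the bound [V] for the series fails; there the
    representation error dominates. It is defined from [D] and [V] only, so its joint measurability
    does not involve the coefficients. *)
Let U (z : mR * mR) := if (V z < (P z.1)%:E)%E then (P z.1)%:E else 0%E.
Let U0 z : (0 <= U z)%E. Proof. by rewrite /U; case: ifP => _; rewrite ?lee_fin. Qed.
Let mU : measurable_fun [set: mR * mR] U.
Proof.
apply: measurable_fun_ifT => //; exact: measurable_fun_lte.
Qed.

Let PVU z : ((P z.1)%:E <= V z + U z)%E.
Proof.
rewrite /U; case: ifPn => [_|]; first by rewrite leeDr.
by rewrite -leNgt adde0.
Qed.

(* The choice [L = |D x| / (4 kap)] in the interpolation of [|b_k|]. *)
Let Urep w x : I w -> Good w ->
  (U (x, w) <= ((2 `^ p) * `|D x - Sop (b w) (Irn r (w * s) G) (w * x)| `^ p)%:E)%E.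
Proof.
move=> Iw Gw; rewrite /U; case: ifPn => [VP|_]; last by rewrite lee_fin mulr_ge0 ?powR_ge0.
rewrite lee_fin -powRM//; apply: ge0_ler_powR; rewrite ?nnegrE ?mulr_ge0 ?(le_trans ler01 p1)//.
rewrite leNgt; apply/negP => DE; move: VP; rewrite ltNge => /negP; apply.
set S := Sop _ _ _ in DE *; have D0 : 0 < `|D x| by apply: le_lt_trans DE; rewrite mulr_ge0.
have DS : `|D x| <= 2 * `|S|.
  by have := ler_normD (D x - S) S; rewrite subrK; move: DE; lra.
have L0 : 0 < `|D x| / (4 * kap) by rewrite divr_gt0// mulr_gt0.
pose L := `|D x| / (4 * kap).
have [w1 w2] := IE Iw; have ww := Iw0 Iw.
have ST : (`|S|%:E <= k0%:E * (L%:E * m (x, w) + (L `^ (1 - p))%:E * q (x, w)))%E.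
  apply: le_trans (le_norm_zsum _) _.
  have Lp0 : 0 <= L `^ (1 - p) by exact: powR_ge0.
  have L0' : 0 <= L by exact: ltW.
  rewrite -!esZZl//; last by move=> k; rewrite mule_ge0.
  rewrite -esZD; last 2 first.
  - by move=> k; rewrite mule_ge0 ?lee_fin.
  - by move=> k; rewrite mule_ge0 ?lee_fin// mule_ge0.
  rewrite -esZZl ?(ltW k00)//; last first.
    by move=> k; rewrite adde_ge0// mule_ge0 ?lee_fin// mule_ge0.
  apply: le_esZ => k; first by rewrite lee_fin.
  rewrite normrM EFinM.
  have h1 : (`|Irn r (w * s) G (w * x - k%:~R)|%:E <= k0%:E * km k (x, w))%E.
    apply: le_trans (norm_Irn_kmaj r' GL k x (ltW s0) ww) _.
    rewrite -[kmaj r' G s k w x]/(km k (x, w)); apply: lee_wpmul2r; first exact: km0.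
    rewrite lee_fin /k0; apply: ler_pM; rewrite ?exprn_ge0 ?mulr_ge0 ?(ltW s0) ?(ltW ww)//.
    by apply: lerXn2r; rewrite ?nnegrE ?mulr_ge0 ?(ltW s0) ?(ltW ww) ?(ltW W0)// ler_wpM2r// ltW.
  have h2 : (`|b w k|%:E <= L%:E + (L `^ (1 - p))%:E * be k w)%E.
    apply: (@le_trans _ _ (L%:E + (L `^ (1 - p))%:E * (`|b w k| `^ p)%:E)%E).
      by rewrite -EFinM -EFinD lee_fin; exact: le_powR_interp.
    by rewrite leeD2l// lee_wpmul2l ?lee_fin// beE//; exact: bbeta.
  apply: le_trans (lee_pmul _ _ h1 h2) _ => //.
  rewrite -muleA lee_wpmul2l ?lee_fin ?(ltW k00)//.
  rewrite ge0_muleDr ?lee_fin ?mule_ge0 ?lee_fin// [(km k _ * L%:E)%E]muleC leeD2l//.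
  by rewrite muleCA [(km k _ * be k w)%E]muleC.
have Dp : 0 <= `|D x| `^ (p - 1) by exact: powR_ge0.
apply: (@le_trans _ _ ((`|D x| `^ (p - 1))%:E * (2 * `|S|)%:E)%E).
  rewrite -EFinM lee_fin /P /=; apply: (@le_trans _ _ (`|D x| `^ (p - 1) * `|D x|)); last by rewrite ler_wpM2l.
  rewrite -{3}[`|D x|]powRr1// -powRD ?subrK//.
  by rewrite (gt_eqF D0) implybT.
apply: (@le_trans _ _ ((`|D x| `^ (p - 1))%:E * (2%:E * (k0%:E * (L%:E * m (x, w) + (L `^ (1 - p))%:E * q (x, w)))))%E).
  by rewrite EFinM; apply: lee_wpmul2l; rewrite ?lee_fin//; apply: lee_wpmul2l; rewrite ?lee_fin.
rewrite /V /= muleA -EFinM muleA -EFinM [_ * 2 * k0](_ : _ = 2 * k0 * `|D x| `^ (p - 1)); last by ring.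
rewrite EFinM -muleA; apply: lee_wpmul2l; first by rewrite lee_fin.
rewrite ge0_muleDr ?mule_ge0 ?lee_fin ?powR_ge0 ?(ltW L0)// !muleA -!EFinM; apply: leeD.
  apply: lee_wpmul2r => //; rewrite lee_fin /L /P mulrA mulrC.
  apply: ler_wpM2l; first by rewrite invr_ge0 (mulr_ge0 (ler0n R 4) (ltW kap0)).
  by rewrite -{2}[`|D x|]powRr1// -powRD ?subrK// (gt_eqF D0) implybT.
have k4 : 0 < 4 * kap := mulr_gt0 (ltr0n R 4) kap0.
have -> : L `^ (1 - p) = (4 * kap) `^ (p - 1) / `|D x| `^ (p - 1).
  by rewrite -(opprB p 1) powRN (powR_div (p - 1) (ltW D0) k4) invf_div.
apply: lee_wpmul2r => //; rewrite lee_fin mulrC divfK//.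
by rewrite gt_eqF// powR_gt0.
Qed.

Let A : set R := [set x | (r%:R + 1) / W <= `|x|].
Let mA : measurable (A : set mR).
Proof. exact: measurable_far. Qed.

Let Q1 x := (\int[mu]_(w in I) q (x, w))%E.
Let U1 x := (\int[mu]_(w in I) U (x, w))%E.
Let mQ1 : measurable_fun [set: R] Q1. Proof. exact: measurable_parametric. Qed.
Let mU1 : measurable_fun [set: R] U1. Proof. exact: measurable_parametric. Qed.
Let Q10 x : (0 <= Q1 x)%E. Proof. exact: integral_ge0. Qed.
Let U10 x : (0 <= U1 x)%E. Proof. exact: integral_ge0. Qed.

(** The constant [4 kap] in [V] is chosen so that the part of the mean of [V] containing [P x] is at
    most [P x / 2]; it is absorbed on the left. *)
Let Pavg x : A x -> ((W / 2 * P x)%:E <= (2 * k0 * (4 * kap) `^ (p - 1))%:E * Q1 x + U1 x)%E.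
Proof.
move=> Ax; have : ((W * P x)%:E <= \int[mu]_(w in I) (V (x, w) + U (x, w)))%E.
  rewrite (_ : (W * P x)%:E = \int[mu]_(w in I) cst (P x)%:E w)%E; last first.
    by rewrite cstI mulrC.
  apply: ge0_le_integral => //.
  - by move=> w _; rewrite lee_fin.
  - by apply: emeasurable_funD; exact: measurable_slice.
  by move=> w _; exact: (PVU (x, w)).
rewrite (ge0_integralD _ mI (fun w _ => V0 (x, w)) (measurable_slice x mI mV) (fun w _ => U0 (x, w)) (measurable_slice x mI mU)).
have EV : (\int[mu]_(w in I) V (x, w) <= (W / 2 * P x)%:E + (2 * k0 * (4 * kap) `^ (p - 1))%:E * Q1 x)%E.
  rewrite (@ge0_integral_combination R I (2 * k0) ((4 * kap)^-1 * P x) _ (fun w => m (x, w)) (fun w => q (x, w)))//; last 2 first.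
  - exact: measurable_slice.
  - exact: measurable_slice.
  apply: leeD2r.
  have := sum_kmaj_average (r' := r') GL W0 (ltW s0) sW Ax; rewrite KGE -/I => Hm.
  have c' : (0 <= (2 * k0 * ((4 * kap)^-1 * P x))%:E)%E by rewrite lee_fin; exact: mulr_ge0 k20 (c10 x).
  apply: le_trans (lee_wpmul2l c' Hm) _.
  rewrite -!EFinM lee_fin.
  have h : 2 * k0 * (4 * kap)^-1 * (r%:R * s * (2 * W) * KG) <= W / 2.
    have k4 : 0 < 4 * kap := mulr_gt0 (ltr0n R 4) kap0.
    rewrite -(ler_pM2l k4).
    rewrite (_ : 4 * kap * (_ * _) = 2 * k0 * (r%:R * s * (2 * W) * KG)); last by field; rewrite (gt_eqF kap0).
    rewrite /kap; have : 0 <= k0 * r%:R * s * W := mulr_ge0 (mulr_ge0 (mulr_ge0 (ltW k00) (ler0n R r)) (ltW s0)) (ltW W0).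
    move=> y0; rewrite (_ : 2 * k0 * _ = 4 * (k0 * r%:R * s * W) * KG); last by ring.
    rewrite [leRHS](_ : _ = 4 * (k0 * r%:R * s * W) * KG + 4 * (k0 * r%:R * s * W)); last by field.
    by rewrite lerDl mulr_ge0.
  by have := ler_wpM2r (P0 x) h; congr (_ <= _); ring.
move=> H; have {}H := le_trans H (leeD2r _ EV).
move: H; rewrite -addeA; set Y := (_ * Q1 x + U1 x)%E.
have Y0 : (0 <= Y)%E by rewrite adde_ge0// mule_ge0// lee_fin mulr_ge0.
case: Y Y0 => [y| |] // y0 H; last exact: leey.
by move: H; rewrite -EFinD !lee_fin; move: (P x) => z; lra.
Qed.

Let intU : (\int[mu]_(x in A) U1 x <= (W * (2 `^ p * E `^ p))%:E)%E.
Proof.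
rewrite mulrC -cstI; apply: le_tonelli => //; first by move=> w _; rewrite lee_fin mulr_ge0 ?powR_ge0.
apply: aeS HGood => w Gw Iw; have {}Gw := Gw Iw.
pose F x := D x - Sop (b w) (Irn r (w * s) G) (w * x).
have mF : measurable_fun [set: R] F.
  have [M bM] := mb Iw Gw; have sg0 : 0 <= sg by exact: ltW (lt_trans ltr01 sg1).
  have ws : 0 <= w * s by rewrite mulr_ge0 ?(ltW s0)// ltW// Iw0.
  have s1 : 0%:R + 1 < sg by rewrite add0r.
  have [mS _] := LI_Sop (LI_Irn r (w * s) GL) (Theta_Irn r sg0 ws GL GT) s1 (bounded_pgrow bM).
  by apply: measurable_funB => //; apply: (measurableT_comp mS); exact: measurable_funM.
apply: (@le_trans _ _ (\int[mu]_x ((2 `^ p)%:E * (`|F x| `^ p)%:E))%E).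
  apply: ge0_le_integral => //.
  - by apply: (measurableT_comp mU); exact: measurable_pair2.
  - by apply: measurable_funeM; exact: measurable_normpow.
  by move=> x _; rewrite -EFinM; exact: Urep.
rewrite ge0_integralZl ?lee_fin ?powR_ge0//; last exact: measurable_normpow.
by rewrite EFinM lee_wpmul2l ?lee_fin ?powR_ge0//; exact: Hrep.
Qed.

Let intkm k w : 0 < w -> (\int[mu]_x km k (x, w) = (r%:R * s * w^-1 * KG)%:E)%E.
Proof.
move=> w0; rewrite /km /kmaj /=.
rewrite (@tonelli_in R (fun xz : mR * mR => `|G (w * (xz.1 + xz.2) - k%:~R)|%:E) setT)//=; last first.
  apply/measurable_EFinP; apply: measurableT_comp => //; apply: (measurableT_comp mG).
  apply: measurable_funB => //; apply: measurable_funM => //.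
  by apply: measurable_funD; [exact: measurable_fst|exact: measurable_snd].
have Ez (z : R) : (\int[mu]_x `|G (w * (x + z) - k%:~R)|%:E = (w^-1 * KG)%:E)%E.
  have G0 v : (0 <= `|G v|%:E)%E by rewrite lee_fin.
  have := @ge0_integral_affine R (fun v => `|G v|%:E) w (w * z - k%:~R) (lt0r_neq0 w0) (mabs mG) G0.
  rewrite (gtr0_norm w0) KGE EFinM => <-; apply: eq_integral => x _; congr (`|G _|%:E).
  by rewrite mulrDr addrA.
under eq_integral do rewrite Ez.
rewrite integral_cst//= lebesgue_measure_itv/= lte_fin mulr_gt0// -EFinB subr0 -EFinM.
by congr (_%:E); ring.
Qed.

(** Integrated in [x] over the line, [kmaj] has the same mass for every [k]; only the integral over
    [w] of the summed majorants is left. *)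
Let intq : (\int[mu]_(x in A) Q1 x <= (r%:R * s * W^-1 * KG * B)%:E)%E.
Proof.
have c0 : 0 <= r%:R * s * W^-1 * KG by rewrite !mulr_ge0 ?(ltW s0)// invr_ge0 ltW.
have mB : measurable_fun (I : set mR) (fun w => esZ (beta ^~ w)).
  by apply: measurable_esZ => // k w; exact: beta0.
have B0' w : I w -> (0 <= esZ (beta ^~ w))%E by move=> Iw; apply: esZ_ge0 => k; exact: beta0.
apply: (@le_trans _ _ (\int[mu]_(w in I) ((r%:R * s * W^-1 * KG)%:E * esZ (beta ^~ w)))%E); last first.
  by rewrite ge0_integralZl ?lee_fin// (EFinM (r%:R * s * W^-1 * KG) B); apply: lee_wpmul2l; rewrite ?lee_fin.
apply: le_tonelli => //; first exact: measurable_funeM.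
  by move=> w Iw; rewrite mule_ge0 ?lee_fin ?B0'.
apply: aeW => w Iw; have [w1 w2] := IE Iw; have ww := Iw0 Iw.
have mk k : measurable_fun setT (fun x : mR => km k (x, w)).
  by apply: (measurableT_comp (mkm k)); exact: measurable_pair2.
rewrite /q /= (@integral_esZ _ mR R mu setT (fun k (x : mR) => (be k w * km k (x, w))%E))//; last 2 first.
- by move=> k; exact: measurable_funeM.
- by move=> k x _; rewrite mule_ge0.
rewrite -esZZl//; last by move=> k; exact: beta0.
apply: le_esZ => k; first by apply: integral_ge0 => x _; rewrite mule_ge0.
rewrite ge0_integralZl//.
rewrite intkm// beE// muleC lee_wpmul2r ?beta0// lee_fin ler_wpM2r// ler_wpM2l ?mulr_ge0 ?(ltW s0)//.
by rewrite lef_pV2.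
Qed.

Lemma far_estimate : 0 <= B -> (\int[mu]_(x in [set x : R | ((r%:R + 1) / W <= `|x|)%R]) (`|D x| `^ p)%:E <=
  (2 * 2 `^ p * E `^ p + (4 * kap) `^ p * (B / W ^+ 2))%:E)%E.
Proof.
move=> B0; pose c := 2 * k0 * (4 * kap) `^ (p - 1).
have c0 : 0 <= c by rewrite mulr_ge0.
have c0' : (0 <= c%:E)%E by rewrite lee_fin.
have W2 : 0 <= 2 / W by rewrite divr_ge0// ltW.
apply: (@le_trans _ _ (\int[mu]_(x in A) ((2 / W)%:E * (c%:E * Q1 x + U1 x)))%E).
  apply: ge0_le_integral => //.
  - exact: measurable_normpowD.
  - apply: measurable_funeM; apply: emeasurable_funD; first apply: measurable_funeM.
      exact: (@measurable_funS _ _ _ _ setT).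
    exact: (@measurable_funS _ _ _ _ setT).
  move=> x Ax; have W2' : (0 <= (2 / W)%:E)%E by rewrite lee_fin.
  apply: le_trans (lee_wpmul2l W2' (Pavg Ax)); rewrite -EFinM lee_fin /P; apply/le_of_eq.
  by move: (_ `^ _) => y; field; rewrite gt_eqF.
have mQA : measurable_fun (A : set mR) Q1 by apply: (@measurable_funS _ _ _ _ setT).
have mUA : measurable_fun (A : set mR) U1 by apply: (@measurable_funS _ _ _ _ setT).
rewrite ge0_integralZl ?lee_fin//; last 2 first.
- by apply: emeasurable_funD => //; exact: measurable_funeM.
- by move=> x _; rewrite adde_ge0// mule_ge0.
rewrite ge0_integralD//; last 2 first.
- by move=> x _; rewrite mule_ge0.
- exact: measurable_funeM.
rewrite ge0_integralZl//.
have W2' : (0 <= (2 / W)%:E)%E by rewrite lee_fin.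
apply: (le_trans (lee_wpmul2l W2' (leeD (lee_wpmul2l c0' intq) intU))).
rewrite -(EFinM c) -EFinD -(EFinM (2 / W)) lee_fin mulrDr addrC; apply: lerD.
  by apply/le_of_eq; move: (_ `^ _) (_ `^ _) => y z; field; rewrite gt_eqF.
have kp : (4 * kap) `^ p = 4 * kap * (4 * kap) `^ (p - 1).
  have k4 : 0 < 4 * kap by rewrite mulr_gt0.
  by rewrite -{2}[4 * kap]powRr1 ?(ltW k4)// -powRD ?subrKC// (gt_eqF k4) implybT.
rewrite kp /c; have := powR_ge0 (4 * kap) (p - 1); move: (_ `^ (p - 1)) => y y0.
rewrite (_ : 2 / W * _ = 4 * (k0 * (r%:R * s * KG)) * (y * (B / W ^+ 2))); last by field; rewrite gt_eqF.
rewrite -[leRHS]mulrA; apply: ler_wpM2r; first by rewrite mulr_ge0// divr_ge0// exprn_ge0// ltW.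
have h : 0 <= k0 * r%:R * s := mulr_ge0 (mulr_ge0 (ltW k00) (ler0n R r)) (ltW s0).
have h2 := mulr_ge0 h KG0.
rewrite /kap -subr_ge0 (_ : _ - _ = 4 * (k0 * r%:R * s * KG) + 8 * (k0 * r%:R * s)); last by ring.
by rewrite addr_ge0// mulr_ge0.
Qed.

End far_estimate.

(** * Finite exponents *)

Section frequent_bounds.
Context {R : realType}.
Local Notation mu := (@lebesgue_measure R).
Local Notation mR := (measurableTypeR R).

Lemma limn_einf_frequently (u : nat -> \bar R) (B : R) : (limn_einf u < B%:E)%E ->
  forall j, exists i, (j <= i)%N /\ (u i < B%:E)%E.
Proof.
rewrite limn_einf_lim => uB j.
have : (einfs u j < B%:E)%E.
  apply: le_lt_trans uB; have /cvg_lim -> // := @cvg_einfs_sup R u.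
  by apply: ereal_sup_ubound; exists j.
by move=> /ereal_inf_lt[_ [i /= ji <-] uiB]; exists i.
Qed.

(* Fatou's lemma for the weighted sums [sum_m z^m / c_m Z_(m,i)], whose integrals are bounded uniformly in [i]. *)
Lemma frequent_bounds (Z : nat -> nat -> R -> \bar R) (c : nat -> R) (z : R) (P : R -> Prop) (a b : R) :
  let J := `[a, b]%classic : set R in a < b -> 0 < z -> z < 1 -> (forall m, 0 < c m) ->
  (forall m i, measurable_fun (J : set mR) (Z m i)) -> (forall m i x, J x -> (0 <= Z m i x)%E) ->
  (forall m i, (\int[mu]_(x in J) Z m i x <= (c m)%:E)%E) -> {ae mu, forall x, J x -> P x} ->
  exists lam, [/\ a <= lam, lam <= b, P lam &
    exists (I : nat -> nat) (B : R), [/\ 0 < B, forall j, (j <= I j)%N &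
      forall m j, (Z m (I j) lam <= (B * (c m / z ^+ m))%:E)%E]].
Proof.
move=> J ab z0 z1 c0 mZ Z0 intZ HP.
have mJ : measurable (J : set mR) by exact: measurable_itv.
pose v m := z ^+ m / c m; have v0 m : 0 < v m by rewrite divr_gt0// exprn_gt0.
have v0' m : 0 <= v m by exact: ltW.
pose Xi i x := (\sum_(m <oo) ((v m)%:E * Z m i x))%E.
have t0 m i x : J x -> (0 <= (v m)%:E * Z m i x)%E by move=> Jx; rewrite mule_ge0 ?lee_fin// Z0.
have mt m i : measurable_fun (J : set mR) (fun x => (v m)%:E * Z m i x)%E by exact: measurable_funeM.
have Xi0 i x : J x -> (0 <= Xi i x)%E by move=> Jx; apply: nneseries_ge0 => m _ _; exact: t0.
have mXi i : measurable_fun (J : set mR) (Xi i).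
  by apply: ge0_emeasurable_sum => [m x Jx _|m _]; [exact: t0|exact: mt].
have intXi i : (\int[mu]_(x in J) Xi i x <= ((1 - z)^-1)%:E)%E.
  rewrite /Xi (@integral_nneseries _ mR R mu J mJ (fun m x => ((v m)%:E * Z m i x)%E) (mt ^~ i))//; last first.
    by move=> m x; exact: t0.
  apply: lime_le.
    by apply: is_cvg_nneseries => m _ _; apply: integral_ge0 => x; exact: t0.
  near=> n; apply: (@le_trans _ _ (\sum_(0 <= m < n) (z ^+ m)%:E)%E).
    apply: lee_sum => m _; rewrite ge0_integralZl ?lee_fin//; last by move=> x; exact: Z0.
    apply: (@le_trans _ _ ((v m)%:E * (c m)%:E)%E); first by rewrite lee_wpmul2l ?lee_fin.
    by rewrite -EFinM lee_fin /v divfK// gt_eqF.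
  rewrite sumEFin lee_fin.
  have := geometric_seriesE 1 (negbT (lt_eqF z1)); move=> /(congr1 (fun h => h n)) /=.
  rewrite /series/=; under eq_bigr do rewrite mul1r; move=> ->.
  by rewrite mul1r ler_pdivrMr ?subr_gt0// mulVf ?gt_eqF ?subr_gt0// gerBl exprn_ge0// ltW.
have fin : (\int[mu]_(x in J) limn_einf (Xi ^~ x) <= ((1 - z)^-1)%:E)%E.
  apply: le_trans (@fatou _ _ R mu J mJ Xi mXi Xi0) _.
  rewrite limn_einf_lim; apply: lime_le; first exact: is_cvg_einfs.
  near=> n; apply: (@le_trans _ _ (\int[mu]_(x in J) Xi n x)%E); last exact: intXi.
  by apply: ereal_inf_lbound; exists n => //=.
have mlim : measurable_fun (J : set mR) (fun x => limn_einf (Xi ^~ x)).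
  apply: (@measurableT_comp _ _ _ _ _ _ (-%E : \bar R -> \bar R)) => //.
  by apply: measurable_fun_limn_esup => n; exact: measurableT_comp.
have lim0 x : J x -> (0 <= limn_einf (Xi ^~ x))%E.
  move=> Jx; rewrite limn_einf_lim; apply: lime_ge; first exact: is_cvg_einfs.
  by near=> n; apply/ereal_infP => _ [k /= _ <-]; exact: Xi0.
have ilim : mu.-integrable J (fun x => limn_einf (Xi ^~ x)).
  apply/integrableP; split => //.
  apply: (@le_lt_trans _ _ (\int[mu]_(x in J) limn_einf (Xi ^~ x))%E); last exact: le_lt_trans fin (ltry _).
  by apply/le_of_eq; apply: eq_integral => x /set_mem Jx; rewrite gee0_abs// lim0.
have [lam [/andP[l1 l2] [Plam fl]]] := ae_ex ab (aeI HP (integrable_ae mJ ilim)).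
have Jl : J lam by rewrite /J/= in_itv/= l1.
exists lam; split => //; first exact: Plam.
pose B := fine (limn_einf (Xi ^~ lam)) + 1.
have EB : (limn_einf (Xi ^~ lam) < B%:E)%E by rewrite /B EFinD fineK ?fl// lteDl ?fl// lte_fin.
have B0 : 0 < B by rewrite ltr_wpDl// fine_ge0// lim0.
have /choice[I HI] : forall j, exists i, (j <= i)%N /\ (Xi i lam < B%:E)%E by exact: limn_einf_frequently.
exists I, B; split => [//|j|m j]; first by case: (HI j).
have [_ XB] := HI j.
have : ((v m)%:E * Z m (I j) lam <= B%:E)%E.
  apply: le_trans (ltW XB); rewrite /Xi (@nneseriesD1 R _ m)//; last by move=> k _; exact: t0.
  by rewrite leeDl//; apply: nneseries_ge0 => k _ _; exact: t0.
have ZI := Z0 m (I j) lam Jl; case: (Z m (I j) lam) ZI => [y| |] // y0; last first.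
  by rewrite gt0_muley ?lte_fin// leye_eq.
rewrite -EFinM !lee_fin (_ : B * _ = B / v m); last by rewrite /v invf_div.
by rewrite ler_pdivlMr// mulrC.
Unshelve. all: by end_near.
Qed.

End frequent_bounds.

Lemma powR_half_lt1 {R : realType} (d : R) : 0 < d -> 2^-1 `^ d < 1 :> R.
Proof.
move=> d0; have h : 2^-1 < 1 :> R by rewrite invf_lt1// ltr1n.
by have := gt0_ltr_powR d0 _ _ h; rewrite powR1; apply; rewrite nnegrE// invr_ge0.
Qed.

Lemma cvg_expr2 {R : realType} (x : R) : `|x| < 1 -> x ^+ m.+2 @[m --> \oo] --> (0 : R).
Proof.
move=> x1; rewrite -(mulr0 (x ^+ 2)) (_ : (fun m => _) = (fun m => x ^+ 2 * x ^+ m)).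
  by apply: cvgMr; exact: cvg_expr.
by apply/funext => m; rewrite -exprD.
Qed.

Section finite_exponent.
Context {R : realType}.
Local Notation mu := (@lebesgue_measure R).
Local Notation mR := (measurableTypeR R).
Variables (r' : nat) (phi psi : R -> R) (g : nat -> R -> R) (p th al M M0 w0 : R) (f a : R -> R) (K : nat) (CZ : R).
Local Notation r := r'.+1.
Hypotheses (p1 : 1 <= p) (hr : (1 <= r')%N) (hs : sobolev_rep r phi g) (hk : discrete_kernel phi)
  (hi : condition_i r phi) (hth : r.+1%:R < th)
  (hg : forall i, (1 <= i <= r)%N -> condition_Theta th (g i)) (mf : measurable_fun [set: R] f)
  (ipsi : integrableR psi) (al0 : 0 < al) (alr : al < r%:R) (M1 : 0 <= M) (w00 : 0 < w0)
  (fM : bnd (Some p) setT f M0)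
  (rate : forall w, w0 <= w -> bnd (Some p) setT (fun x => durrmeyer phi psi f w x - f x) (M * w `^ (- al)))
  (ab : forall s, 0 < s -> bnd (Some p) setT (Dn r s f) (a s))
  (a0 : forall s, 0 < s -> 0 <= a s) (CZ0 : 0 <= CZ)
  (Zavg : forall F W, measurable_fun [set: R] F -> (forall u, 0 <= F u)%E -> 0 < W ->
    (\int[mu]_(w in `[W, (2 * W)%R]) Zout psi K F w <= (CZ * W ^+ 2)%:E * \int[mu]_u F u)%E).
Local Notation Gm := (Gam r' g).
Local Notation b w := (iter r Dz (coef psi w f)).
Local Notation Good w := (Zout psi K (fun u => (`|f u| `^ p)%:E) w < +oo)%E.
Local Notation c2 := (2 * r%:R + 1).

Let p0 : 0 < p. Proof. exact: lt_le_trans p1. Qed.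
Let p0' : 0 <= p. Proof. exact: ltW. Qed.
Let P0 u : (0 <= (`|f u| `^ p)%:E)%E. Proof. by rewrite lee_fin powR_ge0. Qed.
Let mP : measurable_fun [set: R] (fun u => (`|f u| `^ p)%:E). Proof. exact: measurable_normpow. Qed.

(** The average [Zavg] for the density [|f|^p] is finite, hence so is the integrand almost
    everywhere. *)
Lemma Good_ae W : 0 < W -> {ae mu, forall w, `[W, (2 * W)]%classic w -> Good w}.
Proof.
move=> W0; pose I := `[W, (2 * W)]%classic : set R; have mI : measurable (I : set mR) by exact: measurable_itv.
have mZ : measurable_fun (I : set mR) (Zout psi K (fun u => (`|f u| `^ p)%:E)) by apply: measurable_Zout => //; exact: ltW.
have Z0 w : I w -> (0 <= Zout psi K (fun u => (`|f u| `^ p)%:E) w)%E.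
  by rewrite /I/= in_itv/= => /andP[h _]; apply: Zout_ge0 => //; exact: le_trans (ltW W0) h.
have iZ : mu.-integrable I (Zout psi K (fun u => (`|f u| `^ p)%:E)).
  apply/integrableP; split => //; rewrite (_ : (\int[mu]_(x in I) _ =
    \int[mu]_(x in I) Zout psi K (fun u => (`|f u| `^ p)%:E) x)%E); last first.
    by apply: eq_integral => w /set_mem Iw; rewrite gee0_abs// Z0.
  apply: le_lt_trans (Zavg mP P0 W0) _.
  apply: (@le_lt_trans _ _ ((CZ * W ^+ 2)%:E * (M0 `^ p)%:E)%E); last by rewrite -EFinM ltry.
  by apply: lee_wpmul2l => //; rewrite lee_fin mulr_ge0// exprn_ge0// ltW.
by apply: aeS (integrable_ae mI iZ) => w H Iw; have := H Iw; rewrite ge0_fin_numE// Z0.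
Qed.

Let CE := 2 ^+ r * M.
Let CE0 : 0 <= CE. Proof. by rewrite mulr_ge0// exprn_ge0. Qed.

Lemma finite_representation w s : w0 <= w -> Good w -> 0 <= s ->
  bnd (Some p) setT (fun x => Dn r s f x - Sop (b w) (Irn r (w * s) Gm) (w * x)) (CE * w `^ (- al)).
Proof.
move=> ww Gw s0; have w1 : 0 < w by exact: lt_le_trans ww.
rewrite /CE -mulrA; apply: (representation_of_rate (pm := Some p) p1 hr hs hk hi hth hg mf w1 s0 _ _ (rate ww)).
  by rewrite mulr_ge0 ?powR_ge0.
exact: coef_bounded Gw.
Qed.

Lemma finite_far : exists CF, 0 <= CF /\ forall W A s, w0 <= W -> 0 <= A ->
  (forall s', (2 * W)^-1 <= s' <= c2 / W -> a s' <= A) -> 0 < s <= W^-1 ->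
  bnd (Some p) [set x : R | (r%:R + 1) / W <= `|x|] (Dn r s f)
    (CF * ((s * W) ^+ r * (A + W `^ (- al)) + W `^ (- al))).
Proof.
have [C [C0 maj]] := majorants p1 hr hs hk hi hth hg mf ipsi al0 M1 w00 rate ab a0 CZ0 Zavg.
pose KG := fine (\int[mu]_x `|Gm x|%:E)%E.
have KG0 : 0 <= KG by rewrite fine_ge0// integral_ge0.
pose cG := 4 * (2 ^+ r' * 2 * (2 * r%:R * (KG + 1))).
have cG0 : 0 <= cG by rewrite !mulr_ge0 ?exprn_ge0// addr_ge0.
(* The outer factor 2 comes from [u^p + v^p <= (2 (u + v))^p], where [u] is four times the
   representation error and [v] the contribution of the coefficients. *)
pose CF := 2 * (4 * CE + cG * C `^ p^-1).
have Cp0 : 0 <= C `^ p^-1 by exact: powR_ge0.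
have CF0 : 0 <= CF by rewrite mulr_ge0// addr_ge0// mulr_ge0.
exists CF; split => // W A s w0W A0 aA /andP[s0 sW].
have W0 : 0 < W by exact: lt_le_trans w0W.
have [beta [mbeta beta0 bbeta intbeta]] := maj W A w0W A0 aA.
have Wal : 0 <= W `^ (- al) by exact: powR_ge0.
pose N := A + W `^ (- al); have N0 : 0 <= N by rewrite addr_ge0.
pose E := CE * W `^ (- al); have E0 : 0 <= E by rewrite mulr_ge0.
have Hrep w : `[W, (2 * W)]%classic w -> Good w ->
    bnd (Some p) setT (fun x => Dn r s f x - Sop (b w) (Irn r (w * s) Gm) (w * x)) E.
  rewrite /= in_itv/= => /andP[h1 h2] Gw; have := finite_representation (le_trans w0W h1) Gw (ltW s0).
  apply: (bnd_le (pm := Some p) p1); first by rewrite mulr_ge0 ?powR_ge0.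
  by rewrite ler_wpM2l// ler_powRN// ltW.
have mb w : `[W, (2 * W)]%classic w -> Good w -> exists M, forall k, `|b w k| <= M.
  rewrite /= in_itv/= => /andP[h1 h2] Gw; have [|Mc cM] := coef_bounded ipsi p1 mf _ Gw; first exact: lt_le_trans h1.
  by exists (2 ^+ r * Mc); exact: (iter_Dz_bounded r cM).
have B0 : 0 <= C * W ^+ 2 * N `^ p by rewrite mulr_ge0 ?powR_ge0// mulr_ge0// exprn_ge0// ltW.
have := far_estimate p1 (LI_Gam hs hth hg) (Theta_Gam hr hs hth hg) (th_gt1 hth) W0 s0 sW (measurable_Dn r s mf)
  Hrep mb (Good_ae W0) mbeta beta0 bbeta intbeta B0.
rewrite /bnd => /le_trans; apply; rewrite lee_fin.
have k4 : 4 * ((2 * W * s) ^+ r' * (2 * W) * (2 * r%:R * s * (KG + 1))) = cG * (s * W) ^+ r.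
  by rewrite /cG -[2 * W * s]mulrA exprMn exprS [s * W]mulrC; move: (_ ^+ _) (_ ^+ _) => y z; ring.
rewrite -/KG k4 (_ : C * W ^+ 2 * N `^ p / W ^+ 2 = C * N `^ p); last first.
  by move: (N `^ p) => y; field; rewrite gt_eqF.
pose u := 4 * E; pose v := cG * (s * W) ^+ r * (C `^ p^-1 * N).
have sW0 : 0 <= (s * W) ^+ r by rewrite exprn_ge0// mulr_ge0// ltW.
have u0 : 0 <= u by rewrite mulr_ge0.
have v0 : 0 <= v := mulr_ge0 (mulr_ge0 cG0 sW0) (mulr_ge0 Cp0 N0).
have two : 2 <= 2 `^ p by rewrite -{1}[2]powRr1// ler_powR// ler1n.
have h1 : 2 * 2 `^ p * E `^ p <= u `^ p.
  rewrite /u (_ : 4 = 2 * 2); last by rewrite -natrM.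
  rewrite (@powRM _ (2 * 2) E)// (@powRM _ 2 2)//.
  by apply: ler_wpM2r; [exact: powR_ge0|apply: ler_wpM2r => //; exact: powR_ge0].
have h2 : (cG * (s * W) ^+ r) `^ p * (C * N `^ p) = v `^ p.
  rewrite /v (powRM p (mulr_ge0 cG0 sW0) (mulr_ge0 Cp0 N0)) (powRM p Cp0 N0) powR_root//.
have uv0 : 0 <= u + v by rewrite addr_ge0.
rewrite h2; apply: (@le_trans _ _ ((2 * (u + v)) `^ p)).
  rewrite powRM//; apply: (@le_trans _ _ (2 * (u + v) `^ p)); last by rewrite ler_wpM2r ?powR_ge0.
  rewrite [leRHS]mulr_natl [leRHS]mulr2n; apply: lerD.
    by apply: (le_trans h1); apply: ge0_ler_powR; rewrite ?nnegrE// lerDl.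
  by apply: ge0_ler_powR; rewrite ?nnegrE// lerDr.
apply: ge0_ler_powR; rewrite ?nnegrE.
- exact: p0'.
- exact: mulr_ge0 (ler0n R 2) uv0.
- exact: mulr_ge0 CF0 (addr_ge0 (mulr_ge0 sW0 N0) Wal).
have t1 : 0 <= CE * (s * W) ^+ r * N := mulr_ge0 (mulr_ge0 CE0 sW0) N0.
have t2 : 0 <= cG * C `^ p^-1 * W `^ (- al) := mulr_ge0 (mulr_ge0 cG0 Cp0) Wal.
rewrite -/N /CF /u /v /E; clearbody N; move: t1 t2.
by move: (C `^ _) (W `^ _) ((s * W) ^+ r) CE => x y zz ce; lra.
Qed.

(** The coefficients are bounded only in the mean over [w] in [[W, 2 W]], for each frequency
    [q m / t i] separately. [frequent_bounds] yields one factor [lam] in [[1, 2]] and one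
    subsequence of scales good for all [m]; the frequencies are [lam * q m]. *)
Lemma finite_selection (t : nat -> R) : (forall i, 0 < t i) -> (forall i, 0 < a (t i)) ->
   (forall i, i.+1%:R * t i `^ al <= a (t i)) -> t n @[n --> \oo] --> 0 ->
   (forall i s, t i <= s -> a s <= 2 * a (t i) * (s / t i) `^ al) ->
   exists (om : nat -> R) (I : nat -> nat) (Cm : nat -> R),
     [/\ forall m, 0 < om m, om m @[m --> \oo] --> 0, forall j, (j <= I j)%N &
       om m ^+ r * (Cm m * om m `^ (- ep (Some p))) @[m --> \oo] --> 0] /\
     [/\ forall m, \forall j \near \oo, Good (om m / t (I j)),
      forall m, \forall j \near \oo, forall k, `|t (I j) `^ ep (Some p) / a (t (I j)) * b (om m / t (I j)) k| <= Cm m &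
      forall m e, 0 < e -> exists n : nat, \forall j \near \oo, forall s : seq int, uniq s ->
        (forall k, k \in s -> e < `|t (I j) `^ ep (Some p) / a (t (I j)) * b (om m / t (I j)) k|) -> (size s <= n)%N].
Proof.
move=> t0 at0 tal tcv ctrl.
have [C [C0 maj]] := majorants p1 hr hs hk hi hth hg mf ipsi al0 M1 w00 rate ab a0 CZ0 Zavg.
(* The geometric decay of [q m] matches the weights [z ^ m] of [frequent_bounds], and [2 q m <= 1]
   keeps the steps in question coarser than [t i]. *)
pose q m : R := 2^-1 ^+ m.+2.
have h2 : 0 < 2^-1 :> R by rewrite invr_gt0.
have h2' : 2^-1 < 1 :> R by rewrite invf_lt1// ltr1n.
have q0 m : 0 < q m by rewrite exprn_gt0.
have q2 m : 2 * q m <= 1.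
  by rewrite /q exprS mulrA mulfV// mul1r exprn_ile1// ltW.
pose W m i := q m / t i; have W0 m i : 0 < W m i by rewrite divr_gt0.
pose K1 := 2 * c2 `^ al + 1.
have c20 : 0 < c2 :> R by rewrite ltr_wpDl// mulr_ge0.
have K10 : 0 < K1 by rewrite ltr_wpDl// mulr_ge0// powR_ge0.
(* The bound of [majorants] at [W = q m / t i] after normalisation: the scale [t i] cancels. [C + 1]
   keeps [c m] positive. *)
pose c m := (C + 1) * K1 `^ p * q m `^ (1 - al * p).
have c0 m : 0 < c m by rewrite !mulr_gt0 ?powR_gt0// ltr_wpDl.
have c1 m : 0 <= c m by exact: ltW.
pose bt m i lam k := t i `^ p^-1 / a (t i) * b (lam * W m i) k.
have Hm m i : exists Z : R -> \bar R, [/\ measurable_fun (`[1, 2]%classic : set mR) Z,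
    forall x, `[1, 2]%classic x -> (0 <= Z x)%E, (\int[mu]_(x in `[1%R, 2%R]) Z x <= (c m)%:E)%E &
    w0 <= W m i -> {ae mu, forall x, `[1, 2]%classic x -> Good (x * W m i) /\
       (esZ (fun k => (`|bt m i x k| `^ p)%:E) <= Z x)%E}].
  (* For frequencies below [w0] nothing is claimed, and the zero function serves. *)
  have [w0W|Ww0] := leP w0 (W m i); last first.
    by exists (cst 0%E); split => //; rewrite integral0 lee_fin.
  have W1 := W0 m i; have ti := t0 i; have Ni := at0 i.
  pose qa := q m `^ (- al); have qa0 : 0 < qa by rewrite powR_gt0.
  pose A := 2 * a (t i) * (c2 `^ al * qa).
  have A0 : 0 <= A by rewrite !mulr_ge0 ?powR_ge0// ltW.
  have aA s : (2 * W m i)^-1 <= s <= c2 / W m i -> a s <= A.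
    move=> /andP[s1 s2]; have ts : t i <= s.
      apply: le_trans s1; rewrite /W mulrA invf_div -[leLHS]mulr1 ler_wpM2l ?(ltW ti)//.
      by rewrite invf_ge1; [exact: q2|rewrite mulr_gt0].
    have s0 : 0 < s by exact: lt_le_trans ts.
    apply: le_trans (ctrl i s ts) _; rewrite /A ler_wpM2l ?mulr_ge0 ?(ltW Ni)//.
    rewrite /qa powRN -powR_div ?(ltW c20)//.
    apply: ge0_ler_powR; rewrite ?nnegrE ?divr_ge0 ?(ltW al0) ?(ltW s0) ?(ltW ti) ?(ltW c20) ?(ltW (q0 m))//.
    rewrite ler_pdivrMr//; apply: le_trans s2 _; rewrite /W; apply/le_of_eq.
    by field; rewrite !gt_eqF.
  have [beta [mbeta beta0 bbeta intbeta]] := maj (W m i) A w0W A0 aA.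
  pose S w := esZ (beta ^~ w); pose J := `[W m i, (2 * W m i)]%classic : set R.
  have mS : measurable_fun (J : set mR) S by apply: measurable_esZ => // k w; exact: beta0.
  have S0 w : J w -> (0 <= S w)%E by move=> Jw; apply: esZ_ge0 => k; exact: beta0.
  pose kk := t i * (a (t i) `^ p)^-1.
  have kk0 : 0 <= kk by rewrite mulr_ge0 ?invr_ge0 ?powR_ge0// ltW.
  have JE x : `[1, 2]%classic x <-> J (x * W m i).
    by rewrite /J/= !in_itv/= -[X in X <= x * _]mul1r !ler_pM2r.
  have EJ : `[1, 2]%classic = [set x | J (W m i * x + 0)].
    by apply/seteqP; split => x /=; rewrite addr0 mulrC => /JE.
  have mSl : measurable_fun (`[1, 2]%classic : set mR) (fun x => S (x * W m i)).
    apply: (measurable_comp (F := J : set mR)) => //; first exact: measurable_itv.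
      by move=> _ [x /JE Jx <-].
    apply: (@measurable_funS _ _ _ _ setT) => //; exact: measurable_funM.
  exists (fun x => kk%:E * S (x * W m i)%R)%E; split.
  - exact: measurable_funeM.
  - by move=> x /JE Jx; rewrite mule_ge0 ?lee_fin ?S0.
  - rewrite ge0_integralZl//; last by move=> x /JE; exact: S0.
    have EI : (\int[mu]_(x in `[1%R, 2%R]) S (x * W m i)%R = (W m i)^-1%:E * \int[mu]_(w in J) S w)%E.
      have := @ge0_integral_affine_in R S (W m i) 0 J (lt0r_neq0 W1) (measurable_itv _) mS S0.
      rewrite gtr0_norm// -EJ => <-; apply: eq_integral => x _; congr S; by rewrite addr0 mulrC.
    rewrite EI; have kk0' : (0 <= kk%:E)%E by rewrite lee_fin.
    have Wi0 : (0 <= (W m i)^-1%:E)%E by rewrite lee_fin invr_ge0 ltW.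
    apply: (le_trans (lee_wpmul2l kk0' (lee_wpmul2l Wi0 intbeta))).
    rewrite -!EFinM lee_fin; have tN : t i `^ al <= a (t i).
      by apply: le_trans (tal i); rewrite ler_peMl ?powR_ge0// ler1n.
    have WE : W m i `^ (- al) <= a (t i) * qa.
      rewrite /W (powR_div (- al) (ltW (q0 m)) ti) (powRN (t i)) invrK -/qa mulrC.
      by apply: ler_wpM2r => //; exact: ltW.
    have AN : A + W m i `^ (- al) <= a (t i) * (K1 * qa).
      apply: (le_trans (lerD (lexx _) WE)); rewrite /A /K1; apply/le_of_eq.
      by move: (a (t i)) (c2 `^ al) => x y; ring.
    have AN0 : 0 <= A + W m i `^ (- al) by rewrite addr_ge0 ?powR_ge0.
    have Kq : 0 <= K1 * qa by rewrite mulr_ge0// ltW.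
    have H1 : (A + W m i `^ (- al)) `^ p <= a (t i) `^ p * (K1 `^ p * q m `^ (- (al * p))).
      apply: (@le_trans _ _ ((a (t i) * (K1 * qa)) `^ p)).
        by apply: ge0_ler_powR; rewrite ?nnegrE ?mulr_ge0 ?(ltW Ni) ?(ltW K10) ?(ltW qa0).
      by rewrite powRM ?(ltW Ni)// powRM ?(ltW K10) ?(ltW qa0)// /qa -powRrM mulNr.
    have Cc : 0 <= kk * ((W m i)^-1 * (C * W m i ^+ 2)).
      apply: mulr_ge0 kk0 (mulr_ge0 _ (mulr_ge0 C0 _)); first by rewrite invr_ge0 ltW.
      by apply: exprn_ge0; exact: ltW.
    rewrite [leLHS](_ : _ = kk * ((W m i)^-1 * (C * W m i ^+ 2)) * (A + W m i `^ (- al)) `^ p); last by rewrite !mulrA.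
    apply: (le_trans (ler_wpM2l Cc H1)).
    have an0 : a (t i) `^ p != 0 by rewrite gt_eqF// powR_gt0.
    rewrite /c (_ : q m `^ (1 - al * p) = q m * q m `^ (- (al * p))); last first.
      by rewrite powRD ?(gt_eqF (q0 m)) ?implybT// powRr1// ltW.
    rewrite /kk /W; have x0 := powR_ge0 (q m) (- (al * p)); have y0 := powR_ge0 K1 p.
    move: x0 y0 an0; move: (q m `^ (- (al * p))) (K1 `^ p) (a (t i) `^ p) => x y n x0 y0 n0.
    rewrite (_ : _ * _ * _ = C * (y * (q m * x))); last by field; rewrite n0 gt_eqF//= gt_eqF.
    by rewrite -mulrA ler_wpM2r ?lerDl// mulr_ge0// mulr_ge0// ltW.
  move=> _; have W1n : W m i != 0 by rewrite gt_eqF.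
  have := ae_affine 0 W1n (Good_ae W1); apply: aeS => x; rewrite addr0 [W m i * x]mulrC => Gx x12.
  have Jx : J (x * W m i) by exact/JE.
  have Gx' := Gx Jx; split; first exact: Gx'.
  rewrite -esZZl//; last by move=> k; exact: beta0.
  apply: le_esZ => k; first by rewrite lee_fin powR_ge0.
  rewrite /bt normrM powRM// EFinM (_ : `|t i `^ p^-1 / a (t i)| `^ p = kk).
    by rewrite lee_wpmul2l ?lee_fin//; exact: bbeta.
  rewrite ger0_norm; last by rewrite divr_ge0 ?powR_ge0// ltW.
  by rewrite powR_div ?powR_ge0// powR_root// ltW.
have /choice[Z' HZ'] : forall mi : nat * nat, exists Z : R -> \bar R, [/\ measurable_fun (`[1, 2]%classic : set mR) Z,
    forall x, `[1, 2]%classic x -> (0 <= Z x)%E, (\int[mu]_(x in `[1%R, 2%R]) Z x <= (c mi.1)%:E)%E &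
    w0 <= W mi.1 mi.2 -> {ae mu, forall x, `[1, 2]%classic x -> Good (x * W mi.1 mi.2) /\
       (esZ (fun k => (`|bt mi.1 mi.2 x k| `^ p)%:E) <= Z x)%E}] by move=> [m i]; exact: Hm.
pose Z m i := Z' (m, i).
pose Pr x := forall m i, w0 <= W m i -> Good (x * W m i) /\ (esZ (fun k => (`|bt m i x k| `^ p)%:E) <= Z m i x)%E.
have HPr : {ae mu, forall x, `[1, 2]%classic x -> Pr x}.
  have : {ae mu, forall x, forall m, forall i, `[1, 2]%classic x -> w0 <= W m i -> Good (x * W m i) /\
      (esZ (fun k => (`|bt m i x k| `^ p)%:E) <= Z m i x)%E}.
    apply: ae_foralln => m; apply: ae_foralln => i; have [_ _ _ H] := HZ' (m, i).
    have [w0W|Ww0] := leP w0 (W m i); last by apply: aeW.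
    by apply: aeS (H w0W) => x Hx x12 _; exact: Hx.
  by apply: aeS => x Hx x12 m i w0W; exact: Hx.
(* Half of the available gain: the loss [z ^ (- m)], a multiple of [q m ^ (- de)], leaves the rate
   [q m ^ ((r - al) / 2)] after the p-th root. *)
pose de := p * (r%:R - al) / 2; have de0 : 0 < de by rewrite divr_gt0// mulr_gt0// subr_gt0.
pose z : R := 2^-1 `^ de; have z0 : 0 < z by rewrite powR_gt0.
have z1 : z < 1.
  exact: powR_half_lt1.
have [lam [l1 l2 Pl [I [B [B0 jI HB]]]]] := frequent_bounds (ltr1n R 2 : 1 < 2) z0 z1 c0
  (fun m i => let: And4 h _ _ _ := HZ' (m, i) in h) (fun m i => let: And4 _ h _ _ := HZ' (m, i) in h)
  (fun m i => let: And4 _ _ h _ := HZ' (m, i) in h) HPr.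
have qcv : q m @[m --> \oo] --> (0 : R).
  by apply: cvg_expr2; rewrite gtr0_norm.
have l0 : 0 < lam by exact: lt_le_trans l1.
pose D m := B * (c m / z ^+ m); have D0 m : 0 < D m by rewrite mulr_gt0// divr_gt0// exprn_gt0.
have nearW m : \forall j \near \oo, w0 <= W m (I j).
  have qw : 0 < q m / w0 by rewrite divr_gt0.
  have [N _ HN] : \forall n \near \oo, t n < q m / w0.
    by move/cvgrPdist_lt: tcv => /(_ _ qw); apply: filterS => n; rewrite sub0r normrN gtr0_norm.
  exists N => // j /= Nj; have := HN _ (leq_trans Nj (jI j)) => /=.
  by rewrite /W ltr_pdivlMr// ler_pdivlMr// mulrC => /ltW.
have bound m : \forall j \near \oo, Good (lam * q m / t (I j)) /\
    (esZ (fun k => (`|bt m (I j) lam k| `^ p)%:E) <= (D m)%:E)%E.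
  apply: filterS (nearW m) => j w0W; have [h3 h4] := Pl m (I j) w0W.
  by rewrite -mulrA; split => //; apply: le_trans h4 (HB m j).
have btE m j k : bt m (I j) lam k = t (I j) `^ ep (Some p) / a (t (I j)) * b (lam * q m / t (I j)) k.
  by rewrite /bt /W mulrA.
have b0 m j k : (0 <= (`|bt m j lam k| `^ p)%:E)%E by rewrite lee_fin powR_ge0.
exists (fun m => lam * q m), I, (fun m => D m `^ p^-1); split; split => //.
- by move=> m; rewrite mulr_gt0.
- rewrite -(mulr0 lam); apply: cvgMr; exact: qcv.
- rewrite (_ : (fun m => _) = (fun m => lam ^+ r * lam `^ (- p^-1) * (B * ((C + 1) * K1 `^ p * z ^+ 2)) `^ p^-1 *
      (2^-1 `^ ((r%:R - al) / 2)) ^+ m.+2)).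
    rewrite -(mulr0 (lam ^+ r * lam `^ (- p^-1) * (B * ((C + 1) * K1 `^ p * z ^+ 2)) `^ p^-1)); apply: cvgMr.
    apply: cvg_expr2; rewrite ger0_norm ?powR_ge0//.
    by apply: powR_half_lt1; rewrite divr_gt0// subr_gt0.
  apply/funext => m; have qq := q0 m; have qn0 : q m != 0 by rewrite gt_eqF.
  have qpow x : (2^-1 `^ x) ^+ m.+2 = q m `^ x.
    by rewrite -powR_mulrn ?powR_ge0// -powRrM mulrC powRrM powR_mulrn// ltW.
  have qD x y : q m `^ (x + y) = q m `^ x * q m `^ y by rewrite powRD// qn0 implybT.
  have DE : D m = B * ((C + 1) * K1 `^ p * z ^+ 2) * q m `^ (1 - al * p - de).
    rewrite /D /c; have -> : z ^+ m = q m `^ de / z ^+ 2.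
      by rewrite -qpow -/z -[m.+2]addn2 exprD mulfK// expf_neq0// gt_eqF.
    rewrite (qD (1 - al * p) (- de)) (powRN (q m) de); have : q m `^ de != 0 by rewrite gt_eqF// powR_gt0.
    have : z != 0 by rewrite gt_eqF.
    move: (q m `^ de) (q m `^ (1 - al * p)) (K1 `^ p) => x y k xn zn; field.
    by rewrite xn zn.
  have K0 : 0 <= B * ((C + 1) * K1 `^ p * z ^+ 2).
    by rewrite !mulr_ge0 ?exprn_ge0 ?powR_ge0 ?addr_ge0 ?(ltW B0)// ltW.
  have -> : ep (Some p) = p^-1 by [].
  rewrite qpow DE (powRM p^-1 K0 (powR_ge0 _ _)) -(powRrM (q m)) exprMn (powRM (- p^-1) (ltW l0) (ltW qq)).
  rewrite -(powR_mulrn r (ltW qq)).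
  have -> : (r%:R - al) / 2 = r%:R + ((1 - al * p - de) / p + - p^-1).
    by rewrite /de; field; rewrite gt_eqF.
  rewrite (qD r%:R) (qD ((1 - al * p - de) / p)); move: (q m `^ _) (q m `^ _) (q m `^ _) => x y u.
  by move: (lam ^+ r) (lam `^ _) (_ `^ _) => l l' v; ring.

- by move=> m; apply: filterS (bound m) => j [].
- move=> m; apply: filterS (bound m) => j [_ H] k; rewrite -btE; apply: le_powR_root => //.
  by rewrite -lee_fin; apply: le_trans H; exact: (@term_le_esZ R (fun k => (`|bt m (I j) lam k| `^ p)%:E)).
(* Chebyshev's inequality: the p-th powers sum to at most [D m], so at most [D m / e^p] terms exceed
   [e]. *)
move=> m e e0; exists (Num.truncn (D m / e `^ p)).+1.
apply: filterS (bound m) => j [_ H] s us Hs; rewrite leqNgt; apply/negP => ns.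
have ep0 : 0 < e `^ p by rewrite powR_gt0.
have : (\sum_(k <- s) (e `^ p)%:E <= (D m)%:E)%E.
  apply: le_trans H; apply: le_trans (sum_le_esZ us (b0 m (I j))).
  rewrite !big_seq; apply: lee_sum => k ks; rewrite lee_fin; apply: ge0_ler_powR; rewrite ?nnegrE ?(ltW e0)//.
  by rewrite btE ltW// Hs.
rewrite sume_const_seq; last by rewrite lee_fin (ltW ep0).
rewrite -EFinM lee_fin -ler_pdivlMr// => H'.
have := truncnS_gt (D m / e `^ p); rewrite ltNge => /negP; apply; apply: le_trans H'.
by rewrite ler_nat ltnW.
Qed.

End finite_exponent.

Theorem finite_exponent_bound (R : realType) (r' : nat) (phi psi : R -> R) (g : nat -> R -> R)
  (p th th' al M M0 w0 : R) (f : R -> R) : 1 <= p -> (1 <= r')%N -> sobolev_rep r'.+1 phi g ->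
  discrete_kernel phi -> condition_i r'.+1 phi -> r'.+2%:R < th ->
  (forall i, (1 <= i <= r'.+1)%N -> condition_Theta th (g i)) -> measurable_fun [set: R] f ->
  integrableR psi -> condition_Theta th' psi -> 1 < th' -> 0 < al -> al < r'.+1%:R -> 0 <= M -> 0 < w0 ->
  0 <= M0 -> bnd (Some p) setT f M0 ->
  (forall w, w0 <= w -> bnd (Some p) setT (fun x => durrmeyer phi psi f w x - f x) (M * w `^ (- al))) ->
  exists C, 0 <= C /\ forall s, 0 < s <= 1 -> bnd (Some p) setT (Dn r'.+1 s f) (C * s `^ al).
Proof.
move=> p1 hr hs hk hi hth hg mf ipsi psiT th1 al0 alr M1 w00 M00 fM rate.
have [K [CZ [CZ0 Zavg]]] := Zout_average ipsi psiT th1.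
have B00 : 0 <= 2 ^+ r'.+1 * M0 by rewrite mulr_ge0// exprn_ge0.
have /choice[a Ha] : forall s : R, exists a, [/\ 0 <= a, a <= 2 ^+ r'.+1 * M0, bnd (Some p) setT (Dn r'.+1 s f) a &
    forall B, 0 <= B -> bnd (Some p) setT (Dn r'.+1 s f) B -> a <= B].
  by move=> s; apply: (bnd_inf (pm := Some p) p1) => //; apply: (bnd_Dn (pm := Some p) p1).
have ab s : 0 < s -> bnd (Some p) setT (Dn r'.+1 s f) (a s) by move=> _; have [] := Ha s.
have a0 s : 0 < s -> 0 <= a s by move=> _; have [] := Ha s.
have [CF [CF0 farb]] := finite_far p1 hr hs hk hi hth hg mf ipsi al0 M1 w00 fM rate ab a0 CZ0 Zavg.
have CE0 : 0 <= 2 ^+ r'.+1 * M by rewrite mulr_ge0// exprn_ge0.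
have C00 : 0 < r'.+1%:R + 1 :> R by rewrite ltr_wpDl.
have c20 : 0 < 2 * r'.+1%:R + 1 :> R by rewrite ltr_wpDl// mulr_ge0.
apply: (@transfer R (Some p) r' (th - r'.+1%:R) al (2 ^+ r'.+1 * M0) (2 ^+ r'.+1 * M) (r'.+1%:R + 1)
  (2 * r'.+1%:R + 1) CF w0 (Gam r' g) f a (fun w => iter r'.+1 Dz (coef psi w f))
  (fun w => (Zout psi K (fun u => (`|f u| `^ p)%:E) w < +oo)%E)) => //.
- exact: (LI_Gam hs hth hg).
- exact: (Theta_Gam hr hs hth hg).
- exact: th_gt1.
- by move=> s _; have [-> ->] := Ha s.
- by move=> s B _; have [_ _ _] := Ha s; exact.
- move=> w s ww Gw s0; exact: (finite_representation p1 hr hs hk hi hth hg mf ipsi M1 w00 rate ww Gw s0).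
exact: (finite_selection p1 hr hs hk hi hth hg mf ipsi al0 alr M1 w00 fM rate ab a0 CZ0 Zavg).
Qed.

(** * The supremum norm *)

Section tails.
Context {R : realType}.
Local Notation mu := (@lebesgue_measure R).
Local Notation mR := (measurableTypeR R).
Variable psi : R -> R.
Hypothesis ipsi : integrableR psi.

Definition tail V x := if V <= `|x| then psi x else 0.

Lemma measurable_tail V : measurable_fun [set: R] (tail V).
Proof.
apply: measurable_fun_ifT => //; last exact: measurable_psi.
by apply: measurable_fun_ler => //; exact: measurableT_comp.
Qed.

Lemma norm_tail_le V x : `|tail V x| <= `|psi x|.
Proof. by rewrite /tail; case: ifP => // _; rewrite normr0. Qed.

Lemma integrable_tail V : integrableR (tail V).
Proof.
have mt : measurable_fun [set: R] (EFin \o tail V) by apply/measurable_EFinP; exact: measurable_tail.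
have dom x : [set: R] x -> (`|(EFin \o tail V) x| <= `|(EFin \o psi) x|)%E.
  by move=> _; rewrite /= lee_fin norm_tail_le.
have [mp fin] := integrableP _ _ _ ipsi; apply/integrableP; split => //.
apply: le_lt_trans fin; apply: ge0_le_integral => //; exact: measurableT_comp.
Qed.

Lemma small_tail e : 0 < e -> exists V, 0 <= V /\ Kpsi (tail V) <= e.
Proof.
move=> e0; have mp := measurable_psi ipsi.
pose f_ n x := `|tail n%:R x|%:E; pose h x := `|psi x|%:E.
have h1 n : measurable_fun [set: R] (f_ n) by apply: mabs; exact: measurable_tail.
have h2 : measurable_fun [set: R] (cst (0%E : \bar R)) by exact: measurable_cst.
have h3 : {ae mu, forall x, [set: R] x -> f_ ^~ x @ \oo --> cst (0%E : \bar R) x}.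
  apply: aeW => x _; apply: cvg_near_cst; exists (Num.truncn `|x|).+1 => // n /= xn.
  rewrite /f_ /tail leNgt (_ : `|x| < n%:R) ?normr0//.
  by apply: lt_le_trans (truncnS_gt _) _; rewrite ler_nat.
have h4 : mu.-integrable [set: R] h by exact: (integrable_norm ipsi).
have h5 : {ae mu, forall x n, [set: R] x -> (`|f_ n x| <= h x)%E}.
  by apply: aeW => x n _; rewrite /f_ /h /= normr_id lee_fin norm_tail_le.
have [_ _ H] := @dominated_convergence _ mR R mu setT measurableT f_ _ h h1 h2 h3 h4 h5.
move: H; rewrite integral0 => /fine_cvgP[_ /cvgrPdist_le/(_ _ e0)[n _ Hn]].
exists n%:R; split => //; have := Hn n (leqnn n) => /=; rewrite sub0r normrN; apply: le_trans.
by rewrite /Kpsi ler_norm.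
Qed.

End tails.

Lemma integral_abs_psik_tail {R : realType} (psi : R -> R) V w k : integrableR psi -> 0 < w ->
  (\int[@lebesgue_measure R]_u `|tail psi V (w * u - k%:~R)|%:E = (w^-1 * Kpsi (tail psi V))%:E)%E.
Proof. by move=> ipsi w0; have it := integrable_tail ipsi V; rewrite integral_abs_psik// KpsiE. Qed.

(** If [|k| >= V + w c], the points [|u| < c] satisfy [|w u - k| >= V]: there only the tail of [psi]
    meets [g], while elsewhere [g] is bounded by [B1]. *)
Lemma coef_far_near {R : realType} (psi g : R -> R) (w c B1 B2 V : R) (k : int) : integrableR psi ->
  0 < w -> measurable_fun [set: R] g -> icoef psi w g k -> 0 <= B1 -> 0 <= B2 ->
  (forall u, c <= `|u| -> `|g u| <= B1) -> {ae @lebesgue_measure R, forall u, `|g u| <= B2} ->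
  V + w * c <= `|k%:~R : R| -> `|coef psi w g k| <= B1 * Kpsi psi + B2 * Kpsi (tail psi V).
Proof.
move=> ipsi w0 mg ig B10 B20 gfar gB kV; rewrite -lee_fin; apply: le_trans (norm_coef_le w0 ig) _.
have mk : measurable_fun [set: R] (fun u => `|psi (w * u - k%:~R)|%:E) by apply: mabs; exact: measurable_psik.
have mt : measurable_fun [set: R] (fun u => `|tail psi V (w * u - k%:~R)|%:E).
  by apply: mabs; exact: (measurable_psik (integrable_tail ipsi V)).
have m1 : measurable_fun [set: R] (fun u => B1%:E * `|psi (w * u - k%:~R)|%:E)%E by exact: measurable_funeM.
have m2 : measurable_fun [set: R] (fun u => B2%:E * `|tail psi V (w * u - k%:~R)|%:E)%E by exact: measurable_funeM.
apply: (@le_trans _ _ (w%:E * \int[@lebesgue_measure R]_u (B1%:E * `|psi (w * u - k%:~R)|%:E +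
   B2%:E * `|tail psi V (w * u - k%:~R)|%:E))%E).
  apply: lee_wpmul2l; first by rewrite lee_fin ltW.
  apply: ae_ge0_le_integral => //.
  - by apply/measurable_EFinP; apply: measurable_funM; apply: measurableT_comp => //; exact: measurable_psik.
  - by move=> u _; rewrite adde_ge0// mule_ge0 ?lee_fin.
  - exact: emeasurable_funD.
  apply: aeS gB => u gu _; rewrite -!EFinM -EFinD lee_fin.
  have [cu|uc] := leP c `|u|.
    by apply: ler_wpDr; rewrite ?mulr_ge0// mulrC ler_wpM2r// gfar.
  apply: ler_wpDl; first by rewrite mulr_ge0.
  rewrite mulrC /tail (_ : V <= _) ?ler_wpM2r//.
  have h1 : `|k%:~R : R| <= `|w * u - k%:~R| + `|w * u|.
    by rewrite -{1}(subKr (w * u) k%:~R) [leRHS]addrC ler_normB.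
  have h2 : `|w * u| <= w * c by rewrite normrM gtr0_norm// ler_wpM2l ?(ltW w0)// ltW.
  lra.
rewrite ge0_integralD//; last 2 first.
- by move=> u _; rewrite mule_ge0 ?lee_fin.
- by move=> u _; rewrite mule_ge0 ?lee_fin.
rewrite !ge0_integralZl ?lee_fin// integral_abs_psik// KpsiE// integral_abs_psik_tail//.
rewrite -(EFinM w^-1) -(EFinM B1) -(EFinM B2) -EFinD -(EFinM w) lee_fin; apply/le_of_eq.
by field; rewrite gt_eqF.
Qed.

Lemma small_power {R : realType} (D eta b x : R) : 0 <= D -> 0 < eta -> 0 < b -> 0 < x ->
  exists y, [/\ 0 < y, y <= b & D * y `^ x <= eta].
Proof.
move=> D0 e0 b0 x0; have D1 : 0 < D + 1 by rewrite ltr_wpDl.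
pose z := (eta / (D + 1)) `^ x^-1; have z0 : 0 < z by rewrite powR_gt0// divr_gt0.
exists (Num.min b z); have m0 : 0 < Num.min b z by rewrite lt_min b0.
split => //; first by rewrite ge_min lexx.
apply: (@le_trans _ _ (D * (eta / (D + 1)))).
  rewrite ler_wpM2l// -[leRHS](powR_root x0)//; last by rewrite divr_ge0 ?(ltW e0)// ltW.
  by apply: ge0_ler_powR; rewrite ?nnegrE ?(ltW x0) ?(ltW m0) ?(ltW z0)// ge_min lexx orbT.
by rewrite mulrCA ler_piMr ?(ltW e0)// ler_pdivrMr// mul1r lerDl.
Qed.

Lemma powR_inv {R : realType} (x a : R) : 0 < x -> x^-1 `^ a = (x `^ a)^-1.
Proof. by move=> x0; rewrite -(div1r x) powR_div// ?(ltW x0)// powR1 div1r. Qed.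

Lemma norm_Dn_le (R : realType) (n : nat) (s : R) (h : R -> R) (B x : R) : (forall y, `|h y| <= B) -> `|Dn n s h x| <= 2 ^+ n * B.
Proof.
move=> hB; elim: n x => [|n IH] x; first by rewrite expr0 mul1r.
rewrite exprS -mulrA mulr_natl mulr2n; apply: le_trans (ler_normB _ _) _.
by apply: lerD; exact: IH.
Qed.

Section sup_exponent.
Context {R : realType}.
Local Notation mu := (@lebesgue_measure R).
Local Notation mR := (measurableTypeR R).
Variables (r' : nat) (phi psi : R -> R) (g : nat -> R -> R) (th al M M0 w0 : R) (f a : R -> R).
Local Notation r := r'.+1.
Hypotheses (hr : (1 <= r')%N) (hs : sobolev_rep r phi g) (hk : discrete_kernel phi)
  (hi : condition_i r phi) (hth : r.+1%:R < th)
  (hg : forall i, (1 <= i <= r)%N -> condition_Theta th (g i)) (mf : measurable_fun [set: R] f)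
  (ipsi : integrableR psi) (al0 : 0 < al) (alr : al < r%:R) (M1 : 0 <= M) (w00 : 0 < w0)
  (M00 : 0 <= M0) (fM : forall x, `|f x| <= M0)
  (rate : forall w x, w0 <= w -> `|durrmeyer phi psi f w x - f x| <= M * w `^ (- al))
  (ab : forall s, 0 < s -> bnd None setT (Dn r s f) (a s)) (a0 : forall s, 0 < s -> 0 <= a s).
Local Notation Gm := (Gam r' g).
Local Notation b w := (iter r Dz (coef psi w f)).

Let ic w k : 0 < w -> icoef psi w f k. Proof. by move=> w1; exact: (icoef_bounded ipsi _ w1 mf fM). Qed.

Let iD w k : 0 < w -> icoef psi w (Dn r w^-1 f) k /\ b w k = coef psi w (Dn r w^-1 f) k.
Proof. by move=> w1; apply: iter_Dz_coef => // j _; exact: ic. Qed.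

Let cb w : 0 < w -> exists Mc, forall k, `|coef psi w f k| <= Mc.
Proof.
by move=> w1; exists (Kpsi psi * M0) => k; apply: coef_ae_bound => //; [exact: ic|exact: aeW].
Qed.

Let ae_a s : 0 < s -> {ae mu, forall u, `|Dn r s f u| <= a s}.
Proof. by move=> s0; have := ab s0; rewrite /bnd; apply: aeS => u; exact. Qed.

Let b_le w k : 0 < w -> `|b w k| <= Kpsi psi * a w^-1.
Proof.
move=> w1; have wi : 0 < w^-1 by rewrite invr_gt0.
have [i1 ->] := iD k w1; apply: coef_ae_bound => //; [exact: measurable_Dn|exact: a0|exact: ae_a].
Qed.

Let E w := 2 ^+ r * (M * w `^ (- al)).
Lemma sup_representation w s x : w0 <= w -> 0 <= s -> `|Dn r s f x - Sop (b w) (Irn r (w * s) Gm) (w * x)| <= 2 ^+ r * (M * w `^ (- al)).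
Proof.
move=> ww s0; have w1 : 0 < w by exact: lt_le_trans ww.
rewrite (representation_identity hr hs hk hi hth hg x w1 s0 (cb w1)) normrN.
by apply: norm_Dn_le => y; exact: rate.
Qed.

Let KG := fine (\int[mu]_x `|Gm x|%:E)%E.
Let KG0 : 0 <= KG. Proof. by rewrite fine_ge0// integral_ge0. Qed.
Let cG := 2 ^+ r' * 2 * (2 * r%:R * KG).
Let cG0 : 0 <= cG.
Proof. exact: mulr_ge0 (mulr_ge0 (exprn_ge0 _ (ler0n R 2)) (ler0n R 2)) (mulr_ge0 (mulr_ge0 (ler0n R 2) (ler0n R r)) KG0). Qed.

(** The representation holds at every [x], and [w^-1] ranges over [[1 / (2 W), 1 / W]], where [a]
    and hence the coefficients are bounded by [A] up to [Kpsi]. The mean over [w] in [[W, 2 W]] then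
    replaces the periodized kernel by its integral. *)
Lemma sup_far W A s x : w0 <= W -> 0 <= A -> (forall s', (2 * W)^-1 <= s' <= 1 / W -> a s' <= A) ->
  0 < s <= W^-1 -> (r%:R + 1) / W <= `|x| ->
  `|Dn r s f x| <= 2 ^+ r * M * W `^ (- al) + cG * Kpsi psi * ((s * W) ^+ r * A).
Proof.
move=> w0W A0 aA /andP[s0 sW] xW; have W0 : 0 < W by exact: lt_le_trans w0W.
have GL := LI_Gam hs hth hg; have K0 := Kpsi_ge0 psi.
have mG : measurable_fun [set: R] Gm by case: GL.
pose I := `[W, (2 * W)]%classic : set R; have mI : measurable (I : set mR) by exact: measurable_itv.
pose m w := esZ (fun k => kmaj r' Gm s k w x).
have m0 w : (0 <= m w)%E by apply: esZ_ge0 => k; exact: kmaj_ge0.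
have mm : measurable_fun [set: R] m.
  apply: measurable_esZ => [k w _|k]; first exact: kmaj_ge0.
  apply: (@measurable_parametric R _ mR (fun wz => `|Gm (wz.1 * (x + wz.2) - k%:~R)|%:E)) => //.
  apply/measurable_EFinP; apply: measurableT_comp => //; apply: (measurableT_comp mG).
  apply: measurable_funB => //; apply: measurable_funM; first exact: measurable_fst.
  by apply: measurable_funD => //; exact: measurable_snd.
have mmI : measurable_fun (I : set mR) m by apply: (@measurable_funS _ _ _ _ setT).
pose e1 := 2 ^+ r * M * W `^ (- al).
have e10 : 0 <= e1 by rewrite mulr_ge0 ?powR_ge0// mulr_ge0// exprn_ge0.
pose k0 := (2 * W * s) ^+ r' * (2 * W).
have k00 : 0 <= k0 by rewrite mulr_ge0 ?exprn_ge0// ?mulr_ge0 ?(ltW s0) ?(ltW W0).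
have b0 : 0 <= Kpsi psi * A by rewrite mulr_ge0.
have c0 : 0 <= Kpsi psi * A * k0 by rewrite mulr_ge0.
have cI (c : R) : (\int[mu]_(w in I) cst c%:E w = (c * W)%:E)%E.
  rewrite EFinM (_ : W%:E = mu I); first exact: integral_cst.
  by rewrite /I lebesgue_measure_itv/= lte_fin ltr_pMl// ltr1n -EFinB; congr (_%:E); ring.
have pt w : I w -> (`|Dn r s f x|%:E <= e1%:E + (Kpsi psi * A * k0)%:E * m w)%E.
  rewrite /I/= in_itv/= => /andP[w1 w2]; have ww : 0 < w by exact: lt_le_trans w1.
  have S1 : (`|Sop (b w) (Irn r (w * s) Gm) (w * x)|%:E <= (Kpsi psi * A * k0)%:E * m w)%E.
    have bA k : `|b w k| <= Kpsi psi * A.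
      apply: le_trans (b_le k ww) _; rewrite ler_wpM2l//; apply: aA.
      by rewrite div1r !lef_pV2 ?posrE ?mulr_gt0// w2.
    apply: le_trans (le_norm_Sop _ _ bA b0) _; rewrite (EFinM (Kpsi psi * A) k0) -muleA.
    apply: lee_wpmul2l; first by rewrite lee_fin.
    rewrite -esZZl//; last by move=> k; exact: kmaj_ge0.
    apply: le_esZ => k; first by rewrite lee_fin.
    apply: le_trans (norm_Irn_kmaj r' GL k x (ltW s0) ww) _.
    apply: lee_wpmul2r; first exact: kmaj_ge0.
    rewrite lee_fin /k0; apply: ler_pM; rewrite ?exprn_ge0 ?mulr_ge0 ?(ltW s0) ?(ltW ww)//.
    by apply: lerXn2r; rewrite ?nnegrE ?mulr_ge0 ?(ltW s0) ?(ltW ww) ?(ltW W0)// ler_wpM2r// ltW.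
  apply: le_trans (leeD2l e1%:E S1); rewrite -EFinD lee_fin.
  have h : _ <= E w := sup_representation x (le_trans w0W w1) (ltW s0).
  have Ee : E w <= e1.
    rewrite /E /e1 mulrA; apply: ler_wpM2l; first by rewrite mulr_ge0// exprn_ge0.
    by rewrite ler_powRN// ltW.
  have := ler_normD (Dn r s f x - Sop (b w) (Irn r (w * s) Gm) (w * x)) (Sop (b w) (Irn r (w * s) Gm) (w * x)).
  by rewrite subrK; move: h Ee; lra.
have H : ((`|Dn r s f x| * W)%:E <= (e1 * W)%:E + (Kpsi psi * A * k0)%:E * \int[mu]_(w in I) m w)%E.
  rewrite -!cI -ge0_integralZl// -ge0_integralD//; last 2 first.
  - by move=> w _; rewrite mule_ge0 ?lee_fin.
  - exact: measurable_funeM.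
  apply: ge0_le_integral => //.
  - by move=> w _; rewrite lee_fin.
  - by apply: emeasurable_funD => //; exact: measurable_funeM.
have Hm := sum_kmaj_average (r' := r') GL W0 (ltW s0) sW xW.
have KGE : (\int[mu]_x `|Gm x|%:E = KG%:E)%E.
  have /integrableP[_ fin] := Theta_integrable GL (Theta_Gam hr hs hth hg) (th_gt1 hth).
  by rewrite fineK// ge0_fin_numE// integral_ge0.
rewrite KGE in Hm; have c0' : (0 <= (Kpsi psi * A * k0)%:E)%E by rewrite lee_fin.
have := le_trans H (leeD2l _ (lee_wpmul2l c0' Hm)).
rewrite -!EFinM -EFinD lee_fin -/e1.
rewrite (_ : e1 * W + _ = (e1 + cG * Kpsi psi * ((s * W) ^+ r * A)) * W) ?ler_pM2r//.
rewrite [RHS]mulrDl; congr (_ + _); rewrite /cG /k0 (_ : 2 * W * s = 2 * (s * W)); last by ring.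
by rewrite exprMn exprS; move: (2 ^+ r') ((s * W) ^+ r') => y z; ring.
Qed.

Lemma sup_far_ex : exists C, 0 <= C /\ forall W A s x, w0 <= W -> 0 <= A ->
  (forall s', (2 * W)^-1 <= s' <= 1 / W -> a s' <= A) -> 0 < s <= W^-1 -> (r%:R + 1) / W <= `|x| ->
  `|Dn r s f x| <= 2 ^+ r * M * W `^ (- al) + C * ((s * W) ^+ r * A).
Proof.
exists (cG * Kpsi psi); split; first exact: (mulr_ge0 cG0 (Kpsi_ge0 psi)).
by move=> W A s x; exact: sup_far.
Qed.

(** With bounded coefficients every frequency is admissible, and neither a dilation factor nor a
    subsequence has to be chosen. The count of large coefficients cannot come from summability; it
    comes from the smallness of the differences away from the origin. *)
Lemma sup_selection (t : nat -> R) : (forall i, 0 < t i) -> (forall i, 0 < a (t i)) ->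
  (forall i, i.+1%:R * t i `^ al <= a (t i)) -> t n @[n --> \oo] --> 0 ->
  (forall i s, t i <= s -> a s <= 2 * a (t i) * (s / t i) `^ al) ->
  exists (om : nat -> R) (I : nat -> nat) (Cm : nat -> R),
     [/\ forall m, 0 < om m, om m @[m --> \oo] --> 0, forall j, (j <= I j)%N &
       om m ^+ r * (Cm m * om m `^ (- @ep R None)) @[m --> \oo] --> 0] /\
     [/\ forall m : nat, \forall j \near \oo, True,
      forall m : nat, \forall j \near \oo, forall k,
        `|t (I j) `^ @ep R None / a (t (I j)) * b (om m / t (I j)) k| <= Cm m &
      forall m e, 0 < e -> exists n : nat, \forall j \near \oo, forall s : seq int, uniq s ->
        (forall k, k \in s -> e < `|t (I j) `^ @ep R None / a (t (I j)) * b (om m / t (I j)) k|) ->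
        (size s <= n)%N].
Proof.
move=> t0 at0 tal tcv ctrl; have KP0 := Kpsi_ge0 psi.
pose q m : R := 2^-1 ^+ m.+2; have q0 m : 0 < q m by rewrite exprn_gt0.
have q1 m : q m <= 1 by rewrite exprn_ile1// invf_le1// ler1n.
have qcv : q m @[m --> \oo] --> (0 : R).
  by apply: cvg_expr2; rewrite gtr0_norm// invf_lt1// ltr1n.
have qal m : 0 < q m `^ (- al) by rewrite powR_gt0.
have aA m i : a (t i / q m) <= a (t i) * (2 * q m `^ (- al)).
  have h : t i <= t i / q m by rewrite ler_pdivlMr// ler_piMr// ltW.
  apply: le_trans (ctrl i _ h) _; rewrite (_ : t i / q m / t i = (q m)^-1); last first.
    by rewrite mulrC mulKf// gt_eqF.
  by rewrite powRN -powR_inv//; apply/le_of_eq; ring.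
have tE i x : `|t i `^ @ep R None / a (t i) * x| = `|x| / a (t i).
  by rewrite /ep powRr0 normrM mul1r normfV (gtr0_norm (at0 i)) mulrC.
have bA m i k : `|b (q m / t i) k| <= a (t i) * (Kpsi psi * (2 * q m `^ (- al))).
  apply: le_trans (b_le k (divr_gt0 (q0 m) (t0 i))) _; rewrite invf_div mulrCA.
  by rewrite ler_wpM2l.
exists q, id, (fun m => Kpsi psi * (2 * q m `^ (- al))); split; split => //.
- rewrite (_ : (fun m => _) = (fun m => 2 * Kpsi psi * (2^-1 `^ (r%:R - al)) ^+ m.+2)).
    rewrite -(mulr0 (2 * Kpsi psi)); apply: cvgMr; apply: cvg_expr2; rewrite ger0_norm ?powR_ge0//.
    by apply: powR_half_lt1; rewrite subr_gt0.
  apply/funext => m; rewrite /ep oppr0 powRr0 mulr1.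
  have qpow x : (2^-1 `^ x) ^+ m.+2 = q m `^ x.
    by rewrite -powR_mulrn ?powR_ge0// -powRrM mulrC powRrM powR_mulrn// ltW.
  rewrite qpow.
  rewrite powRD ?(gt_eqF (q0 m)) ?implybT// (powR_mulrn r (ltW (q0 m))).
  by move: (q m ^+ r) (q m `^ _) => x y; ring.
- by move=> _; exact: nearW.
- by move=> m; apply: nearW => j k; rewrite tE ler_pdivrMr// [leRHS]mulrC.
(* In the end [2 eta Kpsi <= e / 2] accounts for the values of the difference far from the origin,
   and the other [e / 2] for the tail of [psi]. *)
move=> m e e0; pose eta := e / (4 * (Kpsi psi + 1)).
have K1 : 0 < Kpsi psi + 1 by rewrite ltr_wpDl.
have eta0 : 0 < eta by rewrite divr_gt0// mulr_gt0.
pose D := cG * Kpsi psi * 2 / q m ^+ r.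
have qr0 : 0 <= (q m ^+ r)^-1 by rewrite invr_ge0 exprn_ge0// ltW.
have D0 : 0 <= D by exact: (mulr_ge0 (mulr_ge0 (mulr_ge0 cG0 KP0) (ler0n R 2)) qr0).
have alr' : 0 < r%:R - al by rewrite subr_gt0.
(* A second, lower frequency: [sup_far] at [Om / t] bounds the differences of the given step
   [t / q m], and [al < r] makes the bound as small as [eta] for small [Om]. *)
have [Om [Om0 Omq Ometa]] := small_power D0 eta0 (divr_gt0 (q0 m) (ltr0n R 2)) alr'.
have Oal : 0 < Om `^ (- al) by rewrite powR_gt0.
have Om2 : Om <= 2^-1 by apply: le_trans Omq _; rewrite ler_pdivrMr// mulVf// q1.
have OmQ : Om <= q m by apply: le_trans Omq _; rewrite ler_pdivrMr// ler_peMr ?(ltW (q0 m))// ler1n.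
have e40 : 0 < e / (4 * q m `^ (- al)) by rewrite divr_gt0// mulr_gt0.
have [V [V0 HV]] := small_tail ipsi e40.
(* Beyond this index [coef_far_near] applies at frequency [q m / t], with [c = (r + 1) t / Om] the
   radius outside which [sup_far] is available; the scale [t] cancels. *)
pose X := V + q m * ((r%:R + 1) / Om).
have c10 : 0 <= 2 ^+ r * M * Om `^ (- al) by rewrite !mulr_ge0 ?exprn_ge0// ltW.
pose n1 := Num.truncn X.
have X0 : 0 <= X by rewrite addr_ge0// mulr_ge0 ?(ltW (q0 m))// divr_ge0 ?(ltW Om0)// addr_ge0.
have nearW : \forall j \near \oo, w0 <= Om / t j.
  have qw : 0 < Om / w0 by rewrite divr_gt0.
  move/cvgrPdist_lt: tcv => /(_ _ qw); apply: filterS => n; rewrite sub0r normrN gtr0_norm// => h.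
  by rewrite ler_pdivlMr// mulrC -ler_pdivlMr// ltW.
have nearI : \forall j \near \oo, 2 ^+ r * M * Om `^ (- al) / j.+1%:R <= eta.
  exists (Num.truncn (eta^-1 * (2 ^+ r * M * Om `^ (- al)))) => // j /= nj.
  rewrite ler_pdivrMr ?ltr0n// -ler_pdivrMl//; apply: le_trans (ltW (truncnS_gt _)) _.
  by rewrite ler_nat ltnS.
exists (size (ints n1)); apply: filterS2 nearW nearI => j jW jI s us Hs.
apply: uniq_leq_size => // k /Hs; rewrite tE ltr_pdivlMr// => ek; rewrite mem_ints.
rewrite leqNgt; apply/negP => kn.
have kX : X <= `|k%:~R : R|.
  apply: le_trans (ltW (truncnS_gt _)) _; rewrite -intr_norm -abszE ler_nat; exact: kn.
move: ek; apply/negP; rewrite -leNgt.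
have ti := t0 j; have Nj := at0 j; have W0 : 0 < Om / t j by rewrite divr_gt0.
have h0 : 0 < t j / q m by rewrite divr_gt0.
have w1 : 0 < q m / t j by rewrite divr_gt0.
pose A := a (t j) * (2 * Om `^ (- al)).
have A0 : 0 <= A by rewrite mulr_ge0 ?(ltW Nj)// mulr_ge0// ltW.
have aA' s' : (2 * (Om / t j))^-1 <= s' <= 1 / (Om / t j) -> a s' <= A.
  move=> /andP[s1 s2]; have ts : t j <= s'.
    apply: le_trans s1; rewrite mulrA invf_div ler_pdivlMr ?mulr_gt0// ler_piMr ?(ltW ti)//.
    by rewrite mulrC -ler_pdivlMr// div1r.
  apply: le_trans (ctrl j s' ts) _; rewrite -mulrA mulrCA /A ler_wpM2l ?(ltW Nj)//.
  rewrite ler_wpM2l// powRN -powR_inv//.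
  have sp : 0 < s' by exact: lt_le_trans ts.
  apply: ge0_ler_powR; rewrite ?nnegrE ?divr_ge0 ?invr_ge0 ?(ltW al0) ?(ltW sp) ?(ltW ti) ?(ltW Om0)//.
  by rewrite ler_pdivrMr//; move: s2; rewrite div1r invf_div mulrC.
have hW : 0 < t j / q m <= (Om / t j)^-1.
  by rewrite h0 invf_div ler_wpM2l ?(ltW ti)// lef_pV2 ?posrE.
have far u : (r%:R + 1) / (Om / t j) <= `|u| -> `|Dn r (t j / q m) f u| <= a (t j) * (2 * eta).
  move=> cu; apply: le_trans (sup_far jW A0 aA' hW cu) _.
  rewrite [a _ * _]mulrCA mulr_natl mulr2n; apply: lerD.
    rewrite (powR_div (- al) (ltW Om0) ti) (powRN (t j)) invrK mulrA.
    apply: (@le_trans _ _ (2 ^+ r * M * Om `^ (- al) * (a (t j) / j.+1%:R))).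
      by rewrite ler_wpM2l// ler_pdivlMr ?ltr0n// mulrC.
    by rewrite mulrCA ler_wpM2l// ltW.
  rewrite [leLHS](_ : _ = a (t j) * (D * Om `^ (r%:R - al))); first by rewrite ler_wpM2l// ltW.
  rewrite (_ : t j / q m * (Om / t j) = Om / q m); last by field; rewrite !gt_eqF.
  rewrite powRD ?(gt_eqF Om0) ?implybT// (powR_mulrn r (ltW Om0)) /A /D exprMn exprVn.
  move: cG (Om ^+ r) (q m ^+ r) (Om `^ (- al)) => x1 x2 x3 x4; rewrite -[x3^-1]/(x3^-1).
  by move: (x3^-1) => x5; ring.
have [i1 bE] := iD k w1; rewrite bE.
have B10 : 0 <= a (t j) * (2 * eta) by rewrite mulr_ge0 ?(ltW Nj)// mulr_ge0// ltW.
have B20 : 0 <= a (t j) * (2 * q m `^ (- al)) by rewrite mulr_ge0 ?(ltW Nj)// mulr_ge0// ltW.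
have hE : (q m / t j)^-1 = t j / q m by rewrite invf_div.
have iB : {ae mu, forall u, `|Dn r (t j / q m) f u| <= a (t j) * (2 * q m `^ (- al))}.
  by apply: aeS (ae_a h0) => u hu; exact: le_trans hu (aA m j).
rewrite hE in i1 *.
have kX' : V + q m / t j * ((r%:R + 1) / (Om / t j)) <= `|k%:~R : R|.
  by rewrite (_ : q m / t j * _ = q m * ((r%:R + 1) / Om))//; field; rewrite !gt_eqF.
have mD : measurable_fun [set: R] (Dn r (t j / q m) f) by exact: measurable_Dn.
have H1 := coef_far_near ipsi w1 mD i1 B10 B20 far iB.
have H2 := H1 V kX'.
apply: le_trans H2 _.
rewrite [leLHS](_ : _ = a (t j) * (2 * (eta * Kpsi psi) + 2 * (q m `^ (- al) * Kpsi (tail psi V)))); last by ring.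
rewrite mulrC ler_wpM2r ?(ltW Nj)//.
have e1 : 2 * (eta * Kpsi psi) <= e / 2.
  rewrite /eta (_ : 2 * _ = e / 2 * (Kpsi psi / (Kpsi psi + 1))); last by field; rewrite gt_eqF.
  by rewrite ler_piMr ?divr_ge0 ?(ltW e0)// ler_pdivrMr// mul1r lerDl.
have e2 : 2 * (q m `^ (- al) * Kpsi (tail psi V)) <= e / 2.
  rewrite -ler_pdivlMl// -ler_pdivlMl//; apply: le_trans HV _; apply/le_of_eq.
  by field; rewrite gt_eqF.
by apply: le_trans (lerD e1 e2) _; rewrite -splitr.
Qed.

End sup_exponent.

Theorem sup_exponent_bound (R : realType) (r' : nat) (phi psi : R -> R) (g : nat -> R -> R)
  (th al M M0 w0 : R) (f : R -> R) : (1 <= r')%N -> sobolev_rep r'.+1 phi g ->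
  discrete_kernel phi -> condition_i r'.+1 phi -> r'.+2%:R < th ->
  (forall i, (1 <= i <= r'.+1)%N -> condition_Theta th (g i)) -> measurable_fun [set: R] f ->
  integrableR psi -> 0 < al -> al < r'.+1%:R -> 0 <= M -> 0 < w0 ->
  0 <= M0 -> (forall x, `|f x| <= M0) ->
  (forall w x, w0 <= w -> `|durrmeyer phi psi f w x - f x| <= M * w `^ (- al)) ->
  exists C, 0 <= C /\ forall s, 0 < s <= 1 -> bnd None setT (Dn r'.+1 s f) (C * s `^ al).
Proof.
move=> hr hs hk hi hth hg mf ipsi al0 alr M1 w00 M00 fM rate.
have B00 : 0 <= 2 ^+ r'.+1 * M0 by rewrite mulr_ge0// exprn_ge0.
have /choice[a Ha] : forall s : R, exists a, [/\ 0 <= a, a <= 2 ^+ r'.+1 * M0, bnd None setT (Dn r'.+1 s f) a &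
    forall B, 0 <= B -> bnd None setT (Dn r'.+1 s f) B -> a <= B].
  move=> s; apply: (bnd_inf (pm := None) isT) => //.
  by apply: aeW => x _; exact: norm_Dn_le.
have ab s : 0 < s -> bnd None setT (Dn r'.+1 s f) (a s) by move=> _; have [] := Ha s.
have a0 s : 0 < s -> 0 <= a s by move=> _; have [] := Ha s.
have CE0 : 0 <= 2 ^+ r'.+1 * M by rewrite mulr_ge0// exprn_ge0.
have C00 : 0 < r'.+1%:R + 1 :> R by rewrite ltr_wpDl.
have [cG [cG0 far]] := sup_far_ex hr hs hk hi hth hg mf ipsi al0 M1 w00 M00 fM rate ab a0.
have CF0 : 0 <= 2 ^+ r'.+1 * M + cG by rewrite addr_ge0.
apply: (@transfer R None r' (th - r'.+1%:R) al (2 ^+ r'.+1 * M0) (2 ^+ r'.+1 * M) (r'.+1%:R + 1)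
  1 (2 ^+ r'.+1 * M + cG) w0 (Gam r' g) f a (fun w => iter r'.+1 Dz (coef psi w f)) (fun=> True)) => //.
- exact: (LI_Gam hs hth hg).
- exact: (Theta_Gam hr hs hth hg).
- exact: th_gt1.
- by move=> s _; have [-> ->] := Ha s.
- by move=> s B _; have [_ _ _] := Ha s; exact.
- move=> w s ww _ s0; apply: aeW => x _; rewrite -mulrA.
  exact: (sup_representation hr hs hk hi hth hg mf ipsi w00 M00 fM rate x ww s0).
- move=> W A s w0W A0 aA sW; apply: aeW => x xW.
  have W0 : 0 < W by exact: lt_le_trans w0W.
  apply: le_trans (far W A s x w0W A0 aA sW xW) _.
  have := powR_ge0 W (- al); have sW0 : 0 <= (s * W) ^+ r'.+1.
    by apply: exprn_ge0; apply: mulr_ge0 (ltW W0); case/andP: sW => /ltW.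
  move: sW0 CE0; move: (_ ^+ r'.+1) (W `^ _) (2 ^+ _ * M) => x1 x2 x3 h1 h3 h2.
  rewrite -subr_ge0 (_ : _ - _ = x3 * (x1 * (A + x2)) + cG * (x1 * x2) + cG * x2); last by ring.
  by rewrite !addr_ge0 ?mulr_ge0 ?addr_ge0.
exact: (sup_selection hr hs hk hi hth hg mf ipsi al0 alr M1 w00 M00 fM rate ab a0).
Qed.

(** * Marchaud's inequality *)

Section marchaud.
Context {R : realType}.
Local Notation mu := (@lebesgue_measure R).
Local Notation mR := (measurableTypeR R).
Variable pm : option R.
Hypothesis pm_ge1 : if pm is Some p then 1 <= p else true.
Implicit Types (f h : R -> R) (s x : R) (m n : nat).

Definition Tw s h x := h (x + s) + h x.

Lemma Dl_Tw s n h : Dl s (iter n (Tw s) h) = iter n (Tw s) (Dl s h).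
Proof.
elim: n => // n IH; rewrite /= -IH; apply/funext => x; rewrite /Dl /Tw; ring.
Qed.

(** With [T] the translation by [s], this is the m-th power of [T^2 - 1 = (T + 1) (T - 1)]. *)
Lemma Dn_double m s f : Dn m (2 * s) f = iter m (Tw s) (Dn m s f).
Proof.
elim: m => // m IH; rewrite [LHS]/= -/(Dn m _ _) IH [Dn m.+1 s f]/= -Dl_Tw iterS.
move: (iter m (Tw s) (Dn m s f)) => h.
by apply/funext => x; rewrite /Dl /Tw (_ : x + s + s = x + 2 * s); [ring|ring].
Qed.

Lemma measurable_Tw n s h : measurable_fun [set: R] h -> measurable_fun [set: R] (iter n (Tw s) h).
Proof.
move=> mh; elim: n => // n IH; apply: measurable_funD => //.
by apply: measurableT_comp => //; exact: measurable_funD.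
Qed.

(** Induction by [(T + 1)^(m+1) - 2^(m+1) = (T + 1) ((T + 1)^m - 2^m) + 2^m (T - 1)]. *)
Lemma bnd_Tw m s h N : measurable_fun [set: R] h -> 0 <= N -> bnd pm setT (Dl s h) N ->
  bnd pm setT (fun x => iter m (Tw s) h x - 2 ^+ m * h x) (m%:R * 2 ^+ m * N).
Proof.
move=> mh N0 hN; elim: m => [|m IH].
  have := bndZ pm_ge1 0 measurableT (measurable_Dn 1 s mh) N0 hN; rewrite normr0 !mul0r.
  by congr bnd; apply/funext => x; rewrite /= expr0; ring.
pose d x := iter m (Tw s) h x - 2 ^+ m * h x.
have md : measurable_fun [set: R] d.
  by apply: measurable_funB; [exact: measurable_Tw|exact: measurable_funM].
have B0 : 0 <= m%:R * 2 ^+ m * N by rewrite !mulr_ge0// exprn_ge0.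
have mds : measurable_fun [set: R] (fun x => d (x + s)).
  by apply: measurableT_comp => //; exact: measurable_funD.
have h1 := bndD pm_ge1 measurableT mds md B0 B0 (bnd_shift pm_ge1 s md B0 IH) IH.
have h2 := bndZ pm_ge1 (2 ^+ m) measurableT (measurable_Dn 1 s mh) N0 hN.
rewrite ger0_norm ?exprn_ge0// in h2.
have C0 : 0 <= m%:R * 2 ^+ m * N + m%:R * 2 ^+ m * N by rewrite addr_ge0.
have D0 : 0 <= 2 ^+ m * N by rewrite mulr_ge0// exprn_ge0.
have mdd : measurable_fun [set: R] (fun x => d (x + s) + d x) by exact: measurable_funD.
have mDl : measurable_fun [set: R] (fun x => 2 ^+ m * Dl s h x).
  by apply: measurable_funM => //; exact: (measurable_Dn 1 s mh).
have := bndD pm_ge1 measurableT mdd mDl C0 D0 h1 h2.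
rewrite (_ : (fun x => d (x + s) + d x + 2 ^+ m * Dl s h x) =
    fun x => iter m.+1 (Tw s) h x - 2 ^+ m.+1 * h x); last first.
  by apply/funext => x; rewrite /= /d /Tw /Dl exprS; ring.
apply: (bnd_le pm_ge1); first by rewrite addr_ge0.
rewrite -[m.+1%:R]natr1 exprS; move: (2 ^+ m) m%:R D0 B0 => a b aN baN.
by rewrite -subr_ge0 (_ : _ - _ = a * N) //; ring.
Qed.

(** Halving the step gains the factor [2^(-m)] up to a difference of the next order: [Dn m (2 s) f]
    is [2^m Dn m s f] plus a term that factors through [T - 1]. *)
Lemma bnd_halve m s f B1 B2 : measurable_fun [set: R] f -> 0 <= B1 -> 0 <= B2 ->
  bnd pm setT (Dn m (2 * s) f) B1 -> bnd pm setT (Dn m.+1 s f) B2 ->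
  bnd pm setT (Dn m s f) (2^-1 ^+ m * B1 + m%:R * B2).
Proof.
move=> mf B10 B20; rewrite Dn_double => h1 h2; have mD := measurable_Dn m s mf.
have h3 := bnd_Tw m mD B20 h2.
have mT := measurable_Tw m s mD.
have B0 : 0 <= m%:R * 2 ^+ m * B2 by rewrite !mulr_ge0// exprn_ge0.
have md : measurable_fun [set: R] (fun x => iter m (Tw s) (Dn m s f) x - 2 ^+ m * Dn m s f x).
  by apply: measurable_funB => //; exact: measurable_funM.
have h4 := bndB pm_ge1 measurableT mT md B10 B0 h1 h3.
have mB := measurable_funB mT md.
have := bndZ pm_ge1 (2^-1 ^+ m) measurableT mB (addr_ge0 B10 B0) h4.
have e2 : 2^-1 ^+ m * 2 ^+ m = 1 :> R by rewrite -exprMn mulVf// expr1n.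
rewrite ger0_norm ?exprn_ge0// mulrDr [m%:R * _]mulrC -mulrA [X in _ + X]mulrA e2 mul1r.
congr bnd; apply/funext => x; transitivity (2^-1 ^+ m * 2 ^+ m * Dn m s f x); last by rewrite e2 mul1r.
by rewrite /=; move: (2^-1 ^+ m) (2 ^+ m) => y z; ring.
Qed.

(** Repeated halving from steps at least [1/2]. The recursion contracts with ratio [q = 2^(al - m)],
    which is less than 1 because [al < m]. *)
Lemma marchaud_step m al M0 C f : measurable_fun [set: R] f -> 0 < al -> al < m%:R -> 0 <= M0 ->
  bnd pm setT f M0 -> 0 <= C -> (forall s, 0 < s <= 1 -> bnd pm setT (Dn m.+1 s f) (C * s `^ al)) ->
  exists C', 0 <= C' /\ forall s, 0 < s <= 1 -> bnd pm setT (Dn m s f) (C' * s `^ al).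
Proof.
move=> mf al0 alm M00 fM C0 HC; pose q := 2^-1 ^+ m * 2 `^ al : R.
have q0 : 0 <= q by rewrite mulr_ge0 ?exprn_ge0 ?powR_ge0.
have q1 : q < 1.
  rewrite /q exprVn mulrC ltr_pdivrMr ?exprn_gt0// mul1r -powR_mulrn//.
  by rewrite /powR pnatr_eq0/= ltr_expR ltr_pM2r// ln_gt0// ltr1n.
have q1' : 0 < 1 - q by rewrite subr_gt0.
have a2 : 0 <= 2 `^ al :> R by exact: powR_ge0.
(* The fixed point of [c = q c + m C]. *)
pose c1 := m%:R * C / (1 - q); have c10 : 0 <= c1 by rewrite divr_ge0 ?mulr_ge0// ltW.
have qc : (1 - q) * c1 = m%:R * C by rewrite /c1 mulrC divfK// gt_eqF.
(* The trivial bound [2^m M0], with a factor making it valid for [s >= 1/2], where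
   [(2 s)^al >= 1]. *)
pose c2 := 2 ^+ m * M0 * 2 `^ al; have c20 : 0 <= c2 by rewrite mulr_ge0// mulr_ge0// exprn_ge0.
exists (c1 + c2); have c0 : 0 <= c1 + c2 by rewrite addr_ge0.
have base s : 2^-1 <= s -> bnd pm setT (Dn m s f) ((c1 + c2) * s `^ al).
  move=> s2; have s0 : 0 < s by apply: lt_le_trans s2; rewrite invr_gt0.
  apply: (bnd_le pm_ge1 _ _ (bnd_Dn pm_ge1 m s mf M00 fM)); first by rewrite mulr_ge0// exprn_ge0.
  apply: (@le_trans _ _ (c2 * s `^ al)); last by rewrite ler_wpM2r ?powR_ge0// lerDr.
  rewrite /c2 -mulrA ler_peMr ?mulr_ge0 ?exprn_ge0// -powRM ?(ltW s0)//.
  rewrite -[leLHS](powRr0 (2 * s)); apply: ler_powR; last exact: ltW.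
  by rewrite -ler_pdivrMl// mulr1.
have H n s : (2 ^+ n.+1)^-1 <= s <= 1 -> bnd pm setT (Dn m s f) ((c1 + c2) * s `^ al).
  elim: n s => [|n IH] s /andP[s1 s2]; first by apply: base; rewrite expr1 in s1.
  have [|s3] := leP 2^-1 s; first exact: base.
  have s0 : 0 < s by apply: lt_le_trans s1; rewrite invr_gt0 exprn_gt0.
  have h1 : bnd pm setT (Dn m (2 * s) f) ((c1 + c2) * (2 * s) `^ al).
    apply: IH; apply/andP; split.
      by rewrite -ler_pdivrMl// -invfM -exprS.
    by rewrite -ler_pdivlMl// mulr1 ltW.
  have s01 : 0 < s <= 1 by rewrite s0.
  have sa : 0 <= s `^ al by exact: powR_ge0.
  have := bnd_halve mf (mulr_ge0 c0 (powR_ge0 _ _)) (mulr_ge0 C0 sa) h1 (HC s s01).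
  apply: (bnd_le pm_ge1).
    by rewrite addr_ge0 ?mulr_ge0 ?exprn_ge0 ?powR_ge0.
  rewrite powRM ?(ltW s0)//.
  rewrite (_ : _ + _ = (q * (c1 + c2) + (1 - q) * c1) * s `^ al); last first.
    by rewrite qc /q; clearbody c1 c2; ring.
  rewrite ler_wpM2r// -subr_ge0 (_ : _ - _ = (1 - q) * c2); first by rewrite mulr_ge0// ltW.
  by clearbody c1 c2 q; ring.
split => // s /andP[s0 s1]; apply: (H (Num.truncn s^-1)); rewrite s1 andbT.
rewrite invf_ple ?posrE ?exprn_gt0//; apply: le_trans (ltW (truncnS_gt _)) _.
by rewrite -natrX ler_nat ltnW// ltn_expl.
Qed.

Lemma marchaud k m al M0 f : measurable_fun [set: R] f -> 0 < al -> al < m%:R -> 0 <= M0 ->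
  bnd pm setT f M0 ->
  (exists C, 0 <= C /\ forall s, 0 < s <= 1 -> bnd pm setT (Dn (k + m) s f) (C * s `^ al)) ->
  exists C, 0 <= C /\ forall s, 0 < s <= 1 -> bnd pm setT (Dn m s f) (C * s `^ al).
Proof.
move=> mf al0 alm M00 fM; elim: k => // k IH [C [C0 HC]]; apply: IH.
apply: (marchaud_step mf al0 _ M00 fM C0 HC).
by apply: lt_le_trans alm _; rewrite ler_nat leq_addl.
Qed.

(** The modulus takes steps of both signs; a negative step is a translate of the positive one up to
    sign. *)
Lemma Dn_opp m s f x : Dn m (- s) f x = (-1) ^+ m * Dn m s f (x - m%:R * s).
Proof.
elim: m x => [|m IH] x; first by rewrite expr0 mul1r mul0r subr0.
rewrite [LHS]/= /Dl -/(Dn m _ _) !IH [in RHS]/= /Dl -/(Dn m _ _) exprS -natr1.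
rewrite (_ : x - s - m%:R * s = x - (m%:R + 1) * s); last by ring.
rewrite (_ : x - (m%:R + 1) * s + s = x - m%:R * s); last by ring.
by ring.
Qed.

Lemma bnd_diff_sym m al C f : measurable_fun [set: R] f -> (0 < m)%N -> 0 < al -> 0 <= C ->
  (forall s, 0 < s <= 1 -> bnd pm setT (Dn m s f) (C * s `^ al)) ->
  forall d t, 0 < d <= 1 -> `|t| <= d -> bnd pm setT (diffm m t f) (C * d `^ al).
Proof.
move=> mf m0 al0 C0 HC d t /andP[d0 d1] td; rewrite diffmE.
have pos s : 0 < s -> s <= d -> bnd pm setT (Dn m s f) (C * d `^ al).
  move=> s0 sd; have s01 : 0 < s <= 1 by rewrite s0 (le_trans sd).
  apply: (bnd_le pm_ge1 _ _ (HC s s01)); first by rewrite mulr_ge0 ?powR_ge0.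
  by rewrite ler_wpM2l//; apply: ge0_ler_powR; rewrite ?nnegrE ?(ltW s0) ?(ltW d0) ?(ltW al0).
have Cd : 0 <= C * d `^ al by rewrite mulr_ge0 ?powR_ge0.
have mD s : measurable_fun [set: R] (Dn m s f) by exact: measurable_Dn.
have [t0|t0|->] := ltgtP t 0.
- have nt : 0 < - t by rewrite oppr_gt0.
  have h := pos (- t) nt; rewrite ltr0_norm// in td.
  have mS : measurable_fun [set: R] (fun x => Dn m (- t) f (x + - (m%:R * - t))).
    by apply: measurableT_comp => //; exact: measurable_funD.
  have := bndZ pm_ge1 ((-1) ^+ m) measurableT mS Cd (bnd_shift pm_ge1 _ (mD _) Cd (h td)).
  rewrite normrX normrN1 expr1n mul1r; congr bnd.
  by apply/funext => x; rewrite -[in RHS](opprK t) [RHS]Dn_opp.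
- by apply: pos => //; rewrite -(gtr0_norm t0).
case: m m0 {HC} pos mD => // m _ pos mD.
have := bndZ pm_ge1 0 measurableT (mD d) Cd (pos d d0 (lexx _)); rewrite normr0 mul0r.
rewrite (_ : (fun x => _) = Dn m.+1 0 f); last by apply/funext => x; rewrite /= /Dl mul0r addr0 subrr.
exact: (bnd_le pm_ge1).
Qed.

End marchaud.

(** * From the bounds to the norms of the statement *)

Section sup_norm.
Context {R : realType}.
Local Notation mu := (@lebesgue_measure R).
Implicit Types h : R -> R.

Definition unif_cont h := forall e, 0 < e -> exists d, 0 < d /\ forall x y, `|x - y| < d -> `|h x - h y| < e.

Lemma unif_cont_Dn m s h : unif_cont h -> unif_cont (Dn m s h).
Proof.
move=> hu; elim: m => // m IH e e0; have e2 : 0 < e / 2 by rewrite divr_gt0.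
have [d [d0 Hd]] := IH _ e2; exists d; split => // x y xy; rewrite /= /Dl -/(Dn m _ _).
have h1 := Hd x y xy; have xys : `|x + s - (y + s)| < d by rewrite opprD addrACA subrr addr0.
have h2 := Hd _ _ xys.
rewrite (_ : _ - _ = (Dn m s h (x + s) - Dn m s h (y + s)) - (Dn m s h x - Dn m s h y)); last by ring.
by apply: le_lt_trans (ler_normB _ _) _; rewrite [ltRHS]splitr ltrD.
Qed.

Lemma unif_cont_measurable h : unif_cont h -> measurable_fun [set: R] h.
Proof.
move=> hu; apply: continuous_measurable_fun => x; apply/cvgrPdist_lt => e e0.
have [d [d0 Hd]] := hu e e0; exists d => // y /= xy; exact: Hd.
Qed.

(** [bnd None] is an essential bound whereas [supnorm] is a supremum over all points; every interval
    contains a point where the bound holds, and continuity does the rest. *)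
Lemma unif_cont_ae_le h B : unif_cont h -> {ae mu, forall x, `|h x| <= B} -> forall x, `|h x| <= B.
Proof.
move=> hu hB x; apply/ler_addgt0Pr => e e0; have [d [d0 Hd]] := hu e e0.
have xd : x < x + d / 2 by rewrite ltrDl divr_gt0.
have [y [/andP[y1 y2] hy]] := ae_ex xd hB.
have xy : `|x - y| < d.
  by rewrite distrC ger0_norm ?subr_ge0// ltrBlDl (le_lt_trans y2)// ltrD2l gtr_pMr// invf_lt1// ltr1n.
rewrite -(subrK (h y) (h x)); apply: le_trans (ler_normD _ _) _; rewrite addrC.
by rewrite lerD// ltW// Hd.
Qed.

Lemma supnorm_le h B : (supnorm h <= B%:E)%E <-> forall x, `|h x| <= B.
Proof.
split=> [H x|H]; first by rewrite -lee_fin; apply: le_trans H; apply: ereal_sup_ubound; exists x.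
by apply: ge_ereal_sup => _ [x _ <-]; rewrite lee_fin.
Qed.

End sup_norm.

Lemma Lnorm_le {R : realType} (p B : R) (h : R -> R) : 1 <= p -> 0 <= B ->
  (Lnorm (@lebesgue_measure R) p%:E (EFin \o h) <= B%:E)%E <-> bnd (Some p) setT h B.
Proof.
move=> p1 B0; rewrite (bnd_Lnorm (pm := Some p) p1 h erefl measurableT B0).
by rewrite (_ : h \_ setT = h)//; apply/funext => x; rewrite patchE in_setT.
Qed.

Theorem theorem4p2 (R : realType) (r : nat) (phi psi : R -> R) (g : nat -> R -> R)
  (alpha : R) :
  (2 <= r)%N ->
  sobolev_rep r phi g -> discrete_kernel phi -> condition_i r phi ->
  continuous_kernel psi ->
  0 < alpha -> alpha < r%:R ->
  (* (a) p = +oo *)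
  (forall (theta : R) (f : R -> R),
     r.+1%:R < theta ->
     (forall i, (1 <= i <= r)%N -> condition_Theta theta (g i)) ->
     condition_Theta theta psi ->
     inLp +oo%E f ->
     durrmeyer_rate phi psi +oo%E alpha f ->
     LipStar alpha +oo%E f) /\
  (* (b) 1 <= p < +oo *)
  (forall (p theta : R) (f : R -> R),
     1 <= p ->
     p * r%:R + 1 < theta ->
     (forall i, (1 <= i <= r)%N -> condition_Theta theta (g i)) ->
     condition_Theta theta psi ->
     (p = 1 -> exists A, forall u, A < `|u| -> psi u = 0) ->
     inLp p%:E f ->
     durrmeyer_rate phi psi p%:E alpha f ->
     LipStar alpha p%:E f).
Proof.
case: r => // r' hr hs hk hi [ipsi _] al0 alr; rewrite ltnS in hr.
pose m := (Num.truncn alpha).+1.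
have alm : alpha < m%:R by exact: truncnS_gt.
have mr : (m <= r'.+1)%N.
  rewrite /m ltnS -ltnS -(ltr_nat R); apply: le_lt_trans alr.
  by rewrite truncn_le// ltW.
have mE : (r'.+1 - m + m)%N = r'.+1 by rewrite subnK.
split.
- move=> theta f hth hg _ [[M0 fM] fu] [M [w0 [w00 rate]]].
  have mf := unif_cont_measurable fu.
  have M00 : 0 <= M0 by apply: le_trans (fM 0).
  (* The sign of [M] is not prescribed, hence [|M|]. *)
  have rate' w x : w0 <= w -> `|durrmeyer phi psi f w x - f x| <= `|M| * w `^ (- alpha).
    move=> /rate /supnorm_le /(_ x) /le_trans; apply; by rewrite ler_wpM2r ?powR_ge0// ler_norm.
  have := sup_exponent_bound hr hs hk hi hth hg mf ipsi al0 alr (normr_ge0 M) w00 M00 fM rate'.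
  rewrite -{1}mE => H.
  have fM' : bnd None setT f M0 by apply: aeW => x _; exact: fM.
  have [C [C0 HC]] := marchaud (pm := None) isT mf al0 alm M00 fM' H.
  split; first by split; first exists M0.
  exists C, 1; split => // d d01; apply: ge_ereal_sup => _ [t td <-] /=.
  have := bnd_diff_sym (pm := None) isT mf (ltn0Sn _) al0 C0 HC d01 td => hb.
  rewrite -/m /pnorm; apply/supnorm_le; apply: unif_cont_ae_le.
    by rewrite diffmE; exact: unif_cont_Dn.
  by apply: aeS hb => x; exact.
move=> p theta f p1 hth hg psiT _ [mf fL] [M [w0 [w00 rate]]].
have hth' : r'.+2%:R < theta.
  apply: le_lt_trans hth; rewrite -natr1 lerD2r ler_peMl//.
have th1 : 1 < theta by apply: le_lt_trans hth'; rewrite ler1n.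
have L0 := Lnorm_ge0 (@lebesgue_measure R) p%:E (EFin \o f).
pose M0 := fine (Lnorm (@lebesgue_measure R) p%:E (EFin \o f)).
have M00 : 0 <= M0 by exact: fine_ge0.
have fM : bnd (Some p) setT f M0 by apply/(Lnorm_le _ p1 M00); rewrite fineK// ge0_fin_numE.
have rate' w : w0 <= w ->
    bnd (Some p) setT (fun x => durrmeyer phi psi f w x - f x) (`|M| * w `^ (- alpha)).
  move=> ww; apply/(Lnorm_le _ p1); first by rewrite mulr_ge0 ?powR_ge0.
  by apply: le_trans (rate w ww) _; rewrite lee_fin ler_wpM2r ?powR_ge0// ler_norm.
have := finite_exponent_bound p1 hr hs hk hi hth' hg mf ipsi psiT th1 al0 alr (normr_ge0 M) w00 M00 fM rate'.
rewrite -{1}mE => H.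
have [C [C0 HC]] := marchaud (pm := Some p) p1 mf al0 alm M00 fM H.
split => //; exists C, 1; split => // d d01; apply: ge_ereal_sup => _ [t td <-] /=.
apply/(Lnorm_le _ p1); first by rewrite mulr_ge0 ?powR_ge0.
exact: (bnd_diff_sym (pm := Some p) p1 mf (ltn0Sn _) al0 C0 HC d01 td).
Qed.
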